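(* Let $\mathbf B:\mathbb D^d\to\mathbb D^d$ be given by $\mathbf B(z)=\big(B_1(z_1),\ldots,B_d(z_d)\big)$, where each $B_i$ is a finite Blaschke product of order $m_i\ge 1$, and suppose that $\mathbf B$ is not biholomorphic (i.e. not all $m_i$ equal $1$). Let $\mathbf M_{\mathbf B}=(M_{B_1},\ldots,M_{B_d})$ on $\mathbb A^2(\mathbb D^d)$, where $M_{B_i}$ is multiplication by the function $z\mapsto B_i(z_i)$. Then $\Gamma_{\mathbf B}\big(\mathbb A^2(\mathbb D^d)\big)$ is a non-trivial minimal joint reducing subspace of $\mathbf M_{\mathbf B}$ on $\mathbb A^2(\mathbb D^d)$. Moreover, the restriction of $\mathbf M_{\mathbf B}$ to $\Gamma_{\mathbf B}\big(\mathbb A^2(\mathbb D^d)\big)$ is unitarily equivalent to the Bergman multishift. Moreover, $$\Gamma_{\mathbf B}\big(\mathbb A^2(\mathbb D^d)\big)=\overline{\mathrm{span}}\,\{J_{\mathbf B}\mathbf B^{\alpha}:\alpha\in\mathbb Z_+^d\}$$ and $$\Bigg\{\sqrt{\prod_{j=1}^d\frac{\alpha_j+1}{m_j}}\;J_{\mathbf B}\mathbf B^{\alpha}\Bigg\}_{\alpha\in\mathbb Z_+^d}$$ is an orthonormal basis of $\Gamma_{\mathbf B}\big(\mathbb A^2(\mathbb D^d)\big)$.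
   Context: $\mathbb D$ is the open unit disc in $\mathbb C$. A finite Blaschke product is a function $B(z)=e^{i\theta}\prod_{j=1}^n\big(\frac{z-a_j}{1-\bar a_jz}\big)^{k_j}$ with $\theta\in\mathbb R$, distinct $a_j\in\mathbb D$ and integers $k_j\ge1$; its order is $\sum_j k_j$. $\mathbb A^2(\mathbb D^d)$ is the Bergman space of square-integrable holomorphic functions on $\mathbb D^d$ with respect to Lebesgue measure normalized to total mass $1$, so that $e_{\alpha}(z)=\sqrt{\prod_{i=1}^d(\alpha_i+1)}\,z^{\alpha}$, $\alpha\in\mathbb Z_+^d$ ($\mathbb Z_+$ the nonnegative integers), is an orthonormal basis. The Bergman multishift is the tuple $\mathbf M=(M_1,\ldots,M_d)$ of multiplications by the coordinate functions on $\mathbb A^2(\mathbb D^d)$, so $M_ie_\alpha=\sqrt{\frac{\alpha_i+1}{\alpha_i+2}}\,e_{\alpha+\epsilon_i}$, with $\epsilon_i$ the $i$-th standard unit vector. $J_{\mathbf B}(z)=\prod_j B_j'(z_j)$ is the complex Jacobian determinant of $\mathbf B$, $\mathbf B^\alpha(z)=\prod_jB_j(z_j)^{\alpha_j}$, and $\Gamma_{\mathbf B}\psi=\frac1{\sqrt m}(\psi\circ\mathbf B)J_{\mathbf B}$, where $m=\prod_jm_j$ is the multiplicity of the proper holomorphic map $\mathbf B$. A joint reducing subspace of a tuple $(T_1,\ldots,T_d)$ on a Hilbert space $H$ is a closed subspace $\mathcal M$ with $T_i\mathcal M\subseteq\mathcal M$ and $T_i^*\mathcal M\subseteq\mathcal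 M$ for all $i$; it is non-trivial if it is neither $\{0\}$ nor $H$, and minimal if the only joint reducing subspaces contained in it are $\{0\}$ and itself. Unitary equivalence of tuples means equivalence by a single unitary intertwining all components. *)

(* Defs.v *)
From HB Require Import structures.
From mathcomp Require Import all_boot all_order all_algebra.
From mathcomp Require Import complex.
From mathcomp Require Import all_classical all_reals all_analysis.

Set Implicit Arguments.
Unset Strict Implicit.
Unset Printing Implicit Defensive.

Import Order.TTheory GRing.Theory Num.Theory.
Import numFieldNormedType.Exports.

Local Open Scope classical_set_scope.
Local Open Scope ring_scope.

(* R[i] packed as a numClosedFieldType: MathComp-Analysis puts its topology and
   normed-module structure on such a sort, not on the bare type [complex R]. *)
Definition Cplx (R : realType) : numClosedFieldType := R[i].

Definition ofR (R : realType) (x : R) : Cplx R := real_complex R x.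

Definition cconj (R : realType) (z : Cplx R) : Cplx R := conjc z.

(* The library proves this, but its instance on [m1 \x m2] is not found by
   inference for arbitrary sigma-finite measures. *)
Lemma product_measure_sigma_finite d1 d2 (T1 : measurableType d1)
    (T2 : measurableType d2) (R : realType)
    (m1 : {sigma_finite_measure set T1 -> \bar R})
    (m2 : {sigma_finite_measure set T2 -> \bar R}) :
  sigma_finite setT (m1 \x m2)%E.
Proof.
have /sigma_finiteP[F [TF ndF Foo]] := sigma_finiteT m1.
have /sigma_finiteP[G [TG ndG Goo]] := sigma_finiteT m2.
exists (fun n => F n `*` G n).
  rewrite -setXTT TF TG predeqE => -[x y]; split.
    move=> [/= [n _ Fnx] [k _ Gky]]; exists (maxn n k) => //; split.
    - by move: x Fnx; exact/subsetPset/ndF/leq_maxl.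
    - by move: y Gky; exact/subsetPset/ndG/leq_maxr.
  by move=> [n _ []/= ? ?]; split; exists n.
move=> k; have [? ?] := Foo k; have [? ?] := Goo k.
split; first exact: measurableX.
by rewrite product_measure1E// lte_mul_pinfty// ge0_fin_numE.
Qed.

Section product_of_measures.
Context {disp : measure_display} {T : measurableType disp} {R : realType}.

Section cons_measure.
Variables (mu : {sigma_finite_measure set T -> \bar R}) (n : nat).
Variable nu : {sigma_finite_measure set (n.-tuple T) -> \bar R}.

Definition tuple_of_pair (p : T * n.-tuple T) : n.+1.-tuple T :=
  [tuple of p.1 :: p.2].

Definition pair_of_tuple (t : n.+1.-tuple T) : T * n.-tuple T :=
  (thead t, [tuple of behead t]).

Lemma tuple_of_pairK : cancel tuple_of_pair pair_of_tuple.
Proof.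
by move=> [x t]; congr pair => //=; exact/val_inj.
Qed.

Lemma pair_of_tupleK : cancel pair_of_tuple tuple_of_pair.
Proof. by move=> t; rewrite [RHS]tuple_eta; exact/val_inj. Qed.

Lemma measurable_tuple_of_pair : measurable_fun [set: _] tuple_of_pair.
Proof. by apply: measurable_cons. Qed.

Lemma measurable_pair_of_tuple : measurable_fun [set: _] pair_of_tuple.
Proof.
apply: measurable_fun_pair; last exact: measurable_behead.
exact: measurable_tnth.
Qed.

Definition cons_measure : set (n.+1.-tuple T) -> \bar R :=
  pushforward (mu \x nu)%E tuple_of_pair.

Let cons_measure0 : cons_measure set0 = 0%E.
Proof. by rewrite /cons_measure /pushforward preimage_set0 measure0. Qed.

Let cons_measure_ge0 A : (0 <= cons_measure A)%E.
Proof. exact: (measure_ge0 (mu \x nu)%E). Qed.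

Let cons_measure_sigma_additive : semi_sigma_additive cons_measure.
Proof.
have mf := measurable_tuple_of_pair.
move=> F mF tF mUF; rewrite /cons_measure /pushforward preimage_bigcup.
apply: measure_semi_sigma_additive.
- by move=> k; rewrite -[X in measurable X]setTI; exact: mf.
- apply/trivIsetP => /= i j _ _ ij; rewrite -preimage_setI.
  by move/trivIsetP : tF => /(_ _ _ _ _ ij) ->//; rewrite preimage_set0.
- by rewrite -preimage_bigcup -[X in measurable X]setTI; exact: mf.
Qed.

HB.instance Definition _ := isMeasure.Build _ _ _ cons_measure
  cons_measure0 cons_measure_ge0 cons_measure_sigma_additive.

Let cons_measure_sigma_finite : sigma_finite setT cons_measure.
Proof.
have [F TF Foo] := product_measure_sigma_finite mu nu.
exists (fun k => pair_of_tuple @^-1` F k).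
  by rewrite -preimage_bigcup -TF preimage_setT.
move=> k; have [mF Fk] := Foo k; split.
  by rewrite -[X in measurable X]setTI; exact: measurable_pair_of_tuple.
rewrite /cons_measure /pushforward (_ : _ @^-1` _ = F k)//.
by rewrite -comp_preimage predeqE => p /=; rewrite tuple_of_pairK.
Qed.

HB.instance Definition _ := Measure_isSigmaFinite.Build _ _ _ cons_measure
  cons_measure_sigma_finite.

End cons_measure.

Variable mu : {sigma_finite_measure set T -> \bar R}.

Fixpoint power_measure (n : nat) :
    {sigma_finite_measure set (n.-tuple T) -> \bar R} :=
  if n is n'.+1 then cons_measure mu (power_measure n')
  else (dirac ([tuple] : 0.-tuple T)).

End product_of_measures.

(* [H] is a subset of a complex vector space [E] and [ip] is an inner product on
   [H], linear in the first argument. Operators are total functions [E -> E] of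
   which only the action on [H] matters. *)

Section hilbert.
Variables (R : realType) (E : lmodType (Cplx R)) (H : set E).
Variable ip : E -> E -> Cplx R.

Definition hnorm (f : E) : R := Num.sqrt (complex.Re (ip f f)).

Definition is_subspace (M : set E) : Prop :=
  [/\ M `<=` H, M 0 &
      forall (a : Cplx R) f g, M f -> M g -> M (a *: f + g)].

Definition hclosure (A : set E) : set E :=
  [set f | H f /\
    forall eps : R, 0 < eps -> exists2 g, A g & hnorm (f - g) < eps].

Definition closed_subspace (M : set E) : Prop :=
  is_subspace M /\ hclosure M `<=` M.

Definition lin_span (I : Type) (e : I -> E) : set E :=
  [set f | exists (s : seq I) (c : I -> Cplx R), f = \sum_(i <- s) c i *: e i].

Definition closed_span (I : Type) (e : I -> E) : set E :=
  hclosure (lin_span e).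

Definition orthonormal_basis (I : eqType) (M : set E) (e : I -> E) : Prop :=
  [/\ forall i, M (e i),
      forall i j, ip (e i) (e j) = (i == j)%:R &
      closed_span e = M].

(* The graph of the Hilbert-space adjoint: [adjoint_eq T g h] says that
   T^* g is defined and equal to h. *)
Definition adjoint_eq (T : E -> E) (g h : E) : Prop :=
  [/\ H g, H h & forall f, H f -> ip (T f) g = ip f h].

Definition joint_reducing (I : Type) (T : I -> E -> E) (M : set E) : Prop :=
  [/\ closed_subspace M,
      forall i f, M f -> M (T i f) &
      forall i g, M g -> exists2 h, adjoint_eq (T i) g h & M h].

Definition nontrivial_subspace (M : set E) : Prop := M <> [set 0] /\ M <> H.

Definition minimal_joint_reducing (I : Type) (T : I -> E -> E) (M : set E) :
    Prop :=
  joint_reducing T M /\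
  forall N, joint_reducing T N -> N `<=` M -> N = [set 0] \/ N = M.

End hilbert.

Definition unitarily_equivalent (R : realType) (E1 E2 : lmodType (Cplx R))
    (H1 : set E1) (ip1 : E1 -> E1 -> Cplx R)
    (H2 : set E2) (ip2 : E2 -> E2 -> Cplx R)
    (I : Type) (T1 : I -> E1 -> E1) (T2 : I -> E2 -> E2) : Prop :=
  exists U : E1 -> E2,
    [/\ forall (a : Cplx R) f g, H1 f -> H1 g -> U (a *: f + g) = a *: U f + U g,
        U @` H1 = H2,
        forall f g, H1 f -> H1 g -> ip2 (U f) (U g) = ip1 f g &
        forall i f, H1 f -> U (T1 i f) = T2 i (U f)].

Section blaschke.
Variable R : realType.
Local Notation C := (Cplx R).

Definition expi (theta : R) : C := Complex (cos theta) (sin theta).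

Definition is_finite_blaschke (B : C -> C) (m : nat) : Prop :=
  exists (theta : R) (n : nat) (a : 'I_n -> C) (k : 'I_n -> nat),
    [/\ injective a, forall j, `|a j| < 1, forall j, (1 <= k j)%N,
        m = (\sum_(j < n) k j)%N &
        forall z : C, `|z| < 1 ->
          B z = expi theta *
                \prod_(j < n) ((z - a j) / (1 - cconj (a j) * z)) ^+ k j].

End blaschke.

Section plane_measure.
Variable R : realType.

Definition plane_measure :
    set (measurableTypeR R * measurableTypeR R) -> \bar R :=
  (@lebesgue_measure R \x @lebesgue_measure R)%E.

HB.instance Definition _ := Measure.copy plane_measure
  (@lebesgue_measure R \x @lebesgue_measure R)%E.

HB.instance Definition _ := Measure_isSigmaFinite.Build _ _ _ plane_measure
  (product_measure_sigma_finite (@lebesgue_measure R) (@lebesgue_measure R)).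

End plane_measure.

Section bergman.
Variables (R : realType) (d : nat).
Local Notation C := (Cplx R).
Local Notation Cd := 'rV[C]_d.

Definition polydisc : set Cd := [set z | forall i, `|z ord0 i| < 1].

Definition holomorphic_on (W : normedModType C) (D : set Cd) (f : Cd -> W) :
    Prop :=
  forall z, D z -> differentiable f z.

Definition volume := power_measure (@plane_measure R) d.

Definition point_of (t : d.-tuple (measurableTypeR R * measurableTypeR R)) : Cd :=
  \row_i Complex (tnth t i).1 (tnth t i).2.

Definition polydisc_coords := point_of @^-1` polydisc.

(* The integral over the polydisc against Lebesgue measure on R^(2d),
   normalized so that the polydisc has mass 1. *)
Definition mean (u : Cd -> R) : R :=
  (fine (volume polydisc_coords))^-1 *
  \int[volume]_(t in polydisc_coords) u (point_of t).

Definition bergman_ip (f g : Cd -> C) : C :=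
  Complex (mean (fun z => complex.Re (f z * cconj (g z))))
          (mean (fun z => complex.Im (f z * cconj (g z)))).

Definition extend0 (f : Cd -> C) : Cd -> C := patch (fun=> 0) polydisc f.

(* A function on the polydisc is represented by its extension by 0, so that
   equality of functions on the polydisc is Leibniz equality. *)
Definition bergman : set (Cd -> C) :=
  [set f : Cd -> C |
    [/\ forall z, ~ polydisc z -> f z = 0,
        holomorphic_on polydisc f &
        volume.-integrable polydisc_coords
          (fun t => (Normc.normc (f (point_of t)) ^+ 2)%:E)]].

Definition multiplication (phi f : Cd -> C) : Cd -> C := fun z => phi z * f z.

Definition bergman_multishift (i : 'I_d) : (Cd -> C) -> (Cd -> C) :=
  multiplication (fun z => z ord0 i).

Definition biholomorphic_self_map (F : Cd -> Cd) : Prop :=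
  [/\ holomorphic_on polydisc F, forall z, polydisc z -> polydisc (F z) &
      exists G : Cd -> Cd,
        [/\ holomorphic_on polydisc G, forall z, polydisc z -> polydisc (G z),
            forall z, polydisc z -> G (F z) = z &
            forall z, polydisc z -> F (G z) = z]].

Section product_map.
Variable B : 'I_d -> C -> C.

Definition product_map (z : Cd) : Cd := \row_i B i (z ord0 i).

Definition multiplication_tuple (i : 'I_d) : (Cd -> C) -> (Cd -> C) :=
  multiplication (fun z => B i (z ord0 i)).

Definition jacobian_det (z : Cd) : C := \prod_i derive1 (B i) (z ord0 i).

Definition product_map_pow (alpha : {ffun 'I_d -> nat}) (z : Cd) : C :=
  \prod_i B i (z ord0 i) ^+ alpha i.

Definition jacobian_pow (alpha : {ffun 'I_d -> nat}) : Cd -> C :=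
  extend0 (fun z => jacobian_det z * product_map_pow alpha z).

Definition Gamma (mult : nat) (psi : Cd -> C) : Cd -> C :=
  extend0 (fun z =>
    ofR (Num.sqrt mult%:R)^-1 * (psi (product_map z) * jacobian_det z)).

End product_map.
End bergman.

(* Main.v *)
Require Import Defs.
From HB Require Import structures.
From mathcomp Require Import all_boot all_order all_algebra.
From mathcomp Require Import complex ring lra zify.
From mathcomp Require Import all_classical all_reals all_analysis.
From mathcomp Require Import measurable_realfun.
Import Order.TTheory GRing.Theory Num.Theory.
Import numFieldNormedType.Exports.
Local Open Scope classical_set_scope.
Local Open Scope ring_scope.
Set Implicit Arguments.
Unset Strict Implicit.
Unset Printing Implicit Defensive.

(** The theorem is true because [Gamma] sends the orthogonal monomials [z ^ alpha]
    to the functions [J_B * B ^ alpha / sqrt m], and these have the same inner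
    products and the same behaviour under [M_B] and its adjoint.

    By Fubini this is a matter of one variable (ip_tensor, T_Gamma_mono). Let [b]
    be a Blaschke product of order [m]. Stokes's formula writes the pairing of
    [g] with a derivative [F'] in the Bergman space of the disc as the mean of
    [z * g * conj F] over the unit circle (dprod_derivative). As [b ^ n * b'] is
    the derivative of [b ^ (n + 1) / (n + 1)] and [|b| = 1] on the circle, it
    follows that
      [<b * f, b ^ n * b'> = n / (n + 1) * <f, b ^ (n - 1) * b'>]
    for every [f] (dprod_inner_shift), and [<b', b'>] is the winding number of
    [b] on the circle, which is its order [m] (blaschke_winding). By induction
    the [b ^ n * b'] are orthogonal with squared norms [m / (n + 1)]
    (dprod_inner_gram). Hence [Gamma] is an isometry of the Bergman space which
    intertwines the coordinate multiplications [Z i] with the [M_(B i)], and the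
    first identity says that its range is invariant under the adjoints of the
    [M_(B i)] (Gamma_iso, T_Gamma_commute, T_Gamma).

    The remaining claims on the range are Hilbert space theory for an isometry
    [G] with [T i \o G = G \o Z i], where the [Z i] are weighted shifts of an
    orthogonal family indexed by multi-indices. The range is closed, being the
    range of the projection [G G^*] (M_closed), and [G^-1] is the unitary
    equivalence with the multishift (restriction_equivalent). For minimality, the
    operator [2 (1 - Z_i^* Z_i)] is diagonal with eigenvalue [2 / (alpha_i + 2)],
    so that the powers of the product of these operators converge strongly to the
    projection on the constants. A nonzero reducing subspace, after adjoint
    shifts have moved a nonzero coefficient to the constant one, contains the
    constants, and then all monomials (minimal_M).

    The range is not the whole space: if some [m i >= 2], then [B i] has a
    multiple zero or two distinct zeros in the disc, and this is an obstruction
    to the surjectivity of [Gamma] (blaschke_degenerate, Gamma_proper). If all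
    [m i = 1], then [B] is biholomorphic (blaschke_invertible,
    automorphism_product).

    The function theory used above is derived from complex differentiability with
    circle means instead of contour integrals. The mean of a bounded function is
    a Banach limit of its dyadic Riemann sums: it is defined for every bounded
    function, it splits exactly at dyadic points, and it is invariant under rotations by
    dyadic roots of unity. Bisection gives Goursat's theorem and primitives,
    rotation invariance gives Cauchy's formula for functions with enough
    regularity, and passing through second primitives gives it in general
    (goursat, cauchy_C11, holo_cauchy). Iterating the formula over the variables
    identifies the holomorphic functions on the polydisc with the sums of locally
    uniformly convergent power series (holo_series, series_holo). Together with
    the moments of the area measure, obtained from its invariance under rotations
    and its scaling under dilations (moment_disc), this makes the monomials an
    orthogonal basis of the Bergman space, which is complete (A2_dense,
    A2_riesz_fischer). *)

(** * Complex numbers over a real type *)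

Section norm.
Variable R : realType.
Local Notation C := (Cplx R).
Implicit Types (x y z : C) (r : R).

(** The modulus with values in [R] rather than in the complex numbers, so
    that estimates are inequalities of real numbers. *)
Definition nrm (z : C) : R := Normc.normc z.

Lemma normE z : `|z| = ofR (nrm z).
Proof. by []. Qed.

Lemma nrm_ge0 z : 0 <= nrm z.
Proof. by rewrite -(@lecR R) -/(ofR _) -/(ofR _) -normE normr_ge0. Qed.

Lemma nrm_lt1 z : (`|z| < 1) = (nrm z < 1).
Proof. by rewrite normE -(ltcR (nrm z)). Qed.

Lemma nrm0 : nrm 0 = 0. Proof. exact: Normc.normc0. Qed.
Lemma nrm1 : nrm 1 = 1. Proof. exact: Normc.normc1. Qed.
Lemma nrmM x y : nrm (x * y) = nrm x * nrm y. Proof. exact: Normc.normcM. Qed.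
Lemma nrmV x : nrm x^-1 = (nrm x)^-1. Proof. exact: Normc.normcV. Qed.
Lemma nrmN x : nrm (- x) = nrm x.
Proof. exact: normcN. Qed.
Lemma nrmD x y : nrm (x + y) <= nrm x + nrm y. Proof. exact: le_normcD. Qed.
Lemma nrmB x y : nrm (x - y) <= nrm x + nrm y.
Proof. by rewrite -(nrmN y) nrmD. Qed.
Lemma nrmC x y : nrm (x - y) = nrm (y - x).
Proof. by rewrite -nrmN opprB. Qed.
Lemma nrm_eq0 x : (nrm x == 0) = (x == 0).
Proof.
apply/eqP/eqP => [/Normc.eq0_normc//|->]; exact: nrm0.
Qed.
Lemma nrm_gt0 x : (0 < nrm x) = (x != 0).
Proof. by rewrite lt_def nrm_eq0 nrm_ge0 andbT. Qed.
Lemma nrmX x n : nrm (x ^+ n) = nrm x ^+ n.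
Proof. by elim: n => [|n IH]; rewrite ?expr0 ?nrm1// !exprS nrmM IH. Qed.
Lemma nrm_ofR r : nrm (ofR r) = `|r|.
Proof. by rewrite /nrm /ofR /= expr0n /= addr0 sqrtr_sqr. Qed.
Lemma nrm_nat n : nrm (n%:R : C) = n%:R.
Proof.
have -> : (n%:R : C) = ofR n%:R by rewrite /ofR rmorph_nat.
by rewrite nrm_ofR normr_nat.
Qed.
Lemma nrm_prod (I : Type) (s : seq I) (P : pred I) (F : I -> C) :
  nrm (\prod_(i <- s | P i) F i) = \prod_(i <- s | P i) nrm (F i).
Proof. by apply: (big_morph nrm nrmM nrm1). Qed.
Lemma nrm_sum (I : Type) (s : seq I) (P : pred I) (F : I -> C) :
  nrm (\sum_(i <- s | P i) F i) <= \sum_(i <- s | P i) nrm (F i).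
Proof.
elim/big_ind2 : _ => [|x x' y y' hx hy|//]; first by rewrite nrm0.
by apply: (le_trans (nrmD _ _)); exact: lerD.
Qed.
Lemma nrm_Bge x y : nrm x - nrm y <= nrm (x - y).
Proof. by rewrite lerBlDr; have := nrmD (x - y) y; rewrite subrK. Qed.

Lemma nrm_sqr z : nrm z ^+ 2 = complex.Re z ^+ 2 + complex.Im z ^+ 2.
Proof.
case: z => a b; rewrite /nrm /= sqr_sqrtr//.
by rewrite addr_ge0 ?sqr_ge0.
Qed.

Lemma normRe_le z : `|complex.Re z| <= nrm z.
Proof.
rewrite -(@ler_pXn2r _ 2)// ?nnegrE ?nrm_ge0//.
by rewrite nrm_sqr real_normK ?num_real// lerDl sqr_ge0.
Qed.

Lemma normIm_le z : `|complex.Im z| <= nrm z.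
Proof.
rewrite -(@ler_pXn2r _ 2)// ?nnegrE ?nrm_ge0//.
by rewrite nrm_sqr real_normK ?num_real// lerDr sqr_ge0.
Qed.

Lemma nrm_le_ReIm z : nrm z <= `|complex.Re z| + `|complex.Im z|.
Proof.
rewrite -(@ler_pXn2r _ 2)// ?nnegrE ?nrm_ge0 ?addr_ge0//.
rewrite nrm_sqr sqrrD !real_normK ?num_real//.
by rewrite -addrA lerD2l lerDr mulrn_wge0// mulr_ge0.
Qed.

Lemma cReD x y : complex.Re (x + y) = complex.Re x + complex.Re y.
Proof. by case: x; case: y. Qed.
Lemma cImD x y : complex.Im (x + y) = complex.Im x + complex.Im y.
Proof. by case: x; case: y. Qed.
Lemma cReN x : complex.Re (- x) = - complex.Re x. Proof. by case: x. Qed.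
Lemma cImN x : complex.Im (- x) = - complex.Im x. Proof. by case: x. Qed.
Lemma cReM x y : complex.Re (x * y) =
  complex.Re x * complex.Re y - complex.Im x * complex.Im y.
Proof. by case: x; case: y. Qed.
Lemma cImM x y : complex.Im (x * y) =
  complex.Re x * complex.Im y + complex.Im x * complex.Re y.
Proof. by case: x => a b; case: y => c e /=. Qed.
Lemma cplx_eq x y : complex.Re x = complex.Re y ->
  complex.Im x = complex.Im y -> x = y.
Proof. by case: x => a b; case: y => c e /= -> ->. Qed.

Lemma cconjD x y : cconj (x + y) = cconj x + cconj y.
Proof. by rewrite /cconj; exact: rmorphD. Qed.
Lemma cconjM x y : cconj (x * y) = cconj x * cconj y.
Proof. by rewrite /cconj; exact: rmorphM. Qed.
Lemma cconjN x : cconj (- x) = - cconj x.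
Proof. by rewrite /cconj; exact: rmorphN. Qed.
Lemma cconjK x : cconj (cconj x) = x. Proof. exact: conjcK. Qed.
Lemma cconj1 : cconj (1 : C) = 1. Proof. exact: conjc1. Qed.
Lemma cconj0 : cconj (0 : C) = 0. Proof. exact: conjc0. Qed.
Lemma cconjX x n : cconj (x ^+ n) = cconj x ^+ n.
Proof. by rewrite /cconj; exact: rmorphXn. Qed.
Lemma cconj_ofR r : cconj (ofR r) = ofR r. Proof. exact: conjc_real. Qed.
Lemma cconj_sum (I : Type) (s : seq I) (P : pred I) (F : I -> C) :
  cconj (\sum_(i <- s | P i) F i) = \sum_(i <- s | P i) cconj (F i).
Proof. by rewrite /cconj; exact: rmorph_sum. Qed.
Lemma cconj_prod (I : Type) (s : seq I) (P : pred I) (F : I -> C) :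
  cconj (\prod_(i <- s | P i) F i) = \prod_(i <- s | P i) cconj (F i).
Proof. by rewrite /cconj; exact: rmorph_prod. Qed.
Lemma nrm_conj x : nrm (cconj x) = nrm x.
Proof. by case: x => a b; rewrite /nrm /cconj /= sqrrN. Qed.
Lemma mul_conj x : x * cconj x = ofR (nrm x ^+ 2).
Proof.
rewrite nrm_sqr; case: x => a b; rewrite /cconj /ofR /=.
by apply: cplx_eq; rewrite ?cReM ?cImM/=; ring.
Qed.
Lemma ofRD r s : ofR (r + s) = ofR r + ofR s.
Proof. by rewrite /ofR rmorphD. Qed.
Lemma ofRM r s : ofR (r * s) = ofR r * ofR s.
Proof. by rewrite /ofR rmorphM. Qed.
Lemma ofRN r : ofR (- r) = - ofR r.
Proof. by rewrite /ofR rmorphN. Qed.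
Lemma ofRV r : ofR r^-1 = (ofR r)^-1.
Proof. by rewrite /ofR fmorphV. Qed.
Lemma ofRX r n : ofR (r ^+ n) = ofR r ^+ n.
Proof. by rewrite /ofR rmorphXn. Qed.
Lemma ofR1 : ofR (1 : R) = 1. Proof. by []. Qed.
Lemma ofR0 : ofR (0 : R) = 0. Proof. by []. Qed.
Lemma ofR_nat n : ofR (n%:R : R) = n%:R. Proof. by rewrite /ofR rmorph_nat. Qed.
Lemma ofR_sum (I : Type) (s : seq I) (P : pred I) (F : I -> R) :
  ofR (\sum_(i <- s | P i) F i) = \sum_(i <- s | P i) ofR (F i).
Proof. by rewrite /ofR rmorph_sum. Qed.
Lemma ofR_prod (I : Type) (s : seq I) (P : pred I) (F : I -> R) :
  ofR (\prod_(i <- s | P i) F i) = \prod_(i <- s | P i) ofR (F i).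
Proof. by rewrite /ofR rmorph_prod. Qed.
Lemma ofR_eq0 r : (ofR r == 0) = (r == 0).
Proof. by rewrite -nrm_eq0 nrm_ofR normr_eq0. Qed.
End norm.
Arguments nrm : simpl never.

(** * A translation-invariant mean *)

Section banach_limit.
Variable R : realType.
Local Notation C := (Cplx R).

Definition free_ultrafilter : set_system nat :=
  projT1 (cid (@ultraFilterLemma nat \oo _)).

Local Notation U := free_ultrafilter.

Lemma free_ultrafilter_ultra : UltraFilter U.
Proof. by rewrite /U; case: cid => G []. Qed.

Lemma free_ultrafilter_ge n : U [set k | (n <= k)%N].
Proof.
rewrite /U; case: cid => G [_ +] /=; apply.
exact: nbhs_infty_ge.
Qed.
#[local] Existing Instance free_ultrafilter_ultra.
#[local] Instance free_ultrafilter_proper : ProperFilter U.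
Proof. by have [] := free_ultrafilter_ultra. Qed.

Lemma free_ultrafilter_cvg (u : nat -> R) (K : R) : (forall n, `|u n| <= K) ->
  u @ U --> lim (u @ U).
Proof.
move=> uK.
have := @segment_compact R (- K) K; rewrite compact_ultra => /(_ (u @ U) _).
(* the image of an ultrafilter is an ultrafilter, and the segment is compact *)
have UI : UltraFilter (u @ U).
  split; first exact: fmap_proper_filter.
  move=> G PG sG.
  apply/predeqP => A; split => [GA|]; last exact: sG.
  have [//|nA] := in_ultra_setVsetC (u @^-1` A) free_ultrafilter_ultra.
  have := sG (~` A) nA.
  move=> GnA; exfalso; apply: (@filter_not_empty _ G _).
  by rewrite -(setICr A); exact: filterI.
case/(_ UI) => [|x [_ ux]].
  apply: filterS (@filterT _ U _) => n _ /=.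
  by rewrite in_itv /= -ler_norml.
by apply/cvg_ex; exists x.
Qed.

(** The limit along a free ultrafilter: every bounded sequence has one, by
    compactness of closed balls. *)
Definition ulim (x : nat -> C) : C :=
  Complex (lim ((@complex.Re R \o x) @ U)) (lim ((@complex.Im R \o x) @ U)).

Definition bnd (T : Type) (x : T -> C) := exists K, forall t, nrm (x t) <= K.

Lemma ulim_Re x : bnd x -> @complex.Re R \o x @ U --> complex.Re (ulim x).
Proof.
move=> [K xK]; apply: (@free_ultrafilter_cvg _ K) => n.
exact: le_trans (normRe_le _) _.
Qed.
Lemma ulim_Im x : bnd x -> @complex.Im R \o x @ U --> complex.Im (ulim x).
Proof.
move=> [K xK]; apply: (@free_ultrafilter_cvg _ K) => n.
exact: le_trans (normIm_le _) _.
Qed.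

Lemma ulim_eq x (l : C) : bnd x -> @complex.Re R \o x @ U --> complex.Re l ->
  @complex.Im R \o x @ U --> complex.Im l -> ulim x = l.
Proof.
move=> bx xr xi; apply: cplx_eq => /=; exact: cvg_lim.
Qed.

Lemma bnd_add T (x y : T -> C) : bnd x -> bnd y -> bnd (fun t => x t + y t).
Proof.
move=> [K xK] [L yL]; exists (K + L) => t.
by apply: le_trans (nrmD _ _) _; exact: lerD.
Qed.
Lemma bndM T (x y : T -> C) : bnd x -> bnd y -> bnd (fun t => x t * y t).
Proof.
move=> [K xK] [L yL]; exists (K * L) => t.
by rewrite nrmM; apply: ler_pM => //; exact: nrm_ge0.
Qed.
Lemma bnd_cst T (c : C) : bnd (fun _ : T => c). Proof. by exists (nrm c). Qed.

Lemma ulimD x y : bnd x -> bnd y -> ulim (fun n => x n + y n) = ulim x + ulim y.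
Proof.
move=> bx by_; apply: ulim_eq; first exact: bnd_add.
- rewrite (_ : _ \o _ = fun n => complex.Re (x n) + complex.Re (y n)).
    by rewrite cReD; apply: cvgD; exact: ulim_Re.
  by apply/funext => n /=; rewrite cReD.
- rewrite (_ : _ \o _ = fun n => complex.Im (x n) + complex.Im (y n)).
    by rewrite cImD; apply: cvgD; exact: ulim_Im.
  by apply/funext => n /=; rewrite cImD.
Qed.

Lemma ulimZ (c : C) x : bnd x -> ulim (fun n => c * x n) = c * ulim x.
Proof.
move=> bx; apply: ulim_eq; first by apply: bndM => //; exact: bnd_cst.
- rewrite (_ : _ \o _ = fun n => complex.Re c * complex.Re (x n) -
    complex.Im c * complex.Im (x n)); last by apply/funext => n /=; rewrite cReM.
  rewrite cReM; apply: cvgB; apply: cvgMr; [exact: ulim_Re|exact: ulim_Im].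
- rewrite (_ : _ \o _ = fun n => complex.Re c * complex.Im (x n) +
    complex.Im c * complex.Re (x n)); last by apply/funext => n /=; rewrite cImM.
  rewrite cImM; apply: cvgD; apply: cvgMr; [exact: ulim_Im|exact: ulim_Re].
Qed.

Lemma ulim_approx x e : bnd x -> 0 < e -> U [set n | nrm (x n - ulim x) < e].
Proof.
move=> bx e0.
have e2 : 0 < e / 2 by rewrite divr_gt0.
have /cvgrPdist_lt/(_ _ e2) h1 := ulim_Re bx.
have /cvgrPdist_lt/(_ _ e2) h2 := ulim_Im bx.
apply: filterS2 h1 h2 => n /= h1 h2.
apply: le_lt_trans (nrm_le_ReIm _) _.
rewrite cReD cImD cReN cImN (splitr e) distrC (distrC _ (complex.Im _)).
exact: ltrD.
Qed.

Lemma nrm_ulim_le x (c : C) K : bnd x -> U [set n | nrm (x n - c) <= K] ->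
  nrm (ulim x - c) <= K.
Proof.
move=> bx xK; apply/ler_addgt0Pr => e e0.
have [n [/= h1 h2]] := filter_ex (filterI xK (ulim_approx bx e0)).
rewrite (_ : ulim x - c = (x n - c) - (x n - ulim x)); last by ring.
by apply: le_trans (nrmB _ _) _; apply: lerD => //; exact: ltW.
Qed.

Definition cesaro (x : nat -> C) (n : nat) : C :=
  ofR n.+1%:R^-1 * \sum_(k < n.+1) x k.

(** Averaging before taking the limit makes it invariant under the shift, and
    it keeps the linearity and the bounds of [ulim]. *)
Definition banach_lim (x : nat -> C) : C := ulim (cesaro x).

Lemma cesaro_le x (c : C) K n : (forall n, nrm (x n - c) <= K) ->
  nrm (cesaro x n - c) <= K.
Proof.
move=> xK; have n0 : (n.+1%:R : R) != 0 by rewrite pnatr_eq0.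
have -> : cesaro x n - c = ofR n.+1%:R^-1 * \sum_(k < n.+1) (x k - c).
  rewrite sumrB sumr_const card_ord /cesaro mulrBr; congr (_ - _).
  rewrite -(mulr_natl c) mulrA -(ofR_nat R) -ofRM mulVf// ofR1 mul1r//.
rewrite nrmM nrm_ofR ger0_norm ?invr_ge0// mulrC ler_pdivrMr ?ltr0n//.
apply: le_trans (nrm_sum _ _ _) _.
apply: (@le_trans _ _ (\sum_(k < n.+1) K)); first exact: ler_sum.
by rewrite sumr_const card_ord mulr_natr.
Qed.

Lemma bnd_cesaro x : bnd x -> bnd (cesaro x).
Proof.
move=> [K xK]; exists K => n; rewrite -[cesaro _ _]subr0.
by apply: cesaro_le => m; rewrite subr0.
Qed.

Lemma banach_limD x y : bnd x -> bnd y ->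
  banach_lim (fun n => x n + y n) = banach_lim x + banach_lim y.
Proof.
move=> bx by_; rewrite /banach_lim -ulimD; try exact: bnd_cesaro.
congr ulim; apply/funext => n; rewrite /cesaro -mulrDr; congr (_ * _).
by rewrite big_split.
Qed.

Lemma banach_limZ (c : C) x : bnd x ->
  banach_lim (fun n => c * x n) = c * banach_lim x.
Proof.
move=> bx; rewrite /banach_lim -ulimZ; last exact: bnd_cesaro.
by congr ulim; apply/funext => n; rewrite /cesaro mulrCA -mulr_sumr.
Qed.

(** The Cesaro means of a sequence and of its shift differ by two end terms
    divided by the length. *)
Lemma banach_lim_shift x : bnd x -> banach_lim (fun n => x n.+1) = banach_lim x.
Proof.
move=> bx; have [K xK] := bx.
have bx' : bnd (fun n => x n.+1) by exists K.
have K0 : 0 <= K by apply: le_trans (xK 0%N); exact: nrm_ge0.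
pose d n := cesaro (fun n => x n.+1) n + (-1) * cesaro x n.
have bd : bnd d.
  apply: bnd_add; first exact: bnd_cesaro.
  by apply: bndM; [exact: bnd_cst|exact: bnd_cesaro].
have dK n : nrm (d n) <= (K + K) / n.+1%:R.
  rewrite /d mulN1r -mulrBr nrmM nrm_ofR ger0_norm ?invr_ge0// mulrC.
  rewrite ler_pM2r ?invr_gt0 ?ltr0n//.
  rewrite big_ord_recr [X in _ - X]big_ord_recl /=.
  rewrite (_ : _ - _ = x n.+1 - x 0%N); last by rewrite /bump /=; ring.
  by apply: le_trans (nrmB _ _) _; exact: lerD.
have : ulim d = 0.
  apply/eqP; rewrite -nrm_eq0 eq_le nrm_ge0 andbT.
  apply/ler_addgt0Pr => e e0; rewrite add0r -[ulim d]subr0.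
  apply: nrm_ulim_le => //.
  have := free_ultrafilter_ge (Num.bound ((K + K) / e)).
  apply: filterS => n /= hn; rewrite subr0; apply: le_trans (dK n) _.
  rewrite ler_pdivrMr ?ltr0n// mulrC -ler_pdivrMr//.
  apply: ltW; apply: lt_le_trans (archi_boundP _) _.
    by rewrite divr_ge0 ?addr_ge0// ltW.
  by rewrite ler_nat; exact: leqW.
rewrite /d ulimD; last 2 first.
- exact: bnd_cesaro.
- by apply: bndM; [exact: bnd_cst|exact: bnd_cesaro].
by rewrite ulimZ ?mulN1r; [move/eqP; rewrite subr_eq0 => /eqP|exact: bnd_cesaro].
Qed.

Lemma banach_lim_shiftn x p : bnd x ->
  banach_lim (fun n => x (n + p)%N) = banach_lim x.
Proof.
move=> [K xK]; elim: p => [|p IH].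
  by congr banach_lim; apply/funext => n; rewrite addn0.
rewrite -IH -[RHS]banach_lim_shift; last by exists K.
by congr banach_lim; apply/funext => n; rewrite addnS.
Qed.

Lemma banach_lim_le x (c : C) K p : bnd x ->
  (forall n, (p <= n)%N -> nrm (x n - c) <= K) -> nrm (banach_lim x - c) <= K.
Proof.
move=> bx xK; rewrite -(banach_lim_shiftn p)//.
have [L xL] := bx.
apply: nrm_ulim_le; first by apply: bnd_cesaro; exists L.
apply: filterS (@filterT _ free_ultrafilter _) => n _ /=.
by apply: cesaro_le => m; apply: xK; exact: leq_addl.
Qed.

Lemma banach_lim_eq x y p : bnd x ->
  (forall n, (p <= n)%N -> x n = y n) -> bnd y -> banach_lim x = banach_lim y.
Proof.
move=> bx xy by_; rewrite -(banach_lim_shiftn p)// -[RHS](banach_lim_shiftn p)//.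
by congr banach_lim; apply/funext => n; apply: xy; exact: leq_addl.
Qed.

(** ** The mean over [0, 1] *)

(** Midpoints are used since halving an interval and reflecting it permute
    them exactly: the identities of the mean then hold without any limit
    argument. *)
Definition midpoint (N k : nat) : R := (k%:R + 2^-1) / 2 ^+ N.

Definition midpoint_sum (N : nat) (phi : R -> C) : C :=
  ofR (2 ^+ N)^-1 * \sum_(k < 2 ^ N) phi (midpoint N k).

(** A substitute for the integral from 0 to 1, which is linear and
    norm-decreasing on the space of all bounded functions. *)
Definition avg (phi : R -> C) : C := banach_lim (fun N => midpoint_sum N phi).

Definition bnd01 (phi : R -> C) :=
  exists K, forall t, 0 <= t <= 1 -> nrm (phi t) <= K.

Lemma midpoint01 N k : (k < 2 ^ N)%N -> 0 <= midpoint N k <= 1.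
Proof.
move=> kN; have N0 : (0 : R) < 2 ^+ N by rewrite exprn_gt0.
apply/andP; split; first by rewrite divr_ge0 ?(ltW N0)// addr_ge0// invr_ge0.
rewrite ler_pdivrMr// mul1r -natrX.
apply: (@le_trans _ _ (k.+1%:R)); last by rewrite ler_nat.
by rewrite -[k.+1%:R]natr1 lerD2l; lra.
Qed.

Lemma midpoint_sum_le (phi : R -> C) (c : C) K N :
  (forall t, 0 <= t <= 1 -> nrm (phi t - c) <= K) ->
  nrm (midpoint_sum N phi - c) <= K.
Proof.
move=> pK; have N0 : (0 : R) < 2 ^+ N by rewrite exprn_gt0.
have -> : midpoint_sum N phi - c =
    ofR (2 ^+ N)^-1 * \sum_(k < 2 ^ N) (phi (midpoint N k) - c).
  rewrite sumrB sumr_const card_ord /midpoint_sum mulrBr; congr (_ - _).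
  rewrite -(mulr_natl c) mulrA -(ofR_nat R) -ofRM natrX mulVf ?gt_eqF//.
  by rewrite ofR1 mul1r.
rewrite nrmM nrm_ofR ger0_norm ?invr_ge0 ?(ltW N0)// mulrC ler_pdivrMr//.
apply: le_trans (nrm_sum _ _ _) _.
apply: (@le_trans _ _ (\sum_(k < 2 ^ N) K)).
  by apply: ler_sum => k _; apply: pK; exact: midpoint01.
by rewrite sumr_const card_ord -[K *+ _]mulr_natr natrX.
Qed.

Lemma bnd_midpoint_sum phi : bnd01 phi -> bnd (fun N => midpoint_sum N phi).
Proof.
move=> [K pK]; exists K => N; rewrite -[midpoint_sum _ _]subr0.
by apply: midpoint_sum_le => t t01; rewrite subr0 pK.
Qed.

Lemma eq_avg (phi psi : R -> C) : (forall t, 0 <= t <= 1 -> phi t = psi t) ->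
  avg phi = avg psi.
Proof.
move=> h; congr banach_lim; apply/funext => N; congr (_ * _).
by apply: eq_bigr => k _; apply: h; exact: midpoint01.
Qed.

Lemma avgD phi psi : bnd01 phi -> bnd01 psi ->
  avg (fun t => phi t + psi t) = avg phi + avg psi.
Proof.
move=> bp bq; rewrite /avg -banach_limD; try exact: bnd_midpoint_sum.
congr banach_lim; apply/funext => N.
by rewrite /midpoint_sum -mulrDr big_split.
Qed.

Lemma avgZ (c : C) phi : bnd01 phi -> avg (fun t => c * phi t) = c * avg phi.
Proof.
move=> bp; rewrite /avg -banach_limZ; last exact: bnd_midpoint_sum.
congr banach_lim; apply/funext => N.
by rewrite /midpoint_sum mulrCA -mulr_sumr.
Qed.

Lemma avg_le (phi : R -> C) (c : C) K : (forall t, 0 <= t <= 1 -> nrm (phi t - c) <= K) ->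
  nrm (avg phi - c) <= K.
Proof.
move=> pK; apply: (@banach_lim_le _ _ _ 0%N); last first.
  by move=> n _; exact: midpoint_sum_le.
apply: bnd_midpoint_sum; exists (K + nrm c) => t t01.
rewrite -[phi t](subrK c); apply: le_trans (nrmD _ _) _.
by rewrite lerD2r pK.
Qed.

Lemma avg_cst (c : C) : avg (fun=> c) = c.
Proof.
apply/eqP; rewrite -subr_eq0 -nrm_eq0 eq_le nrm_ge0 andbT.
by apply: avg_le => t _; rewrite subrr nrm0.
Qed.

(** The sum of order [N + 1] over the interval is the mean of the sums of
    order [N] over the two halves; this is where invariance under the shift
    is needed. *)
Lemma avg_half phi : bnd01 phi -> avg phi =
  ofR 2^-1 * (avg (fun t => phi (t / 2)) + avg (fun t => phi ((1 + t) / 2))).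
Proof.
move=> bp; have [K pK] := bp.
have b1 : bnd01 (fun t => phi (t / 2)).
  by exists K => t t01; apply: pK; lra.
have b2 : bnd01 (fun t => phi ((1 + t) / 2)).
  by exists K => t t01; apply: pK; lra.
rewrite -avgD// -avgZ; last first.
  exists (K + K) => t t01; apply: le_trans (nrmD _ _) _.
  by apply: lerD; apply: pK; lra.
rewrite /avg -[LHS]banach_lim_shift; last exact: bnd_midpoint_sum.
congr banach_lim; apply/funext => N; rewrite /midpoint_sum.
have -> : (2 ^ N.+1 = 2 ^ N + 2 ^ N)%N by rewrite expnS mul2n addnn.
rewrite big_split_ord /= -[in RHS]mulr_sumr mulrA -ofRM.
rewrite (_ : 2 ^- N * 2^-1 = 2 ^- N.+1); last by rewrite exprSr invfM mulrC.
congr (_ * _); rewrite big_split /=; congr (_ + _).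
  apply: eq_bigr => k _; congr phi; rewrite /midpoint exprSr invfM mulrA//.
apply: eq_bigr => k _; congr phi; rewrite /midpoint exprSr natrD natrX.
have : (2 : R) ^+ N != 0 by rewrite expf_neq0// pnatr_eq0.
by move=> h; field.
Qed.

Lemma avg_rev phi : bnd01 phi -> avg (fun t => phi (1 - t)) = avg phi.
Proof.
move=> bp; congr banach_lim; apply/funext => N; rewrite /midpoint_sum.
congr (_ * _); rewrite [RHS](reindex_inj rev_ord_inj) /=.
apply: eq_bigr => k _; congr phi; rewrite /midpoint natrB; last exact: ltn_ord.
have : (2 : R) ^+ N != 0 by rewrite expf_neq0// pnatr_eq0.
by move=> h; rewrite natrX -natr1; field.
Qed.

(** The reflection [t |-> 1 - t] preserves the mean. *)
Lemma avg_id : avg (@ofR R) = ofR 2^-1.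
Proof.
have b1 : bnd01 (@ofR R).
  by exists 1 => t /andP[t0 t1]; rewrite nrm_ofR ger0_norm.
have := avg_rev b1.
rewrite (@eq_avg _ (fun t => 1 + (-1) * ofR t)); last first.
  by move=> t _; rewrite ofRD ofRN mulN1r.
rewrite avgD ?avgZ ?avg_cst; [move=> h| exact: b1 | |]; last 2 first.
- by exists 1 => t _; rewrite nrm1.
- by exists 1 => t /andP[t0 t1]; rewrite nrmM nrmN nrm1 mul1r nrm_ofR ger0_norm.
have h2 : (2 : C) != 0 by rewrite pnatr_eq0.
rewrite ofRV ofR_nat; apply: (mulfI h2); rewrite divff//.
have : 1 = avg (@ofR R) + avg (@ofR R) by rewrite -{1}h; ring.
by move=> h'; rewrite mulr_natl mulr2n -h'.
Qed.

(** ** The mean over the unit circle *)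

Definition cavg (phi : C -> C) : C := avg (fun t => phi (expi (2 * pi * t))).

Definition bndS1 (phi : C -> C) :=
  exists K, forall z, nrm z = 1 -> nrm (phi z) <= K.

Lemma expiD (a b : R) : expi (a + b) = expi a * expi b.
Proof.
by apply: cplx_eq; rewrite ?cReM ?cImM /= ?cosD ?sinD //; ring.
Qed.

Lemma nrm_expi (a : R) : nrm (expi a) = 1.
Proof. by rewrite /nrm /= cos2Dsin2 sqrtr1. Qed.

Lemma expi0 : expi (0 : R) = 1.
Proof. by apply: cplx_eq; rewrite /= ?cos0 ?sin0. Qed.

Lemma expiMn (a : R) n : expi (a *+ n) = expi a ^+ n.
Proof.
by elim: n => [|n IH]; rewrite ?expi0// mulrS expiD IH exprS.
Qed.

Lemma expi_pi : expi (pi : R) = -1.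
Proof. by apply: cplx_eq; rewrite /= ?cospi ?sinpi ?oppr0. Qed.

(** The dyadic roots of unity: rotation by [droot p] permutes the [2 ^ N]
    sample points of the circle as soon as [p <= N]. *)
Definition droot (p : nat) : C := expi (2 * pi / 2 ^+ p).

Lemma drootS p : droot p.+1 ^+ 2 = droot p.
Proof.
rewrite -expiMn /droot exprS; congr expi.
have : (2 : R) ^+ p != 0 by rewrite expf_neq0// pnatr_eq0.
by move=> h; rewrite -mulr_natr; field.
Qed.

Lemma droot1 : droot 1 = -1.
Proof. by rewrite /droot expr1 mulrAC divff ?pnatr_eq0// mul1r expi_pi. Qed.

Lemma nrm_droot p : nrm (droot p) = 1. Proof. exact: nrm_expi. Qed.

Lemma droot_neq1 p : droot p.+1 != 1.
Proof.
have h : (-1 : C) != 1.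
  by rewrite -subr_eq0 -opprD oppr_eq0 -(natrD _ 1 1) pnatr_eq0.
elim: p => [|p IH]; first by rewrite droot1.
by apply: contraNneq IH => h2; rewrite -drootS h2 expr1n.
Qed.

Lemma droot_near1 e : 0 < e -> exists p, nrm (droot p.+1 - 1) < e.
Proof.
move=> e0; have e2 : 0 < e / 2 by rewrite divr_gt0.
have hc : cos x @[x --> (0 : R)] --> cos (0 : R) by exact: continuous_cos.
have hs : sin x @[x --> (0 : R)] --> sin (0 : R) by exact: continuous_sin.
have h0 : (fun p : nat => 2 * pi * (2^-1 : R) ^+ p) @ \oo --> (0 : R).
  rewrite -[X in _ --> X](mulr0 (2 * pi)); apply: cvgMr.
  by apply: cvg_expr; rewrite ger0_norm ?invr_ge0//; lra.
have := cvg_comp _ _ h0 hc; have := cvg_comp _ _ h0 hs.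
move=> /cvgrPdist_lt/(_ _ e2) h1 /cvgrPdist_lt/(_ _ e2) h2.
have [p _ h] : \forall p \near \oo, nrm (droot p - 1) < e.
  near=> p.
  apply: le_lt_trans (nrm_le_ReIm _) _; rewrite cReD cImD /= oppr0 addr0.
  rewrite (splitr e) distrC; apply: ltrD.
    by near: p; apply: filterS h2 => p /=; rewrite cos0 exprVn.
  by near: p; apply: filterS h1 => p /=; rewrite sin0 sub0r normrN exprVn.
by exists p; apply: h => /=.
Unshelve. all: by end_near. Qed.

(** If [n] is [2 ^ p] times an odd number, then [droot (p + 1) ^ n = -1]. *)
Lemma droot_pow_neq1 n : (0 < n)%N -> exists p, droot p ^+ n != 1.
Proof.
move=> n0; suff [p hp] : exists p, droot p ^+ n = -1.
  by exists p; rewrite hp -droot1 droot_neq1.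
have [k nk] := ubnP n; elim: k n nk n0 => // k IH n nk n0.
have [on|en] := boolP (odd n).
  by exists 1%N; rewrite droot1 -signr_odd on expr1.
have [||p hp] := IH n./2.
- by rewrite -divn2; lia.
- by case: n n0 en {nk} => [|[|]].
exists p.+1; rewrite -[n]odd_double_half (negbTE en) add0n -mul2n exprM drootS.
exact: hp.
Qed.

Lemma bndS1_01 phi : bndS1 phi -> bnd01 (fun t => phi (expi (2 * pi * t))).
Proof. by move=> [K h]; exists K => t _; apply: h; exact: nrm_expi. Qed.

Lemma eq_cavg (phi psi : C -> C) : (forall z, nrm z = 1 -> phi z = psi z) ->
  cavg phi = cavg psi.
Proof. by move=> h; apply: eq_avg => t _; apply: h; exact: nrm_expi. Qed.

Lemma cavgD phi psi : bndS1 phi -> bndS1 psi ->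
  cavg (fun z => phi z + psi z) = cavg phi + cavg psi.
Proof. by move=> /bndS1_01 h1 /bndS1_01 h2; rewrite /cavg avgD. Qed.

Lemma cavgZ (c : C) phi : bndS1 phi -> cavg (fun z => c * phi z) = c * cavg phi.
Proof. by move=> /bndS1_01 h1; rewrite /cavg avgZ. Qed.

Lemma cavg_le (phi : C -> C) (c : C) K : (forall z, nrm z = 1 -> nrm (phi z - c) <= K) ->
  nrm (cavg phi - c) <= K.
Proof. by move=> h; apply: avg_le => t _; apply: h; exact: nrm_expi. Qed.

Lemma cavg_cst (c : C) : cavg (fun=> c) = c. Proof. exact: avg_cst. Qed.

Lemma sum_periodic_shift (V : zmodType) (g : nat -> V) n s :
  (forall k, g (k + n)%N = g k) -> \sum_(k < n) g (k + s)%N = \sum_(k < n) g k.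
Proof.
move=> gn; elim: s => [|s IH].
  by apply: eq_bigr => k _; rewrite addn0.
rewrite -IH; case: n gn {IH} => [|n] gn; first by rewrite !big_ord0.
rewrite big_ord_recr [RHS]big_ord_recl /= addrC; congr (_ + _).
  by rewrite addnS -addSn addnC gn add0n.
by apply: eq_bigr => k _; rewrite /bump /= add1n addSnnS.
Qed.

Lemma cavg_rot p phi : bndS1 phi -> cavg (fun z => phi (z * droot p)) = cavg phi.
Proof.
move=> bp; have [K pK] := bp.
have b1 : bndS1 (fun z => phi (z * droot p)).
  by exists K => z z1; apply: pK; rewrite nrmM z1 nrm_droot mulr1.
rewrite /cavg/avg; apply: (@banach_lim_eq _ _ p).
- by apply: bnd_midpoint_sum; exact: (bndS1_01 b1).
- move=> N pN; congr (_ * _); pose g k := phi (expi (2 * pi * midpoint N k)).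
  have N0 : (2 : R) ^+ N != 0 by rewrite expf_neq0// pnatr_eq0.
  (* the rotation is the shift of the sample points by [2 ^ (N - p)] *)
  rewrite -(@sum_periodic_shift _ g _ (2 ^ (N - p))).
    apply: eq_bigr => k _; rewrite /g -expiD; congr (phi (expi _)).
    rewrite /midpoint natrD natrX.
    have -> : (2 : R) ^+ N = 2 ^+ (N - p) * 2 ^+ p by rewrite -exprD subnK.
    have h1 : (2 : R) ^+ (N - p) != 0 by rewrite expf_neq0// pnatr_eq0.
    have h2 : (2 : R) ^+ p != 0 by rewrite expf_neq0// pnatr_eq0.
    by field; rewrite h1 h2.
  move=> k; rewrite /g (_ : _ * midpoint N (k + _) = 2 * pi * midpoint N k + pi *+ 2).
    by rewrite expiD expiMn expi_pi sqrrN expr1n mulr1.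
  by rewrite /midpoint natrD natrX; field.
- by apply: bnd_midpoint_sum; exact: bndS1_01.
Qed.

(** Rotation by a dyadic root multiplies [z ^ n] by a constant other than
    one. *)
Lemma cavg_expn n : (0 < n)%N -> cavg (fun z => z ^+ n) = 0.
Proof.
move=> n0; have [p hp] := droot_pow_neq1 n0.
have b : bndS1 (fun z : C => z ^+ n).
  by exists 1 => z z1; rewrite nrmX z1 expr1n.
have := cavg_rot p b.
rewrite (@eq_cavg _ (fun z => droot p ^+ n * z ^+ n)); last first.
  by move=> z _; rewrite exprMn mulrC.
rewrite cavgZ// => /eqP; rewrite -subr_eq0 -[X in _ - X]mul1r -mulrBl mulf_eq0.
by rewrite subr_eq0 (negbTE hp) /= => /eqP.
Qed.

Lemma cavg_expNn n : (0 < n)%N -> cavg (fun z => z^-1 ^+ n) = 0.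
Proof.
move=> n0; have [p hp] := droot_pow_neq1 n0.
have b : bndS1 (fun z : C => z^-1 ^+ n).
  by exists 1 => z z1; rewrite nrmX nrmV z1 invr1 expr1n.
have := cavg_rot p b.
rewrite (@eq_cavg _ (fun z => (droot p)^-1 ^+ n * z^-1 ^+ n)); last first.
  by move=> z _; rewrite invfM exprMn mulrC.
rewrite cavgZ// => /eqP; rewrite -subr_eq0 -[X in _ - X]mul1r -mulrBl mulf_eq0.
rewrite subr_eq0 exprVn invr_eq1 (negbTE hp) /= => /eqP//.
Qed.

End banach_limit.

(** * One complex variable *)

Section one_variable.
Variable R : realType.
Local Notation C := (Cplx R).
Implicit Types (f g : C -> C) (a b c z w : C) (r s t : R).

(** A form of complex differentiability without quotients or filters;
    [cdiff_derive1] links it to [derive1]. *)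
Definition cdiff_at f z (l : C) := forall e : R, 0 < e -> exists2 d : R, 0 < d &
  forall h, nrm h < d -> nrm (f (z + h) - f z - l * h) <= e * nrm h.

Definition holo_on (rho : R) f := forall z, nrm z < rho -> exists l, cdiff_at f z l.

Definition bnd_on r f := exists K, forall z, nrm z <= r -> nrm (f z) <= K.

Lemma nrm_le0_eq0 (x : C) : (forall e : R, 0 < e -> nrm x <= e) -> x = 0.
Proof.
move=> h; apply/eqP; rewrite -nrm_eq0 eq_le nrm_ge0 andbT.
by apply/ler_addgt0Pr => e e0; rewrite add0r h.
Qed.

Lemma expr_small (q K e : R) : 0 <= q < 1 -> 0 <= K -> 0 < e ->
  exists N0, forall N, (N0 <= N)%N -> K * q ^+ N <= e.
Proof.
move=> /andP[q0 q1] K0 e0.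
have : (fun N => K * q ^+ N) @ \oo --> (K * 0 : R).
  by apply: cvgMr; apply: cvg_expr; rewrite ger0_norm.
rewrite mulr0 => /cvgrPdist_le/(_ _ e0)[N0 _ h].
exists N0 => N hN; have := h N hN; rewrite sub0r normrN ger0_norm//.
by rewrite mulr_ge0// exprn_ge0.
Qed.

Lemma in_segment (a b p : C) r t : nrm (a - p) <= r -> nrm (b - p) <= r ->
  0 <= t <= 1 -> nrm (a + ofR t * (b - a) - p) <= r.
Proof.
move=> ar br /andP[t0 t1].
rewrite (_ : _ - p = ofR (1 - t) * (a - p) + ofR t * (b - p)); last first.
  by rewrite ofRD ofRN ofR1; ring.
apply: le_trans (nrmD _ _) _; rewrite !nrmM !nrm_ofR !ger0_norm ?subr_ge0//.
rewrite (_ : r = (1 - t) * r + t * r); last by ring.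
by apply: lerD; apply: ler_wpM2l; rewrite ?subr_ge0.
Qed.

Lemma in_segment0 (a b : C) r t : nrm a <= r -> nrm b <= r ->
  0 <= t <= 1 -> nrm (a + ofR t * (b - a)) <= r.
Proof.
move=> ar br t01; rewrite -[_ + _]subr0; apply: in_segment => //; by rewrite subr0.
Qed.

(** Compactness: along a sequence on which [f] is unbounded, the function
    would be unbounded near the limit of the sequence along the ultrafilter. *)
Lemma holo_bnd rho r f : holo_on rho f -> r < rho -> bnd_on r f.
Proof.
move=> hf rrho; apply: contrapT => nb.
have : forall n : nat, exists z, nrm z <= r /\ n%:R < nrm (f z).
  move=> n; apply: contrapT => nz; apply: nb; exists n%:R => z zr.
  by rewrite leNgt; apply/negP => nf; apply: nz; exists z.
move=> /choice[z hz].
have bz : bnd z by exists r => n; have [] := hz n.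
pose p := ulim z.
have UF := free_ultrafilter_ultra.
have pr : nrm p <= r.
  rewrite -[p]subr0; apply: nrm_ulim_le => //.
  apply: filterS (@filterT _ free_ultrafilter _) => n _ /=.
  by rewrite subr0; have [] := hz n.
have [l /(_ 1 ltr01) [d d0 hd]] := hf p (le_lt_trans pr rrho).
pose K := nrm (f p) + nrm l * d + d.
have h1 := free_ultrafilter_ge (Num.bound K).
have h2 := ulim_approx bz d0.
have [n [/= n1 n2]] := filter_ex (filterI h1 h2).
have [_ +] := hz n; apply/negP; rewrite -leNgt.
have K0 : 0 <= K by rewrite !addr_ge0 ?mulr_ge0 ?nrm_ge0// ltW.
apply: (@le_trans _ _ K); last first.
  by apply: ltW; apply: lt_le_trans (archi_boundP K0) _; rewrite ler_nat.
have := hd _ n2; rewrite -/p (addrC p) subrK mul1r => h3.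
rewrite (_ : f (z n) = f p + l * (z n - p) + (f (z n) - f p - l * (z n - p))); last by ring.
apply: le_trans (nrmD _ _) _; apply: lerD; last exact: le_trans h3 (ltW n2).
apply: le_trans (nrmD _ _) _; rewrite lerD2l nrmM.
by apply: ler_wpM2l; [exact: nrm_ge0|exact: ltW].
Qed.

(** The integral of [f] along the oriented segment from [a] to [b]. *)
Definition seg f a b : C := (b - a) * avg (fun t => f (a + ofR t * (b - a))).

Lemma bnd01_seg r f a b : bnd_on r f -> nrm a <= r -> nrm b <= r ->
  bnd01 (fun t => f (a + ofR t * (b - a))).
Proof. by move=> [K fK] ar br; exists K => t t01; apply/fK/in_segment0. Qed.

Lemma seg_rev r f a b : bnd_on r f -> nrm a <= r -> nrm b <= r ->
  seg f b a = - seg f a b.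
Proof.
move=> bf ar br; rewrite /seg -(avg_rev (bnd01_seg bf ar br)) -mulNr opprB.
by congr (_ * _); apply: eq_avg => t _; congr f; rewrite ofRD ofRN ofR1; ring.
Qed.

Lemma seg_half r f a b : bnd_on r f -> nrm a <= r -> nrm b <= r ->
  seg f a b = seg f a ((a + b) / 2) + seg f ((a + b) / 2) b.
Proof.
move=> bf ar br; rewrite /seg (avg_half (bnd01_seg bf ar br)) mulrDr mulrDr.
have h2 : (2 : C) != 0 by rewrite pnatr_eq0.
rewrite !mulrA; congr (_ * _ + _ * _).
- by rewrite ofRV ofR_nat; field.
- by apply: eq_avg => t _; congr f; rewrite ofRM ofRV ofR_nat; field.
- by rewrite ofRV ofR_nat; field.
- by apply: eq_avg => t _; congr f; rewrite ofRM ofRV ofRD ofR1 ofR_nat; field.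
Qed.

Lemma seg_le f a b (k : C) K :
  (forall t, 0 <= t <= 1 -> nrm (f (a + ofR t * (b - a)) - k) <= K) ->
  nrm (seg f a b - k * (b - a)) <= K * nrm (b - a).
Proof.
move=> h; rewrite /seg mulrC -mulrBl nrmM; apply: ler_wpM2r; first exact: nrm_ge0.
exact: avg_le.
Qed.

Lemma segD f g a b : bnd01 (fun t => f (a + ofR t * (b - a))) ->
  bnd01 (fun t => g (a + ofR t * (b - a))) ->
  seg (fun z => f z + g z) a b = seg f a b + seg g a b.
Proof. by move=> bf bg; rewrite /seg avgD// mulrDr. Qed.

Lemma bnd_on_affine r (c0 c1 p : C) : bnd_on r (fun z => c0 + c1 * (z - p)).
Proof.
exists (nrm c0 + nrm c1 * (r + nrm p)) => z zr.
apply: le_trans (nrmD _ _) _; rewrite lerD2l nrmM ler_wpM2l ?nrm_ge0//.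
by apply: le_trans (nrmB _ _) _; rewrite lerD2r.
Qed.

Lemma seg_affine (c0 c1 p : C) a b : seg (fun z => c0 + c1 * (z - p)) a b =
  (b - a) * (c0 + c1 * (a - p)) + c1 * (b - a) ^+ 2 / 2.
Proof.
rewrite /seg (@eq_avg _ _ (fun t => (c0 + c1 * (a - p)) + c1 * (b - a) * ofR t)); last first.
  by move=> t _; ring.
have b1 : bnd01 (@ofR R).
  by exists 1 => t /andP[t0 t1]; rewrite nrm_ofR ger0_norm.
rewrite avgD ?avgZ ?avg_cst ?avg_id//; last 2 first.
- by exists (nrm (c0 + c1 * (a - p))) => t _.
- by exists (nrm (c1 * (b - a))) => t /andP[t0 t1]; rewrite nrmM nrm_ofR ger0_norm// ler_piMr ?nrm_ge0.
by rewrite ofRV ofR_nat; ring.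
Qed.

Definition tri f a b c : C := seg f a b + seg f b c + seg f c a.

Lemma tri_split r f a b c : bnd_on r f -> nrm a <= r -> nrm b <= r -> nrm c <= r ->
  tri f a b c =
    tri f a ((a + b) / 2) ((c + a) / 2) + tri f ((a + b) / 2) b ((b + c) / 2) +
    tri f ((c + a) / 2) ((b + c) / 2) c +
    tri f ((a + b) / 2) ((b + c) / 2) ((c + a) / 2).
Proof.
move=> bf ar br cr.
have mid x y : nrm x <= r -> nrm y <= r -> nrm ((x + y) / 2) <= r.
  move=> xr yr; have := @in_segment0 x y r 2^-1 xr yr.
  rewrite (_ : x + _ = (x + y) / 2); first by apply; lra.
  by rewrite ofRV ofR_nat; have h2 : (2 : C) != 0 by [rewrite pnatr_eq0]; field.
rewrite /tri (seg_half bf ar br) (seg_half bf br cr) (seg_half bf cr ar).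
have m1 := mid _ _ ar br; have m2 := mid _ _ br cr; have m3 := mid _ _ cr ar.
rewrite (seg_rev bf m1 m3) (seg_rev bf m2 m1) (seg_rev bf m3 m2).
by set s1 := seg f _ _; ring.
Qed.

Definition triangle := (C * C * C)%type.
Definition triT f (T : triangle) := tri f T.1.1 T.1.2 T.2.
Definition subtri (T : triangle) (j : nat) : triangle :=
  let: (a, b, c) := T in
  let m1 := (a + b) / 2 in let m2 := (b + c) / 2 in let m3 := (c + a) / 2 in
  match j with
  | 0 => (a, m1, m3) | 1 => (m1, b, m2) | 2 => (m3, m2, c) | _ => (m1, m2, m3)
  end.

Definition in_ball r (T : triangle) :=
  [/\ nrm T.1.1 <= r, nrm T.1.2 <= r & nrm T.2 <= r].
Definition mesh_le (d : R) (T : triangle) :=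
  [/\ nrm (T.1.1 - T.1.2) <= d, nrm (T.1.2 - T.2) <= d & nrm (T.2 - T.1.1) <= d].

Lemma nrm_half (x : C) : nrm (x / 2) = nrm x / 2.
Proof. by rewrite nrmM nrmV nrm_nat. Qed.

Lemma subtri_spec r d T j : in_ball r T -> mesh_le d T ->
  [/\ in_ball r (subtri T j), mesh_le (d / 2) (subtri T j) &
      nrm ((subtri T j).1.1 - T.1.1) <= d].
Proof.
case: T => [[a b] c] [/= ar br cr] [/= ab bc ca].
have h2 : (2 : C) != 0 by rewrite pnatr_eq0.
have mid x y : nrm x <= r -> nrm y <= r -> nrm ((x + y) / 2) <= r.
  move=> xr yr; have := @in_segment0 x y r 2^-1 xr yr.
  rewrite (_ : x + _ = (x + y) / 2); first by apply; lra.
  by rewrite ofRV ofR_nat; field.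
have half (x y : C) : nrm y <= d -> x = y / 2 \/ x = - y / 2 -> nrm x <= d / 2.
  by move=> yd [->|->]; rewrite nrm_half ?nrmN; lra.
have d0 : 0 <= d by apply: le_trans ab; exact: nrm_ge0.
have halfd (x y : C) : nrm y <= d -> x = y / 2 \/ x = - y / 2 -> nrm x <= d.
  by move=> yd h; have := half x y yd h; lra.
case: j => [|[|[|j]]]; split; do ?[split] => /=; rewrite ?subrr ?nrm0; try by [|exact: mid].
all: try (by apply: (half _ (a - b)) => //; (left + right); field).
all: try (by apply: (half _ (b - c)) => //; (left + right); field).
all: try (by apply: (half _ (c - a)) => //; (left + right); field).
all: try (by apply: (halfd _ (a - b)) => //; (left + right); field).
all: try (by apply: (halfd _ (b - c)) => //; (left + right); field).
all: try (by apply: (halfd _ (c - a)) => //; (left + right); field).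
Qed.

(** The inner sides cancel, so the integrals over the four pieces add up to
    the integral over the triangle. *)
Lemma subtri_large r f T : bnd_on r f -> in_ball r T ->
  exists j, nrm (triT f T) <= 4 * nrm (triT f (subtri T j)).
Proof.
case: T => [[a b] c] bf [/= ar br cr]; apply: contrapT => nj.
have h j : nrm (triT f (subtri (a, b, c) j)) < nrm (triT f (a, b, c)) / 4.
  rewrite ltNge; apply/negP => h; apply: nj; exists j.
  by move: h; rewrite ler_pdivrMr ?ltr0n// mulrC.
have h0 := h 0%N; have h1 := h 1%N; have h2 := h 2%N; have h3 := h 3%N.
have : nrm (triT f (a, b, c)) <= nrm (triT f (subtri (a, b, c) 0)) +
   nrm (triT f (subtri (a, b, c) 1)) + nrm (triT f (subtri (a, b, c) 2)) +
   nrm (triT f (subtri (a, b, c) 3)).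
  rewrite {1}/triT /= (tri_split bf ar br cr).
  do 3! [apply: le_trans (nrmD _ _) _; rewrite lerD2r].
  by [].
lra.
Qed.

(** Bisection: the integral over one of the four pieces is at least a quarter of
    the whole, while complex differentiability at the limit point makes it of
    smaller order than the square of the mesh. *)
Theorem goursat rho r f a b c : holo_on rho f -> r < rho ->
  nrm a <= r -> nrm b <= r -> nrm c <= r -> tri f a b c = 0.
Proof.
move=> hf rrho ar br cr.
have bf := holo_bnd hf rrho.
have : forall T, exists j, in_ball r T -> nrm (triT f T) <= 4 * nrm (triT f (subtri T j)).
  move=> T; have [iT|nT] := pselect (in_ball r T); last by exists 0%N.
  by have [j hj] := subtri_large bf iT; exists j.
move=> /choice[J hJ].
pose T n := iter n (fun T => subtri T (J T)) (a, b, c).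
pose D := nrm (a - b) + nrm (b - c) + nrm (c - a).
have D0 : 0 <= D by rewrite !addr_ge0// nrm_ge0.
pose d n := D / 2 ^+ n.
have dS n : d n.+1 = d n / 2 by rewrite /d exprSr invfM mulrA.
have p2 n : (0 : R) < 2 ^+ n by rewrite exprn_gt0.
have d_ge0 n : 0 <= d n by rewrite divr_ge0// ltW.
(* nested triangles, each carrying at least a quarter of the previous
   integral *)
have inv n : [/\ in_ball r (T n), mesh_le (d n) (T n) &
    nrm (triT f (a, b, c)) <= 4 ^+ n * nrm (triT f (T n))].
  elim: n => [|n [IH1 IH2 IH3]].
    split=> //; rewrite /d ?expr0 ?divr1 ?mul1r//.
    have := nrm_ge0 (a - b); have := nrm_ge0 (b - c); have := nrm_ge0 (c - a).
    by split; rewrite /D /=; lra.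
  have [i1 i2 _] := subtri_spec (J (T n)) IH1 IH2.
  split => //; first by rewrite dS.
  apply: le_trans IH3 _; rewrite exprSr -mulrA ler_pM2l ?exprn_gt0//.
  exact: hJ.
pose v n := (T n).1.1.
have vS n : nrm (v n.+1 - v n) <= d n.
  have [i1 i2 _] := inv n; by have [_ _] := subtri_spec (J (T n)) i1 i2.
have vD n j : nrm (v (n + j)%N - v n) <= 2 * d n - 2 * d (n + j)%N.
  elim: j => [|j IH]; first by rewrite addn0 !subrr nrm0.
  rewrite addnS (_ : v _ - _ = (v (n + j).+1 - v (n + j)%N) + (v (n + j)%N - v n)); last by ring.
  apply: le_trans (nrmD _ _) _; have := vS (n + j)%N; rewrite dS; lra.
have bv : bnd v by exists r => n; have [[]] := inv n.
(* the common point of the triangles, obtained as the Banach limit of their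
   first vertices *)
pose p := banach_lim v.
have pv n : nrm (p - v n) <= 2 * d n.
  apply: (@banach_lim_le _ _ _ _ n) => // k nk.
  rewrite -(subnKC nk); apply: le_trans (vD _ _) _.
  by have := d_ge0 (n + (k - n))%N; lra.
have pr : nrm p <= r.
  rewrite -[p]subr0; apply: (@banach_lim_le _ _ _ _ 0%N) => // n _.
  by rewrite subr0; have [[]] := inv n.
have [l hl] := hf p (le_lt_trans pr rrho).
apply: nrm_le0_eq0 => e e0.
(* the integral of [g] below is at most [9 e' (D / 2 ^ n) ^ 2], and is
   multiplied by [4 ^ n] *)
pose e' := e / (9 * D ^+ 2 + 1).
have q0 : 0 < 9 * D ^+ 2 + 1 by have := sqr_ge0 D; lra.
have e'0 : 0 < e' by rewrite divr_gt0.
have [dl dl0 hdl] := hl _ e'0.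
have [n hn] : exists n, 3 * d n < dl.
  have dl2 : 0 < dl / 2 by rewrite divr_gt0.
  have h12 : 0 <= (2^-1 : R) < 1 by lra.
  have D3 : 0 <= 3 * D by rewrite mulr_ge0.
  have [n hn] := expr_small h12 D3 dl2; exists n.
  have := hn n (leqnn _); rewrite /d exprVn mulrA; lra.
have [[a1 b1 c1] [ab bc ca] h4] := inv n.
apply: le_trans h4 _.
set a' := (T n).1.1 in a1 ab ca *; set b' := (T n).1.2 in b1 ab bc *.
set c' := (T n).2 in c1 bc ca *.
(* the affine part of [f] at [p] has integral zero along a closed triangle *)
pose aff z := f p + l * (z - p).
pose g z := f z - aff z.
have bg : bnd_on r g.
  have [K fK] := bf; have [K' aK] := @bnd_on_affine r (f p) l p.
  exists (K + K') => z zr; apply: le_trans (nrmB _ _) _.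
  by apply: lerD; [exact: fK|exact: aK].
have ga2 : nrm (a' - p) <= 2 * d n by rewrite nrmC; exact: pv.
have ga : nrm (a' - p) <= 3 * d n by have := d_ge0 n; lra.
have gb : nrm (b' - p) <= 3 * d n.
  rewrite (_ : b' - p = (b' - a') + (a' - p)); last by ring.
  by apply: le_trans (nrmD _ _) _; rewrite (nrmC b'); lra.
have gc : nrm (c' - p) <= 3 * d n.
  rewrite (_ : c' - p = (c' - a') + (a' - p)); last by ring.
  by apply: le_trans (nrmD _ _) _; lra.
have gsmall z : nrm (z - p) <= 3 * d n -> nrm (g z) <= e' * (3 * d n).
  move=> zp; have := hdl _ (le_lt_trans zp hn); rewrite (addrC p) subrK => h.
  rewrite /g /aff opprD addrA; apply: le_trans h _.
  by apply: ler_wpM2l => //; exact: ltW.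
have segf x y : nrm x <= r -> nrm y <= r -> seg f x y = seg aff x y + seg g x y.
  move=> xr yr; rewrite -segD; last 2 first.
  - exact: bnd01_seg (@bnd_on_affine r (f p) l p) xr yr.
  - exact: bnd01_seg bg xr yr.
  by rewrite /seg; congr (_ * _); apply: eq_avg => t _; rewrite /g; ring.
have segg x y : nrm (x - p) <= 3 * d n -> nrm (y - p) <= 3 * d n ->
    nrm (y - x) <= d n -> nrm (seg g x y) <= e' * (3 * d n) * d n.
  move=> xp yp xy; have := @seg_le g x y 0 (e' * (3 * d n)).
  rewrite mul0r subr0 => h; apply: le_trans (h _) _.
    by move=> t t01; rewrite subr0; apply: gsmall; exact: in_segment.
  apply: ler_wpM2l => //; rewrite mulr_ge0 ?(ltW e'0)//.
  by have := d_ge0 n; lra.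
have -> : triT f (T n) = seg g a' b' + seg g b' c' + seg g c' a'.
  rewrite /triT /tri -/a' -/b' -/c' !segf// !seg_affine.
  have h2 : (2 : C) != 0 by rewrite pnatr_eq0.
  by field.
have g1 := segg _ _ ga gb; have g2 := segg _ _ gb gc; have g3 := segg _ _ gc ga.
have : nrm (seg g a' b' + seg g b' c' + seg g c' a') <= 9 * e' * d n ^+ 2.
  apply: le_trans (nrmD _ _) _; apply: le_trans (lerD (nrmD _ _) (lexx _)) _.
  rewrite (_ : 9 * _ * _ = e' * (3 * d n) * d n + e' * (3 * d n) * d n + e' * (3 * d n) * d n); last by ring.
  by apply: lerD; [apply: lerD|]; [apply: g1|apply: g2|apply: g3]; rewrite // nrmC.
move=> h; apply: le_trans (ler_wpM2l _ h) _; first by rewrite exprn_ge0.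
rewrite (_ : 4 ^+ n * _ = 9 * e' * D ^+ 2); last first.
  rewrite /d expr_div_n -exprM mulnC exprM (_ : 2 ^+ 2 = 4); last by ring.
  by field; rewrite expf_neq0// pnatr_eq0.
rewrite (_ : 9 * e' * D ^+ 2 = e' * (9 * D ^+ 2)); last by ring.
rewrite /e' mulrAC ler_pdivrMr// ler_pM2l//; lra.
Qed.

Definition primitive f z := seg f 0 z.

Lemma primitiveB rho r f a b : holo_on rho f -> r < rho -> 0 <= r ->
  nrm a <= r -> nrm b <= r -> primitive f b - primitive f a = seg f a b.
Proof.
move=> hf rrho r0 ar br.
have z0 : nrm (0 : C) <= r by rewrite nrm0.
have := goursat hf rrho z0 ar br; rewrite /tri => h.
rewrite /primitive -[seg f 0 b]opprK -(seg_rev (holo_bnd hf rrho) z0 br).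
by move: h; set x := seg f 0 a; set y := seg f a b; set u := seg f b 0 => h; rewrite -[RHS]subr0 -h; ring.
Qed.

Lemma cdiff_cont f z l : cdiff_at f z l -> forall e : R, 0 < e ->
  exists2 d : R, 0 < d & forall h, nrm h < d -> nrm (f (z + h) - f z) <= e.
Proof.
move=> hf e e0; have [d d0 hd] := hf 1 ltr01.
pose m := nrm l + 1; have m0 : 0 < m by rewrite ltr_wpDl ?nrm_ge0.
exists (Num.min d (e / m)); first by rewrite lt_min d0 divr_gt0.
move=> h; rewrite lt_min => /andP[h1 h2].
rewrite (_ : _ - _ = (f (z + h) - f z - l * h) + l * h); last by ring.
apply: le_trans (nrmD _ _) _; rewrite nrmM.
have := hd _ h1; move: h2; rewrite ltr_pdivlMr// /m; lra.
Qed.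

Lemma primitive_cdiff rho f z : holo_on rho f -> nrm z < rho ->
  cdiff_at (primitive f) z (f z).
Proof.
move=> hf zrho e e0; have [l hl] := hf z zrho.
have [d d0 hd] := cdiff_cont hl e0.
pose r := (nrm z + rho) / 2.
exists (Num.min d (r - nrm z)); first by rewrite lt_min d0 /r; lra.
move=> h; rewrite lt_min => /andP[h1 h2].
have rz : nrm z <= r by rewrite /r; lra.
have rr : r < rho by rewrite /r; lra.
have r0 : 0 <= r by apply: le_trans rz; exact: nrm_ge0.
have zh : nrm (z + h) <= r.
  by apply: le_trans (nrmD _ _) _; lra.
rewrite (primitiveB hf rr r0 rz zh).
rewrite (_ : f z * h = f z * (z + h - z)); last by ring.
rewrite -[X in e * nrm X](_ : z + h - z = h); last by ring.
apply: seg_le => t /andP[t0 t1].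
rewrite (_ : z + h - z = h); last by ring.
apply: hd; apply: le_lt_trans h1; rewrite nrmM nrm_ofR ger0_norm//.
by rewrite ler_piMl// nrm_ge0.
Qed.

Lemma primitive_holo rho f : holo_on rho f -> holo_on rho (primitive f).
Proof. by move=> hf z zrho; exists (f z); exact: primitive_cdiff hf zrho. Qed.

(** ** Cauchy's formula *)

(** Cauchy's formula on the circle of radius [r]; the kernel [(1 - w / x)^-1]
    is [x / (x - w)], whose factor [x] comes from the measure
    [dx / (2 i pi x)] on the circle. *)
Definition cauchyF r f := forall w, nrm w < r ->
  f w = cavg (fun z => f (ofR r * z) * (1 - w / (ofR r * z))^-1).

(** Uniform approximation by polynomials on the closed disc of radius [s]. It
    is the regularity used up to the boundary below: it implies Cauchy's
    formula on the circle of radius [s] itself, and it is stable under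
    products. *)
Definition upoly s f := forall e : R, 0 < e -> exists p : {poly C},
  forall w, nrm w <= s -> nrm (f w - p.[w]) <= e.

Lemma bndS1_cst (c : C) : bndS1 (fun _ : C => c).
Proof. by exists (nrm c) => z _. Qed.

Lemma bndS1D (f g : C -> C) : bndS1 f -> bndS1 g -> bndS1 (fun z => f z + g z).
Proof.
move=> [K fK] [L gL]; exists (K + L) => z z1.
by apply: le_trans (nrmD _ _) _; apply: lerD; [exact: fK|exact: gL].
Qed.

Lemma bndS1M (f g : C -> C) : bndS1 f -> bndS1 g -> bndS1 (fun z => f z * g z).
Proof.
move=> [K fK] [L gL]; exists (K * L) => z z1.
by rewrite nrmM; apply: ler_pM; rewrite ?nrm_ge0//; [exact: fK|exact: gL].
Qed.

Lemma bndS1_sum (I : Type) (s : seq I) (F : I -> C -> C) :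
  (forall i, bndS1 (F i)) -> bndS1 (fun z => \sum_(i <- s) F i z).
Proof.
move=> bF; elim: s => [|i s IH].
  by exists 0 => z _; rewrite big_nil nrm0.
have [K hK] := bndS1D (bF i) IH.
by exists K => z z1; rewrite big_cons; exact: hK.
Qed.

Lemma cavg_sum (I : Type) (s : seq I) (F : I -> C -> C) :
  (forall i, bndS1 (F i)) ->
  cavg (fun z => \sum_(i <- s) F i z) = \sum_(i <- s) cavg (F i).
Proof.
move=> bF; elim: s => [|i s IH].
  rewrite big_nil -[RHS](@cavg_cst R 0).
  by apply: eq_cavg => z _; rewrite big_nil.
rewrite big_cons -IH -cavgD//; last exact: bndS1_sum.
by apply: eq_cavg => z _; rewrite big_cons.
Qed.

Lemma cavg_le0 (f : C -> C) (K : R) : (forall z, nrm z = 1 -> nrm (f z) <= K) ->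
  nrm (cavg f) <= K.
Proof.
by move=> h; rewrite -[cavg f]subr0; apply: cavg_le => z z1; rewrite subr0 h.
Qed.

Lemma cavgB (f g : C -> C) : bndS1 f -> bndS1 g ->
  cavg (fun z => f z - g z) = cavg f - cavg g.
Proof.
move=> bf bg; rewrite -mulN1r -cavgZ// -cavgD//; last by apply: bndS1M => //; exact: bndS1_cst.
by apply: eq_cavg => z _; rewrite mulN1r.
Qed.

Lemma one_sub_neq0 (u : C) : nrm u < 1 -> 1 - u != 0.
Proof.
move=> u1; rewrite subr_eq0; apply/eqP => h.
by move: u1; rewrite -h nrm1 ltxx.
Qed.

Lemma nrm_geom (u : C) (q : R) : nrm u <= q -> q < 1 -> nrm (1 - u)^-1 <= (1 - q)^-1.
Proof.
move=> uq q1; rewrite nrmV lef_pV2 ?posrE ?subr_gt0//.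
  by have := nrm_Bge 1 u; rewrite nrm1; lra.
by have := nrm_Bge 1 u; rewrite nrm1; lra.
Qed.

Lemma geom_tail (u : C) N : 1 - u != 0 ->
  (1 - u)^-1 - \sum_(k < N) u ^+ k = u ^+ N * (1 - u)^-1.
Proof.
move=> u1; apply: (mulIf u1); rewrite mulrBl mulVf// -mulrA mulVf// mulr1.
rewrite (_ : (\sum_(k < N) u ^+ k) * (1 - u) = - ((u - 1) * (\sum_(k < N) u ^+ k))).
  by rewrite -subrX1; ring.
by ring.
Qed.

Lemma geom_tail_le (u : C) (q : R) N : nrm u <= q -> q < 1 ->
  nrm ((1 - u)^-1 - \sum_(k < N) u ^+ k) <= (1 - q)^-1 * q ^+ N.
Proof.
move=> uq q1; rewrite geom_tail; last exact/one_sub_neq0/le_lt_trans/q1.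
rewrite nrmM nrmX mulrC; apply: ler_pM; rewrite ?nrm_ge0 ?exprn_ge0 ?nrm_ge0//.
  exact: nrm_geom.
by apply: lerXn2r => //; rewrite nnegrE ?nrm_ge0 ?(le_trans (nrm_ge0 u)).
Qed.

Lemma nrm_div_circle r w z : 0 < r -> nrm z = 1 -> nrm (w / (ofR r * z)) = nrm w / r.
Proof. by move=> r0 z1; rewrite nrmM nrmV nrmM z1 nrm_ofR gtr0_norm// mulr1. Qed.

Lemma bndS1_kernel r w : 0 < r -> nrm w < r ->
  bndS1 (fun z => (1 - w / (ofR r * z))^-1).
Proof.
move=> r0 wr; exists (1 - nrm w / r)^-1 => z z1; apply: nrm_geom.
  by rewrite nrm_div_circle.
by rewrite ltr_pdivrMr// mul1r.
Qed.

Lemma cavg_divX r w k : cavg (fun z => (w / (ofR r * z)) ^+ k) = (k == 0%N)%:R.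
Proof.
case: k => [|k] /=.
  by rewrite -[RHS](@cavg_cst R); apply: eq_cavg => z _; rewrite expr0.
rewrite (@eq_cavg _ _ (fun z => (w / ofR r) ^+ k.+1 * z^-1 ^+ k.+1)); last first.
  by move=> z _; rewrite -exprMn invfM mulrA.
rewrite cavgZ ?cavg_expNn ?mulr0//.
by exists 1 => z z1; rewrite nrmX nrmV z1 invr1 expr1n.
Qed.

Lemma bndS1_divX r w k : 0 < r -> bndS1 (fun z => (w / (ofR r * z)) ^+ k).
Proof.
by move=> r0; exists ((nrm w / r) ^+ k) => z z1; rewrite nrmX nrm_div_circle.
Qed.

(** The nonconstant terms of the geometric series of the kernel have mean
    zero. *)
Lemma cavg_kernel r w : nrm w < r -> cavg (fun z => (1 - w / (ofR r * z))^-1) = 1.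
Proof.
move=> wr; have r0 : 0 < r by apply: le_lt_trans wr; exact: nrm_ge0.
apply/eqP; rewrite -subr_eq0; apply/eqP; apply: nrm_le0_eq0 => e e0.
pose q := nrm w / r; have q1 : q < 1 by rewrite ltr_pdivrMr// mul1r.
have q0 : 0 <= q by rewrite divr_ge0 ?nrm_ge0// ltW.
have q01 : 0 <= q < 1 by rewrite q0.
have k0 : 0 <= (1 - q)^-1 by rewrite invr_ge0; lra.
have [N /(_ N.+1 (leqnSn _)) hN] := expr_small q01 k0 e0.
have h1 : cavg (fun z => \sum_(k <- iota 0 N.+1) (w / (ofR r * z)) ^+ k) = 1.
  rewrite cavg_sum; last by move=> k; exact: bndS1_divX.
  rewrite big_cons cavg_divX big1_seq ?addr0// => k /=.
  by rewrite mem_iota => /andP[k1 _]; rewrite cavg_divX gtn_eqF.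
rewrite -[X in cavg _ - X]h1 -cavgB; last 2 first.
- exact: bndS1_kernel.
- by apply: bndS1_sum => k; exact: bndS1_divX.
apply: cavg_le0 => z z1; apply: le_trans hN.
rewrite -[iota 0 _]/(index_iota 0 N.+1) big_mkord; apply: geom_tail_le => //.
by rewrite nrm_div_circle.
Qed.

(** The contour is contracted to the point [w] along the straight lines from
    [w]. The mean over the circle moves with velocity the mean of
    [G (P t z) * (r * z)], which is the velocity of a rotation of the circle, and
    rotations leave the mean unchanged. *)
Lemma cauchy_C11 r L H G w : 0 < r ->
  (forall a b, nrm a <= r -> nrm b <= r ->
    nrm (H b - H a - G a * (b - a)) <= L * nrm (b - a) ^+ 2) ->
  bnd_on r H -> bnd_on r G -> nrm w < r ->
  H w = cavg (fun z => H (ofR r * z) * (1 - w / (ofR r * z))^-1).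
Proof.
move=> r0 hH [KH bH] [KG bG] wr.
have L0 : 0 <= L.
  have r1 : nrm (ofR r) <= r by rewrite nrm_ofR gtr0_norm.
  have z1 : nrm (0 : C) <= r by rewrite nrm0 ltW.
  have := le_trans (nrm_ge0 _) (hH _ _ z1 r1); rewrite subr0 nrm_ofR gtr0_norm//.
  by rewrite pmulr_lge0// exprn_gt0.
pose k z := (1 - w / (ofR r * z))^-1.
pose P (t : R) z := w + ofR t * (ofR r * z - w).
have bk : bndS1 k by exact: bndS1_kernel.
have rz z : nrm z = 1 -> nrm (ofR r * z) <= r.
  by move=> z1; rewrite nrmM z1 mulr1 nrm_ofR gtr0_norm.
have Pr t z : 0 <= t <= 1 -> nrm z = 1 -> nrm (P t z) <= r.
  by move=> t01 z1; apply: in_segment0 => //; [exact: ltW|exact: rz].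
have bHP t : 0 <= t <= 1 -> bndS1 (fun z => H (P t z)).
  by move=> t01; exists KH => z z1; apply/bH/Pr.
have bGP t : 0 <= t <= 1 -> bndS1 (fun z => G (P t z)).
  by move=> t01; exists KG => z z1; apply/bG/Pr.
have brz : bndS1 (fun z => ofR r * z) by exists r => z z1; exact: rz.
pose c t := cavg (fun z => G (P t z) * (ofR r * z)).
have bc t : 0 <= t <= 1 -> bndS1 (fun z => G (P t z) * (ofR r * z)).
  by move=> t01; apply: bndS1M => //; exact: bGP.
(* The velocity [c t] vanishes: compare [H] at the points [P t z] and
   [P t (z * om)] for a dyadic root [om] close to one. *)
have c0 t : 0 <= t <= 1 -> c t = 0.
  move=> t01; have [t0 t1] := andP t01.
  have [te|tn] := eqVneq t 0.
    rewrite /c te (@eq_cavg _ _ (fun z => (G w * ofR r) * z ^+ 1)); last first.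
      by move=> z _; rewrite /P expr1 ofR0 mul0r addr0 mulrA.
    rewrite cavgZ ?cavg_expn ?mulr0//.
    by exists 1 => z z1; rewrite expr1 z1.
  have tp : 0 < t by rewrite lt_def tn.
  apply: nrm_le0_eq0 => e e0.
  pose M := L * t * r ^+ 2 + 1; have M0 : 0 < M.
    by have := mulr_ge0 (mulr_ge0 L0 t0) (sqr_ge0 r); rewrite /M; lra.
  have eM : 0 < e / M by rewrite divr_gt0.
  have [p hp] := droot_near1 eM.
  pose om := droot R p.+1.
  have om1 : om - 1 != 0 by rewrite subr_eq0 droot_neq1.
  have d z : P t (z * om) - P t z = ofR t * (ofR r * z) * (om - 1).
    by rewrite /P; ring.
  pose rem z := H (P t (z * om)) - H (P t z) - G (P t z) * (P t (z * om) - P t z).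
  have z1om z : nrm z = 1 -> nrm (z * om) = 1.
    by move=> z1; rewrite nrmM z1 nrm_droot mulr1.
  have brem z : nrm z = 1 -> nrm (rem z) <= L * (t * r * nrm (om - 1)) ^+ 2.
    move=> z1; apply: le_trans (hH _ _ (Pr _ _ t01 z1) (Pr _ _ t01 (z1om _ z1))) _.
    by rewrite d !nrmM z1 mulr1 !nrm_ofR !ger0_norm// ltW.
  have remE : cavg rem = - (ofR t * (om - 1)) * c t.
    rewrite /rem cavgB; last 2 first.
    - exists (KH + KH) => z z1; apply: le_trans (nrmB _ _) _.
      by apply: lerD; apply: bH; apply: Pr => //; exact: z1om.
    - exists (KG * (r + r)) => z z1; rewrite nrmM; apply: ler_pM; rewrite ?nrm_ge0//.
        exact/bG/Pr.
      by apply: le_trans (nrmB _ _) _; apply: lerD; apply: Pr => //; exact: z1om.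
    rewrite cavgB; last 2 first.
    - by exists KH => z z1; apply: bH; apply: Pr => //; exact: z1om.
    - exact: bHP.
    rewrite (cavg_rot p.+1 (bHP _ t01)) subrr sub0r mulNr; congr (- _).
    rewrite /c -cavgZ; last exact: bc.
    by apply: eq_cavg => z _; rewrite d; ring.
  have := cavg_le0 brem; rewrite remE nrmM nrmN nrmM nrm_ofR ger0_norm//.
  have om0 : 0 < nrm (om - 1) by rewrite nrm_gt0.
  move=> h; have {h} : nrm (c t) <= L * t * r ^+ 2 * nrm (om - 1).
    have tom : 0 < t * nrm (om - 1) by rewrite mulr_gt0.
    rewrite -(ler_pM2l tom); apply: le_trans h _.
    by rewrite le_eqVlt; apply/orP; left; apply/eqP; ring.
  move=> h; apply: le_trans h _.
  apply: (@le_trans _ _ (M * nrm (om - 1))).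
    by apply: ler_wpM2r; [exact: nrm_ge0|rewrite /M; lra].
  by move: hp; rewrite ltr_pdivlMr// mulrC => /ltW.
pose g t := cavg (fun z => H (P t z) * k z).
have bg t : 0 <= t <= 1 -> bndS1 (fun z => H (P t z) * k z).
  by move=> t01; apply: bndS1M => //; exact: bHP.
have [Kk bK] := bk.
have Kk0 : 0 <= Kk by apply: le_trans (bK 1 (nrm1 R)); exact: nrm_ge0.
have rwk z : nrm z = 1 -> (ofR r * z - w) * k z = ofR r * z.
  move=> z1; have rz0 : ofR r * z != 0 by rewrite -nrm_gt0 nrmM z1 mulr1 nrm_ofR gtr0_norm.
  have : 1 - w / (ofR r * z) != 0.
    by apply: one_sub_neq0; rewrite nrm_div_circle// ltr_pdivrMr// mul1r.
  move=> h; rewrite /k (_ : ofR r * z - w = ofR r * z * (1 - w / (ofR r * z))).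
    by rewrite mulfK.
  by rewrite mulrBr mulr1 mulrCA divff// mulr1.
pose M := L * (r + r) ^+ 2 * Kk.
(* The rest of the first-order expansion is quadratic in the step, so [g] is
   constant: sum over [n] steps of length [1 / n]. *)
have gs t s : 0 <= t <= 1 -> 0 <= t + s <= 1 -> nrm (g (t + s) - g t) <= M * s ^+ 2.
  move=> t01 ts01.
  have -> : g (t + s) - g t =
    cavg (fun z => (H (P (t + s) z) - H (P t z) - G (P t z) * (P (t + s) z - P t z)) * k z).
    rewrite (@eq_cavg _ _ (fun z => H (P (t + s) z) * k z - H (P t z) * k z -
         ofR s * (G (P t z) * (ofR r * z)))); last first.
      by move=> z z1; rewrite -[in RHS](rwk z z1) /P ofRD; ring.
    rewrite cavgB; last 2 first.
    - by have := bndS1D (bg _ ts01) (bndS1M (bndS1_cst (-1)) (bg _ t01)); move=> [K h]; exists K => z z1; have := h z z1; rewrite mulN1r.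
    - by apply: bndS1M; [exact: bndS1_cst|exact: bc].
    rewrite cavgB; [|exact: bg..].
    by rewrite cavgZ; [rewrite -/(c t) c0// mulr0 subr0|exact: bc].
  apply: cavg_le0 => z z1; rewrite nrmM /M.
  rewrite (_ : L * _ * _ * _ = (L * (s ^+ 2 * (r + r) ^+ 2)) * Kk); last by ring.
  apply: ler_pM; rewrite ?nrm_ge0//; last exact: bK.
  apply: le_trans (hH _ _ (Pr _ _ t01 z1) (Pr _ _ ts01 z1)) _.
  apply: ler_wpM2l => //.
  rewrite (_ : P (t + s) z - P t z = ofR s * (ofR r * z - w)); last by rewrite /P ofRD; ring.
  rewrite nrmM exprMn nrm_ofR real_normK ?num_real//; apply: ler_wpM2l; first exact: sqr_ge0.
  apply: lerXn2r; rewrite ?nnegrE ?nrm_ge0 ?addr_ge0 ?(ltW r0)//.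
  by apply: le_trans (nrmB _ _) _; apply: lerD; [exact: rz|exact: ltW].
have M0 : 0 <= M by apply: mulr_ge0 => //; apply: mulr_ge0 => //; exact: sqr_ge0.
have g01 : g 1 = g 0.
  apply/eqP; rewrite -subr_eq0; apply/eqP; apply: nrm_le0_eq0 => e e0.
  pose n := (Num.bound (M / e)).+1.
  have n0 : (0 : R) < n%:R by rewrite ltr0n.
  have hj j : (j <= n)%N -> nrm (g (j%:R / n%:R) - g 0) <= j%:R * (M * (n%:R^-1) ^+ 2).
    elim: j => [|j IH] jn; first by rewrite !mul0r subrr nrm0.
    rewrite -natr1 [(j%:R + 1) * (M * _)]mulrDl mul1r.
    rewrite (_ : g _ - g 0 = (g (j%:R / n%:R) - g 0) + (g ((j%:R + 1) / n%:R) - g (j%:R / n%:R))); last by rewrite [RHS]addrC addrA subrK.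
    apply: le_trans (nrmD _ _) _; apply: lerD; first by apply: IH; exact: ltnW.
    rewrite mulrDl mul1r; apply: gs; first by rewrite divr_ge0//= ler_pdivrMr// mul1r ler_nat ltnW.
    by rewrite -[X in _ + X]mul1r -mulrDl natr1 divr_ge0//= ler_pdivrMr// mul1r ler_nat.
  have := hj n (leqnn _); rewrite divff ?gt_eqF// => h; apply: le_trans h _.
  rewrite (_ : n%:R * _ = M / n%:R); last by field; rewrite gt_eqF.
  rewrite ler_pdivrMr// mulrC -ler_pdivrMr//; apply: ltW.
  apply: lt_le_trans (archi_boundP _) _; first by rewrite divr_ge0// ltW.
  by rewrite ler_nat.
have -> : H w = g 0.
  rewrite /g (@eq_cavg _ _ (fun z => H w * k z)); last first.
    by move=> z _; rewrite /P ofR0 mul0r addr0.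
  by rewrite cavgZ// cavg_kernel// mulr1.
rewrite -g01 /g; apply: eq_cavg => z _; rewrite /P ofR1 mul1r.
by rewrite (_ : w + (_ - w) = ofR r * z) //; ring.
Qed.

Definition cauchy_coef r f k : C :=
  cavg (fun z => f (ofR r * z) * ((ofR r * z)^-1) ^+ k).

Lemma cauchy_coef_bnd r f (K : R) k : 0 < r ->
  (forall z, nrm z = 1 -> nrm (f (ofR r * z)) <= K) ->
  bndS1 (fun z => f (ofR r * z) * ((ofR r * z)^-1) ^+ k).
Proof.
move=> r0 fK; apply: bndS1M; first by exists K.
by exists (r^-1 ^+ k) => z z1; rewrite nrmX nrmV nrmM z1 mulr1 nrm_ofR gtr0_norm.
Qed.

(** The kernel is replaced by a partial sum of its geometric series. *)
Lemma cauchyF_series r f (K q : R) N w : 0 < r -> 0 <= q < 1 -> nrm w <= q * r ->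
  (forall z, nrm z = 1 -> nrm (f (ofR r * z)) <= K) -> cauchyF r f ->
  nrm (f w - \sum_(k < N) cauchy_coef r f k * w ^+ k) <= K * ((1 - q)^-1 * q ^+ N).
Proof.
move=> r0 /andP[q0 q1] wq fK hf.
have wr : nrm w < r by apply: le_lt_trans wq _; rewrite gtr_pMl.
have bf : bndS1 (fun z => f (ofR r * z)) by exists K.
have -> : \sum_(k < N) cauchy_coef r f k * w ^+ k =
    cavg (fun z => f (ofR r * z) * \sum_(k < N) (w / (ofR r * z)) ^+ k).
  rewrite [RHS](@eq_cavg _ _ (fun z => \sum_(k < N)
      w ^+ k * (f (ofR r * z) * ((ofR r * z)^-1) ^+ k))); last first.
    by move=> z _; rewrite mulr_sumr; apply: eq_bigr => k _; rewrite exprMn; ring.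
  rewrite cavg_sum; last first.
    by move=> k; apply: bndS1M; [exact: bndS1_cst|exact: cauchy_coef_bnd fK].
  by apply: eq_bigr => k _; rewrite mulrC cavgZ//; exact: cauchy_coef_bnd fK.
rewrite hf// -cavgB; last 2 first.
- by apply: bndS1M => //; exact: bndS1_kernel.
- by apply: bndS1M => //; apply: bndS1_sum => k; exact: bndS1_divX.
apply: cavg_le0 => z z1; rewrite -mulrBr nrmM; apply: ler_pM; rewrite ?nrm_ge0//.
  exact: fK.
by apply: geom_tail_le => //; rewrite nrm_div_circle// ler_pdivrMr.
Qed.

Lemma cauchyF_upoly r s f : 0 < r -> 0 <= s < r ->
  bndS1 (fun z => f (ofR r * z)) -> cauchyF r f -> upoly s f.
Proof.
move=> r0 /andP[s0 sr] [K fK] hf e e0.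
pose q := s / r; have q01 : 0 <= q < 1.
  by rewrite divr_ge0 ?(ltW r0)//= ltr_pdivrMr// mul1r.
have K0 : 0 <= K by apply: le_trans (fK 1 (nrm1 R)); exact: nrm_ge0.
have Kq : 0 <= K * (1 - q)^-1 by rewrite mulr_ge0// invr_ge0; lra.
have [N /(_ N (leqnn N)) hN] := expr_small q01 Kq e0.
exists (\poly_(k < N) cauchy_coef r f k) => w ws.
rewrite horner_poly; apply: le_trans (cauchyF_series N r0 q01 _ fK hf) _.
  by rewrite /q -mulrA mulVf ?mulr1// gt_eqF.
by rewrite mulrA.
Qed.

(** Induction on [n], with the identity [x * k = x + w * k] for the kernel
    [k = (1 - w / x)^-1]. *)
Lemma cavg_mono_kernel s w n : 0 < s -> nrm w < s ->
  cavg (fun z => (ofR s * z) ^+ n * (1 - w / (ofR s * z))^-1) = w ^+ n.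
Proof.
move=> s0 ws.
have bk := bndS1_kernel s0 ws.
have bz k : bndS1 (fun z => (ofR s * z) ^+ k).
  by exists (s ^+ k) => z z1; rewrite nrmX nrmM z1 mulr1 nrm_ofR gtr0_norm.
elim: n => [|n IH].
  rewrite expr0; apply: etrans (cavg_kernel ws); apply: eq_cavg => z _.
  by rewrite expr0 mul1r.
rewrite (@eq_cavg _ _ (fun z => (ofR s) ^+ n.+1 * z ^+ n.+1 +
   w * ((ofR s * z) ^+ n * (1 - w / (ofR s * z))^-1))); last first.
  move=> z z1; have sz0 : ofR s * z != 0.
    by rewrite -nrm_gt0 nrmM z1 mulr1 nrm_ofR gtr0_norm.
  have h : 1 - w / (ofR s * z) != 0.
    by apply: one_sub_neq0; rewrite nrm_div_circle// ltr_pdivrMr// mul1r.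
  have key : ofR s * z * (1 - w / (ofR s * z))^-1 =
      ofR s * z + w * (1 - w / (ofR s * z))^-1.
    apply: (mulIf h); rewrite mulrDl !divfK// mulrBr mulr1 mulrCA divff// mulr1.
    by rewrite subrK.
  by rewrite -exprMn !exprSr -mulrA key; ring.
rewrite cavgD; last 2 first.
- apply: bndS1M; first exact: bndS1_cst.
  by exists 1 => z z1; rewrite nrmX z1 expr1n.
- by apply: bndS1M; [exact: bndS1_cst|exact: bndS1M].
rewrite cavgZ; last by exists 1 => z z1; rewrite nrmX z1 expr1n.
rewrite cavg_expn// mulr0 add0r cavgZ; last exact: bndS1M.
by rewrite IH exprS.
Qed.

Lemma poly_cauchy s (p : {poly C}) : 0 < s -> cauchyF s (fun w => p.[w]).
Proof.
move=> s0 w ws; rewrite horner_coef.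
rewrite (@eq_cavg _ _ (fun z => \sum_(i < size p)
    p`_i * ((ofR s * z) ^+ i * (1 - w / (ofR s * z))^-1))); last first.
  by move=> z _; rewrite horner_coef mulr_suml; apply: eq_bigr => i _; rewrite mulrA.
have b i : bndS1 (fun z => (ofR s * z) ^+ i * (1 - w / (ofR s * z))^-1).
  apply: bndS1M; last exact: bndS1_kernel.
  by exists (s ^+ i) => z z1; rewrite nrmX nrmM z1 mulr1 nrm_ofR gtr0_norm.
rewrite cavg_sum; last by move=> i; apply: bndS1M => //; exact: bndS1_cst.
by apply: eq_bigr => i _; rewrite cavgZ// cavg_mono_kernel.
Qed.

Lemma poly_bnd_on s (p : {poly C}) : bnd_on s (fun w => p.[w]).
Proof.
exists (\sum_(i < size p) nrm p`_i * s ^+ i) => z zs.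
rewrite horner_coef; apply: le_trans (nrm_sum _ _ _) _; apply: ler_sum => i _.
rewrite nrmM nrmX ler_wpM2l ?nrm_ge0// lerXn2r// nnegrE ?nrm_ge0//.
exact: le_trans (nrm_ge0 _) zs.
Qed.

Lemma upoly_bnd s f : upoly s f -> bnd_on s f.
Proof.
move=> /(_ 1 ltr01)[p hp]; have [K pK] := poly_bnd_on s p.
exists (1 + K) => w ws; rewrite -[f w](subrK p.[w]).
by apply: le_trans (nrmD _ _) _; apply: lerD; [exact: hp|exact: pK].
Qed.

Lemma upoly_cauchy s f : 0 < s -> upoly s f -> cauchyF s f.
Proof.
move=> s0 uf w ws.
have sz z : nrm z = 1 -> nrm (ofR s * z) <= s.
  by move=> z1; rewrite nrmM z1 mulr1 nrm_ofR gtr0_norm.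
have bs g : bnd_on s g -> bndS1 (fun z => g (ofR s * z)).
  by move=> [K gK]; exists K => z z1; apply/gK/sz.
have bk := bndS1_kernel s0 ws; have [Kk hKk] := bk.
have Kk0 : 0 <= Kk by apply: le_trans (hKk 1 (nrm1 R)); exact: nrm_ge0.
apply/eqP; rewrite -subr_eq0; apply/eqP; apply: nrm_le0_eq0 => e e0.
have K1 : 0 < 1 + Kk by rewrite ltr_wpDr.
have e1 : 0 < e / (1 + Kk) by rewrite divr_gt0.
have [p hp] := uf _ e1.
rewrite (_ : _ - _ = (f w - p.[w]) -
   cavg (fun z => (f (ofR s * z) - p.[ofR s * z]) * (1 - w / (ofR s * z))^-1)); last first.
  rewrite {1}(poly_cauchy p s0 ws).
  rewrite (@eq_cavg _ (fun z => (f _ - _) * _) (fun z =>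
    f (ofR s * z) * (1 - w / (ofR s * z))^-1 -
    p.[ofR s * z] * (1 - w / (ofR s * z))^-1)); last by move=> z _; rewrite mulrBl.
  rewrite cavgB; first by ring.
  - by apply: bndS1M => //; apply/bs/upoly_bnd.
  - by apply: bndS1M => //; apply/(bs (fun w => p.[w]))/poly_bnd_on.
apply: le_trans (nrmB _ _) _.
rewrite (_ : e = e / (1 + Kk) + e / (1 + Kk) * Kk); last by field; rewrite gt_eqF.
apply: lerD; first exact/hp/ltW.
apply: cavg_le0 => z z1; rewrite nrmM; apply: ler_pM; rewrite ?nrm_ge0//.
  exact/hp/sz.
exact: hKk.
Qed.

Lemma cdiff_unique f z l l' : cdiff_at f z l -> cdiff_at f z l' -> l = l'.
Proof.
move=> hl hl'; apply/eqP; rewrite -subr_eq0; apply/eqP; apply: nrm_le0_eq0 => e e0.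
have e2 : 0 < e / 2 by rewrite divr_gt0.
have [d d0 hd] := hl _ e2; have [d' d'0 hd'] := hl' _ e2.
pose m := Num.min d d' / 2.
have mm : 0 < Num.min d d' by rewrite lt_min d0.
have m0 : 0 < m by rewrite divr_gt0.
have : m < Num.min d d' by rewrite /m; lra.
rewrite lt_min => /andP[md md'].
have := hd (ofR m); have := hd' (ofR m); rewrite nrm_ofR gtr0_norm// => /(_ md') h1 /(_ md) h2.
have : nrm ((l - l') * ofR m) <= e * m.
  rewrite (_ : _ * _ = (f (z + ofR m) - f z - l' * ofR m) - (f (z + ofR m) - f z - l * ofR m)); last by ring.
  by apply: le_trans (nrmB _ _) _; lra.
by rewrite nrmM nrm_ofR gtr0_norm// ler_pM2r.
Qed.

(** A quadratic error term is the form in which derivatives of explicit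
    formulas are checked below. *)
Lemma quadratic_cdiff f z l (M d : R) : 0 < d ->
  (forall h, nrm h < d -> nrm (f (z + h) - f z - l * h) <= M * nrm h ^+ 2) ->
  cdiff_at f z l.
Proof.
move=> d0 hM e e0; pose M' := `|M| + 1.
have M0 : 0 < M' by rewrite ltr_wpDl.
exists (Num.min d (e / M')); first by rewrite lt_min d0 divr_gt0.
move=> h; rewrite lt_min => /andP[h1]; rewrite ltr_pdivlMr// => h2.
apply: le_trans (hM _ h1) _; rewrite expr2 mulrA ler_wpM2r ?nrm_ge0//.
apply: le_trans (ltW h2); rewrite mulrC; apply: ler_wpM2l; first exact: nrm_ge0.
by apply: le_trans (ler_norm _) _; rewrite /M'; lra.
Qed.

(** Differentiating the kernel: the derivative of [H] is again represented by
    [H], with kernel [(1 - w / x)^-2 / x]. *)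
Lemma cauchyF_derive r H w l : cauchyF r H ->
  bndS1 (fun z => H (ofR r * z)) -> nrm w < r -> cdiff_at H w l ->
  l = cavg (fun z => H (ofR r * z) * ((ofR r * z)^-1 * (1 - w / (ofR r * z))^-1 ^+ 2)).
Proof.
move=> hH bH wr hl; have [K HK] := bH.
have r0 : 0 < r by apply: le_lt_trans wr; exact: nrm_ge0.
pose q := (nrm w + r) / (r + r).
have q1 : q < 1 by rewrite ltr_pdivrMr ?mul1r; lra.
pose k (v z : C) := (1 - v / (ofR r * z))^-1.
have vq v z : nrm v <= (nrm w + r) / 2 -> nrm z = 1 -> nrm (v / (ofR r * z)) <= q.
  move=> vw z1; rewrite nrm_div_circle// ler_pdivrMr// /q.
  by rewrite (_ : _ * r = (nrm w + r) / 2)//; field; rewrite gt_eqF// -mulr2n pmulrn_lgt0.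
have kq v z : nrm v <= (nrm w + r) / 2 -> nrm z = 1 -> nrm (k v z) <= (1 - q)^-1.
  by move=> vw z1; apply: nrm_geom => //; exact: vq.
have ww : nrm w <= (nrm w + r) / 2 by lra.
have bD : bndS1 (fun z => H (ofR r * z) * ((ofR r * z)^-1 * k w z ^+ 2)).
  apply: bndS1M => //; exists (r^-1 * (1 - q)^-1 ^+ 2) => z z1.
  rewrite nrmM nrmV nrmM z1 mulr1 nrm_ofR gtr0_norm// nrmX.
  apply: ler_wpM2l; first by rewrite invr_ge0 ltW.
  by apply: lerXn2r; rewrite ?nnegrE ?nrm_ge0 ?invr_ge0 ?kq// subr_ge0 ltW.
apply: (cdiff_unique hl).
apply: (@quadratic_cdiff _ _ _ (K * (r^-1 ^+ 2 * (1 - q)^-1 ^+ 3)) ((r - nrm w) / 2)).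
  by lra.
move=> h hh.
have whr : nrm (w + h) <= (nrm w + r) / 2 by apply: le_trans (nrmD _ _) _; lra.
have whr' : nrm (w + h) < r by apply: le_lt_trans whr _; lra.
have bk v : nrm v < r -> bndS1 (fun z => H (ofR r * z) * k v z).
  by move=> vr; apply: bndS1M => //; exact: bndS1_kernel.
rewrite (hH _ whr') (hH _ wr) -/(k _ _) mulrC -cavgZ//.
rewrite -cavgB; [|exact: bk|exact: bk].
rewrite -cavgB; last 2 first.
- have := bndS1D (bk _ whr') (bndS1M (bndS1_cst (-1)) (bk _ wr)).
  by move=> [L hL]; exists L => z z1; have := hL z z1; rewrite mulN1r.
- by apply: bndS1M => //; exact: bndS1_cst.
apply: cavg_le0 => z z1.
have rz0 : ofR r * z != 0.
  by rewrite -nrm_gt0 nrmM z1 mulr1 nrm_ofR gtr0_norm.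
have n1 : 1 - w / (ofR r * z) != 0 by apply: one_sub_neq0; exact: le_lt_trans (vq _ _ ww z1) q1.
have n2 : 1 - (w + h) / (ofR r * z) != 0 by apply: one_sub_neq0; exact: le_lt_trans (vq _ _ whr z1) q1.
rewrite (_ : _ - _ = H (ofR r * z) * (((ofR r * z)^-1) ^+ 2 * (k w z ^+ 2 * k (w + h) z)) * h ^+ 2); last first.
  rewrite /k; move: n1 n2; rewrite mulrDl; set u := (ofR r * z)^-1.
  set a := w * u; rewrite opprD addrA => n1 n2.
  by field; rewrite n1 n2.
rewrite nrmM nrmX; apply: ler_wpM2r; first exact: sqr_ge0.
rewrite nrmM; apply: ler_pM; rewrite ?nrm_ge0//; first exact: HK.
rewrite nrmM nrmX nrmV nrmM z1 mulr1 nrm_ofR gtr0_norm//.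
apply: ler_wpM2l; first by rewrite exprn_ge0// invr_ge0 ltW.
rewrite nrmM nrmX [X in _ <= X]exprSr; apply: ler_pM; rewrite ?exprn_ge0 ?nrm_ge0//; last exact: kq.
by apply: lerXn2r; rewrite ?nnegrE ?nrm_ge0 ?invr_ge0 ?kq// subr_ge0 ltW.
Qed.

Lemma arith_geom_sum (K : comPzRingType) (x : K) n :
  (1 - x) ^+ 2 * (\sum_(k < n) k.+1%:R * x ^+ k) = 1 - (n.+1%:R - n%:R * x) * x ^+ n.
Proof.
elim: n => [|n IH]; first by rewrite big_ord0; ring.
rewrite big_ord_recr /= mulrDr IH [x ^+ n.+1]exprS -[n.+2%:R]natr1 -[n.+1%:R]natr1; ring.
Qed.

Lemma arith_geom_le (x : R) n : 0 <= x < 1 ->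
  \sum_(k < n) k.+1%:R * x ^+ k <= (1 - x)^-1 ^+ 2.
Proof.
move=> /andP[x0 x1]; have d0 : 0 < 1 - x by lra.
rewrite exprVn -(ler_pM2l (exprn_gt0 2 d0)) mulfV ?gt_eqF ?exprn_gt0// arith_geom_sum.
rewrite gerBl mulr_ge0 ?exprn_ge0// -natr1 -addrA.
have -> : n%:R + (1 - n%:R * x) = n%:R * (1 - x) + 1 by ring.
by rewrite addr_ge0// mulr_ge0// ltW.
Qed.

Lemma arith_expr_small (q M e : R) : 0 <= q < 1 -> 0 <= M -> 0 < e ->
  exists N0, forall N, (N0 <= N)%N -> M * (N.+1%:R * q ^+ N) <= e.
Proof.
move=> /andP[q0 q1] M0 e0; pose x := Num.sqrt q.
have x0 : 0 <= x by exact: sqrtr_ge0.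
have x1 : x < 1 by rewrite -sqrtr1 ltr_sqrt.
have x01 : 0 <= x < 1 by rewrite x0.
have xq : q = x * x by rewrite -expr2 sqr_sqrtr.
pose A := (1 - x)^-1 ^+ 2; have A0 : 0 <= A by exact: sqr_ge0.
have [N0 hN] := expr_small x01 (mulr_ge0 M0 A0) e0; exists N0 => N NN.
apply: le_trans (hN N NN); rewrite -mulrA ler_wpM2l// xq exprMn mulrA ler_wpM2r ?exprn_ge0//.
apply: le_trans (arith_geom_le N.+1 x01).
by rewrite big_ord_recr /= lerDr; apply: sumr_ge0 => k _; rewrite mulr_ge0// exprn_ge0.
Qed.

(** Term-by-term differentiation: the square of the Cauchy kernel is the sum of
    an arithmetico-geometric series. *)
Lemma cauchyF_derive_series r s H G : cauchyF r H ->
  bndS1 (fun z => H (ofR r * z)) -> 0 <= s < r ->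
  (forall w, nrm w < r -> cdiff_at H w (G w)) -> forall e : R, 0 < e ->
  exists N0, forall N, (N0 <= N)%N -> forall w, nrm w <= s ->
    nrm (G w - \sum_(k < N) k.+1%:R * cauchy_coef r H k.+1 * w ^+ k) <= e.
Proof.
move=> hH bH /andP[s0 sr] hG e e0; have [K HK] := bH.
have r0 : 0 < r by exact: le_lt_trans sr.
have K0 : 0 <= K by apply: le_trans (HK 1 (nrm1 R)); exact: nrm_ge0.
pose q := s / r; have q01 : 0 <= q < 1.
  by rewrite divr_ge0 ?(ltW r0)//= ltr_pdivrMr// mul1r.
have [q0 q1] := andP q01.
pose A := (1 - q)^-1; have A0 : 0 <= A by rewrite invr_ge0; lra.
have M0 : 0 <= K * r^-1 * A ^+ 2 * 2 by rewrite !mulr_ge0 ?sqr_ge0// invr_ge0 ltW.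
have [N0 hN0] := arith_expr_small q01 M0 e0; exists N0 => N /hN0 hN w ws.
have wr : nrm w < r by exact: le_lt_trans sr.
rewrite (cauchyF_derive hH bH wr (hG _ wr)).
have bc k : bndS1 (fun z => H (ofR r * z) * ((ofR r * z)^-1) ^+ k).
  exact: (@cauchy_coef_bnd r H K).
have -> : \sum_(k < N) k.+1%:R * cauchy_coef r H k.+1 * w ^+ k =
    cavg (fun z => H (ofR r * z) * ((ofR r * z)^-1 *
      (\sum_(k < N) k.+1%:R * (w / (ofR r * z)) ^+ k))).
  rewrite (@eq_cavg _ _ (fun z => \sum_(k < N) (k.+1%:R * w ^+ k) *
     (H (ofR r * z) * ((ofR r * z)^-1) ^+ k.+1))); last first.
    move=> z _; rewrite !mulr_sumr; apply: eq_bigr => k _.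
    by rewrite !exprMn exprS; ring.
  rewrite cavg_sum; last by move=> k; apply: bndS1M; [exact: bndS1_cst|exact: bc].
  by apply: eq_bigr => k _; rewrite cavgZ// /cauchy_coef mulrAC.
have uq z : nrm z = 1 -> nrm (w / (ofR r * z)) <= q.
  by move=> z1; rewrite nrm_div_circle// ler_pM2r ?invr_gt0.
have bi : bndS1 (fun z => (ofR r * z)^-1).
  by exists r^-1 => z z1; rewrite nrmV nrmM z1 mulr1 nrm_ofR gtr0_norm.
have bk := bndS1_kernel r0 wr.
have bS : bndS1 (fun z => \sum_(k < N) k.+1%:R * (w / (ofR r * z)) ^+ k).
  by apply: bndS1_sum => k; apply: bndS1M; [exact: bndS1_cst|exact: bndS1_divX].
rewrite -cavgB; last 2 first.
- by do 2![apply: bndS1M => //]; exact: (bndS1M bk bk).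
- by do 2![apply: bndS1M => //].
apply: cavg_le0 => z z1; rewrite -mulrBr -mulrBr.
set u := w / _; have uq1 : nrm u <= q by exact: uq.
have u1 : 1 - u != 0 by apply: one_sub_neq0; exact: le_lt_trans q1.
have -> : (1 - u)^-1 ^+ 2 - \sum_(k < N) k.+1%:R * u ^+ k =
    (1 - u)^-1 ^+ 2 * ((N.+1%:R - N%:R * u) * u ^+ N).
  have u2 : (1 - u) ^+ 2 != 0 by rewrite expf_neq0.
  apply: (mulfI u2); rewrite mulrBr arith_geom_sum exprVn mulfV// mulVKf//.
  by ring.
apply: le_trans hN.
rewrite (_ : _ * (_ * q ^+ N) = K * (r^-1 * (A ^+ 2 * (2 * N.+1%:R * q ^+ N)))); last by ring.
rewrite nrmM; apply: ler_pM; rewrite ?nrm_ge0//; first exact: HK.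
rewrite nrmM nrmV nrmM z1 mulr1 nrm_ofR gtr0_norm//.
apply: ler_wpM2l; first by rewrite invr_ge0 ltW.
rewrite nrmM nrmX; apply: ler_pM; rewrite ?nrm_ge0 ?exprn_ge0 ?nrm_ge0//.
  by apply: lerXn2r; rewrite ?nnegrE ?nrm_ge0//; exact: nrm_geom.
rewrite nrmM nrmX; apply: ler_pM; rewrite ?nrm_ge0 ?exprn_ge0 ?nrm_ge0//; last first.
  by apply: lerXn2r; rewrite ?nnegrE ?nrm_ge0.
apply: le_trans (nrmB _ _) _; rewrite nrmM !nrm_nat.
have : N%:R * nrm u <= N%:R by rewrite ler_piMr//; lra.
by rewrite -natr1; lra.
Qed.

(** The derivative of a function represented by Cauchy's formula is in turn
    regular on smaller discs; this is the step that is used twice in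
    [holo_cauchy]. *)
Lemma cauchyF_derive_upoly r s H G : cauchyF r H ->
  bndS1 (fun z => H (ofR r * z)) -> 0 <= s < r ->
  (forall w, nrm w < r -> cdiff_at H w (G w)) -> upoly s G.
Proof.
move=> hH bH srr hG e e0.
have [N /(_ N (leqnn N)) hN] := cauchyF_derive_series hH bH srr hG e0.
exists (\poly_(k < N) (k.+1%:R * cauchy_coef r H k.+1)) => w ws.
by rewrite horner_poly; exact: hN.
Qed.

(** Goursat's theorem provides primitives [G] of [f] and [H] of [G]; [H] is
    regular enough for the contraction of the contour, and differentiating twice
    recovers [f]. *)
Theorem holo_cauchy rho r f : holo_on rho f -> 0 < r < rho -> cauchyF r f.
Proof.
move=> hf /andP[r0 rrho].
pose r1 := (r + rho) / 2; pose r2 := (r + r1) / 2.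
have r12 : r < r2 < r1 by rewrite /r2 /r1; lra.
have [rr2 r21] := andP r12.
have r1rho : r1 < rho by rewrite /r1; lra.
have r10 : 0 < r1 by rewrite /r1; lra.
have r20 : 0 < r2 by rewrite /r2; lra.
pose G := primitive f; pose H := primitive G.
have hG : holo_on rho G by exact: primitive_holo.
have hH : holo_on rho H by exact: primitive_holo.
have [K fK] := holo_bnd hf r1rho.
have bS1 g s : 0 < s -> s < rho -> holo_on rho g -> bndS1 (fun z => g (ofR s * z)).
  move=> s0 srho hg; have [L gL] := holo_bnd hg srho.
  by exists L => z z1; apply: gL; rewrite nrmM z1 mulr1 nrm_ofR gtr0_norm.
have GL a b : nrm a <= r1 -> nrm b <= r1 -> nrm (G b - G a) <= K * nrm (b - a).
  move=> ar br; rewrite (primitiveB hf r1rho (ltW r10) ar br).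
  have := @seg_le f a b 0 K; rewrite mul0r subr0; apply=> t t01.
  by rewrite subr0; apply: fK; exact: in_segment0.
have K0 : 0 <= K.
  by apply: le_trans (fK 0 _); rewrite ?nrm_ge0// nrm0 ltW.
(* [G] is Lipschitz because it is a primitive of a bounded function, and
   hence [H] has a quadratic remainder. *)
have HG : cauchyF r1 H.
  move=> w wr; apply: (@cauchy_C11 r1 K H G) => //; [|exact: holo_bnd hH _|exact: holo_bnd hG _].
  move=> a b ar br; rewrite (primitiveB hG r1rho (ltW r10) ar br).
  rewrite expr2 mulrA; apply: seg_le => t t01.
  apply: le_trans (GL _ _ ar (in_segment0 ar br t01)) _.
  apply: ler_wpM2l => //; have [t0 t1] := andP t01.
  rewrite (_ : _ - a = ofR t * (b - a)); last by ring.
  by rewrite nrmM nrm_ofR ger0_norm// ler_piMl// nrm_ge0.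
have uG : upoly r2 G.
  apply: (cauchyF_derive_upoly HG); first exact: bS1.
    by rewrite ltW.
  by move=> w wr; apply: (primitive_cdiff hG); lra.
have cG := upoly_cauchy r20 uG.
apply: upoly_cauchy => //; apply: (cauchyF_derive_upoly cG).
- by apply: bS1 => //; lra.
- by rewrite ltW.
- by move=> w wr; apply: (primitive_cdiff hf); lra.
Qed.

End one_variable.

(** * Several complex variables *)

Section frechet.
Variable R : realType.
Local Notation C := (Cplx R).

Lemma cplx_pos (e : C) : 0 < e -> e = ofR (complex.Re e) /\ 0 < complex.Re e.
Proof.
case: e => a b; rewrite ltcE /= => /andP[/eqP hb a0]; split => //.
by rewrite hb.
Qed.

Lemma ofR_le (x y : R) : (ofR x <= ofR y) = (x <= y).
Proof. by rewrite /ofR lecR. Qed.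
Lemma ofR_lt (x y : R) : (ofR x < ofR y) = (x < y).
Proof. by rewrite /ofR ltcR. Qed.

Lemma nbhs_rowP d (z : 'rV[C]_d) (A : set 'rV[C]_d) : nbhs z A <->
  exists2 e : R, 0 < e & forall v : 'rV[C]_d, (forall i, nrm (v ord0 i - z ord0 i) < e) -> A v.
Proof.
split.
  move=> /nbhs_ballP[e /= /cplx_pos[-> e0] h]; exists (complex.Re e) => // v hv.
  apply: h; split; first by rewrite -ofR0 ofR_lt.
  move=> i j; rewrite -ball_normE /ball_ /= normE ofR_lt ord1 nrmC.
  exact: hv.
move=> [e e0 h]; apply/nbhs_ballP; exists (ofR e); first by rewrite /= ofR_lt.
move=> v [_ hv]; apply: h => i; have := hv ord0 i.
by rewrite -ball_normE /ball_ /= normE ofR_lt nrmC.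
Qed.

Definition sum_nrm d (h : 'rV[C]_d) : R := \sum_i nrm (h ord0 i).

Lemma sum_nrm_ge0 d (h : 'rV[C]_d) : 0 <= sum_nrm h.
Proof. by apply: sumr_ge0 => i _; exact: nrm_ge0. Qed.

Lemma nrm_le_sum_nrm d (h : 'rV[C]_d) i : nrm (h ord0 i) <= sum_nrm h.
Proof.
rewrite /sum_nrm (bigD1 i)//= lerDl; apply: sumr_ge0 => j _; exact: nrm_ge0.
Qed.

Lemma mxnorm_le_sum_nrm d (h : 'rV[C]_d) : `|h| <= ofR (sum_nrm h).
Proof.
have -> : `|h| = mx_norm h by [].
have [h0|/mx_norm_neq0[[i j] hij]] := eqVneq (mx_norm h) 0.
  by rewrite h0 -ofR0 ofR_le sum_nrm_ge0.
by rewrite hij /= normE ofR_le ord1 nrm_le_sum_nrm.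
Qed.

Lemma coord_le_mxnorm d (h : 'rV[C]_d) i : `|h ord0 i| <= `|h|.
Proof.
have -> : `|h| = mx_norm h by [].
rewrite mx_normE.
exact: (@le_bigmax _ _ _ 0%:nng (fun i => `|h i.1 i.2|%:nng) (ord0, i)).
Qed.

Lemma sum_nrm_le_mxnorm d (h : 'rV[C]_d) : ofR (sum_nrm h) <= d%:R * `|h|.
Proof.
rewrite ofR_sum mulr_natl -[X in _ *+ X](card_ord d) -sumr_const.
by apply: ler_sum => i _; rewrite -normE coord_le_mxnorm.
Qed.

Lemma mx_coord_le d (h : 'rV[C]_d) (r : R) : (forall i, nrm (h ord0 i) < r) -> 0 < r ->
  sum_nrm h <= d%:R * r.
Proof.
move=> hr r0; rewrite /sum_nrm mulr_natl -[X in _ *+ X](card_ord d) -sumr_const.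
by apply: ler_sum => i _; exact: ltW.
Qed.

(** Differentiability by coordinate increments, with the partial derivatives
    [c] explicit; [differentiable_frechet] and [frechet_differentiable]
    relate it to the differentials for the norm of row vectors. *)
Definition frechet_at d (f : 'rV[C]_d -> C) z (c : 'I_d -> C) :=
  forall e : R, 0 < e -> exists2 r : R, 0 < r & forall h : 'rV[C]_d,
    (forall i, nrm (h ord0 i) < r) ->
    nrm (f (z + h) - f z - \sum_i h ord0 i * c i) <= e * sum_nrm h.

Lemma differentiable_frechet d (f : 'rV[C]_d -> C) z : differentiable f z ->
  exists c, frechet_at f z c.
Proof.
move=> df; exists (fun i => 'd f z (delta_mx ord0 i)) => e e0.
have dE h : 'd f z h = \sum_i h ord0 i * 'd f z (delta_mx ord0 i).
  rewrite [in LHS](row_sum_delta h) linear_sum; apply: eq_bigr => i _.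
  by rewrite linearZ.
have /eqaddoP := diff_locally df.
have e0' : 0 < ofR e by rewrite -ofR0 ofR_lt.
move=> /(_ _ e0') /nbhs_rowP [r r0 hr]; exists r => // h hh.
have := hr h; rewrite -dE => /(_ _).
have hh' : forall i, nrm (h ord0 i - (0 : 'rV[C]_d) ord0 i) < r.
  by move=> i; rewrite mxE subr0.
move=> /(_ hh'); rewrite /= !fctE => h1.
rewrite -ofR_le -normE ofRM; apply: le_trans (le_trans h1 _).
  by rewrite opprD addrA (addrC z).
by rewrite ler_wpM2l ?mxnorm_le_sum_nrm// ltW.
Qed.

Definition row_form d (c : 'I_d -> C) (h : 'rV[C]_d) : C := \sum_i h ord0 i * c i.

Lemma row_form_linear d (c : 'I_d -> C) : linear (row_form c : 'rV[C]_d -> C^o).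
Proof.
move=> a u v; rewrite /row_form scaler_sumr -big_split; apply: eq_bigr => i _ /=.
by rewrite !mxE mulrDl -mulrA.
Qed.

HB.instance Definition _ d (c : 'I_d -> C) :=
  GRing.isLinear.Build C 'rV[C]_d C^o *:%R (row_form c) (row_form_linear c).

Lemma frechet_differentiable d (f : 'rV[C]_d -> C) z c : frechet_at f z c ->
  differentiable f z.
Proof.
move=> hf.
have rc : continuous (row_form c).
  apply: continuous_big => [|i _ v]; first exact: add_continuous.
  apply: cvgMl; first exact: nbhs_filter.
  exact: (@coord_continuous C 1 d ord0 i v).
pose W : normedModType C := C.
have exp : (f : 'rV[C]_d -> W) \o shift z = cst (f z : W) + (row_form c : 'rV[C]_d -> W) +o_ (0 : 'rV[C]_d) id.
  apply/eqaddoP => e' /cplx_pos[-> e0].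
  pose e := complex.Re e'.
  have e1 : 0 < e / d.+1%:R by rewrite divr_gt0.
  have [r r0 hr] := hf _ e1.
  apply/nbhs_rowP; exists r => // h hh; rewrite !fctE /= opprD addrA.
  have hh' i : nrm (h ord0 i) < r by have := hh i; rewrite mxE subr0.
  have := hr h hh'; rewrite -ofR_le -normE ofRM => h1.
  rewrite /shift /= (addrC h); apply: le_trans h1 _.
  rewrite ofRM ofRV ofR_nat -mulrA ler_wpM2l//; first by rewrite -ofR0 ofR_le ltW.
  rewrite mulrC ler_pdivrMr ?ltr0n//; apply: le_trans (sum_nrm_le_mxnorm h) _.
  by rewrite mulrC ler_wpM2l// ler_nat.
have dE : 'd f z = (row_form c : _ -> _) :> (_ -> _) by apply: diff_unique.
by apply/diff_locallyP; split; rewrite dE.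
Qed.

End frechet.

Section torus_mean.
Variables (R : realType) (d : nat).
Local Notation C := (Cplx R).
Local Notation V := 'rV[C]_d.
Implicit Types (z x y xi : V) (i j : 'I_d) (l : seq 'I_d) (r s : R) (Phi Psi : V -> C).

Definition setc z i (w : C) : V := \row_j (if j == i then w else z ord0 j).

Lemma setc_same z i w : setc z i w ord0 i = w.
Proof. by rewrite mxE eqxx. Qed.
Lemma setc_other z i w j : j != i -> setc z i w ord0 j = z ord0 j.
Proof. by rewrite mxE => /negbTE ->. Qed.
Lemma setc_id z i : setc z i (z ord0 i) = z.
Proof. by apply/rowP => j; rewrite mxE; case: eqP => [->|]. Qed.

Definition Dball r z := forall i, nrm (z ord0 i) <= r.

Lemma polydiscP z : polydisc z <-> forall i, nrm (z ord0 i) < 1.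
Proof. by split => h i; have := h i; rewrite nrm_lt1. Qed.

Lemma Dball_polydisc r z : r < 1 -> Dball r z -> polydisc z.
Proof. by move=> r1 h; apply/polydiscP => i; exact: le_lt_trans (h i) r1. Qed.

Lemma Dball_setc r z i w : Dball r z -> nrm w <= r -> Dball r (setc z i w).
Proof. by move=> zr wr j; rewrite mxE; case: ifP => _ //; exact: zr. Qed.

Lemma frechet_slice Phi z i w c : frechet_at Phi (setc z i w) c ->
  cdiff_at (fun w => Phi (setc z i w)) w (c i).
Proof.
move=> hf e e0; have [r r0 hr] := hf _ e0; exists r => // h hh.
pose v : V := \row_j (if j == i then h else 0).
have -> : setc z i (w + h) = setc z i w + v.
  by apply/rowP => j; rewrite !mxE; case: eqP => // _; rewrite addr0.
have v1 : \sum_j v ord0 j * c j = h * c i.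
  rewrite (bigD1 i)//= big1 ?addr0 ?mxE ?eqxx// => j ji.
  by rewrite mxE (negbTE ji) mul0r.
have v2 : sum_nrm v = nrm h.
  rewrite /sum_nrm (bigD1 i)//= big1 ?addr0 ?mxE ?eqxx// => j ji.
  by rewrite mxE (negbTE ji) nrm0.
have := hr v; rewrite v1 v2 (mulrC h); apply=> j.
by rewrite mxE; case: ifP => // _; rewrite nrm0.
Qed.

Definition frechet_on_polydisc Phi := forall z, polydisc z -> exists c, frechet_at Phi z c.

(** A differentiable function of several variables is holomorphic in each of
    them, so that Cauchy's formula applies one variable at a time. *)
Lemma slice_holo Phi z i : frechet_on_polydisc Phi -> polydisc z ->
  holo_on 1 (fun w => Phi (setc z i w)).
Proof.
move=> hf /polydiscP hz w w1.
have [|c hc] := hf (setc z i w).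
  by apply/polydiscP => j; rewrite mxE; case: ifP.
by exists (c i); exact: frechet_slice.
Qed.

Lemma frechet_cont Phi z c : frechet_at Phi z c -> exists2 r : R, 0 < r &
  forall h : V, (forall i, nrm (h ord0 i) < r) -> nrm (Phi (z + h)) <= nrm (Phi z) + 1.
Proof.
move=> hf; have [r r0 hr] := hf 1 ltr01.
pose K := (\sum_i nrm (c i) + 1) * d.+1%:R.
have S0 : 0 <= \sum_i nrm (c i) by apply: sumr_ge0 => i _; exact: nrm_ge0.
have K0 : 0 < K by rewrite mulr_gt0 ?ltr0n//; lra.
exists (Num.min r K^-1); first by rewrite lt_min r0 invr_gt0.
move=> h hh.
have hr1 i : nrm (h ord0 i) < r by have := hh i; rewrite lt_min => /andP[].
have hr2 i : nrm (h ord0 i) < K^-1 by have := hh i; rewrite lt_min => /andP[].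
have h1 := hr h hr1.
have h2 : sum_nrm h <= d%:R * K^-1 by apply: mx_coord_le => //; rewrite invr_gt0.
have h3 : nrm (\sum_i h ord0 i * c i) <= (\sum_i nrm (c i)) * sum_nrm h.
  apply: le_trans (nrm_sum _ _ _) _; rewrite mulr_suml; apply: ler_sum => i _.
  by rewrite nrmM mulrC; apply: ler_wpM2l; [exact: nrm_ge0|exact: nrm_le_sum_nrm].
have h4 : (\sum_i nrm (c i) + 1) * sum_nrm h <= 1.
  apply: (@le_trans _ _ ((\sum_i nrm (c i) + 1) * (d.+1%:R * K^-1))).
    apply: ler_wpM2l; first by lra.
    apply: le_trans h2 _; apply: ler_wpM2r; first by rewrite invr_ge0 ltW.
    by rewrite ler_nat.
  by rewrite mulrA divff// gt_eqF.
rewrite (_ : Phi (z + h) = Phi z + ((Phi (z + h) - Phi z - \sum_i h ord0 i * c i) + \sum_i h ord0 i * c i)); last by rewrite [X in _ = _ + X]subrK [RHS]addrC subrK.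
apply: le_trans (nrmD _ _) _; rewrite lerD2l; apply: le_trans (nrmD _ _) _.
lra.
Qed.

Definition bndD r Phi := exists K, forall z, Dball r z -> nrm (Phi z) <= K.

Lemma frechet_bnd Phi r : r < 1 -> frechet_on_polydisc Phi -> bndD r Phi.
Proof.
move=> r1 hf; apply: contrapT => nb.
have : forall n : nat, exists z, Dball r z /\ n%:R < nrm (Phi z).
  move=> n; apply: contrapT => nz; apply: nb; exists n%:R => z zr.
  by rewrite leNgt; apply/negP => nf; apply: nz; exists z.
move=> /choice[z hz].
have UF := free_ultrafilter_ultra.
have bz i : bnd (fun n => z n ord0 i) by exists r => n; have [] := hz n.
pose p : V := \row_i ulim (fun n => z n ord0 i).
have pr : Dball r p.
  move=> i; rewrite mxE -[ulim _]subr0; apply: nrm_ulim_le => //.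
  apply: filterS (@filterT _ free_ultrafilter _) => n _ /=.
  by rewrite subr0; have [] := hz n.
have [c hc] := hf p (Dball_polydisc r1 pr).
have [e e0 he] := frechet_cont hc.
have h1 := free_ultrafilter_ge (Num.bound (nrm (Phi p) + 1)).
have h2 : free_ultrafilter [set n | forall i, nrm (z n ord0 i - p ord0 i) < e].
  have : forall i, free_ultrafilter [set n | nrm (z n ord0 i - p ord0 i) < e].
    by move=> i; rewrite mxE; exact: ulim_approx.
  exact: filter_forall.
have [n [/= n1 n2]] := filter_ex (filterI h1 h2).
have [_] := hz n; apply/negP; rewrite -leNgt.
have := he (z n - p); rewrite (addrC p) subrK => h3.
apply: le_trans (h3 _) _; first by move=> i; have := n2 i; rewrite !mxE.
apply: ltW; apply: lt_le_trans (archi_boundP _) _; last by rewrite ler_nat; exact: n1.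
by rewrite addr_ge0 ?nrm_ge0.
Qed.

(** The variables are integrated one at a time, in the order of [l], so that the
    one-variable formula can be iterated by induction on [l]. *)
Fixpoint tmean r l Phi z : C :=
  if l is i :: l' then cavg (fun u => tmean r l' Phi (setc z i (ofR r * u)))
  else Phi z.

Definition on_torus r l z xi :=
  [/\ Dball r xi, forall i, i \in l -> nrm (xi ord0 i) = r &
      forall j, j \notin l -> xi ord0 j = z ord0 j].

Lemma nrm_circle r (u : C) : 0 <= r -> nrm u = 1 -> nrm (ofR r * u) = r.
Proof. by move=> r0 u1; rewrite nrmM u1 mulr1 nrm_ofR ger0_norm. Qed.

Lemma on_torus_cons r i l z xi (u : C) : 0 <= r -> i \notin l -> nrm u = 1 ->
  on_torus r l (setc z i (ofR r * u)) xi ->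
  on_torus r (i :: l) z xi /\ xi ord0 i = ofR r * u.
Proof.
move=> r0 il u1 [h1 h2 h3]; have xii : xi ord0 i = ofR r * u by rewrite h3// setc_same.
split => //; split=> //.
  by move=> j; rewrite inE => /orP[/eqP ->|/h2//]; rewrite xii nrm_circle.
by move=> j; rewrite inE negb_or => /andP[ji jl]; rewrite h3// setc_other.
Qed.

Lemma tmean_le r l Phi z (c : C) (K : R) : 0 <= r -> uniq l -> Dball r z ->
  (forall xi, on_torus r l z xi -> nrm (Phi xi - c) <= K) ->
  nrm (tmean r l Phi z - c) <= K.
Proof.
move=> r0; elim: l z => [|i l IH] z /=; first by move=> _ zr; apply; split.
move=> /andP[il ul] zr h; apply: cavg_le => u u1; apply: IH => //.
  by apply: Dball_setc => //; rewrite nrm_circle.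
by move=> xi /(on_torus_cons r0 il u1)[h1 _]; exact: h.
Qed.

Lemma eq_tmean r l Phi Psi z : 0 <= r -> uniq l -> Dball r z ->
  (forall xi, on_torus r l z xi -> Phi xi = Psi xi) ->
  tmean r l Phi z = tmean r l Psi z.
Proof.
move=> r0; elim: l z => [|i l IH] z /=; first by move=> _ zr; apply; split.
move=> /andP[il ul] zr h; apply: eq_cavg => u u1; apply: IH => //.
  by apply: Dball_setc => //; rewrite nrm_circle.
by move=> xi /(on_torus_cons r0 il u1)[h1 _]; exact: h.
Qed.

Definition bndT r l z Phi := exists K, forall xi, on_torus r l z xi -> nrm (Phi xi) <= K.

Lemma bndD_T r l z Phi : bndD r Phi -> bndT r l z Phi.
Proof. by move=> [K hK]; exists K => xi [h _ _]; exact: hK. Qed.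

Lemma bndT_M r l z Phi Psi : bndT r l z Phi -> bndT r l z Psi ->
  bndT r l z (fun xi => Phi xi * Psi xi).
Proof.
move=> [K hK] [L hL]; exists (K * L) => xi h; rewrite nrmM.
by apply: ler_pM; rewrite ?nrm_ge0//; [exact: hK|exact: hL].
Qed.

Lemma bndT_cons r i l z (u : C) Phi : 0 <= r -> i \notin l -> nrm u = 1 ->
  bndT r (i :: l) z Phi -> bndT r l (setc z i (ofR r * u)) Phi.
Proof.
move=> r0 il u1 [K hK]; exists K => xi /(on_torus_cons r0 il u1)[h _].
exact: hK.
Qed.

Lemma bndS1_tmean r i l Phi z : 0 <= r -> i \notin l -> uniq l -> Dball r z ->
  bndT r (i :: l) z Phi ->
  bndS1 (fun u => tmean r l Phi (setc z i (ofR r * u))).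
Proof.
move=> r0 il ul zr [K hK]; exists K => u u1; rewrite -[tmean _ _ _ _]subr0.
apply: tmean_le => //; first by apply: Dball_setc => //; rewrite nrm_circle.
by move=> xi /(on_torus_cons r0 il u1)[h _]; rewrite subr0; exact: hK.
Qed.

Lemma tmeanD r l Phi Psi z : 0 <= r -> uniq l -> Dball r z ->
  bndT r l z Phi -> bndT r l z Psi ->
  tmean r l (fun xi => Phi xi + Psi xi) z = tmean r l Phi z + tmean r l Psi z.
Proof.
move=> r0; elim: l z => [|i l IH] z //= /andP[il ul] zr bP bQ.
rewrite -cavgD; try exact: bndS1_tmean.
apply: eq_cavg => u u1; apply: IH => //; try exact: bndT_cons.
by apply: Dball_setc => //; rewrite nrm_circle.
Qed.

Lemma tmeanZ r l (c : C) Phi z : 0 <= r -> uniq l -> Dball r z -> bndT r l z Phi ->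
  tmean r l (fun xi => c * Phi xi) z = c * tmean r l Phi z.
Proof.
move=> r0; elim: l z => [|i l IH] z //= /andP[il ul] zr bP.
rewrite -cavgZ; try exact: bndS1_tmean.
apply: eq_cavg => u u1; apply: IH => //; try exact: bndT_cons.
by apply: Dball_setc => //; rewrite nrm_circle.
Qed.

Lemma tmean_sum r l (I : Type) (s : seq I) (F : I -> V -> C) z :
  0 <= r -> uniq l -> Dball r z -> (forall k, bndT r l z (F k)) ->
  tmean r l (fun xi => \sum_(k <- s) F k xi) z = \sum_(k <- s) tmean r l (F k) z.
Proof.
move=> r0 ul zr bF; elim: s => [|k s IH].
  rewrite big_nil; apply/eqP; rewrite -nrm_eq0 eq_le nrm_ge0 andbT -[tmean _ _ _ _]subr0.
  by apply: tmean_le => // xi _; rewrite big_nil subrr nrm0.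
rewrite big_cons -IH -tmeanD//.
  by apply: eq_tmean => // xi _; rewrite big_cons.
elim: s {IH} => [|k' s [K hK]]; first by exists 0 => xi _; rewrite big_nil nrm0.
have [L hL] := bF k'; exists (L + K) => xi h; rewrite big_cons.
by apply: le_trans (nrmD _ _) _; apply: lerD; [exact: hL|exact: hK].
Qed.

(** The circle mean in one variable treats the factors in the others as
    constants. *)
Lemma tmean_prod r l (phi : 'I_d -> C -> C) z : 0 <= r -> uniq l -> Dball r z ->
  (forall i, bndS1 (fun u => phi i (ofR r * u))) ->
  tmean r l (fun xi => \prod_(i <- l) phi i (xi ord0 i)) z =
  \prod_(i <- l) cavg (fun u => phi i (ofR r * u)).
Proof.
move=> r0 + + bphi; elim: l z => [|i l IH] z /=; first by rewrite !big_nil.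
move=> /andP[il ul] zr; rewrite big_cons mulrC -cavgZ//.
apply: eq_cavg => u u1; have zr' : Dball r (setc z i (ofR r * u)).
  by apply: Dball_setc => //; rewrite nrm_circle.
rewrite [RHS]mulrC -(IH _ ul zr') -tmeanZ//.
  by apply: eq_tmean => // xi /(on_torus_cons r0 il u1)[_ <-]; rewrite big_cons.
have : forall i, exists K, forall u, nrm u = 1 -> nrm (phi i (ofR r * u)) <= K := bphi.
move=> /choice[K hK]; exists (\prod_(i <- l) K i) => xi [_ h _].
rewrite nrm_prod; elim: l {IH il ul} h => [|j l IH] h; first by rewrite !big_nil.
rewrite !big_cons; apply: ler_pM; rewrite ?nrm_ge0//.
- by apply: prodr_ge0 => k _; exact: nrm_ge0.
- have [r00|rn0] := eqVneq r 0.
    have := hK j 1 (nrm1 R); rewrite r00 ofR0 mul0r; apply: le_trans.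
    have /eqP := h j (mem_head _ _); rewrite r00 nrm_eq0 => /eqP ->; exact: lexx.
  rewrite (_ : xi ord0 j = ofR r * (xi ord0 j / ofR r)); last first.
    by rewrite mulrC divfK// ofR_eq0.
  apply: hK; rewrite nrmM nrmV h ?mem_head// nrm_ofR ger0_norm// divff//.
- by apply: IH => k kl; apply: h; rewrite inE kl orbT.
Qed.

Lemma tmean_base r l Phi x y : (forall j, j \notin l -> x ord0 j = y ord0 j) ->
  tmean r l Phi x = tmean r l Phi y.
Proof.
elim: l x y => [|i l IH] x y /= h.
  by congr Phi; apply/rowP => j; exact: h.
apply: eq_cavg => u _; apply: IH => j jl; rewrite !mxE; case: eqVneq => // ji.
by apply: h; rewrite inE negb_or ji.
Qed.

Lemma bndT_kernel r l z x : 0 < r -> (forall i, i \in l -> nrm (x ord0 i) < r) ->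
  bndT r l z (fun xi => \prod_(i <- l) (1 - x ord0 i / xi ord0 i)^-1).
Proof.
move=> r0 xl; exists (\prod_(i <- l) (1 - nrm (x ord0 i) / r)^-1) => xi [_ h _].
rewrite nrm_prod; elim: l xl h => [|j l IH] xl h; first by rewrite !big_nil.
rewrite !big_cons; apply: ler_pM; rewrite ?nrm_ge0//.
- by apply: prodr_ge0 => k _; exact: nrm_ge0.
- apply: nrm_geom; first by rewrite nrmM nrmV h ?mem_head.
  by rewrite ltr_pdivrMr// mul1r xl ?mem_head.
- by apply: IH => k kl; [apply: xl|apply: h]; rewrite inE kl orbT.
Qed.

(** Cauchy's formula iterated over the variables: each step is the one-variable
    formula on a slice of [Phi]. *)
Lemma tmean_cauchy r l Phi x : 0 < r -> uniq l -> bndD r Phi ->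
  (forall z i, Dball r z -> cauchyF r (fun w => Phi (setc z i w))) ->
  Dball r x -> (forall i, i \in l -> nrm (x ord0 i) < r) ->
  Phi x = tmean r l (fun xi => Phi xi * \prod_(i <- l) (1 - x ord0 i / xi ord0 i)^-1) x.
Proof.
move=> r0 + bP hc; have r0' := ltW r0; elim: l x => [|i l IH] x /=.
  by move=> _ _ _; rewrite big_nil mulr1.
move=> /andP[il ul] xr xl.
have xi_lt : nrm (x ord0 i) < r by apply: xl; rewrite mem_head.
have xl' j : j \in l -> nrm (x ord0 j) < r by move=> jl; apply: xl; rewrite inE jl orbT.
rewrite -{1}(setc_id x i) (hc x i xr _ xi_lt).
apply: eq_cavg => u u1; set y := setc x i (ofR r * u).
have yr : Dball r y by apply: Dball_setc => //; rewrite nrm_circle.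
have yl j : j \in l -> y ord0 j = x ord0 j.
  by move=> jl; rewrite setc_other//; apply: contraNneq il => <-.
rewrite {1}(IH y ul yr); last by move=> j jl; rewrite yl// xl'.
rewrite mulrC -tmeanZ//.
  apply: eq_tmean => // xi [h1 h2 h3]; rewrite big_cons.
  rewrite (_ : xi ord0 i = ofR r * u); last by rewrite h3// setc_same.
  rewrite mulrCA; congr (_ * (_ * _)); apply: eq_big_seq => j jl.
  by rewrite yl.
apply: bndT_M; first exact: bndD_T.
apply: bndT_kernel => // j jl; rewrite yl//; exact: xl'.
Qed.

End torus_mean.

(** * Power series on the polydisc *)

Section box.
Variable d : nat.
Local Notation index := {ffun 'I_d -> nat}.

(** Sums over boxes of multi-indices are products of one-variable sums
    ([big_box]), which is why power series are summed along boxes. *)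
Definition box (N : nat) : seq index :=
  [seq [ffun i => val (b i)] | b : {ffun 'I_d -> 'I_N}].

Lemma box_inj N : injective (fun b : {ffun 'I_d -> 'I_N} => [ffun i => val (b i)] : index).
Proof.
by move=> b b' /ffunP h; apply/ffunP => i; have := h i; rewrite !ffunE => /val_inj.
Qed.

Lemma box_uniq N : uniq (box N).
Proof. by rewrite map_inj_uniq ?enum_uniq//; exact: box_inj. Qed.

Lemma mem_box N (alpha : index) : (alpha \in box N) = [forall i, (alpha i < N)%N].
Proof.
apply/mapP/forallP => [[b _ ->] i|h]; first by rewrite ffunE; exact: ltn_ord.
exists [ffun i => Ordinal (h i)]; first by rewrite mem_enum.
by apply/ffunP => i; rewrite !ffunE.
Qed.

Lemma box_sub N M : (N <= M)%N -> {subset box N <= box M}.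
Proof.
move=> NM alpha; rewrite !mem_box => /forallP h; apply/forallP => i.
exact: leq_trans (h i) NM.
Qed.

Lemma box_exhaust (alpha : index) : exists N, alpha \in box N.
Proof.
exists (\max_i alpha i).+1; rewrite mem_box; apply/forallP => i.
by rewrite ltnS; exact: leq_bigmax.
Qed.

Lemma big_box (K : comPzRingType) N (F : 'I_d -> nat -> K) :
  \sum_(alpha <- box N) \prod_i F i (alpha i) = \prod_i \sum_(k < N) F i k.
Proof.
rewrite bigA_distr_bigA /= big_map enumT; apply: eq_bigr => b _.
by apply: eq_bigr => i _; rewrite ffunE.
Qed.

End box.

Section power_series.
Variables (R : realType) (d : nat).
Local Notation C := (Cplx R).
Local Notation V := 'rV[C]_d.
Local Notation index := {ffun 'I_d -> nat}.
Implicit Types (z x y xi : V) (i j : 'I_d) (l : seq 'I_d) (r s : R) (f g Phi : V -> C).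

Definition mono (alpha : index) z : C := \prod_i z ord0 i ^+ alpha i.

Lemma mono_bnd r alpha z : Dball r z -> nrm (mono alpha z) <= \prod_i r ^+ alpha i.
Proof.
move=> zr; rewrite nrm_prod; apply: ler_prod => i _; rewrite nrm_ge0 nrmX.
by rewrite lerXn2r ?nnegrE ?nrm_ge0 ?(le_trans (nrm_ge0 _) (zr i)).
Qed.

Definition box_sum (c : index -> C) N z : C := \sum_(alpha <- box d N) c alpha * mono alpha z.

Lemma box_sum_bnd c N r : bndD r (box_sum c N : V -> C).
Proof.
exists (\sum_(alpha <- box d N) nrm (c alpha) * \prod_i r ^+ alpha i) => z zr.
apply: le_trans (nrm_sum _ _ _) _; apply: ler_sum => alpha _.
by rewrite nrmM ler_wpM2l ?nrm_ge0// mono_bnd.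
Qed.

Definition tmeanall r Phi : C := tmean r (enum 'I_d) Phi 0.

Definition tcoef r f (alpha : index) : C :=
  tmeanall r (fun xi => f xi * \prod_i ((xi ord0 i)^-1) ^+ alpha i).

(** Cauchy's formula on the torus of radius [r]. *)
Definition reproduces r f := forall z, (forall i, nrm (z ord0 i) < r) ->
  f z = tmeanall r (fun xi => f xi * \prod_i (1 - z ord0 i / xi ord0 i)^-1).

Lemma Dball0 r : 0 <= r -> Dball r (0 : V).
Proof. by move=> r0 i; rewrite mxE nrm0. Qed.

Lemma separately_cauchy_reproduces r f : 0 < r -> bndD r f ->
  (forall z i, Dball r z -> cauchyF r (fun w => f (setc z i w))) -> reproduces r f.
Proof.
move=> r0 bf hf z zr; rewrite (@tmean_cauchy _ _ r (enum 'I_d) f z)//.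
- rewrite /tmeanall (@tmean_base _ _ _ _ _ z 0); last by move=> j; rewrite mem_enum.
  apply: eq_tmean => //; [exact: ltW|exact: enum_uniq|exact: Dball0 (ltW r0)|].
  by move=> xi _; rewrite big_enum.
- exact: enum_uniq.
- by move=> i; exact: ltW.
Qed.

Lemma prod_diff_le (I : Type) (l : seq I) (a b : I -> C) (K e : R) : 1 <= K ->
  (forall i : I, nrm (a i) <= K) -> (forall i : I, nrm (b i) <= K) ->
  (forall i : I, nrm (a i - b i) <= e) ->
  nrm (\prod_(i <- l) a i - \prod_(i <- l) b i) <= (size l)%:R * K ^+ size l * e.
Proof.
move=> K1 aK bK abe.
have K0 : 0 <= K by exact: le_trans K1.
elim: l => [|i l IH]; first by rewrite !big_nil subrr nrm0 !mul0r.
have e0 : 0 <= e by apply: le_trans (abe i); exact: nrm_ge0.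
rewrite !big_cons; set A := \prod_(_ <- _) a _; set B := \prod_(_ <- _) b _.
have AK : nrm A <= K ^+ size l.
  rewrite /A nrm_prod; elim: l {IH A B} => [|j l IH] /=; first by rewrite big_nil.
  by rewrite big_cons exprS ler_pM ?nrm_ge0// prodr_ge0// => k _; exact: nrm_ge0.
rewrite (_ : _ - _ = (a i - b i) * A + b i * (A - B)); last by ring.
apply: le_trans (nrmD _ _) _; rewrite !nrmM /=.
rewrite (_ : (size l).+1%:R * _ * e = e * K ^+ (size l).+1 + K * ((size l)%:R * K ^+ size l * e)); last first.
  by rewrite -natr1 exprS; ring.
apply: lerD; last by apply: ler_pM; rewrite ?nrm_ge0.
apply: ler_pM; rewrite ?nrm_ge0//; apply: le_trans AK _.
by rewrite exprS ler_peMl// exprn_ge0.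
Qed.

Lemma bndT_inv r z alpha : 0 < r ->
  bndT r (enum 'I_d) z (fun xi => \prod_i ((xi ord0 i)^-1) ^+ alpha i).
Proof.
move=> r0; exists (\prod_i (r^-1) ^+ alpha i) => xi [_ h _].
rewrite nrm_prod le_eqVlt; apply/orP; left; apply/eqP; apply: eq_bigr => i _.
by rewrite nrmX nrmV h// mem_enum.
Qed.

(** The product kernel is a product of geometric series, and its partial sum
    over a box is the product of the partial sums. *)
Lemma reproduces_series r s f : 0 < r -> 0 <= s < r -> bndD r f -> reproduces r f ->
  forall e : R, 0 < e -> exists N0, forall N, (N0 <= N)%N -> forall z, Dball s z ->
    nrm (f z - box_sum (tcoef r f) N z) <= e.
Proof.
move=> r0 /andP[s0 sr] bf hf e e0; have [K hK] := bf.
have r0' := ltW r0.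
have K0 : 0 <= K by apply: le_trans (hK 0 (Dball0 r0')); exact: nrm_ge0.
pose q := s / r; have q01 : 0 <= q < 1 by rewrite divr_ge0//= ltr_pdivrMr// mul1r.
have [q0 q1] := andP q01.
pose A := (1 - q)^-1; have A1 : 1 <= A by rewrite invf_ge1 ?subr_gt0//; lra.
pose M := K * ((size (enum 'I_d))%:R * (2 * A) ^+ (size (enum 'I_d)) * A).
have M0 : 0 <= M by rewrite !mulr_ge0 ?exprn_ge0 ?mulr_ge0//; lra.
have [N0 hN0] := expr_small q01 M0 e0; exists N0 => N hN z zs.
have zr i : nrm (z ord0 i) < r by exact: le_lt_trans (zs i) sr.
have un := enum_uniq 'I_d.
have -> : box_sum (tcoef r f) N z = tmeanall r (fun xi =>
    f xi * \prod_i \sum_(k < N) (z ord0 i / xi ord0 i) ^+ k).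
  rewrite /tmeanall (@eq_tmean _ _ _ _ _ (fun xi => \sum_(alpha <- box d N)
     mono alpha z * (f xi * \prod_i ((xi ord0 i)^-1) ^+ alpha i)))//; last 2 first.
  - exact: Dball0.
  - move=> xi _; rewrite -(@big_box d C N (fun i k => (z ord0 i / xi ord0 i) ^+ k)).
    rewrite mulr_sumr; apply: eq_bigr => alpha _.
    under eq_bigr do rewrite exprMn.
    by rewrite big_split /= -/(mono alpha z) mulrCA.
  rewrite tmean_sum//; last 2 first.
  - exact: Dball0.
  - move=> alpha; apply: bndT_M; first by exists (nrm (mono alpha z)).
    by apply: bndT_M; [exact: bndD_T|exact: bndT_inv].
  apply: eq_bigr => alpha _; rewrite mulrC tmeanZ//; first exact: Dball0.
  by apply: bndT_M; [exact: bndD_T|exact: bndT_inv].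
have ub i xi : on_torus r (enum 'I_d) 0 xi -> nrm (z ord0 i / xi ord0 i) <= q.
  move=> [_ h _]; rewrite nrmM nrmV h ?mem_enum// ler_pM2r ?invr_gt0//.
have geomK i xi : on_torus r (enum 'I_d) 0 xi ->
    nrm (\sum_(k < N) (z ord0 i / xi ord0 i) ^+ k) <= 2 * A.
  move=> /(ub i) h; have t1 := geom_tail_le N h q1; have t2 := nrm_geom h q1.
  have qN : A * q ^+ N <= A.
    by rewrite -[X in _ <= X]mulr1 ler_wpM2l ?exprn_ile1//; lra.
  set u := (1 - _)^-1 in t1 t2; set S := \sum_(_ < _) _ in t1 *.
  rewrite (_ : S = u - (u - S)); last by ring.
  by apply: le_trans (nrmB _ _) _; rewrite -/A in t1 t2; lra.
rewrite hf// (_ : _ - _ = tmeanall r (fun xi => f xi *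
    (\prod_i (1 - z ord0 i / xi ord0 i)^-1 - \prod_i \sum_(k < N) (z ord0 i / xi ord0 i) ^+ k))).
  rewrite -[tmeanall _ _]subr0; apply: tmean_le => //; first exact: Dball0.
  move=> xi hxi; rewrite subr0 nrmM.
  apply: le_trans (hN0 N hN).
  rewrite (_ : M * q ^+ N = K * ((size (enum 'I_d))%:R * (2 * A) ^+ (size (enum 'I_d)) * (A * q ^+ N))); last by rewrite /M; ring.
  apply: ler_pM; rewrite ?nrm_ge0//; first by apply: hK; case: hxi.
  rewrite -[index_enum _]/(index_enum _) -!big_enum /=; apply: prod_diff_le.
  - lra.
  - by move=> i; apply: le_trans (nrm_geom (ub i _ hxi) q1) _; rewrite -/A; lra.
  - by move=> i; exact: geomK.
  - by move=> i; apply: geom_tail_le => //; exact: ub.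
rewrite -mulN1r /tmeanall -tmeanZ//; last 2 first.
- exact: Dball0.
- apply: bndT_M; first exact: bndD_T.
  exists (\prod_(i : 'I_d) (2 * A)) => xi hxi; rewrite nrm_prod; apply: ler_prod => i _.
  by rewrite nrm_ge0 geomK.
rewrite -tmeanD//; last 3 first.
- exact: Dball0.
- apply: bndT_M; first exact: bndD_T.
  have [L hL] := @bndT_kernel R d r (enum 'I_d) 0 z r0 (fun i _ => zr i).
  by exists L => xi hxi; have := hL xi hxi; rewrite big_enum.
- apply: bndT_M; first by exists (nrm (-1)).
  apply: bndT_M; first exact: bndD_T.
  exists (\prod_(i : 'I_d) (2 * A)) => xi hxi; rewrite nrm_prod; apply: ler_prod => i _.
  by rewrite nrm_ge0 geomK.
apply: eq_tmean => //; first exact: Dball0.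
by move=> xi _; ring.
Qed.

Lemma cavg_monoV s a b : 0 < s ->
  cavg (fun u => (ofR s * u) ^+ b * ((ofR s * u)^-1) ^+ a) = (a == b)%:R.
Proof.
move=> s0.
have s1 (u : C) : nrm u = 1 -> ofR s * u != 0.
  by move=> u1; rewrite -nrm_gt0 nrmM u1 mulr1 nrm_ofR gtr0_norm.
have [ab|ba|<-] := ltngtP a b.
- rewrite (@eq_cavg _ _ (fun u => ofR s ^+ (b - a) * u ^+ (b - a))); last first.
    by move=> u u1; rewrite -exprMn -(subnKC (ltnW ab)) exprD mulrAC -exprMn divff ?s1// expr1n mul1r addKn.
  rewrite cavgZ; last by exists 1 => u u1; rewrite nrmX u1 expr1n.
  by rewrite cavg_expn ?subn_gt0// mulr0.
- rewrite (@eq_cavg _ _ (fun u => (ofR s)^-1 ^+ (a - b) * u^-1 ^+ (a - b))); last first.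
    by move=> u u1; rewrite -exprMn -invfM -(subnKC (ltnW ba)) exprD mulrA -exprMn divff ?s1// expr1n mul1r addKn.
  rewrite cavgZ; last by exists 1 => u u1; rewrite nrmX nrmV u1 invr1 expr1n.
  by rewrite cavg_expNn ?subn_gt0// mulr0.
- rewrite (@eq_cavg _ _ (fun=> 1)) ?cavg_cst// => u u1.
  by rewrite -exprMn divff ?s1// expr1n.
Qed.

Lemma tcoef_mono s alpha beta : 0 < s ->
  tcoef s (mono beta) alpha = (alpha == beta)%:R.
Proof.
move=> s0; rewrite /tcoef /tmeanall.
rewrite (@eq_tmean _ _ _ _ _ (fun xi => \prod_(i <- enum 'I_d)
    (xi ord0 i ^+ beta i * ((xi ord0 i)^-1) ^+ alpha i))); last first.
- by move=> xi _; rewrite /mono -big_split /= big_enum.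
- exact: Dball0 (ltW s0).
- exact: enum_uniq.
- exact: ltW.
rewrite (@tmean_prod _ _ s _ (fun i w => w ^+ beta i * (w^-1) ^+ alpha i)); last first.
- move=> i; apply: bndS1M.
    by exists (s ^+ beta i) => u u1; rewrite nrmX nrmM u1 mulr1 nrm_ofR gtr0_norm.
  by exists (s^-1 ^+ alpha i) => u u1; rewrite nrmX nrmV nrmM u1 mulr1 nrm_ofR gtr0_norm.
- exact: Dball0 (ltW s0).
- exact: enum_uniq.
- exact: ltW.
under eq_bigr => i _ do rewrite cavg_monoV//.
rewrite big_enum /=; case: eqVneq => [->|ne]; first by rewrite big1// => i _; rewrite eqxx.
have [i hi] : exists i, alpha i != beta i.
  apply/existsP; rewrite -negb_forall; apply: contra ne => /forallP h.
  by apply/eqP/ffunP => i; apply/eqP.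
by rewrite (bigD1 i)//= (negbTE hi) mul0r.
Qed.

Definition unif_series (c : index -> C) f := forall s, 0 <= s < 1 -> forall e : R, 0 < e ->
  exists N0, forall N, (N0 <= N)%N -> forall z, Dball s z ->
    nrm (f z - box_sum c N z) <= e.

(** The coefficients of a uniformly convergent series are means over the
    torus, since monomials are orthogonal there. This makes them independent
    of the radius. *)
Lemma tcoef_unique s f (c : index -> C) alpha : 0 < s ->
  (forall e : R, 0 < e -> exists N0, forall N, (N0 <= N)%N -> forall z, Dball s z ->
    nrm (f z - box_sum c N z) <= e) -> tcoef s f alpha = c alpha.
Proof.
move=> s0 hf; apply/eqP; rewrite -subr_eq0; apply/eqP; apply: nrm_le0_eq0 => e e0.
have s0' := ltW s0; have D0 := Dball0 s0'; have un := enum_uniq 'I_d.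
pose P := \prod_i (s^-1) ^+ alpha i.
have P0 : 0 < P by apply: prodr_gt0 => i _; rewrite exprn_gt0// invr_gt0.
have eP : 0 < e / P by rewrite divr_gt0.
have [N0 hN0] := hf _ eP; have [N1 hN1] := box_exhaust alpha.
pose N := maxn N0 N1.
have aN : alpha \in box d N by apply: box_sub hN1; exact: leq_maxr.
have fN := hN0 N (leq_maxl _ _).
have bS : bndD s (box_sum c N : V -> C) by exact: box_sum_bnd.
have bf : bndD s f.
  have [K hK] := bS; exists (e / P + K) => z zs; rewrite -[f z](subrK (box_sum c N z)).
  by apply: le_trans (nrmD _ _) _; apply: lerD; [exact: fN|exact: hK].
have bI := @bndT_inv s 0 alpha s0.
have <- : tcoef s (box_sum c N) alpha = c alpha.
  rewrite /tcoef /tmeanall (@eq_tmean _ _ _ _ _ (fun xi => \sum_(beta <- box d N)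
    c beta * (mono beta xi * \prod_i ((xi ord0 i)^-1) ^+ alpha i)))//; last first.
    by move=> xi _; rewrite mulr_suml; apply: eq_bigr => beta _; rewrite mulrA.
  have bm beta : bndT s (enum 'I_d) 0 (fun xi => mono beta xi * \prod_i ((xi ord0 i)^-1) ^+ alpha i).
    by apply: bndT_M => //; apply: bndD_T; exists (\prod_i s ^+ beta i) => z zs; exact: mono_bnd.
  rewrite tmean_sum//; last by move=> beta; apply: bndT_M => //; exists (nrm (c beta)).
  under eq_bigr => beta _ do rewrite tmeanZ// -/(tmeanall _ _) -/(tcoef _ _ _) tcoef_mono//.
  rewrite (bigD1_seq alpha) ?box_uniq//= eqxx mulr1 big1 ?addr0// => beta.
  by rewrite eq_sym => /negbTE ->; rewrite mulr0.
rewrite /tcoef -mulN1r /tmeanall -tmeanZ//; last by apply: bndT_M => //; exact: bndD_T.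
rewrite -tmeanD//; last 2 first.
- by apply: bndT_M => //; exact: bndD_T.
- by apply: bndT_M; [exists (nrm (-1))|apply: bndT_M => //; exact: bndD_T].
rewrite -[tmean _ _ _ _]subr0; apply: tmean_le => // xi hxi.
rewrite subr0 mulN1r -mulrBl nrmM -[X in _ <= X](@divfK _ P) ?gt_eqF//.
apply: ler_pM; rewrite ?nrm_ge0//; first by apply: fN; case: hxi.
rewrite nrm_prod le_eqVlt; apply/orP; left; apply/eqP; apply: eq_bigr => i _.
by rewrite nrmX nrmV; case: hxi => _ ->//; rewrite mem_enum.
Qed.

Lemma frechet_reproduces f r : frechet_on_polydisc f -> 0 < r < 1 -> reproduces r f.
Proof.
move=> hf /andP[r0 r1]; apply: separately_cauchy_reproduces => //.
  exact: frechet_bnd.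
move=> z i zr; apply: (@holo_cauchy _ 1); last by rewrite r0.
by apply: slice_holo => //; exact: Dball_polydisc zr.
Qed.

(** The coefficients do not depend on the radius; the value 1/2 is an
    arbitrary choice. *)
Definition hcoef f := tcoef 2^-1 f.

Theorem holo_series f : frechet_on_polydisc f -> unif_series (hcoef f) f.
Proof.
move=> hf s /andP[s0 s1].
have h r t : 0 < r < 1 -> 0 <= t < r -> forall e : R, 0 < e -> exists N0, forall N, (N0 <= N)%N ->
    forall z, Dball t z -> nrm (f z - box_sum (tcoef r f) N z) <= e.
  move=> r01 tr; have [r0 r1] := andP r01; apply: reproduces_series => //.
    exact: frechet_bnd.
  exact: frechet_reproduces.
pose r := (1 + Num.max s 2^-1) / 2.
have sm : s <= Num.max s 2^-1 by rewrite le_max lexx.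
have hm : (2^-1 : R) <= Num.max s 2^-1 by rewrite le_max lexx orbT.
have m1 : Num.max s 2^-1 < 1 by rewrite gt_max s1; lra.
have rE : hcoef f = tcoef r f.
  apply/funext => alpha; apply: tcoef_unique; first by lra.
  by apply: h; rewrite /r; lra.
by rewrite rE; apply: h; rewrite /r; lra.
Qed.

End power_series.

Section differentiation_under_the_mean.
Variables (R : realType) (d : nat).
Local Notation C := (Cplx R).
Local Notation V := 'rV[C]_d.
Local Notation index := {ffun 'I_d -> nat}.
Implicit Types (z x y xi h : V) (i j : 'I_d) (l : seq 'I_d) (r s : R) (f g Phi : V -> C).

Lemma bndT_B r l z Phi Psi : bndT r l z Phi -> bndT r l z Psi ->
  bndT r l z (fun xi => Phi xi - Psi xi).
Proof.
move=> [K hK] [L hL]; exists (K + L) => xi h; apply: le_trans (nrmB _ _) _.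
by apply: lerD; [exact: hK|exact: hL].
Qed.

Lemma tmeanB r l Phi Psi z : 0 <= r -> uniq l -> Dball r z ->
  bndT r l z Phi -> bndT r l z Psi ->
  tmean r l (fun xi => Phi xi - Psi xi) z = tmean r l Phi z - tmean r l Psi z.
Proof.
move=> r0 ul zr bP bQ; rewrite -[in RHS]mulN1r -tmeanZ// -tmeanD//.
  by apply: eq_tmean => // xi _; rewrite mulN1r.
by apply: bndT_M => //; exists (nrm (-1)).
Qed.

(** First-order expansions in [h], with a quadratic error that is uniform in the
    parameter [xi]: such expansions can be multiplied and averaged over [xi]. *)
Definition expands (T : set V) (phi : V -> V -> C) (a : V -> C) (c : V -> 'I_d -> C) :=
  exists K r : R, [/\ 0 < r <= 1, 0 <= K & forall xi h, T xi ->
    (forall i, nrm (h ord0 i) < r) ->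
    [/\ nrm (a xi) <= K, forall i, nrm (c xi i) <= K &
      nrm (phi h xi - a xi - \sum_i h ord0 i * c xi i) <= K * sum_nrm h ^+ 2]].

Lemma expands_cst (T : set V) : expands T (fun _ _ => 1) (fun=> 1) (fun _ _ => 0).
Proof.
exists 1, 1; split; rewrite ?ltr01 ?lexx ?ler01// => xi h _ _; split.
- by rewrite nrm1.
- by move=> i; rewrite nrm0.
- rewrite big1 ?subrr ?subr0 ?nrm0 ?mul1r ?sqr_ge0// => i _; exact: mulr0.
Qed.

Lemma expandsM (T : set V) phi a c psi b c' : expands T phi a c -> expands T psi b c' ->
  expands T (fun h xi => phi h xi * psi h xi) (fun xi => a xi * b xi)
    (fun xi i => a xi * c' xi i + b xi * c xi i).
Proof.
move=> [K [r [/andP[r0 r1] K0 hK]]] [K' [r' [/andP[r'0 r'1] K'0 hK']]].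
pose D : R := d%:R; have D0 : 0 <= D by rewrite /D.
exists (K * K' * (3 + 2 * D + D ^+ 2)), (Num.min r r'); split.
- by rewrite lt_min r0 r'0 ge_min r1.
- by rewrite !mulr_ge0// !addr_ge0 ?mulr_ge0.
move=> xi h hT hh.
have hr i : nrm (h ord0 i) < r by have := hh i; rewrite lt_min => /andP[].
have hr' i : nrm (h ord0 i) < r' by have := hh i; rewrite lt_min => /andP[].
have [a1 c1 p1] := hK xi h hT hr; have [b1 c'1 p2] := hK' xi h hT hr'.
have KK : 0 <= K * K' by rewrite mulr_ge0.
have D2 : 0 <= D ^+ 2 by rewrite sqr_ge0.
split.
- rewrite nrmM; apply: (@le_trans _ _ (K * K')); first by apply: ler_pM; rewrite ?nrm_ge0.
  by rewrite ler_peMr//; lra.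
- move=> i; apply: le_trans (nrmD _ _) _; rewrite !nrmM.
  apply: (@le_trans _ _ (K * K' + K' * K)).
    by apply: lerD; apply: ler_pM; rewrite ?nrm_ge0.
  rewrite (_ : K * K' + K' * K = K * K' * 2); last by ring.
  by apply: ler_wpM2l => //; lra.
set S := sum_nrm h; have S0 : 0 <= S by exact: sum_nrm_ge0.
have SD : S <= D.
  have := mx_coord_le hr r0; rewrite -/S -/D => h1; apply: le_trans h1 _.
  by rewrite ler_piMr.
have form (e : 'I_d -> C) (L : R) : (forall i, nrm (e i) <= L) ->
    nrm (\sum_i h ord0 i * e i) <= L * S.
  move=> eL; apply: le_trans (nrm_sum _ _ _) _; rewrite /S /sum_nrm mulr_sumr.
  by apply: ler_sum => i _; rewrite nrmM mulrC ler_wpM2r ?nrm_ge0.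
have f1 := form _ _ c1; have f2 := form _ _ c'1.
set A := a xi in a1 p1 *; set B := b xi in b1 p2 *.
set L := \sum_i h ord0 i * c xi i in p1 f1 *.
set L' := \sum_i h ord0 i * c' xi i in p2 f2 *.
rewrite (_ : \sum_i _ = A * L' + B * L); last first.
  by rewrite !mulr_sumr -big_split; apply: eq_bigr => i _; rewrite /= /A /B; ring.
set p := phi h xi in p1 *; set q := psi h xi in p2 *.
set u := p - A - L in p1; set v := q - B - L' in p2.
rewrite (_ : p * q - A * B - _ = L * L' + u * (B + L' + v) + (A + L) * v); last first.
  by rewrite /u /v; ring.
have S2 : 0 <= S ^+ 2 by rewrite sqr_ge0.
have S2D : S ^+ 2 <= D ^+ 2 by rewrite lerXn2r ?nnegrE.
have t1 : nrm (L * L') <= (K * S) * (K' * S) by rewrite nrmM ler_pM ?nrm_ge0.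
have t2 : nrm (B + L' + v) <= K' * (1 + D + D ^+ 2).
  apply: le_trans (nrmD _ _) _; apply: le_trans (lerD (nrmD _ _) (lexx _)) _.
  rewrite !mulrDr mulr1; apply: lerD; first apply: lerD => //.
    by apply: le_trans f2 _; rewrite ler_wpM2l.
  by apply: le_trans p2 _; rewrite ler_wpM2l.
have t3 : nrm (u * (B + L' + v)) <= (K * S ^+ 2) * (K' * (1 + D + D ^+ 2)).
  by rewrite nrmM ler_pM ?nrm_ge0.
have t4 : nrm ((A + L) * v) <= (K * (1 + D)) * (K' * S ^+ 2).
  rewrite nrmM ler_pM ?nrm_ge0//; apply: le_trans (nrmD _ _) _.
  by rewrite mulrDr mulr1 lerD//; apply: le_trans f1 _; rewrite ler_wpM2l.
apply: le_trans (nrmD _ _) _; apply: le_trans (lerD (nrmD _ _) (lexx _)) _.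
have -> : K * K' * (3 + 2 * D + D ^+ 2) * S ^+ 2 =
  (K * S) * (K' * S) + (K * S ^+ 2) * (K' * (1 + D + D ^+ 2)) + (K * (1 + D)) * (K' * S ^+ 2).
  by ring.
by rewrite !lerD.
Qed.

Definition kernel_slope z xi i j : C :=
  if j == i then (xi ord0 i)^-1 * (1 - z ord0 i / xi ord0 i)^-1 ^+ 2 else 0.

Lemma expands_kernel r z i : 0 < r -> nrm (z ord0 i) < r ->
  expands [set xi | nrm (xi ord0 i) = r]
    (fun h xi => (1 - (z + h) ord0 i / xi ord0 i)^-1)
    (fun xi => (1 - z ord0 i / xi ord0 i)^-1) (fun xi => kernel_slope z xi i).
Proof.
move=> r0 zr; pose t := (nrm (z ord0 i) + r) / 2; pose q := t / r.
have q1 : q < 1 by rewrite ltr_pdivrMr ?mul1r// /t; lra.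
have q0 : 0 <= q by rewrite divr_ge0 ?(ltW r0)// /t; have := nrm_ge0 (z ord0 i); lra.
pose A := (1 - q)^-1; have A1 : 1 <= A by rewrite invf_ge1 ?subr_gt0//; lra.
have A0 : 0 <= A by lra.
have r1 : 0 <= r^-1 by rewrite invr_ge0 ltW.
exists (A + r^-1 * A ^+ 2 + r^-1 ^+ 2 * A ^+ 3), (Num.min 1 ((r - nrm (z ord0 i)) / 2)); split.
- by rewrite lt_min ltr01 ge_min lexx andbT /=; lra.
- by rewrite !addr_ge0// !mulr_ge0// ?exprn_ge0.
move=> xi h /= xir hh.
have hi : nrm (h ord0 i) < (r - nrm (z ord0 i)) / 2.
  by have := hh i; rewrite lt_min => /andP[].
have xi0 : xi ord0 i != 0 by rewrite -nrm_gt0 xir.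
have vq (v : C) : nrm v <= t -> nrm (v / xi ord0 i) <= q.
  by move=> vt; rewrite nrmM nrmV xir ler_pM2r ?invr_gt0.
have zt : nrm (z ord0 i) <= t by rewrite /t; lra.
have zht : nrm (z ord0 i + h ord0 i) <= t.
  by apply: le_trans (nrmD _ _) _; rewrite /t; lra.
have k1 := nrm_geom (vq _ zt) q1; have k2 := nrm_geom (vq _ zht) q1.
have n1 : 1 - z ord0 i / xi ord0 i != 0 by apply: one_sub_neq0; exact: le_lt_trans (vq _ zt) q1.
have n2 : 1 - (z ord0 i + h ord0 i) / xi ord0 i != 0 by apply: one_sub_neq0; exact: le_lt_trans (vq _ zht) q1.
rewrite -/A in k1 k2; rewrite mxE.
have e1 : 0 <= r^-1 * A ^+ 2 by rewrite mulr_ge0 ?exprn_ge0.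
have e2 : 0 <= r^-1 ^+ 2 * A ^+ 3 by rewrite mulr_ge0 ?exprn_ge0.
have ksq : nrm (1 - z ord0 i / xi ord0 i)^-1 ^+ 2 <= A ^+ 2.
  by rewrite lerXn2r ?nnegrE ?nrm_ge0.
split.
- lra.
- move=> j; rewrite /kernel_slope; case: ifP => _; last by rewrite nrm0; lra.
  rewrite nrmM nrmV xir nrmX; apply: (@le_trans _ _ (r^-1 * A ^+ 2)); last by lra.
  exact: ler_wpM2l.
rewrite (bigD1 i)//= big1 ?addr0; last first.
  by move=> j ji; rewrite /kernel_slope (negbTE ji) mulr0.
rewrite /kernel_slope eqxx.
rewrite (_ : _ - _ = ((xi ord0 i)^-1) ^+ 2 * ((1 - z ord0 i / xi ord0 i)^-1 ^+ 2 *
    (1 - (z ord0 i + h ord0 i) / xi ord0 i)^-1) * h ord0 i ^+ 2); last first.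
  move: n1 n2; rewrite mulrDl; set v := (xi ord0 i)^-1.
  set b := z ord0 i * v; rewrite opprD addrA => n1 n2.
  by field; rewrite n1 n2.
rewrite nrmM [X in _ * X <= _]nrmX; apply: ler_pM; rewrite ?nrm_ge0 ?sqr_ge0//.
  rewrite nrmM nrmX nrmV xir; apply: (@le_trans _ _ (r^-1 ^+ 2 * A ^+ 3)); last by lra.
  apply: ler_wpM2l; first by rewrite exprn_ge0.
  by rewrite nrmM nrmX [X in _ <= X]exprSr ler_pM ?exprn_ge0 ?nrm_ge0.
by rewrite lerXn2r ?nnegrE ?nrm_ge0 ?sum_nrm_ge0// nrm_le_sum_nrm.
Qed.

Lemma expands_kernels r z l : 0 < r -> (forall i, nrm (z ord0 i) < r) ->
  exists c, expands [set xi | forall i, nrm (xi ord0 i) = r]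
    (fun h xi => \prod_(i <- l) (1 - (z + h) ord0 i / xi ord0 i)^-1)
    (fun xi => \prod_(i <- l) (1 - z ord0 i / xi ord0 i)^-1) c.
Proof.
move=> r0 zr; elim: l => [|i l [c IH]].
  exists (fun _ _ => 0); have := @expands_cst [set xi | forall i, nrm (xi ord0 i) = r].
  move=> [K [t [h1 h2 h3]]]; exists K, t; split=> // xi h hT hh.
  by rewrite !big_nil; exact: h3.
have := expands_kernel r0 (zr i) => -[K [t [h1 h2 h3]]].
have : expands [set xi | forall i, nrm (xi ord0 i) = r] (fun h xi => (1 - (z + h) ord0 i / xi ord0 i)^-1)
    (fun xi => (1 - z ord0 i / xi ord0 i)^-1) (fun xi => kernel_slope z xi i).
  by exists K, t; split=> // xi h hT hh; apply: h3 => //; exact: hT.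
move=> /expandsM /(_ IH) => -[K' [t' [h1' h2' h3']]].
eexists; exists K', t'; split; [exact: h1'|exact: h2'|] => xi h hT hh.
by rewrite !big_cons; exact: h3'.
Qed.

Lemma polydisc_radius z : polydisc z -> exists2 r, 0 < r < 1 & forall i, nrm (z ord0 i) < r.
Proof.
move=> /polydiscP hz; pose m := \big[Num.max/0]_i nrm (z ord0 i).
have m1 : m < 1 by apply/bigmax_ltP; split=> // i _; exact: hz.
have m0 : 0 <= m by apply/bigmax_geP; left.
exists ((1 + m) / 2); first by lra.
move=> i; have : nrm (z ord0 i) <= m.
  by apply/bigmax_geP; right; exists i.
lra.
Qed.

Lemma on_torus_all r xi : on_torus r (enum 'I_d) 0 xi -> forall i, nrm (xi ord0 i) = r.
Proof. by move=> [_ h _] i; apply: h; rewrite mem_enum. Qed.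

(** A function reproduced by the Cauchy kernel is differentiable, since the
    kernel is so uniformly on the torus. *)
Lemma reproduces_frechet r f z : 0 < r -> bndD r f -> reproduces r f ->
  (forall i, nrm (z ord0 i) < r) -> exists c, frechet_at f z c.
Proof.
move=> r0 bf hf zr; have [M hM] := bf; have r0' := ltW r0.
have D0 := @Dball0 R d r r0'; have un := enum_uniq 'I_d.
have M0 : 0 <= M by apply: le_trans (hM 0 D0); exact: nrm_ge0.
have [c [K [t [/andP[t0 t1] K0 hK]]]] := expands_kernels (enum 'I_d) r0 zr.
pose ker h xi : C := \prod_(i <- enum 'I_d) (1 - (z + h) ord0 i / xi ord0 i)^-1.
pose ker0 xi : C := \prod_(i <- enum 'I_d) (1 - z ord0 i / xi ord0 i)^-1.
exists (fun i => tmeanall r (fun xi => f xi * c xi i)) => e e0.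
pose m := Num.min t (Num.min ((e / (M * K + 1)) / d.+1%:R) (\big[Num.min/1]_i (r - nrm (z ord0 i)))).
have MK : 0 < M * K + 1 by have := mulr_ge0 M0 K0; lra.
have m0 : 0 < m.
  rewrite !lt_min t0 !divr_gt0 ?ltr0n//=.
  by apply/bigmin_gtP; split=> // i _; rewrite subr_gt0.
exists m => // h hm.
have ht i : nrm (h ord0 i) < t by have := hm i; rewrite !lt_min => /andP[].
have hS i : nrm (h ord0 i) < (e / (M * K + 1)) / d.+1%:R.
  by have := hm i; rewrite !lt_min => /and3P[].
have hz i : nrm ((z + h) ord0 i) < r.
  rewrite mxE; apply: le_lt_trans (nrmD _ _) _; rewrite -ltrBrDl.
  have := hm i; rewrite !lt_min => /and3P[_ _ /lt_le_trans]; apply.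
  by apply/bigmin_leP; right; exists i.
have bF Phi : bndT r (enum 'I_d) 0 Phi -> bndT r (enum 'I_d) 0 (fun xi => f xi * Phi xi).
  by move=> bP; apply: bndT_M => //; exact: bndD_T.
have bc i : bndT r (enum 'I_d) 0 (fun xi => c xi i).
  by exists K => xi /on_torus_all hxi; have [] := hK xi h hxi ht.
have bk x : (forall i, nrm (x ord0 i) < r) ->
    bndT r (enum 'I_d) 0 (fun xi => \prod_(i <- enum 'I_d) (1 - x ord0 i / xi ord0 i)^-1).
  by move=> xr; apply: bndT_kernel => // i _; exact: xr.
have fE x : (forall i, nrm (x ord0 i) < r) -> f x = tmeanall r (fun xi => f xi *
   \prod_(i <- enum 'I_d) (1 - x ord0 i / xi ord0 i)^-1).
  move=> xr; rewrite hf//; apply: eq_tmean => // xi _.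
  by rewrite big_enum.
have -> : f (z + h) - f z - \sum_i h ord0 i * tmeanall r (fun xi => f xi * c xi i) =
    tmeanall r (fun xi => f xi * (ker h xi - ker0 xi - \sum_i h ord0 i * c xi i)).
  have -> : \sum_i h ord0 i * tmeanall r (fun xi => f xi * c xi i) =
      tmeanall r (fun xi => \sum_i h ord0 i * (f xi * c xi i)).
    rewrite /tmeanall tmean_sum//; last first.
      by move=> i; apply: bndT_M; [exists (nrm (h ord0 i))|exact: bF].
    by apply: eq_bigr => i _; rewrite tmeanZ//; exact: bF.
  have bs : bndT r (enum 'I_d) 0 (fun xi => \sum_i h ord0 i * (f xi * c xi i)).
    exists (\sum_(i : 'I_d) nrm (h ord0 i) * (M * K)) => xi hxi.
    apply: le_trans (nrm_sum _ _ _) _; apply: ler_sum => i _.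
    rewrite nrmM ler_wpM2l ?nrm_ge0// nrmM ler_pM ?nrm_ge0//.
      by apply: hM; case: hxi.
    by have [] := hK xi h (on_torus_all hxi) ht.
  have bkz := bF _ (bk _ zr); have bkh := bF _ (bk _ hz).
  rewrite fE// fE// /tmeanall -tmeanB// -tmeanB//; last exact: bndT_B.
  apply: eq_tmean => // xi _; rewrite /ker /ker0 !mulrBr mulr_sumr.
  by congr (_ - _); apply: eq_bigr => i _; ring.
rewrite -[tmeanall _ _]subr0.
have S0 := sum_nrm_ge0 h.
apply: (@le_trans _ _ (M * K * sum_nrm h ^+ 2)).
  apply: tmean_le => // xi hxi; rewrite subr0 nrmM -mulrA ler_pM ?nrm_ge0//.
    by apply: hM; case: hxi.
  by have [] := hK xi h (on_torus_all hxi) ht.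
rewrite expr2 mulrA ler_wpM2r//.
have SE : sum_nrm h <= e / (M * K + 1).
  apply: (@le_trans _ _ (d%:R * ((e / (M * K + 1)) / d.+1%:R))).
    by apply: mx_coord_le => //; rewrite !divr_gt0 ?ltr0n.
  rewrite mulrA ler_pdivrMr ?ltr0n// mulrC ler_wpM2l ?ler_nat//.
  by rewrite divr_ge0 ?(ltW e0) ?(ltW MK).
apply: (@le_trans _ _ ((M * K + 1) * sum_nrm h)); first by rewrite ler_wpM2r//; lra.
by move: SE; rewrite ler_pdivlMr// mulrC.
Qed.

(** The sum is a uniform limit of polynomials in each variable on the
    polydisc of radius [r], hence satisfies Cauchy's formula there. *)
Theorem series_holo (c : index -> C) f : unif_series c f -> frechet_on_polydisc f.
Proof.
move=> hf z /polydisc_radius[r r01 zr]; have [r0 r1] := andP r01.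
have bS N : bndD r (box_sum c N : V -> C) by exact: box_sum_bnd.
have hr e : 0 < e -> exists N, forall x, Dball r x -> nrm (f x - box_sum c N x) <= e.
  move=> e0; have r01' : 0 <= r < 1 by rewrite ltW.
  by have [N0 hN0] := hf r r01' e e0; exists N0; exact: hN0.
have bf : bndD r f.
  have [N hN] := hr 1 ltr01; have [K hK] := bS N; exists (1 + K) => x xr.
  rewrite -[f x](subrK (box_sum c N x)).
  by apply: le_trans (nrmD _ _) _; apply: lerD; [exact: hN|exact: hK].
apply: (@reproduces_frechet r) => //; apply: separately_cauchy_reproduces => //.
move=> x i xr; apply: upoly_cauchy => // e e0; have [N hN] := hr e e0.
exists (\sum_(alpha <- box d N) (c alpha * \prod_(j | j != i) x ord0 j ^+ alpha j) *: 'X^(alpha i)).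
move=> w wr; rewrite horner_sum.
have := hN _ (Dball_setc i xr wr); rewrite /box_sum.
under eq_bigr => alpha _.
  rewrite /mono (bigD1 i)//= setc_same mulrCA mulrC.
  under eq_bigr => j ji do rewrite setc_other//.
  over.
by under [in X in _ -> X]eq_bigr => alpha _ do rewrite hornerZ hornerXn.
Qed.

Lemma unif_series_cvg (c : index -> C) f z : unif_series c f -> polydisc z ->
  forall e : R, 0 < e -> exists N0, forall N, (N0 <= N)%N -> nrm (f z - box_sum c N z) <= e.
Proof.
move=> hf /polydisc_radius[r /andP[r0 r1] zr] e e0.
have r01 : 0 <= r < 1 by rewrite ltW.
have [N0 hN0] := hf r r01 e e0; exists N0 => N hN; apply: hN0 => // i.
exact: ltW.
Qed.

End differentiation_under_the_mean.

(** * Integration of complex-valued functions *)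

Section complex_integral.
Variables (d : measure_display) (T : measurableType d) (R : realType).
Local Notation C := (Cplx R).
Variable (mu : {measure set T -> \bar R}) (D : set T) (mD : measurable D).
Implicit Types (u v : T -> C).

Definition cmeas u := measurable_fun D (fun t => complex.Re (u t)) /\
  measurable_fun D (fun t => complex.Im (u t)).

Lemma eq_cmeas u v : (forall t, D t -> u t = v t) -> cmeas u -> cmeas v.
Proof.
move=> uv [h1 h2]; split.
  by apply: eq_measurable_fun h1 => t; rewrite inE => Dt; rewrite uv.
by apply: eq_measurable_fun h2 => t; rewrite inE => Dt; rewrite uv.
Qed.

Lemma cmeas_cst (c : C) : cmeas (fun=> c).
Proof. by split; exact: measurable_cst. Qed.

Lemma cmeasD u v : cmeas u -> cmeas v -> cmeas (fun t => u t + v t).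
Proof.
move=> [u1 u2] [v1 v2]; split.
  have := measurable_funD u1 v1; congr measurable_fun.
  by apply/funext => t /=; rewrite cReD.
have := measurable_funD u2 v2; congr measurable_fun.
by apply/funext => t /=; rewrite cImD.
Qed.

Lemma cmeasM u v : cmeas u -> cmeas v -> cmeas (fun t => u t * v t).
Proof.
move=> [u1 u2] [v1 v2]; split.
  have := measurable_funB (measurable_funM u1 v1) (measurable_funM u2 v2).
  by congr measurable_fun; apply/funext => t /=; rewrite cReM.
have := measurable_funD (measurable_funM u1 v2) (measurable_funM u2 v1).
by congr measurable_fun; apply/funext => t /=; rewrite cImM.
Qed.

Lemma cmeas_conj u : cmeas u -> cmeas (fun t => cconj (u t)).
Proof.
move=> [u1 u2]; split.
  by move: u1; congr measurable_fun; apply/funext => t; case: (u t).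
have := measurable_funN u2.
by congr measurable_fun; apply/funext => t /=; case: (u t).
Qed.

Lemma cmeas_sum (I : Type) (s : seq I) (F : I -> T -> C) : (forall i, cmeas (F i)) ->
  cmeas (fun t => \sum_(i <- s) F i t).
Proof.
move=> mF; elim: s => [|i s IH].
  by apply: eq_cmeas (cmeas_cst 0) => t _; rewrite big_nil.
by apply: eq_cmeas (cmeasD (mF i) IH) => t _; rewrite big_cons.
Qed.

Lemma cmeas_prod (I : Type) (s : seq I) (F : I -> T -> C) : (forall i, cmeas (F i)) ->
  cmeas (fun t => \prod_(i <- s) F i t).
Proof.
move=> mF; elim: s => [|i s IH].
  by apply: eq_cmeas (cmeas_cst 1) => t _; rewrite big_nil.
by apply: eq_cmeas (cmeasM (mF i) IH) => t _; rewrite big_cons.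
Qed.

Lemma cmeasX u n : cmeas u -> cmeas (fun t => u t ^+ n).
Proof.
move=> mu_; elim: n => [|n IH].
  by apply: eq_cmeas (cmeas_cst 1) => t _; rewrite expr0.
by apply: eq_cmeas (cmeasM mu_ IH) => t _; rewrite exprS.
Qed.

Lemma cmeas_nrm2 u : cmeas u -> measurable_fun D (fun t => nrm (u t) ^+ 2).
Proof.
move=> [u1 u2].
have := measurable_funD (measurable_funX 2 u1) (measurable_funX 2 u2).
by congr measurable_fun; apply/funext => t /=; rewrite nrm_sqr.
Qed.

Lemma cmeas_lim (w : nat -> T -> C) u : (forall n, cmeas (w n)) ->
  (forall t, D t -> forall e : R, 0 < e -> exists N, forall n, (N <= n)%N -> nrm (w n t - u t) <= e) ->
  cmeas u.
Proof.
move=> mw h; split.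
- apply: (@measurable_fun_cvg _ _ _ _ (fun n t => complex.Re (w n t))).
    by move=> n; case: (mw n).
  move=> t Dt; apply/cvgrPdist_le => e e0; have [N hN] := h t Dt e e0.
  exists N => // n /= Nn; rewrite distrC -cReN -cReD.
  by apply: le_trans (normRe_le _) _; exact: hN.
- apply: (@measurable_fun_cvg _ _ _ _ (fun n t => complex.Im (w n t))).
    by move=> n; case: (mw n).
  move=> t Dt; apply/cvgrPdist_le => e e0; have [N hN] := h t Dt e e0.
  exists N => // n /= Nn; rewrite distrC -cImN -cImD.
  by apply: le_trans (normIm_le _) _; exact: hN.
Qed.

Definition cintegrable u := mu.-integrable D (fun t => (complex.Re (u t))%:E) /\
  mu.-integrable D (fun t => (complex.Im (u t))%:E).

Definition cint u : C := Complex (\int[mu]_(t in D) complex.Re (u t))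
  (\int[mu]_(t in D) complex.Im (u t)).

Lemma eq_cint u v : (forall t, D t -> u t = v t) -> cint u = cint v.
Proof.
move=> uv; apply: cplx_eq => /=; apply: eq_Rintegral => t; rewrite inE => Dt;
  by rewrite uv.
Qed.

Lemma eq_cintegrable u v : (forall t, D t -> u t = v t) -> cintegrable u -> cintegrable v.
Proof.
move=> uv [h1 h2]; split.
  by apply: eq_integrable h1 => // t; rewrite inE => Dt; rewrite uv.
by apply: eq_integrable h2 => // t; rewrite inE => Dt; rewrite uv.
Qed.

Lemma cintegrable_cmeas u : cintegrable u -> cmeas u.
Proof.
by move=> [/measurable_int h1 /measurable_int h2]; split; apply/measurable_EFinP.
Qed.

Lemma cintegrable_le u (g : T -> R) : cmeas u -> mu.-integrable D (EFin \o g) ->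
  (forall t, D t -> nrm (u t) <= g t) -> cintegrable u.
Proof.
move=> [u1 u2] ig h; split.
- apply: (le_integrable mD _ _ ig); first exact/measurable_EFinP.
  move=> t Dt /=; rewrite lee_fin; apply: le_trans (normRe_le _) _.
  by apply: le_trans (h t Dt) _; exact: ler_norm.
- apply: (le_integrable mD _ _ ig); first exact/measurable_EFinP.
  move=> t Dt /=; rewrite lee_fin; apply: le_trans (normIm_le _) _.
  by apply: le_trans (h t Dt) _; exact: ler_norm.
Qed.

Lemma integrable_cst (K : R) : (mu D < +oo)%E -> mu.-integrable D (EFin \o (fun=> K)).
Proof.
move=> Dfin; apply: measurable_bounded_integrable => //.
by exists `|K|; split => // x Kx t _ /=; exact: ltW.
Qed.

Lemma cintegrable_bnd u (K : R) : (mu D < +oo)%E -> cmeas u ->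
  (forall t, D t -> nrm (u t) <= K) -> cintegrable u.
Proof.
move=> Dfin mu_ h; apply: (@cintegrable_le _ (fun=> K)) => //.
exact: integrable_cst.
Qed.

Lemma cintegrableD u v : cintegrable u -> cintegrable v -> cintegrable (fun t => u t + v t).
Proof.
move=> [u1 u2] [v1 v2]; split.
- by apply: eq_integrable (integrableD mD u1 v1) => // t _; rewrite cReD.
- by apply: eq_integrable (integrableD mD u2 v2) => // t _; rewrite cImD.
Qed.

Lemma cintegrableZ (c : C) u : cintegrable u -> cintegrable (fun t => c * u t).
Proof.
move=> [u1 u2]; split.
- apply: eq_integrable (integrableB mD (integrableZl mD (complex.Re c) u1)
    (integrableZl mD (complex.Im c) u2)) => // t _.
  by rewrite cReM /= EFinB !EFinM.
- apply: eq_integrable (integrableD mD (integrableZl mD (complex.Re c) u2)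
    (integrableZl mD (complex.Im c) u1)) => // t _.
  by rewrite cImM /= EFinD !EFinM.
Qed.

Lemma cintD u v : cintegrable u -> cintegrable v ->
  cint (fun t => u t + v t) = cint u + cint v.
Proof.
move=> [u1 u2] [v1 v2]; apply: cplx_eq; rewrite ?cReD ?cImD /= -RintegralD//;
  by apply: eq_Rintegral => t _; rewrite ?cReD ?cImD.
Qed.

Lemma cintZ (c : C) u : cintegrable u -> cint (fun t => c * u t) = c * cint u.
Proof.
move=> [u1 u2]; apply: cplx_eq; rewrite ?cReM ?cImM /=.
- rewrite -RintegralZl// -RintegralZl// -RintegralB//; last 2 first.
  + exact: (integrableZl mD (complex.Re c) u1).
  + exact: (integrableZl mD (complex.Im c) u2).
  by apply: eq_Rintegral => t _; rewrite cReM.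
- rewrite -RintegralZl// -RintegralZl// -RintegralD//; last 2 first.
  + exact: (integrableZl mD (complex.Re c) u2).
  + exact: (integrableZl mD (complex.Im c) u1).
  by apply: eq_Rintegral => t _; rewrite cImM.
Qed.

Lemma cint0 : cint (fun=> 0) = 0.
Proof. by apply: cplx_eq; rewrite /= Rintegral_cst// mul0r. Qed.

Lemma cintegrable0 : cintegrable (fun=> 0).
Proof. by split; exact: integrable0. Qed.

Lemma cintegrable_sum (I : Type) (s : seq I) (F : I -> T -> C) :
  (forall i, cintegrable (F i)) -> cintegrable (fun t => \sum_(i <- s) F i t).
Proof.
move=> iF; elim: s => [|i s IH].
  by apply: eq_cintegrable cintegrable0 => t _; rewrite big_nil.
by apply: eq_cintegrable (cintegrableD (iF i) IH) => t _; rewrite big_cons.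
Qed.

Lemma cint_sum (I : Type) (s : seq I) (F : I -> T -> C) :
  (forall i, cintegrable (F i)) ->
  cint (fun t => \sum_(i <- s) F i t) = \sum_(i <- s) cint (F i).
Proof.
move=> iF; elim: s => [|i s IH].
  by rewrite big_nil -[RHS]cint0; apply: eq_cint => t _; rewrite big_nil.
rewrite big_cons -IH -cintD//; last exact: cintegrable_sum.
by apply: eq_cint => t _; rewrite big_cons.
Qed.

Lemma cint_conj u : cintegrable u -> cint (fun t => cconj (u t)) = cconj (cint u).
Proof.
move=> [u1 u2]; apply: cplx_eq => /=; first by apply: eq_Rintegral => t _; case: (u t).
rewrite -mulN1r -RintegralZl//; apply: eq_Rintegral => t _.
by case: (u t) => a b /=; rewrite mulN1r.
Qed.

Lemma nrm_cint_le u (K : R) : (mu D < +oo)%E -> cmeas u ->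
  (forall t, D t -> nrm (u t) <= K) -> nrm (cint u) <= 2 * (K * fine (mu D)).
Proof.
move=> Dfin mu_ h; have [u1 u2] := cintegrable_bnd Dfin mu_ h.
have iK : mu.-integrable D (EFin \o (fun=> K)) by exact: integrable_cst.
apply: le_trans (nrm_le_ReIm _) _ => /=; rewrite mulr2n mulrDl mul1r.
rewrite -(Rintegral_cst mu mD K); apply: lerD; apply: le_trans (le_normr_Rintegral mD _) _ => //.
- apply: le_Rintegral => //; first by apply: integrable_norm.
  by move=> t Dt; apply: le_trans (normRe_le _) _; exact: h.
- apply: le_Rintegral => //; first by apply: integrable_norm.
  by move=> t Dt; apply: le_trans (normIm_le _) _; exact: h.
Qed.

End complex_integral.

(** * Lebesgue measure in the plane *)

Section lebesgue_affine.
Variable R : realType.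
Local Notation leb := (@lebesgue_measure R).

Lemma measurable_affine (a b : R) :
  measurable_fun [set: measurableTypeR R] (fun x : measurableTypeR R => a * x + b : measurableTypeR R).
Proof.
by apply: measurable_funD => //; exact: measurable_funM.
Qed.

(** Lebesgue measure is the only measure that gives intervals their length,
    and the image measure does so up to the factor [a]. *)
Lemma lebesgue_affine (a b : R) (A : set (measurableTypeR R)) : 0 < a -> measurable A ->
  leb A = (a%:E * leb ((fun x : measurableTypeR R => a * x + b)%R @^-1` A))%E.
Proof.
move=> a0 mA.
pose nu := mscale (NngNum (ltW a0))
  (measure_function_pushforward__canonical__measure_function_Measure leb (measurable_affine a b)).
apply: (@lebesgue_measure_unique R nu) => // X [[u v] _ <-] /=.
rewrite /nu /mscale /= /pushforward; set B := _ @^-1` _.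
have -> : B = `](u - b) / a, (v - b) / a]%classic.
  apply/seteqP; split => x; rewrite /B /= !in_itv /= ltr_pdivrMr// ler_pdivlMr// (mulrC x).
    by move=> /andP[h1 h2]; apply/andP; split; lra.
  by move=> /andP[h1 h2]; apply/andP; split; lra.
rewrite !lebesgue_measure_itv /= !lte_fin ltr_pM2r ?invr_gt0// ltrD2r.
case: ifP => _; last by rewrite mule0.
rewrite -!EFinD -EFinM; congr EFin; field; lra.
Qed.

End lebesgue_affine.

Section plane.
Variable R : realType.
Local Notation C := (Cplx R).
Local Notation leb := (@lebesgue_measure R).
Local Notation P := (measurableTypeR R * measurableTypeR R)%type.
Local Notation pm := (@plane_measure R).

Definition shearY (a b : R) (p : P) : P := (p.1, a * p.2 + b * p.1).
Definition shearX (a b : R) (p : P) : P := (a * p.1 + b * p.2, p.2).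

Lemma measurable_shearY a b : measurable_fun [set: P] (shearY a b).
Proof.
apply: measurable_fun_pair; first exact: measurable_fst.
by apply: measurable_funD; apply: measurable_funM.
Qed.

Lemma measurable_shearX a b : measurable_fun [set: P] (shearX a b).
Proof.
apply: measurable_fun_pair; last exact: measurable_snd.
by apply: measurable_funD; apply: measurable_funM.
Qed.

Lemma measurable_preimage (f : P -> P) A : measurable_fun [set: P] f -> measurable A ->
  measurable (f @^-1` A).
Proof. by move=> mf mA; rewrite -[X in measurable X]setTI; exact: mf. Qed.

(** On each vertical line the shear is an affine map of slope [a]. *)
Lemma plane_shearY a b A : 0 < a -> measurable A ->
  pm A = (a%:E * pm (shearY a b @^-1` A))%E.
Proof.
move=> a0 mA; have mB := measurable_preimage (measurable_shearY a b) mA.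
rewrite /plane_measure /product_measure1 -ge0_integralZl//; last 2 first.
- exact: measurable_fun_xsection.
- by rewrite lee_fin ltW.
apply: eq_integral => x _ /=.
rewrite (@lebesgue_affine R a (b * x) _ a0); last exact: measurable_xsection.
congr (_ * leb _)%E; apply/seteqP; split => y /=; rewrite /xsection /= !inE//.
Qed.

(** The other order of integration, which is the one adapted to [shearX]. *)
Lemma plane_measureE A : measurable A -> pm A = (leb \x^ leb)%E A.
Proof.
move=> mA; apply: product_measure_unique => // X Y mX mY.
exact: product_measure2E.
Qed.

Lemma plane_shearX a b A : 0 < a -> measurable A ->
  pm A = (a%:E * pm (shearX a b @^-1` A))%E.
Proof.
move=> a0 mA; have mB := measurable_preimage (measurable_shearX a b) mA.
rewrite !plane_measureE// /product_measure2 -ge0_integralZl//; last 2 first.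
- exact: measurable_fun_ysection.
- by rewrite lee_fin ltW.
apply: eq_integral => y _ /=.
rewrite (@lebesgue_affine R a (b * y) _ a0); last exact: measurable_ysection.
congr (_ * leb _)%E; apply/seteqP; split => x /=; rewrite /ysection /= !inE//.
Qed.

Definition rotate (c s : R) (p : P) : P := (c * p.1 - s * p.2, s * p.1 + c * p.2).

(** Shears preserve the plane measure by translation invariance in one variable
    and Fubini. A rotation is a composition of three of them, unless it is the
    rotation by [pi]: the slope [s / (1 + c)] is the tangent of half the angle. *)
Lemma rotate_shears (c s : R) : 1 + c != 0 -> c ^+ 2 + s ^+ 2 = 1 ->
  rotate c s = shearX 1 (- (s / (1 + c))) \o shearY 1 s \o shearX 1 (- (s / (1 + c))).
Proof.
move=> c1 cs; apply/funext => -[x y]; rewrite /rotate /shearX /shearY /=.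
have h : s / (1 + c) * s = 1 - c.
  apply: (mulIf c1); rewrite mulrAC divfK//.
  by rewrite (_ : s * s = 1 - c ^+ 2); [ring|rewrite -cs; ring].
have h2 : s / (1 + c) * (1 + c) = s by rewrite divfK.
set t := s / (1 + c) in h h2 *; congr pair.
  rewrite !mul1r (_ : _ + _ * (y + _) = x - (t * s) * x - t * (2 - t * s) * y); last by ring.
  by rewrite h -{1}h2; ring.
by rewrite !mul1r (_ : y + _ = s * x + (1 - t * s) * y); [rewrite h; ring|ring].
Qed.

Lemma measurable_rotate c s : measurable_fun [set: P] (rotate c s).
Proof.
apply: measurable_fun_pair.
  by apply: measurable_funB; apply: measurable_funM.
by apply: measurable_funD; apply: measurable_funM.
Qed.

Lemma plane_rotate (c s : R) A : 1 + c != 0 -> c ^+ 2 + s ^+ 2 = 1 -> measurable A ->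
  pm A = pm (rotate c s @^-1` A).
Proof.
move=> c1 cs mA; rewrite rotate_shears// !comp_preimage.
set t := - _; have m1 := measurable_preimage (measurable_shearX 1 t) mA.
have m2 := measurable_preimage (measurable_shearY 1 s) m1.
rewrite (plane_shearX t ltr01 mA) mul1e (plane_shearY s ltr01 m1) mul1e.
by rewrite (plane_shearX t ltr01 m2) mul1e.
Qed.

Definition dilate (r : R) (p : P) : P := (r * p.1, r * p.2).

Lemma measurable_dilate r : measurable_fun [set: P] (dilate r).
Proof.
by apply: measurable_fun_pair; apply: measurable_funM.
Qed.

Lemma plane_dilate (r : R) A : 0 < r -> measurable A ->
  pm A = ((r ^+ 2)%:E * pm (dilate r @^-1` A))%E.
Proof.
move=> r0 mA; have -> : dilate r = shearX r 0 \o shearY r 0.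
  by apply/funext => -[x y]; rewrite /dilate /shearX /shearY /= !mul0r !addr0.
rewrite comp_preimage; have m1 := measurable_preimage (measurable_shearX r 0) mA.
by rewrite (plane_shearX 0 r0 mA) (plane_shearY 0 r0 m1) muleA -EFinM expr2.
Qed.

Definition pt (p : P) : C := Complex p.1 p.2.

Lemma pt_rotate c s p : pt (rotate c s p) = Complex c s * pt p.
Proof. by apply: cplx_eq; rewrite ?cReM ?cImM /=; ring. Qed.

Lemma pt_dilate r p : pt (dilate r p) = ofR r * pt p.
Proof. by apply: cplx_eq; rewrite ?cReM ?cImM /=; ring. Qed.

Lemma cmeas_pt : cmeas [set: P] pt.
Proof. by split; [exact: measurable_fst|exact: measurable_snd]. Qed.

Lemma cmeasS (D : set P) (u : P -> C) : measurable D -> cmeas [set: P] u -> cmeas D u.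
Proof. by move=> mD [h1 h2]; split; exact: measurable_funTS. Qed.

Definition disc (r : R) : set P := [set p | nrm (pt p) < r].

Lemma measurable_disc r : measurable (disc r).
Proof.
have [r0|r0] := ltP 0 r; last first.
  rewrite (_ : disc r = set0) ?measurable0//.
  apply/seteqP; split => p //=; rewrite /disc /= ltNge => /negP; apply.
  by apply: le_trans r0 _; exact: (nrm_ge0 (pt p)).
have := cmeas_nrm2 cmeas_pt => /(_ measurableT `]-oo, r ^+ 2[%classic (measurable_itv _)).
rewrite setTI; congr measurable; apply/seteqP; split => p; rewrite /disc /= in_itv /=.
  by rewrite ltr_pXn2r// nnegrE ?nrm_ge0 ?ltW.
by move=> h; rewrite ltr_pXn2r// nnegrE ?nrm_ge0 ?ltW.
Qed.

Lemma leb_itv (a b : R) : a < b -> leb `]a, b[%classic = (b - a)%:E.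
Proof. by move=> ab; rewrite lebesgue_measure_itv /= lte_fin ab EFinB. Qed.

Lemma disc_fin r : (pm (disc r) < +oo)%E.
Proof.
pose I : set (measurableTypeR R) := `](- `|r|), `|r|[%classic.
have mI : measurable I by exact: measurable_itv.
apply: (@le_lt_trans _ _ (pm (I `*` I))).
  apply: le_measure; rewrite ?inE; [exact: measurable_disc|exact: measurableX|].
  move=> p /= pr; have r0 : 0 < r by exact: le_lt_trans (nrm_ge0 _) pr.
  have h1 := normRe_le (pt p); have h2 := normIm_le (pt p).
  rewrite /I /= !in_itv /= -!ltr_norml (gtr0_norm r0).
  by split; [apply: le_lt_trans h1 _|apply: le_lt_trans h2 _].
rewrite [X in (X < _)%E](_ : _ = (leb I * leb I)%E); last exact: product_measure1E.
rewrite /I; have [r0|r0] := ltP (- `|r|) `|r|; first by rewrite leb_itv// -EFinM ltry.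
by rewrite set_itv_ge ?measure0 ?mule0 ?ltry// bnd_simp -leNgt.
Qed.

Definition area (r : R) : R := fine (pm (disc r)).

Lemma areaE r : pm (disc r) = (area r)%:E.
Proof. by rewrite /area fineK// ge0_fin_numE// disc_fin. Qed.

Lemma area_gt0 : 0 < area 1.
Proof.
rewrite -lte_fin -areaE.
pose I : set (measurableTypeR R) := `]0, 2^-1[%classic.
have mI : measurable I by exact: measurable_itv.
apply: (@lt_le_trans _ _ (pm (I `*` I))).
  rewrite [X in (_ < X)%E](_ : _ = (leb I * leb I)%E); last exact: product_measure1E.
  by rewrite /I leb_itv ?invr_gt0// -EFinM lte_fin subr0 mulr_gt0 ?invr_gt0.
apply: le_measure; rewrite ?inE; [exact: measurableX|exact: measurable_disc|].
move=> [x y]; rewrite /I /= !in_itv /= => -[/andP[x0 x1] /andP[y0 y1]].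
apply: le_lt_trans (nrm_le_ReIm _) _ => /=; rewrite !gtr0_norm//; lra.
Qed.

(** ** Moments of the disc *)

Definition mono2 (a b : nat) (p : P) : C := pt p ^+ a * cconj (pt p) ^+ b.

Lemma cmeas_mono2 a b : cmeas [set: P] (mono2 a b).
Proof. by apply: cmeasM; apply: cmeasX; [|apply: cmeas_conj]; exact: cmeas_pt. Qed.

Lemma nrm_mono2 a b p : nrm (mono2 a b p) = nrm (pt p) ^+ (a + b).
Proof. by rewrite nrmM !nrmX nrm_conj exprD. Qed.

Lemma cintegrable_mono2 r a b : cintegrable pm (disc r) (mono2 a b).
Proof.
apply: (@cintegrable_bnd _ _ _ _ _ (measurable_disc r) _ (r ^+ (a + b))).
- exact: disc_fin.
- by apply: cmeasS; [exact: measurable_disc|exact: cmeas_mono2].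
- move=> p pr; rewrite nrm_mono2; apply: lerXn2r; rewrite ?nnegrE ?nrm_ge0//.
    by apply: ltW; apply: le_lt_trans pr; exact: nrm_ge0.
  exact: ltW.
Qed.

Definition moment r a b : C := cint pm (disc r) (mono2 a b).

Lemma cint_invariant (f : P -> P) D (u : P -> C) : measurable_fun [set: P] f ->
  (forall A, measurable A -> pm A = pm (f @^-1` A)) -> measurable D ->
  cmeas [set: P] u -> cintegrable pm (f @^-1` D) (u \o f) ->
  cint pm D u = cint pm (f @^-1` D) (u \o f).
Proof.
move=> mf hf mD [u1 u2] [i1 i2].
have E (v : P -> R) : measurable_fun [set: P] v ->
    pm.-integrable (f @^-1` D) (fun p => (v (f p))%:E) ->
    \int[pm]_(p in D) v p = \int[pm]_(p in f @^-1` D) v (f p).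
  move=> mv iv; rewrite /Rintegral; congr fine.
  rewrite (@eq_measure_integral _ _ _ _ (pushforward pm f)); last first.
    by move=> A mA _; first [exact: hf|exact/esym/hf].
  rewrite (@integral_pushforward _ _ _ _ _ _ mf pm D (EFin \o v))//.
  exact/measurable_EFinP.
by apply: cplx_eq => /=; exact: E.
Qed.

(** Rotation by [w] preserves the disc and multiplies [z ^ a * conj z ^ b] by
    [w ^ a * conj w ^ b]. *)
Lemma moment_rot r a b (w : C) : nrm w = 1 -> w != -1 ->
  moment r a b = w ^+ a * cconj w ^+ b * moment r a b.
Proof.
case: w => c s w1 wN1.
have cs : c ^+ 2 + s ^+ 2 = 1 by have := nrm_sqr (Complex c s : C); rewrite w1 expr1n.
have c1 : 1 + c != 0.
  apply: contraNneq wN1 => h; have cN : c = -1 by lra.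
  have : s ^+ 2 = 0 by move: cs; rewrite cN; lra.
  move=> /eqP; rewrite sqrf_eq0 => /eqP ->; rewrite cN.
  by apply/eqP; apply: cplx_eq; rewrite /= ?oppr0.
have D_ : rotate c s @^-1` disc r = disc r.
  by apply/seteqP; split => p; rewrite /disc /= pt_rotate nrmM w1 mul1r.
have E p : mono2 a b (rotate c s p) = (Complex c s : C) ^+ a * cconj (Complex c s) ^+ b * mono2 a b p.
  by rewrite /mono2 pt_rotate cconjM !exprMn; ring.
have mD := measurable_disc r.
rewrite {1}/moment (@cint_invariant (rotate c s)) ?D_//.
- rewrite -cintZ//; last exact: cintegrable_mono2.
  by apply: eq_cint => p _; rewrite /= E.
- exact: measurable_rotate.
- by move=> A mA; exact: plane_rotate.
- exact: cmeas_mono2.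
- apply: eq_cintegrable (cintegrableZ mD ((Complex c s : C) ^+ a * cconj (Complex c s) ^+ b) (cintegrable_mono2 r a b)) => //.
  by move=> p _; rewrite /= E.
Qed.

Lemma moment_orth r a b : a != b -> moment r a b = 0.
Proof.
move=> ab.
(* two more square roots of a dyadic root keep [w] away from [-1], where
   [moment_rot] does not apply *)
have key n : (0 < n)%N -> exists w : C, [/\ nrm w = 1, w != -1 & w ^+ n != 1].
  move=> n0; have [p hp] := droot_pow_neq1 R n0.
  exists (droot R p.+2); split.
  - exact: nrm_droot.
  - apply: contraNneq (droot_neq1 R p) => h.
    by rewrite -drootS h sqrrN expr1n.
  - have E : droot R p ^+ n = (droot R p.+2 ^+ n) ^+ 4.
      by rewrite -drootS -drootS -!exprM; congr (_ ^+ _); lia.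
    by apply: contraNneq hp => h; rewrite E h expr1n.
have conj1 (w : C) : nrm w = 1 -> w * cconj w = 1.
  by move=> w1; rewrite mul_conj w1 expr1n.
have fin (w : C) : w * moment r a b = moment r a b -> w != 1 -> moment r a b = 0.
  move=> h w1; apply/eqP; move/eqP: h; rewrite -subr_eq0 -[X in _ - X]mul1r -mulrBl.
  by rewrite mulf_eq0 subr_eq0 (negbTE w1).
have := ab; rewrite neq_ltn => /orP[lt|lt].
- have gt0 : (0 < b - a)%N by rewrite subn_gt0.
  have [w [w1 wN wn]] := key _ gt0.
  apply: (fin (cconj w ^+ (b - a))).
    rewrite [RHS](moment_rot r a b w1 wN) -(subnKC (ltnW lt)) exprD mulrA -exprMn conj1//.
    by rewrite expr1n mul1r addKn.
  apply: contraNneq wn => h; apply/eqP; rewrite -[w ^+ _]cconjK cconjX h cconj1//.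
- have gt0 : (0 < a - b)%N by rewrite subn_gt0.
  have [w [w1 wN wn]] := key _ gt0.
  apply: (fin (w ^+ (a - b))) => //.
  have E : w ^+ a * cconj w ^+ b = w ^+ (a - b).
    by rewrite -{1}(subnKC (ltnW lt)) exprD mulrAC -exprMn conj1// expr1n mul1r.
  by rewrite [RHS](moment_rot r a b w1 wN) E.
Qed.

Definition radial r n : R := \int[pm]_(p in disc r) nrm (pt p) ^+ n.*2.

Lemma moment_diag r n : moment r n n = ofR (radial r n).
Proof.
apply: cplx_eq => /=; first by apply: eq_Rintegral => p _; rewrite /mono2 -exprMn mul_conj -ofRX /= -exprM mul2n.
rewrite (@eq_Rintegral _ _ _ _ _ (fun=> 0)) ?Rintegral_cst ?mul0r//; first exact: measurable_disc.
by move=> p _; rewrite /mono2 -exprMn mul_conj -ofRX.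
Qed.

Lemma measurable_nrm2X n D : measurable D -> measurable_fun D (fun p => nrm (pt p) ^+ n.*2).
Proof.
move=> mD; have := measurable_funX n (cmeas_nrm2 (cmeasS mD cmeas_pt)).
by congr measurable_fun; apply/funext => p; rewrite -mul2n exprM.
Qed.

Lemma integrable_radial r n : pm.-integrable (disc r) (fun p => (nrm (pt p) ^+ n.*2)%:E).
Proof.
have [h _] := cintegrable_mono2 r n n.
apply: eq_integrable h; first exact: measurable_disc.
by move=> p _; rewrite /= /mono2 -exprMn mul_conj -ofRX /= -exprM mul2n.
Qed.

(** The dilation of ratio [r] multiplies the weight by [r ^ 2n] and the
    measure by [r ^ 2]. *)
Lemma radial_dilate r n : 0 < r -> radial r n = r ^+ n.+1.*2 * radial 1 n.
Proof.
move=> r0; have mD := measurable_disc r.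
have D_ : dilate r @^-1` disc r = disc 1.
  apply/seteqP; split => p; rewrite /disc /= pt_dilate nrmM nrm_ofR gtr0_norm//.
    by rewrite gtr_pMr.
  by move=> h; rewrite gtr_pMr.
pose nu := mscale (NngNum (sqr_ge0 r))
  (measure_function_pushforward__canonical__measure_function_Measure pm (measurable_dilate r)).
rewrite /radial /Rintegral (@eq_measure_integral _ _ _ _ nu); last first.
  by move=> A mA _; first [exact: plane_dilate|exact/esym/plane_dilate].
rewrite (_ : integral nu _ _ = (r ^+ 2)%:E *
    \int[pushforward pm (dilate r)]_(p in disc r) (nrm (pt p) ^+ n.*2)%:E)%E; last first.
  rewrite (ge0_integral_mscale _ mD (NngNum (sqr_ge0 r)))//.
    by apply/measurable_EFinP; exact: measurable_nrm2X.
  by move=> p _; rewrite lee_fin exprn_ge0 ?nrm_ge0.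
rewrite (@ge0_integral_pushforward _ _ _ _ _ _ (measurable_dilate r) pm)//; last 2 first.
- by apply/measurable_EFinP; exact: measurable_nrm2X.
- by move=> p _; rewrite lee_fin exprn_ge0 ?nrm_ge0.
rewrite D_ (_ : \int[pm]_(x in disc 1) _ = (r ^+ n.*2)%:E * \int[pm]_(p in disc 1) (nrm (pt p) ^+ n.*2)%:E)%E; last first.
  rewrite -ge0_integralZl//.
  - by apply: eq_integral => p _ /=; rewrite pt_dilate nrmM nrm_ofR gtr0_norm// exprMn.
  - exact: measurable_disc.
  - by apply/measurable_EFinP; apply: measurable_nrm2X; exact: measurable_disc.
  - by move=> p _; rewrite lee_fin exprn_ge0 ?nrm_ge0.
  - by rewrite lee_fin exprn_ge0// ltW.
rewrite muleA -EFinM -exprD doubleS.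
rewrite fineM//; apply: integrable_fin_num => //; first exact: measurable_disc.
exact: integrable_radial.
Qed.

Lemma radial0 r : radial r 0 = area r.
Proof.
rewrite /radial (@eq_Rintegral _ _ _ _ _ (fun=> 1)).
  by rewrite Rintegral_cst ?mul1r//; exact: measurable_disc.
by move=> p _; rewrite double0 expr0.
Qed.

Lemma radial_annulus r n : 0 < r < 1 ->
  radial 1 n - radial r n = \int[pm]_(p in disc 1 `\` disc r) nrm (pt p) ^+ n.*2.
Proof.
move=> /andP[r0 r1]; have [m1 m2] := (measurable_disc 1, measurable_disc r).
have E : disc 1 = disc r `|` (disc 1 `\` disc r).
  apply/seteqP; split => p; rewrite /disc /=.
    by move=> p1; have [pr|pr] := pselect (nrm (pt p) < r); [left|right].
  by move=> [pr|[]//]; exact: lt_trans pr r1.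
rewrite {1}/radial E Rintegral_setU -?E//.
- by rewrite addrC addKr.
- exact: measurableD.
- exact: integrable_radial.
- by apply/disj_setPS => p [pr []].
Qed.

Lemma area_ge0 r : 0 <= area r.
Proof. by apply: fine_ge0; exact: measure_ge0. Qed.

(** On the annulus between the radii [r] and [1] the weight [|z| ^ 2n] lies
    between [r ^ 2n] and [1], and the integral over the annulus is known from
    [radial_dilate]. *)
Lemma radial_squeeze r n : 0 < r < 1 ->
  r ^+ n.*2 * (1 - r ^+ 2) * area 1 <= (1 - r ^+ n.+1.*2) * radial 1 n <= (1 - r ^+ 2) * area 1.
Proof.
move=> rr; have /andP[r0 r1] := rr.
have mA : measurable (disc 1 `\` disc r) by apply: measurableD; exact: measurable_disc.
have iR k : pm.-integrable (disc 1 `\` disc r) (fun p => (nrm (pt p) ^+ k.*2)%:E).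
  apply: integrableS (integrable_radial 1 k) => //; first exact: measurable_disc.
have E0 : (1 - r ^+ 2) * area 1 = \int[pm]_(p in disc 1 `\` disc r) nrm (pt p) ^+ 0.*2.
  by rewrite -radial_annulus// (radial_dilate _ r0) !radial0 mulrBl mul1r.
have E : (1 - r ^+ n.+1.*2) * radial 1 n = \int[pm]_(p in disc 1 `\` disc r) nrm (pt p) ^+ n.*2.
  by rewrite -radial_annulus// (radial_dilate _ r0) mulrBl mul1r.
rewrite E -mulrA E0 -RintegralZl//; last exact: (iR 0%N).
apply/andP; split; apply: le_Rintegral => //; try exact: iR.
- have := integrableZl mA (r ^+ n.*2) (iR 0%N).
  by apply: eq_integrable.
- move=> p [p1 /negP]; rewrite -leNgt => rp; rewrite double0 expr0 mulr1.
  by apply: lerXn2r => //; rewrite nnegrE ?nrm_ge0 ?ltW.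
- move=> p [p1 _]; rewrite double0 expr0.
  by apply: exprn_ile1; [exact: nrm_ge0|exact: ltW].
Qed.

Lemma le0_of_le_small (u v : R) : (forall e, 0 < e < 1 -> u <= v * e) -> u <= 0.
Proof.
move=> h; rewrite leNgt; apply/negP => u0.
have w0 : 0 < `|v| + u + 1 by have := normr_ge0 v; lra.
have e0 : 0 < u / (`|v| + u + 1) < 1.
  by rewrite divr_gt0//= ltr_pdivrMr// mul1r; have := normr_ge0 v; lra.
have := h _ e0; rewrite mulrA ler_pdivlMr// leNgt => /negP; apply.
rewrite mulrC ltr_pM2l//; have := ler_norm v; lra.
Qed.

Lemma bernoulli (e : R) n : 0 <= e <= 1 -> 1 - n%:R * e <= (1 - e) ^+ n.
Proof.
move=> /andP[e0 e1]; elim: n => [|n IH]; first by rewrite mul0r subr0 expr0.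
rewrite exprS; apply: (@le_trans _ _ ((1 - e) * (1 - n%:R * e))).
  have : 0 <= n%:R * e * e by rewrite !mulr_ge0.
  rewrite -natr1; nra.
by rewrite ler_wpM2l// subr_ge0.
Qed.

(** Let [r] tend to 1 in [radial_squeeze], where
    [(1 - r ^ (2n + 2)) / (1 - r ^ 2)] tends to [n + 1]. *)
Lemma radial1 n : n.+1%:R * radial 1 n = area 1.
Proof.
have A0 := area_ge0 1.
have I0 : 0 <= radial 1 n.
  by apply: Rintegral_ge0 => // p _; rewrite exprn_ge0// nrm_ge0.
(* in the notation of [radial_squeeze], [r ^ 2 = 1 - e] *)
have key e : 0 < e < 1 -> (1 - n%:R * e) * area 1 <= n.+1%:R * radial 1 n /\
    n.+1%:R * (1 - n%:R * e) * radial 1 n <= area 1.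
  move=> /andP[e0 e1].
  have x0 : 0 < 1 - e by lra.
  have r0 : 0 < Num.sqrt (1 - e) by rewrite sqrtr_gt0.
  have r1 : Num.sqrt (1 - e) < 1 by rewrite -[X in _ < X]sqrtr1 ltr_sqrt//; lra.
  have r01 : 0 < Num.sqrt (1 - e) < 1 by rewrite r0 r1.
  have /andP[] := radial_squeeze n r01.
  rewrite -!mul2n !exprM sqr_sqrtr ?(ltW x0)//.
  have B : 1 - n%:R * e <= (1 - e) ^+ n by apply: bernoulli; lra.
  have S : 1 - (1 - e) ^+ n.+1 = e * \sum_(i < n.+1) (1 - e) ^+ i.
    by rewrite -opprB subrX1 -mulNr; congr (_ * _); ring.
  have S1 : \sum_(i < n.+1) (1 - e) ^+ i <= n.+1%:R.
    apply: (@le_trans _ _ (\sum_(i < n.+1) 1)); last by rewrite sumr_const card_ord.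
    by apply: ler_sum => i _; apply: exprn_ile1; lra.
  have S2 : n.+1%:R * (1 - e) ^+ n <= \sum_(i < n.+1) (1 - e) ^+ i.
    apply: (@le_trans _ _ (\sum_(i < n.+1) (1 - e) ^+ n)).
      by rewrite sumr_const card_ord mulr_natl.
    apply: ler_sum => i _; apply: ler_wiXn2l; [lra|lra|].
    by rewrite -ltnS.
  have ee : 1 - (1 - e) = e by ring.
  rewrite S ee => h1 h2; split.
    have : e * ((1 - n%:R * e) * area 1) <= e * (n.+1%:R * radial 1 n).
      apply: (@le_trans _ _ ((1 - e) ^+ n * e * area 1)).
        by rewrite -[leRHS]mulrA [leRHS]mulrCA ler_wpM2l ?(ltW e0)// ler_wpM2r.
      by apply: le_trans h1 _; rewrite -mulrA ler_wpM2l ?(ltW e0)// ler_wpM2r.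
    by rewrite ler_pM2l.
  have : e * (n.+1%:R * (1 - n%:R * e) * radial 1 n) <= e * area 1.
    apply: le_trans h2; rewrite -[leRHS]mulrA ler_wpM2l ?(ltW e0)// ler_wpM2r//.
    by apply: le_trans S2; rewrite ler_wpM2l.
  by rewrite ler_pM2l.
apply/eqP; rewrite eq_le; apply/andP; split; rewrite -subr_le0.
  apply: (@le0_of_le_small _ (n.+1%:R * n%:R * radial 1 n)) => e /key[_].
  nra.
apply: (@le0_of_le_small _ (n%:R * area 1)) => e /key[].
nra.
Qed.

Lemma moment_disc r a b : 0 < r ->
  moment r a b = ofR (area 1) * (ofR (r ^+ a.+1.*2 / a.+1%:R) * (a == b)%:R).
Proof.
move=> r0; case: eqVneq => [<-|ab]; last by rewrite moment_orth// !mulr0.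
rewrite moment_diag radial_dilate// -(radial1 a) mulr1 -ofRM; congr ofR.
by field.
Qed.

End plane.

(** * Integration on the polydisc *)

Section tensor.
Variable R : realType.
Local Notation C := (Cplx R).

Section two_factors.
Variables (d1 d2 : measure_display) (T1 : measurableType d1) (T2 : measurableType d2).
Variables (m1 : {sigma_finite_measure set T1 -> \bar R})
          (m2 : {sigma_finite_measure set T2 -> \bar R}).
Local Notation m12 := (m1 \x m2)%E.

Lemma integrable_real_tensor (f : T1 -> R) (g : T2 -> R) :
  m1.-integrable setT (EFin \o f) -> m2.-integrable setT (EFin \o g) ->
  m12.-integrable setT (EFin \o (fun p => f p.1 * g p.2)).
Proof.
move=> If Ig.
have mf : measurable_fun setT f by apply/measurable_EFinP; exact: measurable_int If.
have mg : measurable_fun setT g by apply/measurable_EFinP; exact: measurable_int Ig.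
have mfg : measurable_fun setT (EFin \o (fun p : T1 * T2 => f p.1 * g p.2)).
  apply/measurable_EFinP; apply: measurable_funM.
    exact: measurableT_comp measurable_fst.
  exact: measurableT_comp measurable_snd.
apply/integrable12ltyP => //=.
under eq_integral => x _.
  under eq_integral => y _ do rewrite normrM EFinM.
  rewrite ge0_integralZl//; last by apply/measurable_EFinP; exact: measurableT_comp.
  over.
have /integrableP[_ oof] := If; have /integrableP[_ oog] := Ig.
have mnf : measurable_fun setT (fun x => (`|f x|%R%:E : \bar R)).
  by apply/measurable_EFinP; exact: measurableT_comp.
rewrite ge0_integralZr//; last exact: integral_ge0.
by apply: lte_mul_pinfty => //; [exact: integral_ge0|rewrite ge0_fin_numE//; exact: integral_ge0].
Qed.

Lemma Rintegral_tensor (f : T1 -> R) (g : T2 -> R) :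
  m1.-integrable setT (EFin \o f) -> m2.-integrable setT (EFin \o g) ->
  \int[m12]_p (f p.1 * g p.2) = \int[m1]_x f x * \int[m2]_y g y.
Proof.
move=> If Ig; have Ifg := integrable_real_tensor If Ig.
rewrite /Rintegral -integral12_prod_meas1//.
have fing := integrable_fin_num measurableT Ig.
have finf := integrable_fin_num measurableT If.
have E x : fubini_F m2 (EFin \o (fun p => f p.1 * g p.2)) x = ((fine (\int[m2]_y (g y)%:E))%:E * (f x)%:E)%E.
  rewrite /fubini_F /=; under eq_integral => y _ do rewrite EFinM.
  by rewrite integralZl// fineK// muleC.
transitivity (fine (\int[m1]_x ((fine (\int[m2]_y (g y)%:E))%:E * (f x)%:E)%E)).
  by congr fine; apply: eq_integral => x _; exact: E.
by rewrite integralZl// fineM// mulrC.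
Qed.

Lemma cint_tensor2 (u : T1 -> C) (v : T2 -> C) :
  cintegrable m1 setT u -> cintegrable m2 setT v ->
  cintegrable m12 setT (fun p => u p.1 * v p.2) /\
  cint m12 setT (fun p => u p.1 * v p.2) = cint m1 setT u * cint m2 setT v.
Proof.
move=> [u1 u2] [v1 v2].
have I11 := integrable_real_tensor u1 v1; have I12 := integrable_real_tensor u1 v2.
have I21 := integrable_real_tensor u2 v1; have I22 := integrable_real_tensor u2 v2.
split; [split|].
- have := integrableB measurableT I11 I22; apply: eq_integrable => // p _.
  by rewrite cReM.
- have := integrableD measurableT I12 I21; apply: eq_integrable => // p _.
  by rewrite cImM.
apply: cplx_eq; rewrite ?cReM ?cImM /=.
  rewrite (@eq_Rintegral _ _ _ _ _ (fun p => complex.Re (u p.1) * complex.Re (v p.2) - complex.Im (u p.1) * complex.Im (v p.2))).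
    by rewrite (RintegralB measurableT I11 I22) (Rintegral_tensor u1 v1) (Rintegral_tensor u2 v2).
  by move=> p _; rewrite cReM.
rewrite (@eq_Rintegral _ _ _ _ _ (fun p => complex.Re (u p.1) * complex.Im (v p.2) + complex.Im (u p.1) * complex.Re (v p.2))).
  by rewrite (RintegralD measurableT I12 I21) (Rintegral_tensor u1 v2) (Rintegral_tensor u2 v1).
by move=> p _; rewrite cImM.
Qed.

End two_factors.

Section powers.
Variables (d : measure_display) (T : measurableType d).
Variable mu : {sigma_finite_measure set T -> \bar R}.

(** Fubini's theorem for functions of separated variables, by induction on
    the number of factors; the measure on tuples is the image of a product
    measure under [tuple_of_pair]. *)
Lemma cint_tensor n (u : 'I_n -> T -> C) : (forall i, cintegrable mu setT (u i)) ->
  cintegrable (power_measure mu n) setT (fun t => \prod_i u i (tnth t i)) /\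
  cint (power_measure mu n) setT (fun t => \prod_i u i (tnth t i)) = \prod_i cint mu setT (u i).
Proof.
elim: n u => [|n IH] u iu.
  have E : (fun t : 0.-tuple T => \prod_i u i (tnth t i)) = fun=> 1.
    by apply/funext => t; rewrite big_ord0.
  rewrite E big_ord0; split.
    apply: (@cintegrable_bnd _ _ _ _ _ measurableT _ 1) => /=.
    - by rewrite diracT ltry.
    - exact: cmeas_cst.
    - by move=> t _; rewrite nrm1.
  apply: cplx_eq; rewrite /= Rintegral_cst ?mul0r//.
  by rewrite mul1r /= indicT.
pose nu := power_measure mu n.
have [I1 I2] := IH _ (fun i => iu (lift ord0 i)).
have [J1 J2] := cint_tensor2 (iu ord0) I1.
pose phi := @tuple_of_pair _ T n.
have mphi : measurable_fun [set: _] phi := @measurable_tuple_of_pair _ T n.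
pose F (t : n.+1.-tuple T) := \prod_i u i (tnth t i).
have FE p : F (phi p) = u ord0 p.1 * \prod_i u (lift ord0 i) (tnth p.2 i).
  rewrite /F big_ord_recl tnth0; congr (_ * _); apply: eq_bigr => i _.
  by rewrite tnthS.
have cF : cmeas setT F.
  apply: cmeas_prod => i; have [h1 h2] := cintegrable_cmeas (iu i).
  by split; [exact: (measurableT_comp h1 (measurable_tnth i))
            |exact: (measurableT_comp h2 (measurable_tnth i))].
have [cF1 cF2] := cF.
have K : cintegrable (mu \x nu)%E setT (F \o phi).
  by apply: eq_cintegrable J1 => // p _; rewrite /= FE.
have [K1 K2] := K.
have push (v : n.+1.-tuple T -> R) : measurable_fun setT v ->
    (mu \x nu)%E.-integrable setT (EFin \o (v \o phi)) ->
    (power_measure mu n.+1).-integrable setT (EFin \o v) /\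
    \int[power_measure mu n.+1]_t v t = \int[(mu \x nu)%E]_p v (phi p).
  move=> mv iv; split.
    apply: (@integrable_pushforward _ _ _ _ _ _ mphi (mu \x nu)%E setT (EFin \o v)) => //.
    exact/measurable_EFinP.
  rewrite /Rintegral (@integral_pushforward _ _ _ _ _ _ mphi (mu \x nu)%E setT (EFin \o v))//.
  exact/measurable_EFinP.
have [P1 Q1] := push _ cF1 K1; have [P2 Q2] := push _ cF2 K2.
split; first by split.
rewrite big_ord_recl -I2 -J2; transitivity (cint (mu \x nu)%E setT (F \o phi)).
  by apply: cplx_eq.
by apply: eq_cint => p _; rewrite /= FE.
Qed.

End powers.
End tensor.

Section square_integrable.
Variables (d : measure_display) (T : measurableType d) (R : realType).
Local Notation C := (Cplx R).
Variables (mu : {measure set T -> \bar R}) (D : set T) (mD : measurable D).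
Implicit Types u v : T -> C.

Definition L2 u := cmeas D u /\ mu.-integrable D (fun t => (nrm (u t) ^+ 2)%:E).

Definition sqint u : R := \int[mu]_(t in D) nrm (u t) ^+ 2.

Lemma sqint_ge0 u : 0 <= sqint u.
Proof. by apply: Rintegral_ge0 => t _; rewrite sqr_ge0. Qed.

Lemma L2_cintegrable u v : L2 u -> L2 v -> cintegrable mu D (fun t => u t * cconj (v t)).
Proof.
move=> [mu_ iu] [mv iv].
apply: (@cintegrable_le _ _ _ _ _ mD _ (fun t => nrm (u t) ^+ 2 + nrm (v t) ^+ 2)).
- by apply: cmeasM => //; exact: cmeas_conj.
- have := integrableD mD iu iv; apply: eq_integrable => //.
- move=> t _; rewrite nrmM nrm_conj.
  have := sqr_ge0 (nrm (u t) - nrm (v t)); have := nrm_ge0 (u t); have := nrm_ge0 (v t).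
  nra.
Qed.

Lemma L2_le u v w (a b : R) : L2 u -> L2 v -> cmeas D w ->
  (forall t, D t -> nrm (w t) ^+ 2 <= a * nrm (u t) ^+ 2 + b * nrm (v t) ^+ 2) -> L2 w.
Proof.
move=> [mu_ iu] [mv iv] mw h; split => //.
apply: (le_integrable mD _ _ (integrableD mD (integrableZl mD a iu) (integrableZl mD b iv))).
  by apply/measurable_EFinP; exact: cmeas_nrm2.
move=> t Dt; rewrite lee_fin ger0_norm ?sqr_ge0//.
by apply: le_trans (h t Dt) _; exact: ler_norm.
Qed.

Lemma sqr_nrmD_le (x y : C) : nrm (x + y) ^+ 2 <= 2 * nrm x ^+ 2 + 2 * nrm y ^+ 2.
Proof.
have h := nrmD x y; have := sqr_ge0 (nrm x - nrm y); have := nrm_ge0 (x + y).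
have := nrm_ge0 x; have := nrm_ge0 y; nra.
Qed.

Lemma L2D u v : L2 u -> L2 v -> L2 (fun t => u t + v t).
Proof.
move=> Lu Lv; apply: (L2_le (a := 2) (b := 2) Lu Lv).
  by case: Lu => + _; case: Lv => + _ => ? ?; exact: cmeasD.
by move=> t _; exact: sqr_nrmD_le.
Qed.

Lemma L2Z (c : C) u : L2 u -> L2 (fun t => c * u t).
Proof.
move=> Lu; apply: (L2_le (a := nrm c ^+ 2) (b := 0) Lu Lu).
  by case: Lu => h _; apply: cmeasM => //; exact: cmeas_cst.
by move=> t _; rewrite nrmM exprMn mul0r addr0.
Qed.

Lemma L2_mul_bnd (w : T -> C) (K : R) u : cmeas D w -> (forall t, D t -> nrm (w t) <= K) ->
  L2 u -> L2 (fun t => w t * u t).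
Proof.
move=> mw wK Lu; apply: (L2_le (a := K ^+ 2) (b := 0) Lu Lu).
  by case: Lu => h _; exact: cmeasM.
move=> t Dt; rewrite nrmM exprMn mul0r addr0 ler_wpM2r ?sqr_ge0//.
by apply: lerXn2r; rewrite ?nnegrE ?nrm_ge0 ?wK//; apply: le_trans (wK t Dt); exact: nrm_ge0.
Qed.

Lemma eq_L2 u v : (forall t, D t -> u t = v t) -> L2 u -> L2 v.
Proof.
move=> uv [m i]; split; first exact: eq_cmeas m.
by apply: eq_integrable i => // t /set_mem Dt; rewrite uv.
Qed.

Lemma cint_self u : L2 u -> cint mu D (fun t => u t * cconj (u t)) = ofR (sqint u).
Proof.
move=> _; apply: cplx_eq => /=.
  by apply: eq_Rintegral => t _; rewrite mul_conj.
rewrite (@eq_Rintegral _ _ _ _ _ (fun=> 0)) ?Rintegral_cst ?mul0r//.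
by move=> t _; rewrite mul_conj.
Qed.

(** Fatou's lemma: square-integrability with a bound passes to pointwise limits.
    This is how sums of power series are shown to be
    square-integrable. *)
Lemma L2_lim (w : nat -> T -> C) u (K : R) : (forall n, L2 (w n)) ->
  (forall n, sqint (w n) <= K) ->
  (forall t, D t -> forall e : R, 0 < e ->
     exists N, forall n, (N <= n)%N -> nrm (w n t - u t) <= e) ->
  L2 u /\ sqint u <= K.
Proof.
move=> Lw wK lim.
have mu_ : cmeas D u by apply: cmeas_lim lim => n; case: (Lw n).
have mn2 : measurable_fun D (fun t => (nrm (u t) ^+ 2)%:E).
  by apply/measurable_EFinP; exact: cmeas_nrm2.
have F : (\int[mu]_(t in D) (nrm (u t) ^+ 2)%:E <= K%:E)%E.
  have mw n : measurable_fun D (fun t => (nrm (w n t) ^+ 2)%:E).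
    by apply/measurable_EFinP; apply: cmeas_nrm2; case: (Lw n).
  have w0 n t : D t -> (0 <= (nrm (w n t) ^+ 2)%:E)%E by rewrite lee_fin sqr_ge0.
  have := fatou mu mD mw w0.
  rewrite (@eq_integral _ _ _ _ _ (fun t => (nrm (u t) ^+ 2)%:E)); last first.
    move=> t /set_mem Dt.
    have cv : (fun n => (nrm (w n t) ^+ 2)%:E) @ \oo --> (nrm (u t) ^+ 2)%:E.
      apply: cvg_EFin; first by apply: nearW.
      have cn : nrm (w n t) @[n --> \oo] --> nrm (u t).
        apply/cvgrPdist_le => e e0; have [N hN] := lim t Dt e e0; exists N => // n /= Nn.
        have h1 := nrm_Bge (w n t) (u t); have h2 := nrm_Bge (u t) (w n t).
        rewrite -(opprB (w n t)) nrmN in h2; have h3 := hN n Nn.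
        by rewrite ler_norml; apply/andP; split; lra.
      exact: (cvgM cn cn).
    by rewrite is_cvg_limn_einfE; [apply/cvg_lim|apply/cvg_ex; eexists; exact: cv].
  move=> h; apply: le_trans h _; rewrite limn_einf_lim (cvg_lim _ (@cvg_einfs_sup _ _))//.
  apply: ge_ereal_sup => _ [n _ <-].
  apply: (@le_trans _ _ (\int[mu]_(t in D) (nrm (w n t) ^+ 2)%:E)%E).
    by apply: ereal_inf_lbound; exists n => /=.
  have [_ iw] := Lw n; rewrite -[X in (X <= _)%E]fineK; first by rewrite lee_fin; exact: wK.
  exact: integrable_fin_num.
split; [split => //|].
  apply/integrableP; split => //; apply: le_lt_trans (ltry K).
  by under eq_integral => t _ do rewrite gee0_abs ?lee_fin ?sqr_ge0//.
rewrite -lee_fin; apply: (le_trans _ F); rewrite /sqint /Rintegral fineK//.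
rewrite ge0_fin_numE; last by apply: integral_ge0 => t _; rewrite lee_fin sqr_ge0.
exact: le_lt_trans F (ltry _).
Qed.

End square_integrable.

Section polydisc_integration.
Variables (R : realType).
Local Notation C := (Cplx R).
Local Notation P := (measurableTypeR R * measurableTypeR R)%type.
Local Notation pm := (@plane_measure R).

Section cut.
Variables (dd : measure_display) (T : measurableType dd) (mu : {measure set T -> \bar R}).
Variables (D : set T) (mD : measurable D).

(** Extension by zero turns integrals over a set into integrals over the
    whole space, where the tensor formulas apply. *)
Definition cut (u : T -> C) : T -> C := patch (fun=> 0) D u.

Lemma cutT u t : D t -> cut u t = u t.
Proof. by move=> Dt; rewrite /cut /patch mem_set. Qed.

Lemma cutF u t : ~ D t -> cut u t = 0.
Proof. by move=> Dt; rewrite /cut /patch memNset. Qed.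

Lemma cut_restrict (h : C -> R) u : h 0 = 0 -> (fun t => h (cut u t)) = (fun t => h (u t)) \_ D.
Proof.
move=> h0; apply/funext => t; rewrite /cut /patch; case: ifP => _ //.
Qed.

Lemma cintegrable_cut u : cintegrable mu D u <-> cintegrable mu setT (cut u).
Proof.
have E (h : C -> R) : h 0 = 0 -> (mu.-integrable D (fun t => (h (u t))%:E) <->
    mu.-integrable setT (fun t => (h (cut u t))%:E)).
  move=> h0; rewrite (integrable_mkcond _ mD) restrict_EFin.
  by rewrite (_ : (fun t => (h (cut u t))%:E) = EFin \o (fun t => h (cut u t)))// cut_restrict.
by split; move=> [h1 h2]; split; apply/E.
Qed.

Lemma cint_cut u : cint mu D u = cint mu setT (cut u).
Proof.
by apply: cplx_eq; rewrite /= Rintegral_mkcond -cut_restrict.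
Qed.
End cut.

Variable d : nat.
Local Notation T := (d.-tuple P).
Local Notation vol := (volume R d).
Local Notation index := {ffun 'I_d -> nat}.

Definition pcr (r : R) : set T := [set t | forall i, disc r (tnth t i)].

Lemma measurable_pcr r : measurable (pcr r).
Proof.
have -> : pcr r = \bigcap_(i in [set: 'I_d]) ((fun t : T => tnth t i) @^-1` disc r).
  by apply/seteqP; split => t /= h i; [move=> _; exact: h|exact: h].
apply: fin_bigcap_measurable => // i _; rewrite -[X in measurable X]setTI.
by apply: (measurable_tnth i) => //; exact: measurable_disc.
Qed.

Lemma point_ofE (t : T) i : point_of t ord0 i = pt (tnth t i).
Proof. by rewrite mxE. Qed.

Lemma polydisc_coordsE : @polydisc_coords R d = pcr 1.
Proof.
by apply/seteqP; split => t h i; have := h i; rewrite point_ofE nrm_lt1.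
Qed.

Lemma cint_pcr r (u : 'I_d -> P -> C) : (forall i, cintegrable pm (disc r) (u i)) ->
  cintegrable vol (pcr r) (fun t => \prod_i u i (tnth t i)) /\
  cint vol (pcr r) (fun t => \prod_i u i (tnth t i)) = \prod_i cint pm (disc r) (u i).
Proof.
move=> iu; have mp := measurable_pcr r; have md := measurable_disc r.
have E : cut (pcr r) (fun t => \prod_i u i (tnth t i)) =
    fun t => \prod_i cut (disc r) (u i) (tnth t i).
  apply/funext => t; have [tr|tr] := pselect (pcr r t).
    by rewrite cutT//; apply: eq_bigr => i _; rewrite cutT.
  rewrite cutF//; have [i ti] : exists i, ~ disc r (tnth t i) by apply/existsNP.
  by rewrite (bigD1 i)//= cutF// mul0r.
have [h1 h2] := @cint_tensor _ _ _ (@plane_measure R) d (fun i => cut (disc r) (u i))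
  (fun i => (cintegrable_cut pm md (u i)).1 (iu i)).
split; first by apply/(cintegrable_cut _ mp); rewrite E.
rewrite cint_cut E; apply: etrans h2 _; apply: eq_bigr => i _.
exact/esym/cint_cut.
Qed.

Lemma vol_pcr r : vol (pcr r) = (area r ^+ d)%:E.
Proof.
have mp := measurable_pcr r; have md := measurable_disc r.
have i1 : cintegrable pm (disc r) (fun=> 1 : C).
  by apply: (@cintegrable_bnd _ _ _ _ _ md _ 1); [exact: disc_fin|exact: cmeas_cst|move=> t _; rewrite nrm1].
have [[h1 _] h2] := @cint_pcr r (fun _ _ => 1) (fun=> i1).
have fin : (vol (pcr r) < +oo)%E.
  move/integrableP : h1 => [_].
  rewrite (@eq_integral _ _ _ _ _ (fun=> 1%E)) ?integral_cst ?mul1e//.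
  by move=> t _; rewrite big1_eq /= normr1.
have := congr1 (@complex.Re R) h2.
rewrite (@eq_cint _ _ _ _ _ _ (fun=> 1)); last by move=> t _; rewrite big1_eq.
rewrite /= Rintegral_cst//= mul1r => h; rewrite -[LHS]fineK ?ge0_fin_numE// h; congr EFin.
have -> : cint pm (disc r) (fun=> 1) = ofR (area r).
  by apply: cplx_eq; rewrite /= Rintegral_cst// ?mul1r ?mul0r.
by rewrite prodr_const card_ord -ofRX.
Qed.

Definition tot : R := area (1 : R) ^+ d.

Lemma tot_gt0 : 0 < tot.
Proof. by rewrite exprn_gt0// area_gt0. Qed.

Lemma vol_pcr_fin r : (vol (pcr r) < +oo)%E.
Proof. by rewrite vol_pcr ltry. Qed.

(** The inner product over the polydisc of radius [r], still normalised by the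
    volume of the unit polydisc. *)
Definition ipr r (f g : 'rV[C]_d -> C) : C :=
  ofR tot^-1 * cint vol (pcr r) (fun t => f (point_of t) * cconj (g (point_of t))).

Lemma bergman_ipE f g : @bergman_ip R d f g = ipr 1 f g.
Proof.
rewrite /bergman_ip /mean /ipr polydisc_coordsE -/vol vol_pcr /=.
by apply: cplx_eq; rewrite ?cReM ?cImM /=; rewrite mul0r ?subr0 ?addr0.
Qed.

(** The squared norm of the monomial [z ^ alpha] in the Bergman space. *)
Definition wt (alpha : index) : R := \prod_i (alpha i).+1%:R^-1.

Lemma wt_gt0 alpha : 0 < wt alpha.
Proof. by apply: prodr_gt0 => i _; rewrite invr_gt0. Qed.

(** Monomials are orthogonal on polydiscs of every radius, a fact needed to
    bound the coefficients of functions known to be power series only inside. *)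
Lemma ipr_mono r alpha beta : 0 < r ->
  cintegrable vol (pcr r) (fun t => mono alpha (point_of t) * cconj (mono beta (point_of t))) /\
  ipr r (mono alpha) (mono beta) =
    ofR ((\prod_i r ^+ (alpha i).+1.*2) * wt alpha) * (alpha == beta)%:R.
Proof.
move=> r0; have [h1 h2] := @cint_pcr r (fun i => mono2 (alpha i) (beta i))
  (fun i => cintegrable_mono2 r (alpha i) (beta i)).
have E (t : T) : mono alpha (point_of t) * cconj (mono beta (point_of t)) =
    \prod_i mono2 (alpha i) (beta i) (tnth t i).
  rewrite /mono cconj_prod -big_split; apply: eq_bigr => i _.
  by rewrite /= point_ofE cconjX.
split; first by apply: eq_cintegrable h1 => //; exact: measurable_pcr.
rewrite /ipr; under eq_cint do rewrite E.
rewrite h2; under eq_bigr => i _ do rewrite -/(moment _ _ _) moment_disc//.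
rewrite big_split /= -ofR_prod prodr_const card_ord mulrA -ofRM mulVf ?gt_eqF ?tot_gt0// mul1r.
rewrite big_split /= -ofR_prod; congr (ofR _ * _).
  by rewrite big_split.
case: eqVneq => [->|ab]; first by rewrite big1// => i _; rewrite eqxx.
have [i ai] : exists i, alpha i != beta i.
  by apply/existsP; apply: contraNT ab => /existsPn h; apply/eqP/ffunP => i; apply/eqP; have := h i; rewrite negbK.
by rewrite (bigD1 i)//= (negbTE ai) mul0r.
Qed.

End polydisc_integration.

(** * Inner product spaces *)

Section prehilbert.
Variables (R : realType) (E : lmodType (Cplx R)) (H : set E) (ip : E -> E -> Cplx R).
Local Notation C := (Cplx R).
Implicit Types f g h : E.

Record prehilbert : Prop := Prehilbert {
  ph_0 : H 0;
  ph_lin : forall (a : C) f g, H f -> H g -> H (a *: f + g);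
  ph_ipl : forall (a : C) f g h, H f -> H g -> H h -> ip (a *: f + g) h = a * ip f h + ip g h;
  ph_conj : forall f g, H f -> H g -> ip g f = cconj (ip f g);
  ph_ge0 : forall f, H f -> exists2 x : R, 0 <= x & ip f f = ofR x;
  ph_def : forall f, H f -> ip f f = 0 -> f = 0 }.

Hypothesis ph : prehilbert.

Lemma phD f g : H f -> H g -> H (f + g).
Proof. by move=> hf hg; have := ph_lin ph 1 hf hg; rewrite scale1r. Qed.

Lemma phZ (a : C) f : H f -> H (a *: f).
Proof. by move=> hf; have := ph_lin ph a hf (ph_0 ph); rewrite addr0. Qed.

Lemma phB f g : H f -> H g -> H (f - g).
Proof. by move=> hf hg; rewrite -scaleN1r addrC; exact: ph_lin. Qed.

Lemma ph_sum (I : Type) (s : seq I) (F : I -> E) : (forall i, H (F i)) -> H (\sum_(i <- s) F i).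
Proof. by move=> h; elim/big_ind: _ => //; [exact: ph_0|exact: phD]. Qed.

Lemma ipDl f g h : H f -> H g -> H h -> ip (f + g) h = ip f h + ip g h.
Proof. by move=> hf hg hh; have := ph_ipl ph 1 hf hg hh; rewrite scale1r mul1r. Qed.

Lemma ip0l h : H h -> ip 0 h = 0.
Proof.
move=> hh; have := ipDl (ph_0 ph) (ph_0 ph) hh; rewrite addr0 => /eqP.
by rewrite -subr_eq0 opprD addrA subrr sub0r oppr_eq0 => /eqP.
Qed.

Lemma ipZl (a : C) f h : H f -> H h -> ip (a *: f) h = a * ip f h.
Proof. by move=> hf hh; have := ph_ipl ph a hf (ph_0 ph) hh; rewrite ip0l// !addr0. Qed.

Lemma ipBl f g h : H f -> H g -> H h -> ip (f - g) h = ip f h - ip g h.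
Proof.
move=> hf hg hh; rewrite -scaleN1r ipDl//; last exact: phZ.
by rewrite ipZl// mulN1r.
Qed.

Lemma ipDr f g h : H f -> H g -> H h -> ip h (f + g) = ip h f + ip h g.
Proof.
move=> hf hg hh; rewrite (ph_conj ph (phD hf hg) hh) ipDl// cconjD.
by rewrite -!(ph_conj ph).
Qed.

Lemma ipZr (a : C) f h : H f -> H h -> ip h (a *: f) = cconj a * ip h f.
Proof.
by move=> hf hh; rewrite (ph_conj ph (phZ a hf) hh) ipZl// cconjM -(ph_conj ph).
Qed.

Lemma ip0r h : H h -> ip h 0 = 0.
Proof. by move=> hh; rewrite (ph_conj ph (ph_0 ph) hh) ip0l// cconj0. Qed.

Lemma ip_suml (I : Type) (s : seq I) (F : I -> E) h : (forall i, H (F i)) -> H h ->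
  ip (\sum_(i <- s) F i) h = \sum_(i <- s) ip (F i) h.
Proof.
move=> hF hh; elim: s => [|i s IH]; first by rewrite !big_nil ip0l.
by rewrite !big_cons ipDl ?IH//; exact: ph_sum.
Qed.

Lemma ip_sumr (I : Type) (s : seq I) (F : I -> E) h : (forall i, H (F i)) -> H h ->
  ip h (\sum_(i <- s) F i) = \sum_(i <- s) ip h (F i).
Proof.
move=> hF hh; elim: s => [|i s IH]; first by rewrite !big_nil ip0r.
by rewrite !big_cons ipDr ?IH//; exact: ph_sum.
Qed.

Definition sq f : R := complex.Re (ip f f).

Lemma ip_self f : H f -> ip f f = ofR (sq f).
Proof. by move=> /(ph_ge0 ph)[x _ h]; rewrite /sq h. Qed.

Lemma sq_ge0 f : H f -> 0 <= sq f.
Proof. by move=> /(ph_ge0 ph)[x x0 h]; rewrite /sq h. Qed.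

Lemma sq0 f : H f -> sq f = 0 -> f = 0.
Proof. by move=> hf h; apply: (ph_def ph) => //; rewrite ip_self// h ofR0. Qed.

Lemma sqZ (a : C) f : H f -> sq (a *: f) = nrm a ^+ 2 * sq f.
Proof.
move=> hf; have hZ := phZ a hf.
suff : ofR (sq (a *: f)) = ofR (nrm a ^+ 2 * sq f) by case.
by rewrite -ip_self// ipZl// ipZr// mulrA mul_conj ip_self// ofRM.
Qed.

Lemma sqD f g : H f -> H g -> sq (f + g) = sq f + sq g + 2 * complex.Re (ip f g).
Proof.
move=> hf hg; have hD := phD hf hg.
rewrite /sq ipDl// !ipDr// (ph_conj ph hf hg) !cReD.
have -> : complex.Re (cconj (ip f g)) = complex.Re (ip f g) by case: (ip f g).
by ring.
Qed.

Lemma sqN f : H f -> sq (- f) = sq f.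
Proof. by move=> hf; rewrite -scaleN1r sqZ// nrmN nrm1 expr1n mul1r. Qed.

Lemma sqD_orth f g : H f -> H g -> ip f g = 0 -> sq (f + g) = sq f + sq g.
Proof. by move=> hf hg h; rewrite sqD// h /= mulr0 addr0. Qed.

Lemma sqB f g : H f -> H g -> sq (f - g) = sq f + sq g - 2 * complex.Re (ip f g).
Proof.
move=> hf hg; rewrite sqD//; last by rewrite -scaleN1r; exact: phZ.
rewrite sqN// -scaleN1r ipZr// cconjN cconj1 mulN1r cReN; ring.
Qed.

Lemma cauchy_schwarz f g : H f -> H g -> nrm (ip f g) ^+ 2 <= sq f * sq g.
Proof.
move=> hf hg; have sf := sq_ge0 hf; have sg := sq_ge0 hg.
have [g0|g0] := eqVneq (sq g) 0.
  by rewrite (sq0 hg g0) ip0r// nrm0 expr0n /= mulr_ge0// sq_ge0//; exact: ph_0.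
set a := ip f g; have hag := phZ a hg; have hf' := phZ (ofR (sq g)) hf.
have := sq_ge0 (phB hf' hag).
rewrite sqB// !sqZ// ipZl// ipZr// -/a (mulrC (cconj a)) mul_conj -ofRM /= nrm_ofR.
rewrite ger0_norm// => h.
have sg0 : 0 < sq g by rewrite lt_def g0.
have : 0 <= sq g * (sq f * sq g - nrm a ^+ 2) by nra.
by rewrite pmulr_rge0// subr_ge0.
Qed.

Lemma hnorm_lt f (e : R) : H f -> 0 < e -> (hnorm ip f < e) = (sq f < e ^+ 2).
Proof.
move=> hf e0; rewrite /hnorm -/(sq f) -[X in _ < X](ger0_norm (ltW e0)) -sqrtr_sqr.
by rewrite ltr_sqrt// exprn_gt0.
Qed.

Lemma hclosureP (A : set E) f : A `<=` H -> hclosure H ip A f <->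
  H f /\ forall e : R, 0 < e -> exists2 g, A g & sq (f - g) <= e.
Proof.
move=> AH; split => -[hf h]; split => // e e0.
  have e0' : 0 < Num.sqrt e by rewrite sqrtr_gt0.
  have [g Ag gf] := h _ e0'; exists g => //.
  have hg := phB hf (AH _ Ag).
  by apply: ltW; move: gf; rewrite hnorm_lt// sqr_sqrtr ?ltW.
have e0' : 0 < e ^+ 2 / 2 by rewrite divr_gt0// exprn_gt0.
have [g Ag gf] := h _ e0'; exists g => //.
have hg := phB hf (AH _ Ag); rewrite hnorm_lt//; apply: le_lt_trans gf _.
by have := exprn_gt0 2 e0; lra.
Qed.

Lemma nrm_ip_le f g (a b : R) : H f -> H g -> sq f <= a ^+ 2 -> sq g <= b ^+ 2 -> 0 <= a -> 0 <= b ->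
  nrm (ip f g) <= a * b.
Proof.
move=> hf hg fa gb a0 b0; have := cauchy_schwarz hf hg.
have h : sq f * sq g <= (a * b) ^+ 2.
  by rewrite exprMn; apply: ler_pM => //; exact: sq_ge0.
move=> /le_trans/(_ h); rewrite ler_pXn2r// nnegrE ?nrm_ge0//.
exact: mulr_ge0.
Qed.

End prehilbert.

(** * Weighted shifts on an abstract Hilbert space *)

Section shifts.
Variables (R : realType) (d : nat) (V : lmodType (Cplx R)) (H : set V) (ip : V -> V -> Cplx R).
Local Notation C := (Cplx R).
Local Notation index := {ffun 'I_d -> nat}.
Local Notation w := (@wt R d).
Local Notation sq := (sq ip).
Implicit Types (f g h psi phi : V) (alpha beta : index).
Hypothesis ph : prehilbert H ip.

Variable e : index -> V.
Hypothesis eH : forall alpha, H (e alpha).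
Hypothesis e_orth : forall alpha beta, ip (e alpha) (e beta) = ofR (w alpha) * (alpha == beta)%:R.

(** Fourier coefficients for the unnormalised family [e], of squared norms
    [w]. *)
Definition fc f alpha : C := ofR (w alpha)^-1 * ip f (e alpha).

Hypothesis e_dense : forall f, H f -> forall eps : R, 0 < eps -> exists N0,
  forall N, (N0 <= N)%N -> sq (f - \sum_(alpha <- box d N) fc f alpha *: e alpha) <= eps.
Hypothesis e_complete : forall (c : index -> C) (K : R),
  (forall N, \sum_(alpha <- box d N) nrm (c alpha) ^+ 2 * w alpha <= K) ->
  exists2 f, H f & forall alpha, fc f alpha = c alpha.

Lemma ip_e f alpha : ip f (e alpha) = ofR (w alpha) * fc f alpha.
Proof. by rewrite /fc mulrA -ofRM divff ?ofR1 ?mul1r// gt_eqF ?wt_gt0. Qed.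

Let p (c : index -> C) (s : seq index) := \sum_(alpha <- s) c alpha *: e alpha.

Let pH c s : H (p c s).
Proof. by apply: (ph_sum ph) => alpha; apply: (phZ ph). Qed.

Lemma fc_p c s alpha : uniq s -> fc (p c s) alpha = if alpha \in s then c alpha else 0.
Proof.
move=> us; rewrite /fc /p (ip_suml ph)//; last by move=> beta; exact: (phZ ph).
case: ifPn => [as_|as_].
  rewrite (bigD1_seq alpha)//= big1 => [|beta ba].
    rewrite addr0 (ipZl ph)// e_orth eqxx mulr1 mulrCA -ofRM mulVf ?ofR1 ?mulr1//.
    by rewrite gt_eqF// wt_gt0.
  by rewrite (ipZl ph)// e_orth (negbTE ba) !mulr0.
rewrite big_seq big1 ?mulr0// => beta bs.
by rewrite (ipZl ph)// e_orth; case: eqVneq as_ => [<-|_ _]; rewrite ?bs// !mulr0.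
Qed.

Lemma sq_p c s : uniq s -> sq (p c s) = \sum_(alpha <- s) nrm (c alpha) ^+ 2 * w alpha.
Proof.
move=> us; suff : ofR (sq (p c s)) = ofR (\sum_(alpha <- s) nrm (c alpha) ^+ 2 * w alpha) by case.
rewrite -(ip_self ph)// {2}/p (ip_sumr ph)//; last by move=> beta; exact: (phZ ph).
rewrite ofR_sum big_seq [RHS]big_seq; apply: eq_bigr => alpha as_.
rewrite (ipZr ph)// ip_e fc_p// as_ ofRM -mul_conj; ring.
Qed.

Lemma ip_p_tail f s : H f -> uniq s -> ip (p (fc f) s) (f - p (fc f) s) = 0.
Proof.
move=> hf us; have hB := phB ph hf (pH (fc f) s).
rewrite /p (ip_suml ph)//; last by move=> beta; exact: (phZ ph).
rewrite big_seq big1// => alpha as_; rewrite (ipZl ph)//.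
rewrite (ph_conj ph hB (eH alpha)) (ipBl ph)// !ip_e fc_p// as_ subrr.
by rewrite cconj0 mulr0.
Qed.

Lemma sq_tail f s : H f -> uniq s ->
  sq f = \sum_(alpha <- s) nrm (fc f alpha) ^+ 2 * w alpha + sq (f - p (fc f) s).
Proof.
move=> hf us; rewrite -sq_p// -(sqD_orth ph)//; first by rewrite subrKC.
  exact: (phB ph).
exact: ip_p_tail.
Qed.

Lemma bessel f s : H f -> uniq s -> \sum_(alpha <- s) nrm (fc f alpha) ^+ 2 * w alpha <= sq f.
Proof.
by move=> hf us; rewrite (sq_tail hf us) lerDl; apply: (sq_ge0 ph); exact: (phB ph).
Qed.

Lemma sq_le_coef f K : H f ->
  (forall N, \sum_(alpha <- box d N) nrm (fc f alpha) ^+ 2 * w alpha <= K) -> sq f <= K.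
Proof.
move=> hf h; apply/ler_addgt0Pr => eps eps0; have [N0 hN] := e_dense hf eps0.
by rewrite (sq_tail hf (box_uniq d N0)); apply: lerD => //; exact: hN.
Qed.

Lemma fc0_eq0 f : H f -> (forall alpha, fc f alpha = 0) -> f = 0.
Proof.
move=> hf h; apply: (sq0 ph) => //; apply/eqP; rewrite eq_le (sq_ge0 ph)// andbT.
by apply: sq_le_coef => // N; rewrite big1// => alpha _; rewrite h nrm0 expr0n mul0r.
Qed.

Lemma ip_e_eq f g : H f -> H g -> (forall alpha, ip f (e alpha) = ip g (e alpha)) -> f = g.
Proof.
move=> hf hg h; apply/eqP; rewrite -subr_eq0; apply/eqP; apply: fc0_eq0; first exact: (phB ph).
by move=> alpha; rewrite /fc (ipBl ph)// h subrr mulr0.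
Qed.

Lemma fcB f g alpha : H f -> H g -> fc (f - g) alpha = fc f alpha - fc g alpha.
Proof. by move=> hf hg; rewrite /fc (ipBl ph)// mulrBr. Qed.

(** Density of the span of the [e alpha], as an induction principle. *)
Lemma dense_ind (M : set V) : (forall (a : C) f g, M f -> M g -> M (a *: f + g)) -> M 0 ->
  M `<=` H -> (forall f, H f -> (forall eps : R, 0 < eps -> exists2 g, M g & sq (f - g) <= eps) -> M f) ->
  (forall alpha, M (e alpha)) -> H `<=` M.
Proof.
move=> Mlin M0 MH Mcl Me f hf; apply: Mcl => // eps eps0.
have [N0 hN] := e_dense hf eps0; exists (p (fc f) (box d N0)); last exact: hN.
rewrite /p; elim: (box d N0) => [|alpha s IH]; first by rewrite big_nil.
by rewrite big_cons; exact: Mlin.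
Qed.

Definition linear_contraction (A : V -> V) := [/\ forall f, H f -> H (A f),
  forall (a : C) f g, H f -> H g -> A (a *: f + g) = a *: A f + A g &
  forall f, H f -> sq (A f) <= sq f].

Section contractions.
Variables (A : V -> V) (hA : linear_contraction A).

Lemma contr_H f : H f -> H (A f). Proof. by case: hA => h _ _; exact: h. Qed.

Lemma contr_lin (a : C) f g : H f -> H g -> A (a *: f + g) = a *: A f + A g.
Proof. by case: hA => _ h _; exact: h. Qed.

Lemma contr_sq f : H f -> sq (A f) <= sq f.
Proof. by case: hA => _ _; exact. Qed.

Lemma contr0 : A 0 = 0.
Proof.
have := contr_lin 1 (ph_0 ph) (ph_0 ph); rewrite !scale1r addr0 => /eqP.
by rewrite -subr_eq0 opprD addrA subrr sub0r oppr_eq0 => /eqP.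
Qed.

Lemma contrZ (a : C) f : H f -> A (a *: f) = a *: A f.
Proof. by move=> hf; have := contr_lin a hf (ph_0 ph); rewrite contr0 !addr0. Qed.

Lemma contrB f g : H f -> H g -> A (f - g) = A f - A g.
Proof.
move=> hf hg; have := contr_lin (-1) hg hf; rewrite !scaleN1r.
by rewrite addrC => ->; rewrite addrC.
Qed.

Lemma contr_sum c s : A (p c s) = \sum_(alpha <- s) c alpha *: A (e alpha).
Proof.
rewrite /p; elim: s => [|alpha s IH]; first by rewrite !big_nil contr0.
by rewrite !big_cons contr_lin// ?IH//; exact: pH.
Qed.

(** Adjoint relations for bounded operators need only be checked on the family
    [e], by density. *)
Lemma contr_adj_eq psi phi : H psi -> H phi ->
  (forall alpha, ip (A (e alpha)) psi = ip (e alpha) phi) ->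
  forall f, H f -> ip (A f) psi = ip f phi.
Proof.
move=> hpsi hphi h; suff S : H `<=` [set f | H f /\ ip (A f) psi = ip f phi] by move=> f /S[].
apply: dense_ind => /=.
- move=> a f g [hf ef] [hg eg]; split; first exact: (ph_lin ph).
  by rewrite contr_lin// !(ph_ipl ph)// ?ef ?eg//; exact: contr_H.
- by split; [exact: (ph_0 ph)|rewrite contr0 !(ip0l ph)].
- by move=> f [].
- move=> f hf hc; split => //; apply/eqP; rewrite -subr_eq0; apply/eqP.
  apply: nrm_le0_eq0 => eps eps0.
  pose K := 1 + sq psi + sq phi.
  have K0 : 1 <= K by rewrite /K; have := sq_ge0 ph hpsi; have := sq_ge0 ph hphi; lra.
  have d0 : 0 < eps / 2 / K by rewrite !divr_gt0//; lra.
  have [g [hg eg] fg] := hc _ (exprn_gt0 2 d0).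
  have hB := phB ph hf hg.
  have -> : ip (A f) psi - ip f phi = ip (A (f - g)) psi - ip (f - g) phi.
    by rewrite contrB// !(ipBl ph)// ?eg; [ring|exact: contr_H..].
  have b psi' : H psi' -> sq psi' <= K - 1 -> forall f', H f' -> sq f' <= (eps / 2 / K) ^+ 2 -> nrm (ip f' psi') <= eps / 2.
    move=> hp pK f' hf' f'e; apply: (@le_trans _ _ (eps / 2 / K * K)).
      apply: (nrm_ip_le ph) => //; [|by lra|by lra].
      by apply: le_trans pK _; nra.
    by rewrite divfK//; lra.
  apply: le_trans (nrmD _ _) _; rewrite nrmN (splitr eps); apply: lerD; apply: b => //.
  + rewrite /K; have := sq_ge0 ph hphi; lra.
  + exact: contr_H.
  + exact: le_trans (contr_sq hB) fg.
  + rewrite /K; have := sq_ge0 ph hpsi; lra.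
- by move=> alpha; split.
Qed.

(** The adjoint of a contraction is built from its coefficients
    [c alpha = ip psi (A (e alpha)) / w alpha]: testing against the partial sum
    [q] gives [sq q <= sq psi] by the Cauchy-Schwarz inequality, and
    completeness applies. *)
Lemma contr_adjoint psi : H psi ->
  exists2 phi, H phi & forall f, H f -> ip (A f) psi = ip f phi.
Proof.
move=> hpsi; pose c alpha := ofR (w alpha)^-1 * ip psi (A (e alpha)).
have hAe alpha : H (A (e alpha)) by exact: contr_H.
have cE alpha : cconj (c alpha) * ofR (w alpha) = ip (A (e alpha)) psi.
  rewrite cconjM cconj_ofR -(ph_conj ph)// mulrC mulrA -ofRM divff ?ofR1 ?mul1r//.
  by rewrite gt_eqF ?wt_gt0.
have [|phi hphi phic] := @e_complete c (sq psi).
  move=> N; rewrite -sq_p ?box_uniq//; set q := p c (box d N).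
  have hq : H q by exact: pH.
  have E1 : ip (A q) psi = ofR (sq q).
    rewrite contr_sum (ip_suml ph)//; last by move=> beta; exact: (phZ ph).
    rewrite sq_p ?box_uniq// ofR_sum; apply: eq_bigr => alpha _.
    by rewrite (ipZl ph)// -cE mulrA mul_conj ofRM.
  have := cauchy_schwarz ph (contr_H hq) hpsi.
  rewrite E1 nrm_ofR ger0_norm ?(sq_ge0 ph)// => h1.
  have h2 := contr_sq hq; have h3 := sq_ge0 ph hpsi; have h4 := sq_ge0 ph hq.
  have [->//|q0] := eqVneq (sq q) 0.
  have q0' : 0 < sq q by rewrite lt_def q0.
  rewrite -(ler_pM2l q0') -expr2; apply: le_trans h1 _.
  by rewrite ler_wpM2r.
exists phi => //; apply: contr_adj_eq => // alpha.
rewrite (ph_conj ph hphi (eH alpha)) ip_e phic cconjM cconj_ofR mulrC cE//.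
Qed.

End contractions.

Section main.
Variables (G : V -> V) (T Z : 'I_d -> V -> V).
Hypothesis hG : linear_contraction G.
Hypothesis G_iso : forall f g, H f -> H g -> ip (G f) (G g) = ip f g.
Hypothesis hZ : forall i, linear_contraction (Z i).
Hypothesis TH : forall i f, H f -> H (T i f).
Hypothesis TG : forall i f, H f -> T i (G f) = G (Z i f).

Definition inc (i : 'I_d) alpha : index := [ffun j => if j == i then (alpha j).+1 else alpha j].
Definition dec (i : 'I_d) alpha : index := [ffun j => if j == i then (alpha j).-1 else alpha j].

Hypothesis Ze : forall i alpha, Z i (e alpha) = e (inc i alpha).
Hypothesis TGe : forall i alpha f, H f -> ip (T i f) (G (e alpha)) =
  ofR ((alpha i)%:R / (alpha i).+1%:R) * ip f (G (e (dec i alpha))).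

Local Notation M := (G @` H).

Lemma decK i alpha : (0 < alpha i)%N -> inc i (dec i alpha) = alpha.
Proof.
by move=> a0; apply/ffunP => j; rewrite !ffunE; case: eqP => [->|//]; rewrite prednK.
Qed.

Lemma incK i alpha : dec i (inc i alpha) = alpha.
Proof. by apply/ffunP => j; rewrite !ffunE; case: eqP. Qed.

Lemma G_H f : H f -> H (G f). Proof. exact: contr_H. Qed.

Lemma M_H : M `<=` H. Proof. by move=> _ [f hf <-]; exact: G_H. Qed.

Lemma Z_H i f : H f -> H (Z i f). Proof. exact: contr_H. Qed.

Lemma G_inj f g : H f -> H g -> G f = G g -> f = g.
Proof.
move=> hf hg h; apply: ip_e_eq => // alpha.
by rewrite -(G_iso hf (eH alpha)) h G_iso.
Qed.

Lemma Z_coef i f alpha : H f ->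
  ip (Z i f) (e alpha) = ofR ((alpha i)%:R / (alpha i).+1%:R) * ip f (e (dec i alpha)).
Proof.
move=> hf; rewrite -(G_iso (Z_H i hf) (eH alpha)) -TG// TGe//; last exact: G_H.
by rewrite G_iso.
Qed.

(** Here [ft] is the adjoint of [G] at [f], so that [G ft] is the orthogonal
    projection of [f] to the range of [G]. *)
Lemma G_adjoint f : H f -> exists2 ft, H ft & forall psi, H psi -> ip f (G psi) = ip ft psi.
Proof.
move=> hf; have [ft hft h] := contr_adjoint hG hf.
exists ft => // psi hpsi; have hGp := G_H hpsi.
by rewrite (ph_conj ph hGp hf) h// -(ph_conj ph).
Qed.

Lemma M_lin (a : C) f g : M f -> M g -> M (a *: f + g).
Proof.
move=> [f' hf' <-] [g' hg' <-]; exists (a *: f' + g'); first exact: (ph_lin ph).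
by rewrite contr_lin.
Qed.

(** The projection [G ft] is at least as close to [f] as any element of the
    range, by Pythagoras. *)
Lemma M_closed f : H f -> (forall eps : R, 0 < eps -> exists2 g, M g & sq (f - g) <= eps) -> M f.
Proof.
move=> hf h; have [ft hft fE] := G_adjoint hf; exists ft => //.
have hGft := G_H hft; have hB := phB ph hf hGft.
apply/esym/eqP; rewrite -subr_eq0; apply/eqP/(sq0 ph) => //.
apply/eqP; rewrite eq_le (sq_ge0 ph)// andbT; apply/ler_addgt0Pr => eps eps0; rewrite add0r.
have [_ [psi hpsi <-] le] := h _ eps0; apply: le_trans le.
have hB2 := phB ph hft hpsi; have hGB2 := G_H hB2.
have -> : f - G psi = (f - G ft) + G (ft - psi).
  by rewrite contrB// addrA subrK.
rewrite (sqD_orth ph)// ?lerDl ?(sq_ge0 ph)//.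
by rewrite (ipBl ph)// fE// G_iso// subrr.
Qed.

Lemma subspace_M : closed_subspace H ip M.
Proof.
split; first split.
- exact: M_H.
- by exists 0; [exact: (ph_0 ph)|exact: contr0].
- exact: M_lin.
move=> f /(hclosureP ph _ M_H)[hf h]; exact: M_closed.
Qed.

(** On the range of [G] the adjoint of [T i] is the transport of the adjoint of
    [Z i]. For [f] outside of the range this rests on [TGe], by
    which [G^* T i f] and [Z i G^* f] have the same coefficients. *)
Lemma T_adjoint i psi : H psi -> exists2 phi, H phi & adjoint_eq H ip (T i) (G psi) (G phi).
Proof.
move=> hpsi; have [phi hphi h] := contr_adjoint (hZ i) hpsi; exists phi => //.
split; [exact: G_H|exact: G_H|move=> f hf].
have [ft hft fE] := G_adjoint hf; have [Ft hFt FE] := G_adjoint (TH i hf).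
rewrite fE// FE// -h//; congr ip; apply: ip_e_eq => //; first exact: Z_H.
by move=> alpha; rewrite -FE// TGe// Z_coef// fE.
Qed.

Lemma joint_reducing_M : joint_reducing H ip T M.
Proof.
split; first exact: subspace_M.
- by move=> i _ [f hf <-]; rewrite TG//; exists (Z i f) => //; exact: Z_H.
- move=> i _ [f hf <-]; have [phi hphi h] := T_adjoint i hf.
  by exists (G phi) => //; exists phi.
Qed.

(** ** Minimality *)

Section minimal.
Variable N : set V.
Hypotheses (rN : joint_reducing H ip T N) (NM : N `<=` M).
(** Minimality is proved on the side of the [Z i], where coefficients are
    available: [N'] is invariant under the [Z i] and their adjoints. *)
Let N' : set V := [set psi | H psi /\ N (G psi)].

Let N'H psi : N' psi -> H psi. Proof. by case. Qed.

Let N'lin (a : C) f g : N' f -> N' g -> N' (a *: f + g).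
Proof.
move=> [hf Nf] [hg Ng]; split; first exact: (ph_lin ph).
by rewrite contr_lin//; case: rN => -[[_ _ h] _] _ _; exact: h.
Qed.

Let N'0 : N' 0.
Proof.
split; first exact: (ph_0 ph).
by rewrite contr0//; case: rN => -[[_ h _] _] _ _.
Qed.

Let N'Z a f : N' f -> N' (a *: f).
Proof. by move=> Nf; have := N'lin a Nf N'0; rewrite addr0. Qed.

Let N'B f g : N' f -> N' g -> N' (f - g).
Proof. by move=> Nf Ng; have := N'lin (-1) Ng Nf; rewrite scaleN1r addrC. Qed.

Let N'cl f : H f -> (forall eps : R, 0 < eps -> exists2 g, N' g & sq (f - g) <= eps) -> N' f.
Proof.
move=> hf h; split => //; case: rN => -[[NH _ _] cl] _ _; apply: cl.
apply/(hclosureP ph _ NH); split; first exact: G_H.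
move=> eps eps0; have [g [hg Ng] fg] := h _ eps0; exists (G g) => //.
have hB := phB ph hf hg; rewrite -contrB//; exact: le_trans (contr_sq hG hB) fg.
Qed.

Let N'Zi i f : N' f -> N' (Z i f).
Proof.
move=> [hf Nf]; split; first exact: Z_H.
by rewrite -TG//; case: rN => _ h _; exact: h.
Qed.

(** The adjoint of [Z i] moves the coefficient at [inc i alpha] to [alpha]. *)
Let shift_down i psi : N' psi -> exists2 phi, N' phi &
  forall alpha, ip phi (e alpha) = ip psi (e (inc i alpha)).
Proof.
move=> [hpsi Npsi]; case: rN => _ _ /(_ i _ Npsi)[h [hGp hh hadj] Nh].
have [phi hphi Eh] := NM Nh; exists phi; first by split; rewrite ?Eh.
move=> alpha; rewrite (ph_conj ph (eH alpha) hphi) -(G_iso (eH alpha) hphi) Eh.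
rewrite -hadj ?TG//; last exact: G_H.
rewrite Ze G_iso// -(ph_conj ph)//.
Qed.

(** The operator [2 (1 - Z_i^* Z_i)] is diagonal with entries
    [2 / (alpha_i + 2)], since [Z_i^* Z_i] has the entries
    [(alpha_i + 1) / (alpha_i + 2)]. The factor 2 makes the entry at
    [alpha_i = 0] equal to one, and all others are at most 2/3. *)
Let damp i psi : N' psi -> exists2 phi, N' phi &
  forall alpha, ip phi (e alpha) = ofR (2 / (alpha i).+2%:R) * ip psi (e alpha).
Proof.
move=> Np; have [phi Nphi E] := shift_down i (N'Zi i Np).
exists (2%:R *: (psi - phi)); first by apply: N'Z; exact: N'B.
move=> alpha; have hp := N'H Np; have hphi := N'H Nphi.
rewrite (ipZl ph)//; last exact: (phB ph).
rewrite (ipBl ph)// E Z_coef// incK ffunE eqxx.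
set x := ip psi _; set n := alpha i.
rewrite -(ofR_nat R 2) -[X in X - _]mul1r -ofR1 -mulrBl -ofRN -ofRD mulrA -ofRM.
congr (ofR _ * _); field.
by rewrite -!natr1; have : 0 <= n%:R :> R by []; lra.
Qed.

Let qfac alpha : R := \prod_i (2 / (alpha i).+2%:R).

Let damp_all psi : N' psi -> exists2 phi, N' phi &
  forall alpha, ip phi (e alpha) = ofR (qfac alpha) * ip psi (e alpha).
Proof.
move=> Np; rewrite /qfac.
suff [phi Nphi E] : exists2 phi, N' phi & forall alpha,
    ip phi (e alpha) = ofR (\prod_(i <- enum 'I_d) (2 / (alpha i).+2%:R)) * ip psi (e alpha).
  by exists phi => // alpha; rewrite E big_enum.
elim: (enum 'I_d) => [|i s [phi Nphi IH]].
  by exists psi => // alpha; rewrite big_nil ofR1 mul1r.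
have [phi' Nphi' E] := damp i Nphi; exists phi' => // alpha.
by rewrite E IH big_cons mulrA -ofRM.
Qed.

Let damp_iter k psi : N' psi -> exists2 phi, N' phi &
  forall alpha, ip phi (e alpha) = ofR (qfac alpha ^+ k) * ip psi (e alpha).
Proof.
move=> Np; elim: k => [|k [phi Nphi IH]].
  by exists psi => // alpha; rewrite expr0 ofR1 mul1r.
have [phi' Nphi' E] := damp_all Nphi; exists phi' => // alpha.
by rewrite E IH exprS mulrA -ofRM.
Qed.

Let i0 : index := [ffun=> 0%N].

Let qfac_bnd alpha : 0 <= qfac alpha <= if alpha == i0 then 1 else 2 / 3.
Proof.
have b (n : nat) : ((0 : R) <= 2 / n.+2%:R) && (2 / n.+2%:R <= (1 : R)).
  by apply/andP; split; [exact: divr_ge0|rewrite ler_pdivrMr// mul1r ler_nat].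
apply/andP; split; first by apply: prodr_ge0 => i _; case/andP: (b (alpha i)).
case: eqVneq => [->|a0].
  by rewrite /qfac big1// => i _; rewrite ffunE divff.
have [i ai] : exists i, (0 < alpha i)%N.
  apply/existsP; apply: contraNT a0 => /existsPn h; apply/eqP/ffunP => i.
  by have := h i; rewrite lt0n negbK ffunE => /eqP.
rewrite /qfac (bigD1 i)//= -[leRHS]mulr1; apply: ler_pM.
- by case/andP: (b (alpha i)).
- by apply: prodr_ge0 => j _; case/andP: (b (alpha j)).
- rewrite ler_pM2l// lef_pV2 ?posrE// ler_nat; lia.
- apply: (@le_trans _ _ (\prod_(j < d | j != i) 1)); last by rewrite big1_eq.
  by apply: ler_prod => j _; exact: b.
Qed.

(** A nonzero [N'] has an element with a nonzero constant term; damping it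
    leaves the constant term alone in the limit, so [N'] contains [e 0], and
    by the shifts all [e alpha]. *)
Lemma minimal_M : N = [set 0] \/ N = M.
Proof.
have [NT|Nn0] := pselect (forall psi, N' psi -> psi = 0).
  left; apply/seteqP; split => f.
    move=> Nf; have [psi hpsi Ef] := NM Nf; have p0 : psi = 0 by apply: NT; split; rewrite ?Ef.
    by rewrite /= -Ef p0 (contr0 hG).
  by move=> ->; case: rN => -[[_ h _] _].
right; apply/seteqP; split => //.
have [psi [beta [Np pb]]] : exists psi beta, N' psi /\ ip psi (e beta) != 0.
  apply: contrapT => h; apply: Nn0 => psi Np; apply: fc0_eq0; first exact: N'H.
  move=> alpha; rewrite /fc; have [->|h'] := eqVneq (ip psi (e alpha)) 0; first by rewrite mulr0.
  by exfalso; apply: h; exists psi, alpha.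
(* adjoint shifts move a nonzero coefficient down to the index zero *)
have {psi beta Np pb}[psi Np p0] : exists2 psi, N' psi & ip psi (e i0) != 0.
  have [n nb] := ubnP (\sum_i beta i); elim: n => // n IH in beta nb psi Np pb *.
  have [b0|b0] := eqVneq beta i0; first by exists psi => //; rewrite -b0.
  have [i bi] : exists i, (0 < beta i)%N.
    apply/existsP; apply: contraNT b0 => /existsPn h; apply/eqP/ffunP => i.
    by have := h i; rewrite lt0n negbK ffunE => /eqP.
  have [phi Nphi E] := shift_down i Np.
  apply: (IH (dec i beta) _ phi) => //; last by rewrite E decK.
  rewrite ltnS in nb; apply: leq_trans nb.
  rewrite (bigD1 i)//= [X in (_ < X)%N](bigD1 i)//= ffunE eqxx.
  rewrite (eq_bigr beta) => [|j ji]; last by rewrite ffunE (negbTE ji).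
  by rewrite ltn_add2r prednK.
have hp := N'H Np.
have Ne0 : N' (e i0).
  pose c := fc psi i0.
  have c0 : c != 0.
    by rewrite /c /fc mulf_neq0// ofR_eq0 invr_eq0 gt_eqF// wt_gt0.
  suff Nc : N' (c *: e i0).
    by have := N'Z c^-1 Nc; rewrite scalerA mulVf// scale1r.
  apply: N'cl; first exact: (phZ ph).
  move=> eps eps0; have sp := sq_ge0 ph hp.
  (* 4/9 is the square of the bound 2/3 on the damping factors *)
  have [k hk] : exists k, (4 / 9) ^+ k * (sq psi + 1) <= eps.
    have sp1 : 0 < sq psi + 1 by lra.
    have q1 : ((0 : R) <= 4 / 9) && ((4 / 9 : R) < 1) by rewrite divr_ge0//= ltr_pdivrMr// mul1r ltr_nat.
    have [k hk] := expr_small q1 (ltW sp1) eps0.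
    by exists k; rewrite mulrC hk.
  have [phi Nphi E] := damp_iter k Np; exists phi => //; have hphi := N'H Nphi.
  have hce := phZ ph c (eH i0).
  apply: (@le_trans _ _ ((4 / 9) ^+ k * (sq psi + 1))) => //.
  apply: sq_le_coef; first exact: (phB ph).
  move=> n; apply: (@le_trans _ _ ((4 / 9) ^+ k * \sum_(alpha <- box d n) nrm (fc psi alpha) ^+ 2 * w alpha)); last first.
    rewrite ler_wpM2l ?exprn_ge0//.
    by have := bessel hp (box_uniq d n); lra.
  rewrite mulr_sumr; apply: ler_sum => alpha _; rewrite mulrA ler_wpM2r ?(ltW (wt_gt0 _ _))//.
  rewrite fcB// [fc phi _]/fc E [fc (c *: _) _]/fc (ipZl ph)// e_orth.
  have := qfac_bnd alpha; case: eqVneq => [->|a0] /andP[q0 q1].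
    have -> : qfac i0 = 1 by rewrite /qfac big1// => i _; rewrite ffunE divff.
    rewrite expr1n ofR1 mul1r mulr1 -/(fc psi i0) -/c mulrCA -ofRM mulVf ?gt_eqF ?wt_gt0//.
    by rewrite ofR1 mulr1 subrr nrm0 expr0n /= mulr_ge0 ?exprn_ge0 ?divr_ge0 ?nrm_ge0.
  rewrite !mulr0 sub0r nrmN mulrCA -/(fc psi alpha) nrmM exprMn.
  rewrite ler_wpM2r ?sqr_ge0// nrm_ofR ger0_norm ?exprn_ge0// exprAC.
  have -> : 4 / 9 = (2 / 3) ^+ 2 :> R by field.
  by rewrite lerXn2r ?nnegrE ?sqr_ge0// lerXn2r ?nnegrE//; lra.
(* shifts move [e 0] up to every [e alpha] *)
have Ne alpha : N' (e alpha).
  have [n na] := ubnP (\sum_i alpha i); elim: n => // n IH in alpha na *.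
  have [->//|a0] := eqVneq alpha i0.
  have [i ai] : exists i, (0 < alpha i)%N.
    apply/existsP; apply: contraNT a0 => /existsPn h; apply/eqP/ffunP => i.
    by have := h i; rewrite lt0n negbK ffunE => /eqP.
  rewrite -(decK ai) -Ze; apply: N'Zi; apply: IH.
  rewrite ltnS in na; apply: leq_trans na.
  rewrite (bigD1 i)//= [X in (_ < X)%N](bigD1 i)//= ffunE eqxx.
  rewrite (eq_bigr alpha) => [|j ji]; last by rewrite ffunE (negbTE ji).
  by rewrite ltn_add2r prednK.
move=> _ [f hf <-]; have [] // : N' f.
exact: (dense_ind N'lin N'0 N'H N'cl Ne hf).
Qed.

End minimal.

Theorem minimal_reducing : minimal_joint_reducing H ip T M.
Proof. by split; [exact: joint_reducing_M|exact: minimal_M]. Qed.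

(** The inverse of [G] is the intertwining unitary. *)
Theorem restriction_equivalent : unitarily_equivalent M ip H ip T Z.
Proof.
pose U f := xget 0 [set psi | H psi /\ G psi = f].
have UP f : M f -> H (U f) /\ G (U f) = f.
  move=> [psi hpsi Ef]; rewrite /U.
  by case: xgetP => [g _ [] //|/(_ psi)]; case; split.
have UG psi : H psi -> U (G psi) = psi.
  move=> hpsi; have [h1 h2] : H (U (G psi)) /\ G (U (G psi)) = G psi by apply: UP; exists psi.
  exact: G_inj.
exists U; split.
- move=> a _ _ [f hf <-] [g hg <-]; rewrite -contr_lin// !UG//; exact: (ph_lin ph).
- apply/seteqP; split => [_ [f /UP[h _] <-]//|f hf]; exists (G f); last exact: UG.
  by exists f.
- by move=> _ _ [f hf <-] [g hg <-]; rewrite !UG// G_iso.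
- by move=> i _ [f hf <-]; rewrite TG// !UG//; exact: Z_H.
Qed.

(** An isometry maps the dense span of the [e alpha] to a dense subspace of
    its range. *)
Theorem span_M (gam : index -> V) (k : index -> C) : (forall alpha, k alpha != 0) ->
  (forall alpha, gam alpha = k alpha *: G (e alpha)) -> closed_span H ip gam = M.
Proof.
move=> k0 gE; have LM : lin_span gam `<=` M.
  move=> f [s [c ->]]; elim: s => [|alpha s IH].
    by rewrite big_nil; exists 0; [exact: (ph_0 ph)|exact: contr0].
  rewrite big_cons; apply: M_lin => //; rewrite gE; exists (k alpha *: e alpha).
    exact: (phZ ph).
  by rewrite contrZ.
have LH : lin_span gam `<=` H by move=> f /LM/M_H.
apply/seteqP; split => f.
  move=> /(hclosureP ph _ LH)[hf h]; apply: M_closed => // eps eps0.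
  by have [g /LM Mg fg] := h _ eps0; exists g.
move=> [psi hpsi <-]; apply/(hclosureP ph _ LH); split; first exact: G_H.
move=> eps eps0; have [N0 hN] := e_dense hpsi eps0.
pose q := p (fc psi) (box d N0); exists (G q).
  rewrite /q contr_sum//; exists (box d N0), (fun alpha => fc psi alpha / k alpha).
  by apply: eq_bigr => alpha _; rewrite gE scalerA divfK.
have hq : H q by exact: pH.
have hB := phB ph hpsi hq; rewrite -contrB//; apply: le_trans (contr_sq hG hB) _.
exact: hN.
Qed.

End main.
End shifts.

(** * The Bergman space *)

Section real_lemmas.
Variable R : realType.

Lemma bounded_mono_cauchy (a : nat -> R) K : {homo a : N M / (N <= M)%N >-> N <= M} ->
  (forall N, a N <= K) -> forall e : R, 0 < e ->
  exists N0, forall N M, (N0 <= N)%N -> (N <= M)%N -> a M - a N <= e.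
Proof.
move=> am aK e e0.
have ub : has_ubound (range a) by exists K => _ [n _ <-].
have cv : a @ \oo --> sup (range a) by apply: nondecreasing_cvgn.
have /cvgrPdist_le/(_ e e0)[N0 _ hN] := cv; exists N0 => N M hN0 NM.
have h1 : a M <= sup (range a) by apply: ub_le_sup => //; exists M.
by have := hN N hN0; rewrite ler_norml => /andP[_]; lra.
Qed.

End real_lemmas.

Section bergman_space.
Variables (R : realType) (d : nat).
Local Notation C := (Cplx R).
Local Notation Vd := 'rV[C]_d.
Local Notation index := {ffun 'I_d -> nat}.
Local Notation vol := (volume R d).
Local Notation T := (d.-tuple (measurableTypeR R * measurableTypeR R)).
Local Notation w := (@wt R d).
Local Notation A2 := (@bergman R d).
Local Notation ip := (@bergman_ip R d).
Local Notation L2r r := (L2 vol (pcr r)).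
Implicit Types (f g : Vd -> C) (c : index -> C) (s : seq index).

(** Integrals are taken over tuples of real coordinates. *)
Definition hat f (t : T) : C := f (point_of t).
Definition psum c s (z : Vd) : C := \sum_(alpha <- s) c alpha * mono alpha z.
(** The squared norm over the polydisc of radius [r], normalised as in [ipr];
    it is defined for every [f], so that it can be estimated before [f] is
    known to belong to the space. *)
Definition nsqr r f : R := (tot R d)^-1 * sqint vol (pcr r) (hat f).

Lemma pcr_Dball r t : pcr r t -> Dball r (point_of t : Vd).
Proof. by move=> h i; rewrite point_ofE; apply: ltW; exact: h. Qed.

Lemma pcr_polydisc t : pcr 1 t -> @polydisc R d (point_of t).
Proof. by rewrite -polydisc_coordsE. Qed.

Lemma cmeas_mono D alpha : measurable D -> cmeas D (hat (mono alpha)).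
Proof.
move=> mD; apply: cmeas_prod => i; apply: cmeasX.
have [h1 h2] := @cmeas_pt R.
have E : (fun t : T => point_of t ord0 i) = (fun t => pt (tnth t i)).
  by apply/funext => t; rewrite point_ofE.
rewrite E; split.
  by apply: measurable_funTS; exact: (measurableT_comp h1 (measurable_tnth i)).
by apply: measurable_funTS; exact: (measurableT_comp h2 (measurable_tnth i)).
Qed.

Lemma cmeas_psum D c s : measurable D -> cmeas D (hat (psum c s)).
Proof.
move=> mD; apply: cmeas_sum => alpha.
by apply: cmeasM; [exact: cmeas_cst|exact: cmeas_mono].
Qed.

(** Measurability is a consequence of the expansion in a power series, since
    partial sums are measurable. *)
Lemma cmeas_series c f : unif_series c f -> cmeas (pcr 1) (hat f).
Proof.
move=> hf; apply: (@cmeas_lim _ _ _ _ (fun N => hat (box_sum c N))) => [N|t tp].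
  by apply: cmeas_psum; exact: measurable_pcr.
move=> e e0; have [N0 hN] := unif_series_cvg hf (pcr_polydisc tp) e0.
by exists N0 => N NN; rewrite -nrmN opprB; exact: hN.
Qed.

Lemma bergmanP f : A2 f <-> [/\ forall z, ~ polydisc z -> f z = 0,
  frechet_on_polydisc f & L2r 1 (hat f)].
Proof.
rewrite /bergman /= polydisc_coordsE; split => -[h1 h2 h3]; split => //.
- by move=> z hz; exact/differentiable_frechet/h2.
- split => //; apply: cmeas_series; apply: holo_series => z hz.
  exact/differentiable_frechet/h2.
- by move=> z hz; have [cc] := h2 z hz; exact: frechet_differentiable.
- by case: h3.
Qed.

Lemma L2_psum r c s : 0 < r -> L2r r (hat (psum c s)).
Proof.
move=> r0; have mp := (@measurable_pcr R d r); split; first exact: cmeas_psum.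
pose K := \sum_(alpha <- s) nrm (c alpha) * \prod_i r ^+ alpha i.
suff [] : cintegrable vol (pcr r) (fun t => ofR (nrm (hat (psum c s) t) ^+ 2)) by [].
apply: (@cintegrable_bnd _ _ _ _ _ mp _ (K ^+ 2)); first exact: vol_pcr_fin.
  by split; [apply: cmeas_nrm2; exact: cmeas_psum|exact: measurable_cst].
move=> t tr; rewrite nrm_ofR ger0_norm ?sqr_ge0//.
have h : nrm (hat (psum c s) t) <= K.
  apply: le_trans (nrm_sum _ _ _) _; apply: ler_sum => alpha _.
  by rewrite nrmM ler_wpM2l ?nrm_ge0// mono_bnd//; exact: pcr_Dball.
by apply: lerXn2r => //; rewrite nnegrE ?nrm_ge0//; apply: le_trans h; exact: nrm_ge0.
Qed.

Lemma nsqr_ge0 r f : 0 <= nsqr r f.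
Proof. by rewrite mulr_ge0 ?sqint_ge0// invr_ge0 ltW// tot_gt0. Qed.

Lemma nsqr_ipr r f : L2r r (hat f) -> ipr r f f = ofR (nsqr r f).
Proof. by move=> Lf; rewrite /ipr (cint_self (@measurable_pcr R d r) Lf) -ofRM. Qed.

Lemma nsqr_psum r c s : 0 < r -> uniq s ->
  nsqr r (psum c s) = \sum_(alpha <- s) nrm (c alpha) ^+ 2 * w alpha * \prod_i r ^+ (alpha i).+1.*2.
Proof.
move=> r0 us; have mp := (@measurable_pcr R d r).
suff : ofR (nsqr r (psum c s)) =
  ofR (\sum_(alpha <- s) nrm (c alpha) ^+ 2 * w alpha * \prod_i r ^+ (alpha i).+1.*2) by case.
rewrite -nsqr_ipr; last exact: L2_psum.
rewrite /ipr.
pose F alpha beta (t : T) := c alpha * cconj (c beta) * (mono alpha (point_of t) * cconj (mono beta (point_of t))).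
have iF alpha beta : cintegrable vol (pcr r) (F alpha beta).
  by apply: cintegrableZ => //; have [] := @ipr_mono R d r alpha beta r0.
rewrite (@eq_cint _ _ _ _ _ _ (fun t => \sum_(alpha <- s) \sum_(beta <- s) F alpha beta t)); last first.
  move=> t _; rewrite /psum cconj_sum mulr_suml; apply: eq_bigr => alpha _.
  by rewrite mulr_sumr; apply: eq_bigr => beta _; rewrite cconjM /F; ring.
rewrite cint_sum//; last by move=> alpha; apply: cintegrable_sum.
rewrite mulr_sumr ofR_sum big_seq [RHS]big_seq; apply: eq_bigr => alpha as_.
rewrite cint_sum// mulr_sumr (bigD1_seq alpha)//= big1 ?addr0 => [|beta ba].
  rewrite /F cintZ//; last by have [] := @ipr_mono R d r alpha alpha r0.
  have [_] := @ipr_mono R d r alpha alpha r0; rewrite /ipr eqxx mulr1 mul_conj mulrCA => ->.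
  by rewrite -ofRM; congr ofR; ring.
rewrite /F cintZ//; last by have [] := @ipr_mono R d r alpha beta r0.
have [_] := @ipr_mono R d r alpha beta r0; rewrite /ipr eq_sym (negbTE ba) mulr0 mulrCA => ->.
by rewrite mulr0.
Qed.

Lemma box_diff (W : zmodType) (F : index -> W) N M : (N <= M)%N ->
  \sum_(alpha <- box d M) F alpha - \sum_(alpha <- box d N) F alpha =
  \sum_(alpha <- [seq alpha <- box d M | alpha \notin box d N]) F alpha.
Proof.
move=> NM; have p : perm_eq [seq alpha <- box d M | alpha \in box d N] (box d N).
  apply: uniq_perm; rewrite ?filter_uniq ?box_uniq// => alpha.
  by rewrite mem_filter; case: (boolP (alpha \in box d N)) => // /(box_sub NM).
have q : perm_eq ([seq alpha <- box d M | alpha \in box d N] ++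
    [seq alpha <- box d M | alpha \notin box d N]) (box d M).
  by rewrite (perm_filterC (mem (box d N))).
by rewrite -(perm_big _ q) big_cat /= (perm_big _ p) addrAC subrr add0r.
Qed.

Definition ell2 c N : R := \sum_(alpha <- box d N) nrm (c alpha) ^+ 2 * w alpha.

Lemma ell2_mono c : {homo ell2 c : N M / (N <= M)%N >-> N <= M}.
Proof.
move=> N M NM; rewrite -subr_ge0 /ell2 (box_diff _ NM); apply: sumr_ge0 => alpha _.
by rewrite mulr_ge0 ?sqr_ge0// ltW// wt_gt0.
Qed.

Lemma nsqr_box_diff c N M : (N <= M)%N ->
  nsqr 1 (fun z => box_sum c M z - box_sum c N z) = ell2 c M - ell2 c N.
Proof.
move=> NM; have -> : (fun z => box_sum c M z - box_sum c N z) =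
    psum c [seq alpha <- box d M | alpha \notin box d N].
  by apply/funext => z; rewrite /box_sum box_diff.
rewrite nsqr_psum ?ltr01 ?filter_uniq ?box_uniq// /ell2 (box_diff _ NM).
by apply: eq_bigr => alpha _; rewrite [X in _ * X]big1 ?mulr1// => i _; rewrite expr1n.
Qed.

Lemma eq_nsqr r f g : (forall t, pcr r t -> hat f t = hat g t) -> nsqr r f = nsqr r g.
Proof.
by move=> fg; congr (_ * _); apply: eq_Rintegral => t /set_mem tr; rewrite fg.
Qed.

(** The coefficients of a square-integrable holomorphic function are bounded by
    its norm: the series converges uniformly on the polydisc of radius [r < 1],
    where monomials are still orthogonal. *)
Lemma ell2_le_nsqr c f N : L2r 1 (hat f) -> unif_series c f -> ell2 c N <= nsqr 1 f.
Proof.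
move=> Lf hf; pose S r := \sum_(alpha <- box d N) nrm (c alpha) ^+ 2 * w alpha * \prod_i r ^+ (alpha i).+1.*2.
have nn alpha : 0 <= nrm (c alpha) ^+ 2 * w alpha.
  by rewrite mulr_ge0 ?sqr_ge0// ltW// wt_gt0.
have V0 := tot_gt0 R d.
(* Parseval on the polydisc of radius [r], up to the error [e] of the
   approximation of [f] by polynomials *)
have Sr r : 0 < r < 1 -> S r <= nsqr 1 f.
  move=> /andP[r0 r1]; have mp := @measurable_pcr R d r.
  have sub : pcr r `<=` @pcr R d 1.
    by move=> t h i; apply: lt_trans r1; exact: h.
  have [K hK] := frechet_bnd r1 (series_holo hf).
  have K0 : 0 <= K by apply: le_trans (hK 0 _); [exact: nrm_ge0|apply: Dball0; exact: ltW].
  have [mf if1] := Lf.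
  have if_ : vol.-integrable (pcr r) (fun t => (nrm (hat f t) ^+ 2)%:E).
    by apply: integrableS if1 => //; exact: measurable_pcr.
  have fr : sqint vol (pcr r) (hat f) <= sqint vol (pcr 1) (hat f).
    rewrite /sqint /Rintegral; apply: fine_le.
    - exact: integrable_fin_num.
    - by apply: integrable_fin_num => //; exact: measurable_pcr.
    - apply: ge0_subset_integral => //; first exact: measurable_pcr.
        exact: measurable_int if1.
      by move=> t _; rewrite lee_fin sqr_ge0.
  rewrite -subr_le0; apply: (@le0_of_le_small _ _ (2 * K + 1)) => e /andP[e0 e1].
  have r01 : 0 <= r < 1 by rewrite ltW.
  have [N0 hN] := hf r r01 e e0; pose M := maxn N N0.
  have {hN} := hN M (leq_maxr _ _) => hM.
  have S1 : S r <= nsqr r (box_sum c M).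
    rewrite nsqr_psum ?box_uniq// -subr_ge0 (box_diff _ (leq_maxl N N0)).
    apply: sumr_ge0 => alpha _; rewrite mulr_ge0//.
    by apply: prodr_ge0 => i _; rewrite exprn_ge0// ltW.
  have S2 : nsqr r (box_sum c M) <= nsqr r f + (2 * K + 1) * e.
    have volr : fine (vol (pcr r)) <= tot R d.
      rewrite vol_pcr /= /tot; apply: lerXn2r; rewrite ?nnegrE ?area_ge0//.
      rewrite -!radial0 (radial_dilate _ r0) ger_pMl; last by rewrite radial0 area_gt0.
      by apply: exprn_ile1; exact: ltW.
    have le : sqint vol (pcr r) (hat (box_sum c M)) <=
        sqint vol (pcr r) (hat f) + (2 * K + 1) * e * fine (vol (pcr r)).
      rewrite /sqint -Rintegral_cst// -RintegralD//; last first.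
        exact: integrable_cst (vol_pcr_fin d r).
      have [_ iM] := L2_psum c (box d M) r0.
      apply: le_Rintegral => //.
        have := integrableD mp if_ (integrable_cst mp ((2 * K + 1) * e) (vol_pcr_fin d r)).
        by apply: eq_integrable.
      move=> t /pcr_Dball tr; have h1 := hM _ tr; have h2 := hK _ tr; rewrite /hat.
      have h3 : nrm (box_sum c M (point_of t)) <= nrm (f (point_of t)) + e.
        rewrite -[X in nrm X](subrK (f (point_of t))).
        apply: le_trans (nrmD _ _) _; rewrite addrC lerD2l -nrmN opprB//.
      have := nrm_ge0 (f (point_of t)); have := nrm_ge0 (box_sum c M (point_of t)); nra.
    have -> : nsqr r (box_sum c M) = (tot R d)^-1 * sqint vol (pcr r) (hat (box_sum c M)) by [].
    apply: (@le_trans _ _ ((tot R d)^-1 * (sqint vol (pcr r) (hat f) + (2 * K + 1) * e * tot R d))).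
      rewrite ler_wpM2l ?invr_ge0 ?(ltW V0)//; apply: le_trans le _.
      by rewrite lerD2l ler_wpM2l// mulr_ge0 ?(ltW e0)//; lra.
    by rewrite mulrDr [X in _ + X]mulrCA mulVf ?gt_eqF// mulr1.
  have S3 : nsqr r f <= nsqr 1 f by rewrite ler_wpM2l ?invr_ge0 ?(ltW V0).
  by rewrite lerBlDr; apply: le_trans S1 _; apply: le_trans S2 _; rewrite addrC lerD2l.
(* let [r = 1 - e] tend to 1; the damping of the coefficients is at least
   [r ^ k] *)
rewrite -subr_le0; pose k := (N * d).*2.
apply: (@le0_of_le_small _ _ (k%:R * ell2 c N)) => e /andP[e0 e1].
have r0 : 0 < 1 - e by lra.
have r1 : 1 - e <= 1 by lra.
have r01 : 0 < 1 - e < 1 by rewrite r0; lra.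
have := Sr _ r01.
have E0 : 0 <= ell2 c N by apply: sumr_ge0 => alpha _; exact: nn.
have h : (1 - e) ^+ k * ell2 c N <= S (1 - e).
  rewrite mulr_sumr big_seq [leRHS]big_seq; apply: ler_sum => alpha.
  rewrite mem_box => /forallP ab; rewrite mulrC ler_wpM2l//.
  rewrite -expr_sum; apply: ler_wiXn2l => //; first exact: ltW.
  rewrite /k (_ : (N * d).*2 = \sum_(i < d) N.*2)%N; last first.
    by rewrite sum_nat_const card_ord -!muln2; lia.
  by apply: leq_sum => i _; rewrite leq_double.
have B : 1 - k%:R * e <= (1 - e) ^+ k by apply: bernoulli; lra.
nra.
Qed.

(** The converse bound, by Fatou's lemma applied to the partial sums. *)
Lemma series_tail c f N K : unif_series c f ->
  (forall M, (N <= M)%N -> ell2 c M - ell2 c N <= K) ->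
  L2r 1 (hat (fun z => f z - box_sum c N z)) /\ nsqr 1 (fun z => f z - box_sum c N z) <= K.
Proof.
move=> hf hK; have V0 := tot_gt0 R d; have mp := @measurable_pcr R d 1.
have Lpoly M : L2r 1 (hat (fun z => box_sum c M z - box_sum c N z)).
  have L1 := L2_psum c (box d M) (ltr01 : 0 < (1 : R)).
  have L2_ := L2Z mp (-1) (L2_psum c (box d N) (ltr01 : 0 < (1 : R))).
  by apply: (eq_L2 mp) (L2D mp L1 L2_) => t _; rewrite mulN1r.
have [|n|t /pcr_polydisc tp e e0|h1 h2] := @L2_lim _ _ _ vol _ mp
  (fun n => hat (fun z => box_sum c (n + N) z - box_sum c N z))
  (hat (fun z => f z - box_sum c N z)) (tot R d * K).
- by move=> n; exact: Lpoly.
- have := nsqr_box_diff c (leq_addl n N).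
  move=> E; have : nsqr 1 (fun z => box_sum c (n + N) z - box_sum c N z) <= K.
    by rewrite E; apply: hK; exact: leq_addl.
  by rewrite /nsqr mulrC ler_pdivrMr// mulrC.
- have [N0 hN] := unif_series_cvg hf tp e0; exists N0 => n Nn.
  have := hN (n + N)%N (leq_trans Nn (leq_addr _ _)).
  by rewrite -nrmN /hat; congr (nrm _ <= _); ring.
split => //; rewrite /nsqr mulrC ler_pdivrMr// mulrC//.
Qed.

Definition bmonomial alpha : Vd -> C := extend0 (mono alpha).
Local Notation Em := bmonomial.

Lemma extend0E (f : Vd -> C) z : polydisc z -> extend0 f z = f z.
Proof. by move=> hz; rewrite /extend0 /patch mem_set. Qed.

Lemma extend0F (f : Vd -> C) z : ~ polydisc z -> extend0 f z = 0.
Proof. by move=> hz; rewrite /extend0 /patch memNset. Qed.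

Lemma eq_unif_series c f g : (forall z, polydisc z -> f z = g z) ->
  unif_series c f -> unif_series c g.
Proof.
move=> fg hf s s01 e e0; have [N0 hN] := hf s s01 e e0; exists N0 => N NN z zs.
rewrite -fg; first exact: hN.
by apply: Dball_polydisc zs; case/andP: s01.
Qed.

Lemma hat_ext0 f t : pcr 1 t -> hat (extend0 f) t = hat f t.
Proof. by move=> /pcr_polydisc h; rewrite /hat extend0E. Qed.

Lemma bergman_series f : A2 f -> unif_series (hcoef f) f.
Proof. by case/bergmanP => _ h _; exact: holo_series. Qed.

Lemma bergman_intro c f : (forall z, ~ polydisc z -> f z = 0) -> unif_series c f ->
  L2r 1 (hat f) -> A2 f.
Proof. by move=> h1 h2 h3; apply/bergmanP; split => //; exact: series_holo h2. Qed.

Lemma mono_series alpha : unif_series (fun beta => (beta == alpha)%:R : C) (mono alpha : Vd -> C).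
Proof.
move=> s s01 e e0; have [N0 hN] := box_exhaust alpha; exists N0 => N NN z _.
rewrite /box_sum (bigD1_seq alpha) ?box_uniq//=; last exact: box_sub hN.
rewrite eqxx mul1r big1 ?addr0 ?subrr ?nrm0 ?ltW// => beta ba.
by rewrite (negbTE ba) mul0r.
Qed.

Lemma L2_mono alpha : L2r 1 (hat (mono alpha)).
Proof.
have := L2_psum (fun=> 1) [:: alpha] (ltr01 : 0 < (1 : R)).
by congr (L2 _ _ (hat _)); apply/funext => z; rewrite /psum big_seq1 mul1r.
Qed.

Lemma monomial_A2 alpha : A2 (Em alpha).
Proof.
apply: (@bergman_intro (fun beta => (beta == alpha)%:R)).
- by move=> z; exact: extend0F.
- by apply: eq_unif_series (mono_series alpha) => z hz; rewrite /bmonomial extend0E.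
- apply: eq_L2 (L2_mono alpha); first exact: measurable_pcr.
  by move=> t ht; rewrite hat_ext0.
Qed.

Lemma A2_L2 f : A2 f -> L2r 1 (hat f).
Proof. by case/bergmanP. Qed.

Lemma A2_0 : A2 0.
Proof.
apply: (@bergman_intro (fun=> 0)) => //.
- move=> s _ e e0; exists 0%N => N _ z _; rewrite /box_sum big1 ?subr0 ?nrm0 ?ltW//.
  by move=> alpha _; rewrite mul0r.
- have := L2_psum (fun=> 0) [::] (ltr01 : 0 < (1 : R)).
  by congr (L2 _ _ (hat _)); apply/funext => z; rewrite /psum big_nil.
Qed.

Lemma A2_lin (a : C) f g : A2 f -> A2 g -> A2 (a *: f + g).
Proof.
move=> Af Ag; have [f0 hf _] := Af; have [g0 hg _] := Ag; apply/bergmanP; split.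
- by move=> z hz; rewrite (_ : (a *: f + g) z = a * f z + g z)// f0// g0// mulr0 addr0.
- move=> z hz; apply: differentiable_frechet.
  by apply: differentiableD; [apply: differentiableZ; exact: hf|exact: hg].
- have mp := @measurable_pcr R d 1.
  exact: (L2D mp (L2Z mp a (A2_L2 Af)) (A2_L2 Ag)).
Qed.

Lemma ipE f g : ip f g = ofR (tot R d)^-1 * cint vol (pcr 1) (fun t => hat f t * cconj (hat g t)).
Proof. by rewrite bergman_ipE. Qed.

Lemma ip_A2_self f : A2 f -> ip f f = ofR (nsqr 1 f).
Proof. by move=> Af; rewrite bergman_ipE nsqr_ipr//; exact: A2_L2. Qed.

(** The inner product is definite because the norm bounds the coefficients,
    which determine a holomorphic function. *)
Lemma A2_prehilbert : prehilbert A2 ip.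
Proof.
have mp := @measurable_pcr R d 1.
split.
- exact: A2_0.
- exact: A2_lin.
- move=> a f g h Af Ag Ah; rewrite !ipE mulrCA -mulrDr; congr (_ * _).
  have i1 := L2_cintegrable mp (A2_L2 Af) (A2_L2 Ah).
  have i2 := L2_cintegrable mp (A2_L2 Ag) (A2_L2 Ah).
  rewrite -cintZ// -cintD//; last exact: cintegrableZ.
  by apply: eq_cint => t _; rewrite /hat /= mulrDl -mulrA.
- move=> f g Af Ag; rewrite !ipE cconjM cconj_ofR; congr (_ * _).
  rewrite -(cint_conj mp); last exact: (L2_cintegrable mp (A2_L2 Af) (A2_L2 Ag)).
  by apply: eq_cint => t _; rewrite cconjM cconjK mulrC.
- by move=> f Af; exists (nsqr 1 f); [exact: nsqr_ge0|exact: ip_A2_self].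
- move=> f Af; rewrite ip_A2_self// => /eqP; rewrite ofR_eq0 => /eqP f0.
  have c0 alpha : hcoef f alpha = 0.
    have [N aN] := box_exhaust alpha.
    have := ell2_le_nsqr N (A2_L2 Af) (bergman_series Af); rewrite f0 /ell2.
    rewrite (bigD1_seq alpha) ?box_uniq//= => h.
    have h1 : 0 <= \sum_(i <- box d N | i != alpha) nrm (hcoef f i) ^+ 2 * w i.
      by apply: sumr_ge0 => beta _; rewrite mulr_ge0 ?sqr_ge0// ltW// wt_gt0.
    have h2 : nrm (hcoef f alpha) ^+ 2 * w alpha <= 0 by lra.
    have h3 : nrm (hcoef f alpha) ^+ 2 <= 0 by rewrite -(pmulr_lle0 _ (wt_gt0 R alpha)).
    have : nrm (hcoef f alpha) ^+ 2 == 0 by rewrite eq_le h3 sqr_ge0.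
    by rewrite sqrf_eq0 nrm_eq0 => /eqP.
  apply/funext => z; have [hz|hz] := pselect (polydisc z); last by have [-> ] := Af.
  apply: nrm_le0_eq0 => e e0; have [N0 hN] := unif_series_cvg (bergman_series Af) hz e0.
  have := hN N0 (leqnn _); rewrite /box_sum big1 ?subr0// => alpha _.
  by rewrite c0 mul0r.
Qed.

Let ph := A2_prehilbert.
Local Notation sq := (sq ip).

Lemma sqE f : A2 f -> sq f = nsqr 1 f.
Proof. by move=> Af; rewrite /sq ip_A2_self. Qed.

Lemma monomial_orth alpha beta : ip (Em alpha) (Em beta) = ofR (w alpha) * (alpha == beta)%:R.
Proof.
have [_] := @ipr_mono R d 1 alpha beta ltr01.
rewrite [X in ofR (X * _)]big1 ?mul1r => [<-|i _]; last by rewrite expr1n.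
rewrite bergman_ipE; congr (_ * _); apply: eq_cint => t ht.
by have := hat_ext0 (mono alpha) ht; have := hat_ext0 (mono beta) ht; rewrite /hat /bmonomial => -> ->.
Qed.

Lemma monomial_sumE c N z : polydisc z -> (\sum_(alpha <- box d N) c alpha *: Em alpha) z = box_sum c N z.
Proof.
by move=> hz; rewrite fct_sumE; apply: eq_bigr => alpha _;
  rewrite (_ : (c alpha *: Em alpha) z = c alpha * Em alpha z)// /bmonomial extend0E.
Qed.

Lemma monomial_sum_A2 c N : A2 (\sum_(alpha <- box d N) c alpha *: Em alpha).
Proof. by apply: (ph_sum ph) => alpha; apply: (phZ ph); exact: monomial_A2. Qed.

Lemma series_dense f c : A2 f -> unif_series c f -> forall e : R, 0 < e -> exists N0,
  forall N, (N0 <= N)%N -> sq (f - \sum_(alpha <- box d N) c alpha *: Em alpha) <= e.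
Proof.
move=> Af hf e e0.
have [N0 hN] := bounded_mono_cauchy (ell2_mono c) (fun N => ell2_le_nsqr N (A2_L2 Af) hf) e0.
exists N0 => N NN; rewrite sqE; last by apply: (phB ph) => //; exact: monomial_sum_A2.
have [_ le] := series_tail hf (fun M NM => hN N M NN NM).
apply: le_trans le; rewrite le_eqVlt; apply/orP; left; apply/eqP.
apply: eq_nsqr => t /pcr_polydisc ht; rewrite /hat.
by rewrite -monomial_sumE.
Qed.

(** The coefficients of the power series are the Fourier coefficients: inner
    products are continuous, and the partial sums have the coefficient
    [c alpha] as soon as the box contains [alpha]. *)
Lemma ip_monomial f c alpha : A2 f -> unif_series c f -> ip f (Em alpha) = ofR (w alpha) * c alpha.
Proof.
move=> Af hf; have AE := monomial_A2 alpha.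
apply/eqP; rewrite -subr_eq0; apply/eqP; apply: nrm_le0_eq0 => e e0.
have s0 := sq_ge0 ph AE; pose K := 1 + sq (Em alpha).
have K0 : 1 <= K by rewrite /K; lra.
have d0 : 0 < e / K by rewrite divr_gt0//; lra.
have [N0 h0] := series_dense Af hf (exprn_gt0 2 d0).
have [N1 aN] := box_exhaust alpha.
have := h0 (maxn N0 N1) (leq_maxl _ _); set N := maxn N0 N1; set p := \sum_(_ <- _) _ => h.
have Ap : A2 p by exact: monomial_sum_A2.
have -> : ofR (w alpha) * c alpha = ip p (Em alpha).
  rewrite /p (ip_suml ph _ (fun beta => phZ ph (c beta) (monomial_A2 beta)) AE).
  have E beta : ip (c beta *: Em beta) (Em alpha) = c beta * (ofR (w beta) * (beta == alpha)%:R).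
    by rewrite (ipZl ph (c beta) (monomial_A2 beta) AE) monomial_orth.
  under eq_bigr do rewrite E.
  rewrite (bigD1_seq alpha) ?box_uniq//=; last by apply: box_sub aN; exact: leq_maxr.
  by rewrite eqxx mulr1 mulrC big1 ?addr0// => beta /negbTE ->; rewrite !mulr0.
rewrite -(ipBl ph)//; apply: (@le_trans _ _ (e / K * K)); last by rewrite divfK//; lra.
have K1 : sq (Em alpha) <= K ^+ 2.
  by move: s0 K0; rewrite /K; move: (sq (Em alpha)) => x; nra.
exact: (nrm_ip_le ph (phB ph Af Ap) AE h K1 (ltW d0) (le_trans ler01 K0)).
Qed.

Lemma fc_series f c alpha : A2 f -> unif_series c f -> fc ip Em f alpha = c alpha.
Proof.
by move=> Af hf; rewrite /fc (ip_monomial alpha Af hf) mulrA -ofRM mulVf ?ofR1 ?mul1r// gt_eqF ?wt_gt0.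
Qed.

Lemma A2_dense f : A2 f -> forall e : R, 0 < e -> exists N0, forall N, (N0 <= N)%N ->
  sq (f - \sum_(alpha <- box d N) fc ip Em f alpha *: Em alpha) <= e.
Proof.
move=> Af e e0; have hf := bergman_series Af.
have [N0 h] := series_dense Af hf e0; exists N0 => N NN.
under eq_bigr do rewrite (fc_series _ Af hf).
exact: h.
Qed.

(** ** Square-summable coefficients *)

Section completeness.
Variables (c : index -> C) (K : R).
Hypothesis cK : forall N, ell2 c N <= K.

Let A rho N : R := \sum_(alpha <- box d N) nrm (c alpha) * \prod_i rho ^+ alpha i.

Let A_mono rho : 0 <= rho -> {homo A rho : N M / (N <= M)%N >-> N <= M}.
Proof.
move=> rho0 N M NM; rewrite -subr_ge0 /A (box_diff _ NM); apply: sumr_ge0 => alpha _.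
by rewrite mulr_ge0 ?nrm_ge0//; apply: prodr_ge0 => i _; exact: exprn_ge0.
Qed.

(** The inequality between arithmetic and geometric means compares the sum with
    the weighted square sum of [c] and the squared norm of the reproducing kernel,
    which is a product of arithmetico-geometric series. *)
Let A_bnd rho N : 0 <= rho < 1 -> A rho N <= (K + ((1 - rho ^+ 2)^-1 ^+ 2) ^+ d) / 2.
Proof.
move=> /andP[rho0 rho01].
have x01 : 0 <= rho ^+ 2 < 1 by rewrite sqr_ge0/= expr_lt1.
have le1 : \sum_(alpha <- box d N) \prod_(i < d) ((alpha i).+1%:R * (rho ^+ 2) ^+ alpha i) <=
    ((1 - rho ^+ 2)^-1 ^+ 2) ^+ d.
  rewrite (big_box N (fun (_ : 'I_d) k => k.+1%:R * (rho ^+ 2) ^+ k)).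
  rewrite (_ : _ ^+ d = \prod_(i < d) ((1 - rho ^+ 2)^-1 ^+ 2)); last by rewrite prodr_const card_ord.
  apply: ler_prod => i _.
  rewrite arith_geom_le// andbT; apply: sumr_ge0 => k _.
  by rewrite mulr_ge0// exprn_ge0// sqr_ge0.
rewrite ler_pdivlMr//; apply: (@le_trans _ _ (ell2 c N +
  \sum_(alpha <- box d N) \prod_(i < d) ((alpha i).+1%:R * (rho ^+ 2) ^+ alpha i))); last exact: lerD.
rewrite /A mulr_suml /ell2 -big_split; apply: ler_sum => alpha _ /=.
have -> : \prod_(i < d) ((alpha i).+1%:R * (rho ^+ 2) ^+ alpha i) = (w alpha)^-1 * (\prod_i rho ^+ alpha i) ^+ 2.
  rewrite big_split /= -prodrXl /w prodfV invrK; congr (_ * _).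
  by apply: eq_bigr => i _; rewrite -!exprM mulnC.
have w0 := wt_gt0 R alpha; set W := w alpha in w0 *; set a := nrm _; set p := \prod_i _.
have -> : a ^+ 2 * W + W^-1 * p ^+ 2 = W^-1 * ((a * W - p) ^+ 2) + a * p * 2.
  by field; rewrite gt_eqF.
by rewrite lerDr mulr_ge0 ?sqr_ge0// invr_ge0 ltW.
Qed.

Let box_cauchy rho e : 0 <= rho < 1 -> 0 < e -> exists N0, forall N M, (N0 <= N)%N -> (N <= M)%N ->
  forall z : Vd, Dball rho z -> nrm (box_sum c M z - box_sum c N z) <= e.
Proof.
move=> rho01 e0; have /andP[rho0 _] := rho01.
have [N0 hN] := bounded_mono_cauchy (A_mono rho0) (fun N => A_bnd N rho01) e0.
exists N0 => N M NN NM z zs; apply: le_trans (hN N M NN NM).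
rewrite /box_sum /A !(box_diff _ NM); apply: le_trans (nrm_sum _ _ _) _.
by apply: ler_sum => alpha _; rewrite nrmM ler_wpM2l ?nrm_ge0// mono_bnd.
Qed.

(** The series converges absolutely inside the polydisc, by [A_bnd], and its
    sum is square-integrable by [series_tail]. *)
Lemma A2_complete : exists2 f, A2 f & unif_series c f.
Proof.
pose f : Vd -> C := extend0 (fun z => ulim (fun N => box_sum c N z)).
have hf : unif_series c f.
  move=> rho rho01 e e0; have [N0 hN] := box_cauchy rho01 e0; exists N0 => N NN z zs.
  have zp : polydisc z by apply: Dball_polydisc zs; case/andP: rho01.
  rewrite /f extend0E//; apply: nrm_ulim_le.
    exists ((K + ((1 - rho ^+ 2)^-1 ^+ 2) ^+ d) / 2) => M; apply: le_trans (A_bnd M rho01).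
    apply: le_trans (nrm_sum _ _ _) _; apply: ler_sum => alpha _.
    by rewrite nrmM ler_wpM2l ?nrm_ge0// mono_bnd.
  have [PF _] := free_ultrafilter_ultra.
  apply: filterS (free_ultrafilter_ge N) => M NM /=; exact: hN.
exists f => //; apply: (bergman_intro _ hf); first by move=> z; exact: extend0F.
have tl M : (0 <= M)%N -> ell2 c M - ell2 c 0 <= K - ell2 c 0 by move=> _; rewrite lerB.
have [L _] := series_tail hf tl.
have mp := @measurable_pcr R d 1.
apply: (eq_L2 mp) (L2D mp L (L2_psum c (box d 0) (ltr01 : 0 < (1 : R)))) => t _.
by rewrite /hat subrK.
Qed.

End completeness.

Lemma A2_riesz_fischer c (K : R) :
  (forall N, \sum_(alpha <- box d N) nrm (c alpha) ^+ 2 * w alpha <= K) ->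
  exists2 f, A2 f & forall alpha, fc ip Em f alpha = c alpha.
Proof.
move=> cK; have [f Af hf] := A2_complete cK.
by exists f => // alpha; exact: fc_series.
Qed.

(** ** Multiplication operators *)

(** Used for the partial sums of [Gamma psi], which converge pointwise and are
    bounded in norm. *)
Lemma A2_limit f (F : nat -> Vd -> C) (K : R) : (forall z, ~ polydisc z -> f z = 0) ->
  frechet_on_polydisc f -> (forall n, A2 (F n)) -> (forall n, sq (F n) <= K) ->
  (forall z, polydisc z -> forall e : R, 0 < e ->
     exists N, forall n, (N <= n)%N -> nrm (F n z - f z) <= e) ->
  A2 f /\ sq f <= K.
Proof.
move=> f0 hf AF FK lim; have V0 := tot_gt0 R d; have mp := @measurable_pcr R d 1.
have [|n|t /pcr_polydisc ht|Lf le] := @L2_lim _ _ _ vol _ mp (fun n => hat (F n)) (hat f) (tot R d * K).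
- by move=> n; exact: A2_L2.
- by have := FK n; rewrite sqE// /nsqr mulrC ler_pdivrMr// mulrC.
- exact: lim.
have Af : A2 f by apply/bergmanP; split.
by split => //; rewrite sqE// /nsqr mulrC ler_pdivrMr// mulrC.
Qed.

Lemma holomorphicM f g : holomorphic_on (@polydisc R d) f -> holomorphic_on (@polydisc R d) g ->
  holomorphic_on (@polydisc R d) (fun z : Vd => f z * g z).
Proof. by move=> hf hg z hz; apply: differentiableM; [exact: hf|exact: hg]. Qed.

Lemma multiplication_contraction (phi : Vd -> C) : holomorphic_on (@polydisc R d) phi ->
  (forall z, polydisc z -> nrm (phi z) <= 1) -> linear_contraction A2 ip (multiplication phi).
Proof.
move=> hphi b; have mp := @measurable_pcr R d 1.
have mphi : cmeas (pcr 1) (hat phi).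
  have s0 : unif_series (hcoef phi) phi.
    by apply: holo_series => z hz; exact/differentiable_frechet/hphi.
  exact: cmeas_series s0.
have AM f : A2 f -> A2 (multiplication phi f).
  move=> Af; have [f0 hf _] := Af; apply/bergmanP; split.
  - by move=> z hz; rewrite /multiplication f0// mulr0.
  - by move=> z hz; apply: differentiable_frechet; exact: holomorphicM.
  - apply: (@L2_mul_bnd _ _ _ _ _ mp (hat phi) 1 (hat f)) => //.
      by move=> t /pcr_polydisc; exact: b.
    exact: A2_L2.
split => //.
- move=> a f g _ _; apply/funext => z; rewrite /multiplication.
  rewrite (_ : (a *: f + g) z = a * f z + g z)//.
  by rewrite (_ : (_ + _) z = a * (phi z * f z) + phi z * g z)//; ring.
- move=> f Af; rewrite !sqE//; last exact: AM.
  rewrite /nsqr ler_wpM2l ?invr_ge0 ?(ltW (tot_gt0 R d))//.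
  have [_ i1] := A2_L2 (AM _ Af); have [_ i2] := A2_L2 Af.
  apply: le_Rintegral => // t /pcr_polydisc ht.
  rewrite /hat /multiplication nrmM exprMn ler_piMl ?sqr_ge0//.
  by apply: exprn_ile1; [exact: nrm_ge0|exact: b].
Qed.

Lemma shift_monomial (i : 'I_d) alpha : bergman_multishift i (Em alpha) = Em (inc i alpha).
Proof.
apply/funext => z; rewrite /bergman_multishift /multiplication.
have [hz|hz] := pselect (polydisc z); last by rewrite /bmonomial !extend0F ?mulr0.
rewrite /bmonomial !extend0E// /mono (bigD1 i)//= [RHS](bigD1 i)//= ffunE eqxx exprS mulrA.
by congr (_ * _); apply: eq_bigr => j ji; rewrite ffunE (negbTE ji).
Qed.

Lemma shift_contraction (i : 'I_d) : linear_contraction A2 ip (@bergman_multishift R d i).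
Proof.
apply: multiplication_contraction.
  by move=> z _; exact: differentiable_coord.
by move=> z /(_ i); rewrite nrm_lt1 => /ltW.
Qed.

End bergman_space.

(** * Finite Blaschke products *)

Section derivatives.
Variable R : realType.
Local Notation C := (Cplx R).
Implicit Types (f g : C -> C) (z : C).

(** The derivatives of the definition of the Jacobian are the ones computed
    here. *)
Lemma cdiff_derive1 f z (l : C) : cdiff_at f z l -> derive1 f z = l.
Proof.
move=> hf; apply: cvg_lim => //; apply/cvgrPdist_le => e /cplx_pos[-> e0].
move: (complex.Re e) e0 => e' e0.
have [d d0 hd] := hf e' e0.
near=> h.
have h0 : h != 0 by near: h; exact: nbhs_dnbhs_neq.
have hd' : nrm h < d.
  have : `|h| < ofR d.
    near: h; apply: dnbhs0_lt; by rewrite -ofR0 ofR_lt.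
  by rewrite normE ofR_lt.
rewrite normE ofR_le -(ler_pM2r (_ : 0 < nrm h)) ?nrm_gt0//.
have := hd h hd'; rewrite -nrmN -nrmM /=; congr (nrm _ <= _).
rewrite (addrC h z) -[_ *: _]/(h^-1 * _) mulrBl mulrAC mulVf// mul1r; ring.
Unshelve. all: by end_near.
Qed.

Lemma cdiff_cst (c : C) z : cdiff_at (fun=> c) z 0.
Proof. by move=> e e0; exists 1 => // h _; rewrite subrr mul0r subr0 nrm0 mulr_ge0 ?nrm_ge0// ltW. Qed.

Lemma eq_cdiff f g z (l m : C) : f = g -> l = m -> cdiff_at f z l -> cdiff_at g z m.
Proof. by move=> -> ->. Qed.

Lemma near_cdiff f g z (l : C) (d : R) : 0 < d -> (forall h, nrm h < d -> f (z + h) = g (z + h)) ->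
  cdiff_at f z l -> cdiff_at g z l.
Proof.
move=> d0 fg hf e e0; have [d' d'0 hd'] := hf e e0.
exists (Num.min d d'); first by rewrite lt_min d0.
move=> h; rewrite lt_min => /andP[h1 h2]; rewrite -fg//.
have := fg 0; rewrite nrm0 addr0 => <-//; exact: hd'.
Qed.

Lemma cdiffM f g z (l m : C) : cdiff_at f z l -> cdiff_at g z m ->
  cdiff_at (fun w => f w * g w) z (l * g z + f z * m).
Proof.
move=> hf hg e e0.
pose K := nrm (g z) + 1 + nrm l + nrm (f z).
have K0 : 0 < K by rewrite /K; have := nrm_ge0 (g z); have := nrm_ge0 l; have := nrm_ge0 (f z); lra.
have e1 : 0 < e / K by rewrite divr_gt0.
pose e2 := Num.min 1 (e / K); have e20 : 0 < e2 by rewrite lt_min ltr01.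
have [d1 d10 h1] := hf _ e1; have [d2 d20 h2] := hg _ e1.
have [d3 d30 h3] := cdiff_cont hg e20.
exists (Num.min d1 (Num.min d2 d3)); first by rewrite !lt_min d10 d20.
move=> h; rewrite !lt_min => /and3P[hd1 hd2 hd3].
have {}h1 := h1 h hd1; have {}h2 := h2 h hd2.
have {}h3 : nrm (g (z + h) - g z) <= e2 by exact: h3.
have [h31 h32] : nrm (g (z + h) - g z) <= 1 /\ nrm (g (z + h) - g z) <= e / K.
  by move: h3; rewrite /e2 le_min => /andP[].
have -> : f (z + h) * g (z + h) - f z * g z - (l * g z + f z * m) * h =
  (f (z + h) - f z - l * h) * g (z + h) + l * h * (g (z + h) - g z) +
  f z * (g (z + h) - g z - m * h) by ring.
have gb : nrm (g (z + h)) <= nrm (g z) + 1.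
  rewrite -[X in nrm X](subrK (g z)); apply: le_trans (nrmD _ _) _.
  by rewrite addrC lerD2l.
apply: le_trans (nrmD _ _) _.
have -> : e * nrm h = e / K * nrm h * (nrm (g z) + 1) + nrm l * nrm h * (e / K) + nrm (f z) * (e / K * nrm h).
  have -> : e * nrm h = e / K * K * nrm h by rewrite divfK ?gt_eqF.
  by rewrite {2}/K; ring.
apply: lerD; first apply: le_trans (nrmD _ _) (lerD _ _).
- by rewrite nrmM; apply: ler_pM; rewrite ?nrm_ge0.
- by rewrite !nrmM ler_wpM2l ?mulr_ge0 ?nrm_ge0.
- by rewrite nrmM ler_wpM2l ?nrm_ge0.
Qed.

Lemma cdiffZ (c : C) f z (l : C) : cdiff_at f z l -> cdiff_at (fun w => c * f w) z (c * l).
Proof.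
by move=> hf; apply: eq_cdiff (cdiffM (cdiff_cst c z) hf) => //; rewrite mul0r add0r.
Qed.

Lemma cdiffX f z (l : C) n : cdiff_at f z l -> cdiff_at (fun w => f w ^+ n.+1) z (n.+1%:R * f z ^+ n * l).
Proof.
move=> hf; elim: n => [|n IH].
  by apply: eq_cdiff hf => //; rewrite expr0 !mul1r.
have E : (fun w => f w * f w ^+ n.+1) = (fun w => f w ^+ n.+2) by apply/funext => w; rewrite -exprS.
by apply: eq_cdiff (cdiffM hf IH) => //; rewrite -natr1 !exprS; ring.
Qed.

Lemma holoM rho f g : holo_on rho f -> holo_on rho g -> holo_on rho (fun w => f w * g w).
Proof.
move=> hf hg z zr; have [l hl] := hf z zr; have [m hm] := hg z zr.
by eexists; exact: (cdiffM hl hm).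
Qed.

Lemma holo_cst rho (c : C) : holo_on rho (fun=> c).
Proof. by move=> z _; exists 0; exact: cdiff_cst. Qed.

Lemma holoX rho f n : holo_on rho f -> holo_on rho (fun w => f w ^+ n).
Proof.
move=> hf; elim: n => [|n IH]; first exact: holo_cst.
have -> : (fun w => f w ^+ n.+1) = (fun w => f w * f w ^+ n) by apply/funext => w; rewrite exprS.
exact: holoM.
Qed.

Lemma holo_prod rho (I : Type) (s : seq I) (F : I -> C -> C) : (forall i, holo_on rho (F i)) ->
  holo_on rho (fun w => \prod_(i <- s) F i w).
Proof.
move=> hF; elim: s => [|i s IH].
  have -> : (fun w => \prod_(i <- [::]) F i w) = fun=> 1 by apply/funext => w; rewrite big_nil.
  exact: holo_cst.
have -> : (fun w => \prod_(j <- i :: s) F j w) = (fun w => F i w * \prod_(j <- s) F j w).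
  by apply/funext => w; rewrite big_cons.
exact: holoM.
Qed.

Lemma holo_derive1 rho f z : holo_on rho f -> nrm z < rho -> cdiff_at f z (derive1 f z).
Proof. by move=> hf zr; have [l hl] := hf z zr; rewrite (cdiff_derive1 hl). Qed.

Lemma holo_upoly rho s f : holo_on rho f -> 0 <= s < rho -> upoly s f.
Proof.
move=> hf /andP[s0 sr]; pose r := (s + rho) / 2.
have rr : s < r < rho by rewrite /r; apply/andP; split; lra.
have [sr' rrho] := andP rr; have r0 : 0 < r by lra.
apply: (@cauchyF_upoly _ r); rewrite ?s0//.
  have [K hK] := holo_bnd hf rrho; exists K => z z1; apply: hK.
  by rewrite nrmM z1 mulr1 nrm_ofR gtr0_norm.
by apply: holo_cauchy hf _; rewrite r0.
Qed.

(** A function holomorphic past the closed disc has a derivative that is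
    regular up to the boundary. *)
Lemma holo_derive_upoly rho s f : holo_on rho f -> 0 <= s < rho -> upoly s (derive1 f).
Proof.
move=> hf /andP[s0 sr]; pose r := (s + rho) / 2.
have rr : s < r < rho by rewrite /r; apply/andP; split; lra.
have [sr' rrho] := andP rr; have r0 : 0 < r by lra.
apply: (@cauchyF_derive_upoly _ r s f).
- by apply: holo_cauchy hf _; rewrite r0.
- have [K hK] := holo_bnd hf rrho; exists K => z z1; apply: hK.
  by rewrite nrmM z1 mulr1 nrm_ofR gtr0_norm.
- by rewrite s0.
- by move=> w wr; apply: (holo_derive1 hf); lra.
Qed.

Lemma upolyM s f g : 0 <= s -> upoly s f -> upoly s g -> upoly s (fun w => f w * g w).
Proof.
move=> s0 uf ug e e0; have [K hK] := upoly_bnd uf; have [L hL] := upoly_bnd ug.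
have K0 : 0 <= K by apply: le_trans (hK 0 _); rewrite ?nrm_ge0// nrm0.
have L0 : 0 <= L by apply: le_trans (hL 0 _); rewrite ?nrm_ge0// nrm0.
have S0 : 0 < K + L + 1 by lra.
pose e1 := Num.min 1 (e / (K + L + 1)).
have e10 : 0 < e1 by rewrite lt_min ltr01 divr_gt0.
have [p hp] := uf _ e10; have [q hq] := ug _ e10.
exists (p * q) => w ws; rewrite hornerM.
have -> : f w * g w - p.[w] * q.[w] = f w * (g w - q.[w]) + (f w - p.[w]) * g w - (f w - p.[w]) * (g w - q.[w]) by ring.
have h1 := hp w ws; have h2 := hq w ws; have h3 := hK w ws; have h4 := hL w ws.
have b1 : e1 <= 1 by rewrite ge_min lexx.
have b2 : e1 * (K + L + 1) <= e by rewrite -ler_pdivlMr// ge_min lexx orbT.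
apply: le_trans (nrmB _ _) _; apply: (@le_trans _ _ (K * e1 + e1 * L + e1 * 1)).
  apply: lerD; first apply: le_trans (nrmD _ _) (lerD _ _).
  - by rewrite nrmM; apply: ler_pM; rewrite ?nrm_ge0.
  - by rewrite nrmM; apply: ler_pM; rewrite ?nrm_ge0.
  - by rewrite nrmM; apply: ler_pM; rewrite ?nrm_ge0//; exact: le_trans b1.
by apply: le_trans b2; rewrite le_eqVlt; apply/orP; left; apply/eqP; ring.
Qed.

Lemma upoly_poly s (p : {poly C}) : upoly s (fun w => p.[w]).
Proof. by move=> e e0; exists p => w _; rewrite subrr nrm0 ltW. Qed.

Lemma eq_upoly s f g : (forall w, nrm w <= s -> f w = g w) -> upoly s f -> upoly s g.
Proof. by move=> fg uf e e0; have [p hp] := uf e e0; exists p => w ws; rewrite -fg// hp. Qed.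

Lemma upoly_id s : upoly s (fun w : C => w).
Proof. by apply: eq_upoly (upoly_poly s 'X) => w _; rewrite hornerX. Qed.

Lemma upoly_cst s (c : C) : upoly s (fun=> c).
Proof. by apply: eq_upoly (upoly_poly s c%:P) => w _; rewrite hornerC. Qed.

Lemma upolyX s f n : 0 <= s -> upoly s f -> upoly s (fun w => f w ^+ n).
Proof.
move=> s0 uf; elim: n => [|n IH]; first exact: upoly_cst.
by apply: eq_upoly (upolyM s0 uf IH) => w _; rewrite exprS.
Qed.

(** The mean value property at the centre, for a function vanishing there. *)
Lemma cavg_id_mul f : upoly 1 f -> cavg (fun z => z * f z) = 0.
Proof.
move=> uf; have := upoly_cauchy ltr01 (upolyM ler01 (@upoly_id 1) uf).
move=> /(_ 0); rewrite nrm0 mul0r => /(_ ltr01) E; rewrite [RHS]E.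
by apply: eq_cavg => z _; rewrite ofR1 mul1r mul0r subr0 invr1 mulr1.
Qed.

End derivatives.

Section blaschke_products.
Variable R : realType.
Local Notation C := (Cplx R).

Lemma circle_conj (z : C) : nrm z = 1 -> z * cconj z = 1.
Proof. by move=> z1; rewrite mul_conj z1 expr1n. Qed.

Lemma circle_neq0 (z : C) : nrm z = 1 -> z != 0.
Proof. by move=> z1; rewrite -nrm_gt0 z1. Qed.

Lemma circle_inv (z : C) : nrm z = 1 -> z^-1 = cconj z.
Proof.
by move=> z1; apply: (mulfI (circle_neq0 z1)); rewrite circle_conj// mulfV// circle_neq0.
Qed.

Section factor.
Variable a : C.
Hypothesis a1 : nrm a < 1.

Definition bl (z : C) : C := (z - a) / (1 - cconj a * z).

Lemma bl_den (z : C) : nrm (cconj a * z) < 1 -> 1 - cconj a * z != 0.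
Proof. exact: one_sub_neq0. Qed.

Lemma bl_den1 (z : C) : nrm z <= 1 -> 1 - cconj a * z != 0.
Proof.
move=> z1; apply: bl_den; rewrite nrmM nrm_conj; apply: le_lt_trans a1.
by rewrite ler_piMr// nrm_ge0.
Qed.

Lemma bl_cdiff (z : C) : 1 - cconj a * z != 0 ->
  cdiff_at bl z ((1 - a * cconj a) / (1 - cconj a * z) ^+ 2).
Proof.
move=> den; pose D := nrm (1 - cconj a * z); have D0 : 0 < D by rewrite nrm_gt0.
pose d := D / (2 * (nrm a + 1)).
have a0 := nrm_ge0 a.
have d0 : 0 < d by rewrite divr_gt0// mulr_gt0//; lra.
apply: (@quadratic_cdiff _ _ _ _ (nrm (1 - a * cconj a) * nrm a * (2 / D ^+ 3)) d) => // h hd.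
have den' : D / 2 <= nrm (1 - cconj a * (z + h)).
  have -> : 1 - cconj a * (z + h) = (1 - cconj a * z) - cconj a * h by ring.
  apply: le_trans (nrm_Bge _ _); rewrite nrmM nrm_conj -/D.
  have : nrm a * nrm h <= D / 2.
    apply: (@le_trans _ _ ((nrm a + 1) * d)).
      by apply: ler_pM; rewrite ?nrm_ge0//; [lra|exact: ltW].
    by rewrite /d le_eqVlt; apply/orP; left; apply/eqP; field; lra.
  lra.
have den'0 : 1 - cconj a * (z + h) != 0 by rewrite -nrm_gt0; apply: lt_le_trans den'; rewrite divr_gt0.
have -> : bl (z + h) - bl z - (1 - a * cconj a) / (1 - cconj a * z) ^+ 2 * h =
    (1 - a * cconj a) * cconj a / ((1 - cconj a * z) ^+ 2 * (1 - cconj a * (z + h))) * h ^+ 2.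
  by rewrite /bl; field; rewrite den den'0.
rewrite nrmM nrmX ler_wpM2r ?sqr_ge0// nrmM [nrm (_ * cconj a)]nrmM nrm_conj.
rewrite ler_wpM2l ?mulr_ge0 ?nrm_ge0// nrmV nrmM nrmX -/D.
have -> : 2 / D ^+ 3 = (D ^+ 2 * (D / 2))^-1 by field; rewrite gt_eqF.
have E0 : 0 < D ^+ 2 * (D / 2) by rewrite mulr_gt0 ?exprn_gt0 ?divr_gt0.
rewrite lef_pV2 ?posrE//; first by rewrite ler_wpM2l ?sqr_ge0.
by rewrite mulr_gt0 ?exprn_gt0//; apply: lt_le_trans den'; rewrite divr_gt0.
Qed.

Lemma bl_circle (z : C) : nrm z = 1 -> nrm (bl z) = 1.
Proof.
move=> z1; rewrite /bl; have -> : 1 - cconj a * z = z * cconj (z - a).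
  by rewrite cconjD cconjN mulrDr circle_conj// mulrN mulrC.
rewrite nrmM nrmV nrmM nrm_conj z1 mul1r mulfV// nrm_eq0 subr_eq0.
by apply: contraTneq a1 => <-; rewrite z1 ltxx.
Qed.

Lemma bl_disc (z : C) : nrm z < 1 -> nrm (bl z) < 1.
Proof.
move=> z1; have den := bl_den1 (ltW z1).
rewrite nrmM nrmV ltr_pdivrMr ?nrm_gt0// mul1r -(@ltr_pXn2r _ 2) ?nnegrE ?nrm_ge0//.
suff : ofR (nrm (1 - cconj a * z) ^+ 2 - nrm (z - a) ^+ 2) = ofR ((1 - nrm a ^+ 2) * (1 - nrm z ^+ 2)).
  case => h; rewrite -subr_gt0 h mulr_gt0// subr_gt0 expr_lt1 ?nrm_ge0//.
have E x : ofR (nrm x ^+ 2) = x * cconj x by rewrite mul_conj.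
rewrite ofRD ofRN !E [RHS]ofRM !ofRD !ofRN ofR1 !E.
rewrite !(cconjD, cconjN, cconjM, cconjK, cconj1); ring.
Qed.

(** The logarithmic derivative of [bl], which has no pole on the circle. *)
Definition bl_log (z : C) : C := (z - a)^-1 + cconj a / (1 - cconj a * z).

Lemma bl_cdiff_log (z : C) : nrm z = 1 -> cdiff_at bl z (bl z * bl_log z).
Proof.
move=> z1; have den : 1 - cconj a * z != 0 by apply: bl_den1; rewrite z1.
have za : z - a != 0.
  by rewrite subr_eq0; apply: contraTneq a1 => <-; rewrite z1 ltxx.
apply: eq_cdiff (bl_cdiff den) => //.
by rewrite /bl /bl_log; field; rewrite za den.
Qed.

Lemma bl_holo : exists2 rho : R, 1 < rho & holo_on rho bl.
Proof.
have a0 := nrm_ge0 a.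
exists (2 / (1 + nrm a)); first by have := a1; rewrite ltr_pdivlMr; lra.
move=> z zr; eexists; apply: bl_cdiff; apply: bl_den; rewrite nrmM nrm_conj.
have : nrm a * nrm z <= nrm a * (2 / (1 + nrm a)) by rewrite ler_wpM2l// ltW.
move=> /le_lt_trans; apply; have := a1; rewrite mulrA ltr_pdivrMr; lra.
Qed.

(** On the circle [z * bl_log z] is the sum of a Cauchy kernel, of mean one, and
    of an affine function of [bl z], of mean zero by the mean value property. *)
Lemma cavg_bl_log : cavg (fun z => z * bl_log z) = 1.
Proof.
have [rho rho1 hb] := bl_holo.
have ub := holo_upoly hb (_ : 0 <= 1 < rho).
have {}ub : upoly 1 bl by apply: ub; rewrite ler01.
have b0 : cavg bl = - a.
  have <- : bl 0 = - a by rewrite /bl mulr0 subr0 sub0r divr1.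
  have := upoly_cauchy ltr01 ub; move=> /(_ 0); rewrite nrm0 => /(_ ltr01) ->.
  by apply: eq_cavg => z _; rewrite ofR1 mul1r mul0r subr0 invr1 mulr1.
have [K hK] := upoly_bnd ub.
have bb : bndS1 bl by exists K => z z1; apply: hK; rewrite z1.
have aa : 1 - a * cconj a != 0.
  by rewrite mulrC; apply: bl_den1; exact: ltW.
have bk : bndS1 (fun z : C => (1 - a / (ofR 1 * z))^-1) by exact: bndS1_kernel.
rewrite (@eq_cavg _ _ (fun z => (1 - a / (ofR 1 * z))^-1 + ((1 - a * cconj a)^-1 * cconj a * bl z + ((1 - a * cconj a)^-1 - 1)))).
  rewrite cavgD//; last first.
    by apply: bndS1D; [apply: bndS1M => //; exact: bndS1_cst|exact: bndS1_cst].
  rewrite cavgD ?cavgZ ?cavg_cst//; try exact: bndS1_cst.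
    rewrite cavg_kernel// b0; have -> : (1 - a * cconj a)^-1 * cconj a * - a + ((1 - a * cconj a)^-1 - 1) = 0; last by rewrite addr0.
    by field.
  by apply: bndS1M => //; exact: bndS1_cst.
move=> z z1; have den : 1 - cconj a * z != 0 by apply: bl_den1; rewrite z1.
have za : z - a != 0.
  by rewrite subr_eq0; apply: contraTneq a1 => <-; rewrite z1 ltxx.
have z0 := circle_neq0 z1.
by rewrite ofR1 mul1r /bl_log /bl; field; rewrite za z0 den aa.
Qed.

End factor.

Section product.
Variables (theta : R) (n : nat) (a : 'I_n -> C) (k : 'I_n -> nat).
Hypothesis a1 : forall j, nrm (a j) < 1.

Definition blaschke (z : C) : C := expi theta * \prod_(j < n) bl (a j) z ^+ k j.

Lemma blaschke_holo : exists2 rho : R, 1 < rho & holo_on rho blaschke.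
Proof.
suff [rho rho1 h] : exists2 rho : R, 1 < rho & forall j, holo_on rho (bl (a j)).
  exists rho => //; apply: holoM; first exact: holo_cst.
  by apply: holo_prod => j; exact: holoX.
have [r hr] := choice (fun j => let: ex_intro2 r h1 h2 := bl_holo (a1 j) in
  ex_intro (fun r => 1 < r /\ holo_on r (bl (a j))) r (conj h1 h2)).
exists (\big[Num.min/2]_(j < n) r j).
  by apply/bigmin_gtP; split; [lra|move=> j _; case: (hr j)].
move=> j z zr; have [_ h] := hr j; apply: h; apply: lt_le_trans zr _.
exact: bigmin_le_cond.
Qed.

Lemma blaschke_circle (z : C) : nrm z = 1 -> nrm (blaschke z) = 1.
Proof.
move=> z1; rewrite /blaschke nrmM nrm_expi mul1r nrm_prod big1// => j _.
by rewrite nrmX bl_circle// expr1n.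
Qed.

Lemma blaschke_disc (z : C) : (0 < \sum_j k j)%N -> nrm z < 1 -> nrm (blaschke z) < 1.
Proof.
move=> k0 z1; have [j kj] : exists j, (0 < k j)%N.
  apply/existsP; apply: contraTT k0 => /existsPn h; rewrite -eqn0Ngt sum_nat_eq0.
  by apply/forallP => j; rewrite implyTb; have := h j; rewrite lt0n negbK.
have b i : 0 <= nrm (bl (a i) z ^+ k i) <= 1.
  by rewrite nrm_ge0 nrmX exprn_ile1 ?nrm_ge0// ltW// bl_disc.
rewrite /blaschke nrmM nrm_expi mul1r nrm_prod (bigD1 j)//=.
apply: (@le_lt_trans _ _ (nrm (bl (a j) z ^+ k j))).
  rewrite ler_piMr ?nrm_ge0//; apply: (@le_trans _ _ (\prod_(i < n | i != j) 1)).
    by apply: ler_prod => i _; exact: b.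
  by rewrite big1_eq.
by rewrite nrmX exprn_ilt1 ?nrm_ge0 ?bl_disc// -lt0n.
Qed.

Definition blaschke_log (z : C) : C := \sum_(j < n) (k j)%:R * bl_log (a j) z.

Lemma blaschke_cdiff_log (z : C) : nrm z = 1 -> cdiff_at blaschke z (blaschke z * blaschke_log z).
Proof.
move=> z1; rewrite /blaschke -mulrA; apply: cdiffZ; rewrite /blaschke_log.
elim: (index_enum _) => [|j s IH].
  by apply: eq_cdiff (cdiff_cst 1 z); [apply/funext => w; rewrite big_nil|rewrite !big_nil mulr0].
have X : cdiff_at (fun w => bl (a j) w ^+ k j) z (bl (a j) z ^+ k j * ((k j)%:R * bl_log (a j) z)).
  case: (k j) => [|kj].
    by apply: eq_cdiff (cdiff_cst 1 z) => //; rewrite mul0r mulr0.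
  apply: eq_cdiff (cdiffX kj (bl_cdiff_log (a1 j) z1)) => //.
  by rewrite exprS; ring.
apply: eq_cdiff (cdiffM X IH); first by apply/funext => w; rewrite big_cons.
by rewrite !big_cons; ring.
Qed.

Lemma blaschke_derive_circle (z : C) : nrm z = 1 -> derive1 blaschke z = blaschke z * blaschke_log z.
Proof. by move=> z1; apply: cdiff_derive1; exact: blaschke_cdiff_log. Qed.

Lemma bndS1_bl_log j : bndS1 (fun z => z * bl_log (a j) z).
Proof.
exists (2 * (1 - nrm (a j))^-1) => z z1; rewrite nrmM z1 mul1r.
have d0 : 0 < 1 - nrm (a j) by rewrite subr_gt0.
have h1 : 1 - nrm (a j) <= nrm (z - a j) by have := nrm_Bge z (a j); rewrite z1.
have h2 : 1 - nrm (a j) <= nrm (1 - cconj (a j) * z).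
  by have := nrm_Bge 1 (cconj (a j) * z); rewrite nrm1 nrmM nrm_conj z1 mulr1.
apply: le_trans (nrmD _ _) _; rewrite mulr_natl mulr2n; apply: lerD.
  by rewrite nrmV lef_pV2 ?posrE//; exact: lt_le_trans h1.
rewrite nrmM nrmV nrm_conj -[leRHS]mul1r; apply: ler_pM; rewrite ?nrm_ge0 ?invr_ge0 ?nrm_ge0//.
  exact: ltW.
by rewrite lef_pV2 ?posrE//; exact: lt_le_trans h2.
Qed.

(** The argument principle: since [|b| = 1] on the circle, [z b' conj b] is the
    logarithmic derivative [z b' / b] there, which is additive in the factors. *)
Lemma blaschke_winding :
  cavg (fun z => z * derive1 blaschke z * cconj (blaschke z)) = (\sum_j k j)%:R.
Proof.
rewrite (@eq_cavg _ _ (fun z => \sum_(j < n) (k j)%:R * (z * bl_log (a j) z))); last first.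
  move=> z z1; rewrite blaschke_derive_circle//.
  rewrite (_ : z * _ * _ = (blaschke z * cconj (blaschke z)) * (z * blaschke_log z)); last by ring.
  rewrite (circle_conj (blaschke_circle z1)) mul1r /blaschke_log.
  by rewrite mulr_sumr; apply: eq_bigr => j _; ring.
rewrite cavg_sum; last by move=> j; apply: bndS1M; [exact: bndS1_cst|exact: bndS1_bl_log].
rewrite natr_sum; apply: eq_bigr => j _.
by rewrite cavgZ ?cavg_bl_log ?mulr1//; exact: bndS1_bl_log.
Qed.

End product.
End blaschke_products.

(** * A Stokes-type identity on the disc *)

Section pairing.
Variable R : realType.
Local Notation C := (Cplx R).
Local Notation P := (measurableTypeR R * measurableTypeR R)%type.
Local Notation pm := (@plane_measure R).
Implicit Types f g F G : C -> C.

Let md := @measurable_disc R 1.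

(** The inner product of the Bergman space of the disc, on functions that need
    not vanish outside of it. *)
Definition dprod g f : C :=
  ofR (area (1 : R))^-1 * cint pm (disc 1) (fun p => g (pt p) * cconj (f (pt p))).

Lemma cmeas_upoly f : upoly 1 f -> cmeas (disc 1) (f \o @pt R).
Proof.
move=> uf; have pos n : 0 < (n.+1%:R : R)^-1 by rewrite invr_gt0.
have [p hp] := choice (fun n : nat => uf n.+1%:R^-1 (pos n)).
apply: (@cmeas_lim _ _ _ _ (fun n t => (p n).[pt t])) => [n|t tD e e0].
  apply: (@eq_cmeas _ _ _ _ (fun t => \sum_(i < size (p n)) (p n)`_i * pt t ^+ i)).
    by move=> t _; rewrite horner_coef.
  apply: cmeas_sum => i; apply: cmeasM; first exact: cmeas_cst.
  by apply: cmeasX; apply: cmeasS => //; exact: cmeas_pt.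
have [N hN] : exists N : nat, N.+1%:R^-1 <= e.
  exists (Num.truncn e^-1); rewrite invf_ple ?posrE ?invr_gt0//.
  by apply: ltW; apply: truncnS_gt.
exists N => n Nn; rewrite -nrmN opprB; apply: le_trans (hp n _ (ltW tD)) _.
by apply: le_trans hN; rewrite lef_pV2 ?posrE// ler_nat.
Qed.

Lemma dprod_cintegrable g f : upoly 1 g -> upoly 1 f ->
  cintegrable pm (disc 1) (fun p => g (pt p) * cconj (f (pt p))).
Proof.
move=> ug uf; have [K hK] := upoly_bnd ug; have [L hL] := upoly_bnd uf.
apply: (@cintegrable_bnd _ _ _ _ _ md _ (K * L)); first exact: disc_fin.
  by apply: cmeasM; [|apply: cmeas_conj]; exact: cmeas_upoly.
move=> p /ltW p1; rewrite nrmM nrm_conj; apply: ler_pM; rewrite ?nrm_ge0//.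
  exact: hK.
exact: hL.
Qed.

Lemma eq_dprod g g' f f' : (forall z, nrm z < 1 -> g z = g' z) ->
  (forall z, nrm z < 1 -> f z = f' z) -> dprod g f = dprod g' f'.
Proof.
by move=> gg ff; congr (_ * _); apply: eq_cint => p hp; rewrite gg// ff.
Qed.

(** The integrands differ by at most [e]; the factor 2 covers the separate
    estimates of real and imaginary parts. *)
Lemma dprod_diff_le g f g' f' (e : R) : upoly 1 g -> upoly 1 f -> upoly 1 g' -> upoly 1 f' ->
  (forall z, nrm z <= 1 -> nrm (g z * cconj (f z) - g' z * cconj (f' z)) <= e) ->
  nrm (dprod g f - dprod g' f') <= 2 * e.
Proof.
move=> ug uf ug' uf' h.
have i1 := dprod_cintegrable ug uf; have i2 := dprod_cintegrable ug' uf'.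
have i3 := cintegrableZ md (-1) i2.
have -> : dprod g f - dprod g' f' = ofR (area (1 : R))^-1 *
    cint pm (disc 1) (fun p => g (pt p) * cconj (f (pt p)) + (-1) * (g' (pt p) * cconj (f' (pt p)))).
  by rewrite cintD// cintZ// /dprod; ring.
have A0 := area_gt0 R; rewrite nrmM nrm_ofR ger0_norm ?invr_ge0 ?(ltW A0)//.
rewrite mulrC ler_pdivrMr//; have -> : 2 * e * area 1 = 2 * (e * fine (pm (disc 1))) by rewrite /area; ring.
apply: nrm_cint_le => //; first exact: disc_fin.
  by apply: cmeasD; [exact: (cintegrable_cmeas i1)|exact: (cintegrable_cmeas i3)].
by move=> p /ltW p1; rewrite mulN1r; exact: h.
Qed.

Lemma dprod_mono i k : dprod (fun z => z ^+ i) (fun z => z ^+ k) = ofR i.+1%:R^-1 * (i == k)%:R.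
Proof.
rewrite /dprod (@eq_cint _ _ _ _ _ _ (mono2 i k)); last by move=> p _; rewrite /mono2 cconjX.
rewrite -/(moment 1 i k) moment_disc// mulrA -ofRM (mulVf (lt0r_neq0 (area_gt0 R))) ofR1 mul1r.
by rewrite expr1n mul1r.
Qed.

Lemma dprod_sum (I J : Type) (s : seq I) (t : seq J) (a : I -> C) (b : J -> C) (u : I -> nat) (v : J -> nat) :
  dprod (fun z => \sum_(i <- s) a i * z ^+ u i) (fun z => \sum_(j <- t) b j * z ^+ v j) =
  \sum_(i <- s) \sum_(j <- t) a i * cconj (b j) * (ofR (u i).+1%:R^-1 * (u i == v j)%:R).
Proof.
have iX i k : cintegrable pm (disc 1) (fun p => pt p ^+ i * cconj (pt p ^+ k)).
  have X n : upoly 1 (fun z : C => z ^+ n) by apply: upolyX; [exact: ler01|exact: upoly_id].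
  exact: dprod_cintegrable (X i) (X k).
rewrite /dprod (@eq_cint _ _ _ _ _ _ (fun p => \sum_(i <- s) \sum_(j <- t)
   (a i * cconj (b j)) * (pt p ^+ u i * cconj (pt p ^+ v j)))); last first.
  move=> p _; rewrite cconj_sum mulr_suml; apply: eq_bigr => i _.
  by rewrite mulr_sumr; apply: eq_bigr => j _; rewrite cconjM; ring.
rewrite cint_sum//; last by move=> i; apply: cintegrable_sum => // j; exact: cintegrableZ.
rewrite mulr_sumr; apply: eq_bigr => i _.
rewrite cint_sum//; last by move=> j; exact: cintegrableZ.
rewrite mulr_sumr; apply: eq_bigr => j _.
by rewrite cintZ// mulrCA -dprod_mono.
Qed.

Lemma cavg_circle_sum (I J : Type) (s : seq I) (t : seq J) (a : I -> C) (b : J -> C) (u : I -> nat) (v : J -> nat) :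
  cavg (fun z => z * (\sum_(i <- s) a i * z ^+ u i) * cconj (\sum_(j <- t) b j * z ^+ v j)) =
  \sum_(i <- s) \sum_(j <- t) a i * cconj (b j) * (v j == (u i).+1)%:R.
Proof.
have bX i k : bndS1 (fun z : C => (ofR 1 * z) ^+ i * ((ofR 1 * z)^-1) ^+ k).
  by exists 1 => z z1; rewrite ofR1 mul1r nrmM !nrmX nrmV z1 invr1 !expr1n mulr1.
rewrite (@eq_cavg _ _ (fun z => \sum_(i <- s) \sum_(j <- t)
   (a i * cconj (b j)) * ((ofR 1 * z) ^+ (u i).+1 * ((ofR 1 * z)^-1) ^+ v j))); last first.
  move=> z z1; rewrite cconj_sum mulr_sumr mulr_suml; apply: eq_bigr => i _.
  rewrite mulr_sumr; apply: eq_bigr => j _.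
  by rewrite cconjM cconjX ofR1 !mul1r circle_inv// exprS; ring.
have bZ i j : bndS1 (fun z => (a i * cconj (b j)) * ((ofR 1 * z) ^+ (u i).+1 * ((ofR 1 * z)^-1) ^+ v j)).
  by apply: bndS1M; [exact: bndS1_cst|exact: bX].
rewrite cavg_sum; last by move=> i; apply: bndS1_sum => j; exact: bZ.
apply: eq_bigr => i _; rewrite cavg_sum//; apply: eq_bigr => j _.
by rewrite cavgZ// cavg_monoV.
Qed.

(** Stokes's formula, checked on monomials: the pairing of [z ^ i] with the
    derivative of [z ^ (k + 1)] is one if [i = k] and zero otherwise, and so is
    the mean of [z * z ^ i * conj (z ^ (k + 1))]. The general case follows by
    approximation of [g], [F] and the derivative of [F] by polynomials. *)
Lemma dprod_derivative rho F g : 1 < rho -> holo_on rho F -> upoly 1 g ->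
  dprod g (derive1 F) = cavg (fun z => z * g z * cconj (F z)).
Proof.
move=> rho1 hF ug; pose r := (1 + rho) / 2.
have [r1 rrho] : 1 < r /\ r < rho by rewrite /r; split; lra.
have r0 : 0 < r by lra.
have hr : cauchyF r F by apply: holo_cauchy hF _; rewrite r0.
have bF : bndS1 (fun z => F (ofR r * z)).
  have [K hK] := holo_bnd hF rrho; exists K => z z1; apply: hK.
  by rewrite nrmM z1 mulr1 nrm_ofR gtr0_norm.
have r01 : (0 <= (1 : R)) && (1 < r) by rewrite ler01.
have uF : upoly 1 F by apply: holo_upoly hF _; rewrite ler01.
have uG : upoly 1 (derive1 F) by apply: holo_derive_upoly hF _; rewrite ler01.
have [A hA] := upoly_bnd ug; have [B hB] := upoly_bnd uG; have [D hD] := upoly_bnd uF.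
have n0 : nrm (0 : C) <= 1 by rewrite nrm0.
have A0 : 0 <= A by apply: le_trans (hA 0 n0); exact: nrm_ge0.
have B0 : 0 <= B by apply: le_trans (hB 0 n0); exact: nrm_ge0.
have D0 : 0 <= D by apply: le_trans (hD 0 n0); exact: nrm_ge0.
apply/eqP; rewrite -subr_eq0; apply/eqP; apply: nrm_le0_eq0 => e e0.
(* [S * d] is the total error when [g], [F] and the derivative of [F] are
   approximated up to [d <= 1] *)
pose S := 2 * (A + B + 1) + (A + D + 1).
have S0 : 0 < S by rewrite /S; lra.
pose d := Num.min 1 (e / S); have d0 : 0 < d by rewrite lt_min ltr01 divr_gt0.
have d1 : d <= 1 by rewrite ge_min lexx.
have dS : S * d <= e by rewrite mulrC -ler_pdivlMr// ge_min lexx orbT.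
pose c k := cauchy_coef r F k.
have [p hp] := ug _ d0.
have [N1 h1] : exists N0, forall N, (N0 <= N)%N -> forall w, nrm w <= 1 ->
    nrm (derive1 F w - \sum_(k < N) k.+1%:R * c k.+1 * w ^+ k) <= d.
  by apply: cauchyF_derive_series hr bF r01 _ _ d0 => w wr; apply: (holo_derive1 hF); exact: lt_trans rrho.
have [N2 h2] : exists N0, forall N, (N0 <= N)%N -> forall w, nrm w <= 1 ->
    nrm (F w - \sum_(k < N) c k * w ^+ k) <= d.
  have [K hK] := bF; pose q := r^-1.
  have q01 : 0 <= q < 1 by rewrite invr_ge0 (ltW r0)/= invf_lt1.
  have K0 : 0 <= K by apply: le_trans (hK 1 (nrm1 R)); exact: nrm_ge0.
  have [q0 q1] := andP q01; have M0 : 0 <= K * (1 - q)^-1 by rewrite mulr_ge0// invr_ge0; lra.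
  have [N0 hN] := expr_small q01 M0 d0; exists N0 => N NN w w1.
  apply: le_trans (cauchyF_series N r0 q01 _ hK hr) _; first by rewrite mulVf ?gt_eqF.
  by rewrite mulrA; exact: hN.
pose N := maxn N1 N2.
pose GN (w : C) := \sum_(k < N) k.+1%:R * c k.+1 * w ^+ k.
pose FN (w : C) := \sum_(k < N.+1) c k * w ^+ k.
have {}h1 w : nrm w <= 1 -> nrm (derive1 F w - GN w) <= d by move=> w1; apply: h1 => //; exact: leq_maxl.
have {}h2 w : nrm w <= 1 -> nrm (F w - FN w) <= d.
  by move=> w1; apply: h2 => //; apply: leqW; exact: leq_maxr.
have upol n (a : 'I_n -> C) (v : 'I_n -> nat) : upoly 1 (fun z => \sum_(k < n) a k * z ^+ v k).
  apply: (@eq_upoly _ _ (fun w => (\sum_(k < n) a k *: 'X^(v k)).[w])); last exact: upoly_poly.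
  by move=> w _; rewrite horner_sum; apply: eq_bigr => k _; rewrite hornerZ hornerXn.
have pE z : p.[z] = \sum_(i < size p) p`_i * z ^+ i by rewrite horner_coef.
have up : upoly 1 (fun z => p.[z]) by exact: upoly_poly.
have EQ : dprod (fun z => p.[z]) GN = cavg (fun z => z * p.[z] * cconj (FN z)).
  rewrite (@eq_dprod _ (fun z => \sum_(i < size p) p`_i * z ^+ i) _ GN)//.
  rewrite dprod_sum (@eq_cavg _ _ (fun z => z * (\sum_(i < size p) p`_i * z ^+ i) * cconj (FN z))); last first.
    by move=> z _; rewrite pE.
  rewrite cavg_circle_sum; apply: eq_bigr => i _.
  rewrite big_ord_recl /= mulr0 add0r; apply: eq_bigr => k _.
  rewrite /= eqSS eq_sym; case: eqVneq => [->|_]; last by rewrite !mulr0.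
  rewrite !mulr1 cconjM -(ofR_nat R) cconj_ofR.
  have -> : p`_i * (ofR i.+1%:R * cconj (c i.+1)) * ofR i.+1%:R^-1 = p`_i * cconj (c i.+1) * ofR (i.+1%:R * i.+1%:R^-1) by rewrite ofRM; ring.
  by rewrite divff// ofR1 mulr1.
have diff (x x' y y' : C) (X Y : R) : nrm x <= X -> nrm y <= Y -> nrm (x - x') <= d -> nrm (y - y') <= d ->
    nrm (x * cconj y - x' * cconj y') <= (X + Y + 1) * d.
  move=> hx hy hxx hyy.
  have -> : x * cconj y - x' * cconj y' = x * cconj (y - y') + (x - x') * cconj y - (x - x') * cconj (y - y').
    by rewrite cconjD cconjN; ring.
  have -> : (X + Y + 1) * d = X * d + d * Y + 1 * d by ring.
  apply: le_trans (nrmB _ _) (lerD _ _); first apply: le_trans (nrmD _ _) (lerD _ _).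
  - by rewrite nrmM nrm_conj; apply: ler_pM; rewrite ?nrm_ge0.
  - by rewrite nrmM nrm_conj; apply: ler_pM; rewrite ?nrm_ge0.
  - by rewrite nrmM nrm_conj; apply: ler_pM; rewrite ?nrm_ge0//; exact: le_trans d1.
have L1 : nrm (dprod g (derive1 F) - dprod (fun z => p.[z]) GN) <= 2 * ((A + B + 1) * d).
  apply: dprod_diff_le => //; first exact: upol.
  by move=> z z1; apply: diff; [exact: hA|exact: hB|exact: hp|exact: h1].
have L2 : nrm (cavg (fun z => z * g z * cconj (F z)) - cavg (fun z => z * p.[z] * cconj (FN z))) <= (A + D + 1) * d.
  have bu f : upoly 1 f -> bndS1 f by move=> /upoly_bnd[K hK]; exists K => z z1; apply: hK; rewrite z1.
  have bc f : bndS1 f -> bndS1 (fun z => cconj (f z)) by move=> [K hK]; exists K => z z1; rewrite nrm_conj hK.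
  have bz f f' : upoly 1 f -> upoly 1 f' -> bndS1 (fun z => z * f z * cconj (f' z)).
    move=> uf uf'; apply: bndS1M; last by apply: bc; exact: bu.
    by apply: bndS1M; [apply: bu; exact: upoly_id|exact: bu].
  rewrite -cavgB; [|exact: bz|by apply: bz => //; exact: upol].
  apply: cavg_le0 => z z1; rewrite -!mulrA -mulrBr nrmM z1 mul1r.
  by apply: diff; [apply: hA|apply: hD|apply: hp|apply: h2]; rewrite z1.
apply: le_trans dS; rewrite -[dprod g _](subrK (dprod (fun z => p.[z]) GN)) EQ -addrA.
apply: le_trans (nrmD _ _) _; rewrite -EQ.
have -> : S * d = 2 * ((A + B + 1) * d) + (A + D + 1) * d by rewrite /S; ring.
by apply: lerD => //; rewrite EQ -nrmN opprB.
Qed.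

End pairing.

Section inner_functions.
Variable R : realType.
Local Notation C := (Cplx R).
Implicit Types f g : C -> C.

Lemma dprodZr (c : C) g f : upoly 1 g -> upoly 1 f ->
  dprod g (fun z => c * f z) = cconj c * dprod g f.
Proof.
move=> ug uf; have i1 := dprod_cintegrable ug uf; have md := @measurable_disc R 1.
rewrite /dprod mulrCA -(cintZ md (cconj c) i1).
by congr (_ * _); apply: eq_cint => p _; rewrite cconjM mulrCA.
Qed.

Lemma dprod_conj f g : upoly 1 f -> upoly 1 g -> dprod g f = cconj (dprod f g).
Proof.
move=> uf ug; have i1 := dprod_cintegrable uf ug; have md := @measurable_disc R 1.
rewrite /dprod cconjM cconj_ofR -(cint_conj md i1).
by congr (_ * _); apply: eq_cint => p _; rewrite cconjM cconjK mulrC.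
Qed.

(** Holomorphic past the closed disc, of modulus one on the circle, with
    winding number [m] there; a finite Blaschke product of order [m]. *)
Record inner (b : C -> C) (m : nat) : Prop := Inner {
  inner_holo : exists2 rho : R, 1 < rho & holo_on rho b;
  inner_circle : forall z, nrm z = 1 -> nrm (b z) = 1;
  inner_disc : forall z, nrm z < 1 -> nrm (b z) < 1;
  inner_winding : cavg (fun z => z * derive1 b z * cconj (b z)) = m%:R }.

Variables (b : C -> C) (m : nat).
Hypothesis hb : inner b m.
Let b' := derive1 b.

Lemma inner_upoly : upoly 1 b.
Proof. by have [rho r1 h] := inner_holo hb; apply: holo_upoly h _; rewrite ler01. Qed.

Lemma inner_derive_upoly : upoly 1 b'.
Proof. by have [rho r1 h] := inner_holo hb; apply: holo_derive_upoly h _; rewrite ler01. Qed.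

Lemma inner_pow_upoly n : upoly 1 (fun z => b z ^+ n * b' z).
Proof.
apply: upolyM; [exact: ler01| |exact: inner_derive_upoly].
by apply: upolyX; [exact: ler01|exact: inner_upoly].
Qed.

(** [b ^ n * b'] is, up to a constant, the derivative of [b ^ (n + 1)]. *)
Lemma dprod_inner g n : upoly 1 g ->
  dprod g (fun z => b z ^+ n * b' z) = ofR n.+1%:R^-1 * cavg (fun z => z * g z * cconj (b z) ^+ n.+1).
Proof.
move=> ug; have [rho r1 h] := inner_holo hb.
have := dprod_derivative r1 (holoX n.+1 h) ug.
rewrite (@eq_cavg _ _ (fun z => z * g z * cconj (b z) ^+ n.+1)); last by move=> z _; rewrite cconjX.
move=> <-; rewrite (@eq_dprod _ _ g (derive1 _) (fun z => ofR n.+1%:R * (b z ^+ n * b' z)))//.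
  rewrite dprodZr//; last exact: inner_pow_upoly.
  by rewrite cconj_ofR mulrA -ofRM mulVf// ofR1 mul1r.
move=> z z1; have zr : nrm z < rho by exact: lt_trans r1.
by rewrite (cdiff_derive1 (cdiffX n (holo_derive1 h zr))) ofR_nat mulrA.
Qed.

(** On the circle [b * conj b = 1], which lowers the power of [conj b] by
    one. For [n = 0] the boundary integral is the mean of [z * f], which
    vanishes. *)
Lemma dprod_inner_shift f n : upoly 1 f ->
  dprod (fun z => b z * f z) (fun z => b z ^+ n * b' z) =
  ofR (n%:R / n.+1%:R) * dprod f (fun z => b z ^+ n.-1 * b' z).
Proof.
move=> uf; have ubf : upoly 1 (fun z => b z * f z) by apply: upolyM; [exact: ler01|exact: inner_upoly|].
rewrite dprod_inner//.
rewrite (@eq_cavg _ _ (fun z => z * f z * cconj (b z) ^+ n)); last first.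
  move=> z z1; rewrite exprS.
  rewrite (_ : _ * _ = z * f z * cconj (b z) ^+ n * (b z * cconj (b z))); last by ring.
  by rewrite (circle_conj (inner_circle hb z1)) mulr1.
case: n => [|n].
  rewrite mul0r ofR0 mul0r (@eq_cavg _ _ (fun z => z * f z)) ?cavg_id_mul ?mulr0//.
  by move=> z _; rewrite expr0 mulr1.
rewrite [in RHS]dprod_inner// [RHS]mulrA -ofRM; congr (ofR _ * _).
field; rewrite -!natr1; have n0 : (0 : R) <= n%:R by []; apply/andP; split; lra.
Qed.

(** Induction on [i] by [dprod_inner_shift]; the winding number is the value
    at [i = j = 0]. *)
Lemma dprod_inner_gram i j : dprod (fun z => b z ^+ i * b' z) (fun z => b z ^+ j * b' z) =
  ofR (m%:R / i.+1%:R) * (i == j)%:R.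
Proof.
elim: i j => [|i IH] j.
  case: j => [|j].
    rewrite dprod_inner; last exact: inner_pow_upoly.
    rewrite (@eq_cavg _ _ (fun z => z * b' z * cconj (b z))); last first.
      by move=> z _; rewrite expr0 mul1r expr1.
    by rewrite (inner_winding hb) !invr1 ofR1 mul1r mulr1 eqxx mulr1 ofR_nat.
  rewrite dprod_conj; try exact: inner_pow_upoly.
  rewrite (@eq_dprod _ _ (fun z => b z * (b z ^+ j * b' z)) _ (fun z => b z ^+ 0 * b' z))//; last first.
    by move=> z _; rewrite exprS mulrA.
  rewrite dprod_inner_shift; last exact: inner_pow_upoly.
  by rewrite mul0r ofR0 mul0r cconj0 mulr0.
rewrite (@eq_dprod _ _ (fun z => b z * (b z ^+ i * b' z)) _ (fun z => b z ^+ j * b' z))//; last first.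
  by move=> z _; rewrite exprS mulrA.
rewrite dprod_inner_shift; last exact: inner_pow_upoly.
rewrite IH; case: j => [|j] /=; first by rewrite !(mul0r, ofR0, mulr0).
rewrite eqSS; case: eqVneq => [->|_]; last by rewrite !mulr0.
rewrite !mulr1 -ofRM; congr ofR; field.
by rewrite -!natr1; have n0 : (0 : R) <= j%:R by []; apply/andP; split; lra.
Qed.

End inner_functions.

(** * Tensor products and composition on the polydisc *)

Section tensor_functions.
Variables (R : realType) (d : nat).
Local Notation C := (Cplx R).
Local Notation Vd := 'rV[C]_d.
Local Notation index := {ffun 'I_d -> nat}.
Local Notation vol := (volume R d).
Local Notation A2 := (@bergman R d).
Local Notation ip := (@bergman_ip R d).

Definition tensor (phi : 'I_d -> C -> C) (z : Vd) : C := \prod_i phi i (z ord0 i).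

(** A product of functions satisfying Cauchy's formula satisfies it in each
    variable separately. *)
Lemma tensor_frechet phi : (forall i, upoly 1 (phi i)) -> frechet_on_polydisc (tensor phi).
Proof.
move=> up z /polydiscP hz; have [K hK] := choice (fun i => upoly_bnd (up i)).
have bT : bndD 1 (tensor phi).
  exists (\prod_i K i) => x xz; rewrite nrm_prod; apply: ler_prod => i _.
  by rewrite nrm_ge0 hK.
apply: (reproduces_frechet ltr01 bT _ hz).
apply: separately_cauchy_reproduces => // x i xz.
apply: upoly_cauchy => //.
have := upolyM ler01 (up i) (@upoly_cst _ 1 (\prod_(j < d | j != i) phi j (x ord0 j))).
apply: eq_upoly => w _; rewrite /tensor [RHS](bigD1 i)//= setc_same; congr (_ * _).
by apply: eq_bigr => j ji; rewrite setc_other.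
Qed.

(** Fubini's theorem reduces inner products to one variable. *)
Lemma ip_tensor phi chi : (forall i, upoly 1 (phi i)) -> (forall i, upoly 1 (chi i)) ->
  ip (extend0 (tensor phi)) (extend0 (tensor chi)) = \prod_i dprod (phi i) (chi i).
Proof.
move=> uphi uchi; have [_ h] := @cint_pcr R d 1 (fun i p => phi i (pt p) * cconj (chi i (pt p)))
  (fun i => dprod_cintegrable (uphi i) (uchi i)).
rewrite ipE (@eq_cint _ _ _ _ _ _ (fun t => \prod_i (phi i (pt (tnth t i)) * cconj (chi i (pt (tnth t i)))))).
  rewrite h /dprod big_split /= prodr_const card_ord; congr (_ * _).
  by rewrite -ofRX exprVn.
move=> t ht; rewrite !hat_ext0// /hat /tensor cconj_prod -big_split; apply: eq_bigr => i _.
by rewrite /= !point_ofE.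
Qed.

Lemma tensor_A2 phi : (forall i, upoly 1 (phi i)) -> A2 (extend0 (tensor phi)).
Proof.
move=> up; have mp := @measurable_pcr R d 1; have hf := tensor_frechet up.
have [K hK] := choice (fun i => upoly_bnd (up i)).
apply/bergmanP; split.
- by move=> z; exact: extend0F.
- apply: series_holo; apply: eq_unif_series (holo_series hf) => z hz.
  by rewrite extend0E.
- have L1 : L2 vol (pcr 1) (fun t => ofR 1).
    have := L2_psum (fun=> 1) [:: [ffun=> 0%N] : index] (ltr01 : 0 < (1 : R)).
    apply: eq_L2 => // t _; rewrite /hat /psum big_seq1 mul1r /mono big1// => i _.
    by rewrite ffunE expr0.
  have L := @L2_mul_bnd _ _ _ vol _ mp (hat (tensor phi)) (\prod_i K i) _ (cmeas_series (holo_series hf)) _ L1.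
  apply: eq_L2 (L _) => //.
    by move=> t ht; rewrite hat_ext0// ofR1 mulr1.
  move=> t /pcr_Dball ht; rewrite nrm_prod; apply: ler_prod => i _.
  by rewrite nrm_ge0 hK.
Qed.

(** Chain rule for a map acting separately on the coordinates. *)
Lemma frechet_comp_coord (psi : Vd -> C) (b : 'I_d -> C -> C) (z : Vd) (l : 'I_d -> C) c :
  (forall i, cdiff_at (b i) (z ord0 i) (l i)) ->
  frechet_at psi (\row_i b i (z ord0 i)) c ->
  frechet_at (fun x : Vd => psi (\row_i b i (x ord0 i))) z (fun i => l i * c i).
Proof.
move=> hb hpsi e e0; pose w : Vd := \row_i b i (z ord0 i).
pose M := 1 + \sum_i nrm (l i).
have M1 : 1 <= M by rewrite lerDl; apply: sumr_ge0 => i _; exact: nrm_ge0.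
have lM i : nrm (l i) + 1 <= M.
  rewrite /M addrC lerD2l (bigD1 i)//= lerDl; apply: sumr_ge0 => j _; exact: nrm_ge0.
pose D := 1 + \sum_i nrm (c i).
have D1 : 1 <= D by rewrite lerDl; apply: sumr_ge0 => i _; exact: nrm_ge0.
have cD i : nrm (c i) <= D.
  rewrite /D (bigD1 i)//= addrCA lerDl addr_ge0//; apply: sumr_ge0 => j _; exact: nrm_ge0.
have e1 : 0 < e / 2 / M by rewrite !divr_gt0//; lra.
have [r1 r10 h1] := hpsi _ e1.
pose e2 := Num.min 1 (e / 2 / D).
have e20 : 0 < e2 by rewrite lt_min ltr01 !divr_gt0//; lra.
have [r hr] := choice (fun i => let: ex_intro2 r h1 h2 := hb i e2 e20 in
  ex_intro (fun r => 0 < r /\ forall h, nrm h < r ->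
    nrm (b i (z ord0 i + h) - b i (z ord0 i) - l i * h) <= e2 * nrm h) r (conj h1 h2)).
pose r0 := \big[Num.min/(r1 / M)]_(i < d) r i.
have r00 : 0 < r0.
  apply/bigmin_gtP; split; first by rewrite divr_gt0//; lra.
  by move=> i _; case: (hr i).
exists r0 => // h hh.
pose k : Vd := \row_i (b i (z ord0 i + h ord0 i) - b i (z ord0 i)).
have h2 i : nrm (k ord0 i - l i * h ord0 i) <= e2 * nrm (h ord0 i).
  rewrite mxE; apply: (hr i).2; apply: lt_le_trans (hh i) _; exact: bigmin_le_cond.
have kh i : nrm (k ord0 i) <= M * nrm (h ord0 i).
  rewrite -[X in nrm X](subrK (l i * h ord0 i)); apply: le_trans (nrmD _ _) _.
  rewrite nrmM; apply: (@le_trans _ _ (1 * nrm (h ord0 i) + nrm (l i) * nrm (h ord0 i))).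
    rewrite lerD2r; apply: le_trans (h2 i) _; rewrite ler_wpM2r ?nrm_ge0// ge_min lexx//.
  by rewrite -mulrDl addrC ler_wpM2r ?nrm_ge0.
have kr i : nrm (k ord0 i) < r1.
  apply: le_lt_trans (kh i) _; rewrite mulrC -ltr_pdivlMr; last by lra.
  by apply: lt_le_trans (hh i) _; exact: bigmin_le_id.
have E : \row_i b i ((z + h) ord0 i) = w + k.
  by apply/rowP => i; rewrite !mxE subrKC.
rewrite E -/w.
have -> : psi (w + k) - psi w - \sum_i h ord0 i * (l i * c i) =
    (psi (w + k) - psi w - \sum_i k ord0 i * c i) + \sum_i (k ord0 i - l i * h ord0 i) * c i.
  have -> : \sum_i (k ord0 i - l i * h ord0 i) * c i = \sum_i k ord0 i * c i - \sum_i h ord0 i * (l i * c i).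
    by rewrite -sumrB; apply: eq_bigr => i _; ring.
  by ring.
apply: le_trans (nrmD _ _) _; rewrite (splitr e) mulrDl; apply: lerD.
  apply: le_trans (h1 k kr) _.
  have -> : e / 2 * sum_nrm h = e / 2 / M * (M * sum_nrm h) by rewrite mulrA divfK// gt_eqF//; lra.
  rewrite ler_wpM2l ?(ltW e1)// /sum_nrm mulr_sumr; apply: ler_sum => i _; exact: kh.
apply: le_trans (nrm_sum _ _ _) _; rewrite /sum_nrm mulr_sumr; apply: ler_sum => i _.
rewrite nrmM; have -> : e / 2 * nrm (h ord0 i) = e / 2 / D * nrm (h ord0 i) * D.
  by rewrite [RHS]mulrAC divfK// gt_eqF//; lra.
apply: ler_pM; rewrite ?nrm_ge0//; apply: le_trans (h2 i) _.
by rewrite ler_wpM2r ?nrm_ge0// ge_min lexx orbT.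
Qed.

End tensor_functions.

(** * The isometry Gamma *)

Section gamma.
Variables (R : realType) (d : nat).
Local Notation C := (Cplx R).
Local Notation Vd := 'rV[C]_d.
Local Notation index := {ffun 'I_d -> nat}.
Local Notation A2 := (@bergman R d).
Local Notation ip := (@bergman_ip R d).
Local Notation sq := (sq ip).
Local Notation Em := (@bmonomial R d).
Local Notation w := (@wt R d).
Local Notation ph := (@A2_prehilbert R d).
Variables (m : 'I_d -> nat) (B b : 'I_d -> C -> C).
Hypothesis m0 : forall i, (0 < m i)%N.
Hypothesis hb : forall i, inner (b i) (m i).
Hypothesis Bb : forall i z, nrm z < 1 -> B i z = b i z.
Implicit Types (f g psi : Vd -> C) (alpha beta gam : index) (z : Vd).

Local Notation mm := (\prod_i m i)%N.
Local Notation G := (Gamma B mm).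
Local Notation T := (multiplication_tuple B).
Let kap : C := ofR (Num.sqrt mm%:R)^-1.

Lemma eq_frechet_on f g : (forall z, polydisc z -> f z = g z) ->
  frechet_on_polydisc f -> frechet_on_polydisc g.
Proof. by move=> fg hf; apply: series_holo; apply: eq_unif_series (holo_series hf). Qed.

Lemma holomorphic_frechet f : holomorphic_on (@polydisc R d) f <-> frechet_on_polydisc f.
Proof.
split=> h z hz; first by exact/differentiable_frechet/h.
by have [c] := h z hz; exact: frechet_differentiable.
Qed.

Lemma derive1_B i (x : C) : nrm x < 1 -> derive1 (B i) x = derive1 (b i) x.
Proof.
move=> x1; have [rho r1 hr] := inner_holo (hb i).
apply: cdiff_derive1; apply: (@near_cdiff _ (b i) _ x _ (1 - nrm x)); [lra| |exact: (holo_derive1 hr (lt_trans x1 r1))].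
move=> h hh; apply/esym/Bb; apply: le_lt_trans (nrmD _ _) _; lra.
Qed.

Lemma product_mapE z : polydisc z -> product_map B z = \row_i b i (z ord0 i).
Proof. by move=> /polydiscP hz; apply/rowP => i; rewrite !mxE Bb. Qed.

Lemma product_map_polydisc z : polydisc z -> polydisc (product_map B z).
Proof.
move=> /polydiscP hz; apply/polydiscP => i; rewrite mxE Bb//.
exact: inner_disc (hz i).
Qed.

Definition jac : Vd -> C := tensor (fun i => derive1 (b i)).

Lemma jacobianE z : polydisc z -> jacobian_det B z = jac z.
Proof. by move=> /polydiscP hz; apply: eq_bigr => i _; rewrite derive1_B. Qed.

Lemma GammaE psi z : polydisc z -> G psi z = kap * (psi (product_map B z) * jac z).
Proof. by move=> hz; rewrite /Gamma (extend0E _ hz) (jacobianE hz). Qed.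

Lemma GammaF psi z : ~ polydisc z -> G psi z = 0.
Proof. exact: extend0F. Qed.

Lemma Gamma_lin (a : C) f g : G (a *: f + g) = a *: G f + G g.
Proof.
apply/funext => z; have E (u v : Vd -> C) : (a *: u + v) z = a * u z + v z by [].
rewrite E; have [hz|hz] := pselect (polydisc z); last by rewrite !(GammaF _ hz) mulr0 addr0.
rewrite !GammaE//; have -> : (a *: f + g) (product_map B z) = a * f (product_map B z) + g (product_map B z) by [].
ring.
Qed.

(** The factors of [J_B * B ^ alpha]. *)
Definition monoB alpha i (x : C) : C := b i x ^+ alpha i * derive1 (b i) x.

Lemma monoB_upoly alpha i : upoly 1 (monoB alpha i).
Proof. exact: (inner_pow_upoly (hb i)). Qed.

Lemma Gamma_monomial alpha : G (Em alpha) = kap *: extend0 (tensor (monoB alpha)).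
Proof.
apply/funext => z; have -> : (kap *: extend0 (tensor (monoB alpha))) z = kap * extend0 (tensor (monoB alpha)) z by [].
have [hz|hz] := pselect (polydisc z); last by rewrite (GammaF _ hz) (extend0F _ hz) mulr0.
rewrite GammaE// /bmonomial !extend0E//; last exact: product_map_polydisc.
congr (_ * _); rewrite /mono /jac /tensor -big_split; apply: eq_bigr => i _ /=.
by rewrite mxE Bb//; move/polydiscP: hz.
Qed.

Lemma Gamma_monomial_A2 alpha : A2 (G (Em alpha)).
Proof.
by rewrite Gamma_monomial; apply: (phZ ph); apply: tensor_A2 => i; exact: monoB_upoly.
Qed.

Lemma mm_gt0 : 0 < (mm%:R : R).
Proof. by rewrite ltr0n prodn_gt0. Qed.

Lemma kap_conj : kap * cconj kap = ofR mm%:R^-1.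
Proof. by rewrite /kap cconj_ofR -ofRM -invfM -expr2 sqr_sqrtr// ltW// mm_gt0. Qed.

Lemma Gamma_gram alpha beta : ip (G (Em alpha)) (G (Em beta)) = ofR (w alpha) * (alpha == beta)%:R.
Proof.
have At gam : A2 (extend0 (tensor (monoB gam))) by apply: tensor_A2 => i; exact: monoB_upoly.
rewrite !Gamma_monomial (ipZl ph kap (At alpha) (phZ ph kap (At beta))) (ipZr ph kap (At beta) (At alpha)).
rewrite mulrA kap_conj (ip_tensor (monoB_upoly alpha) (monoB_upoly beta)).
have E i : dprod (monoB alpha i) (monoB beta i) =
    ofR ((m i)%:R / (alpha i).+1%:R) * (alpha i == beta i)%:R := dprod_inner_gram (hb i) _ _.
rewrite (eq_bigr _ (fun i _ => E i)).
rewrite big_split /= -ofR_prod mulrA -ofRM big_split /= mulrA natr_prod mulVf ?mul1r; last first.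
  by rewrite -natr_prod gt_eqF ?mm_gt0.
congr (_ * _); case: eqVneq => [->|ab]; first by rewrite big1// => i _; rewrite eqxx.
have [i ai] : exists i, alpha i != beta i.
  apply/existsP; apply: contraNT ab => /existsPn h; apply/eqP/ffunP => i.
  by apply/eqP; have := h i; rewrite negbK.
by rewrite (bigD1 i)//= (negbTE ai) mul0r.
Qed.

Lemma T_contraction i : linear_contraction A2 ip (T i).
Proof.
apply: multiplication_contraction.
  apply/holomorphic_frechet.
  apply: eq_frechet_on (tensor_frechet (phi := fun j => if j == i then b i else fun=> 1) _) => [z hz|j].
    rewrite /tensor (bigD1 i)//= eqxx big1 ?mulr1 => [|j /negbTE ->//].
    by rewrite Bb//; move/polydiscP: hz.
  by case: eqP => [_|_]; [exact: inner_upoly (hb i)|exact: upoly_cst].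
by move=> z /polydiscP hz; rewrite Bb//; apply: ltW; exact: inner_disc (hz i).
Qed.

Let monoX gam j (x : C) : C := x ^+ gam j.

Let monoX_upoly gam j : upoly 1 (monoX gam j).
Proof. by apply: upolyX; [exact: ler01|exact: upoly_id]. Qed.

Let monomial_tensor gam : Em gam = extend0 (tensor (monoX gam)).
Proof. by []. Qed.

Let T_monomial i gam : T i (Em gam) =
  extend0 (tensor (fun j x => if j == i then b i x * monoX gam j x else monoX gam j x)).
Proof.
apply/funext => z; rewrite /multiplication_tuple /multiplication.
have [hz|hz] := pselect (polydisc z); last by rewrite /bmonomial !(extend0F _ hz) mulr0.
rewrite /bmonomial !extend0E// /tensor /mono (bigD1 i)//= [RHS](bigD1 i)//= eqxx mulrA Bb; last by move/polydiscP: hz.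
by congr (_ * _); apply: eq_bigr => j /negbTE ->.
Qed.

(** The factors other than the [i]-th are untouched, so that the one-variable
    identity [dprod_inner_shift] applies. *)
Let T_Gamma_mono i gam alpha : ip (T i (Em gam)) (G (Em alpha)) =
  ofR ((alpha i)%:R / (alpha i).+1%:R) * ip (Em gam) (G (Em (dec i alpha))).
Proof.
have uT j : upoly 1 (fun x => if j == i then b i x * monoX gam j x else monoX gam j x).
  case: (j == i); last exact: monoX_upoly.
  by apply: upolyM; [exact: ler01|exact: inner_upoly (hb i)|exact: monoX_upoly].
have At alpha' : A2 (extend0 (tensor (monoB alpha'))) by apply: tensor_A2 => j; exact: monoB_upoly.
have Ae : A2 (Em gam) by exact: monomial_A2.
have AT : A2 (T i (Em gam)) by exact: (contr_H (T_contraction i)).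
rewrite !Gamma_monomial (ipZr ph kap (At _) AT) (ipZr ph kap (At _) Ae) mulrCA; congr (_ * _).
rewrite T_monomial monomial_tensor (ip_tensor uT (monoB_upoly alpha)) (ip_tensor (monoX_upoly gam) (monoB_upoly _)).
rewrite (bigD1 i)//= [in RHS](bigD1 i)//= eqxx mulrA; congr (_ * _).
  have -> : monoB (dec i alpha) i = (fun x => b i x ^+ (alpha i).-1 * derive1 (b i) x).
    by apply/funext => x; rewrite /monoB ffunE eqxx.
  exact: (dprod_inner_shift (hb i) (alpha i) (monoX_upoly gam i)).
apply: eq_bigr => j /negbTE ji; rewrite ji; congr dprod.
by apply/funext => x; rewrite /monoB ffunE ji.
Qed.

(** This is the statement that the adjoint of [T i] lowers [alpha i] on the
    image of the monomials, with the same weights as for the multishift. *)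
Lemma T_Gamma i alpha f : A2 f -> ip (T i f) (G (Em alpha)) =
  ofR ((alpha i)%:R / (alpha i).+1%:R) * ip f (G (Em (dec i alpha))).
Proof.
set la := (_ / _)%R => Af; have A1 := Gamma_monomial_A2 alpha; have A1' := Gamma_monomial_A2 (dec i alpha).
have E f' : A2 f' -> ofR la * ip f' (G (Em (dec i alpha))) = ip f' (ofR la *: G (Em (dec i alpha))).
  by move=> Af'; rewrite (ipZr ph (ofR la) A1' Af') cconj_ofR.
rewrite (E f Af).
exact: (contr_adj_eq ph (@monomial_A2 R d) (@A2_dense R d) (T_contraction i) A1 (phZ ph (ofR la) A1')
  (fun gam => etrans (T_Gamma_mono i gam alpha) (E _ (monomial_A2 R gam))) Af).
Qed.

(** ** Gamma on the whole Bergman space *)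

Let EA := @monomial_A2 R d.
Let EO := @monomial_orth R d.
Let ED := @A2_dense R d.

Lemma Gamma_frechet psi : frechet_on_polydisc psi -> frechet_on_polydisc (G psi).
Proof.
move=> hpsi.
have h1 : frechet_on_polydisc (fun z : Vd => psi (\row_i b i (z ord0 i))).
  move=> z hz; have hz' := product_map_polydisc hz; rewrite product_mapE// in hz'.
  have [c hc] := hpsi _ hz'.
  exists (fun i => derive1 (b i) (z ord0 i) * c i); refine (frechet_comp_coord _ hc) => i.
  have [rho r1 hr] := inner_holo (hb i); apply: (holo_derive1 hr).
  by apply: lt_trans r1; move/polydiscP: hz.
have h2 : frechet_on_polydisc jac by apply: tensor_frechet => i; exact: inner_derive_upoly (hb i).
have h3 : holomorphic_on (@polydisc R d) (kap *: (fun z => psi (\row_i b i (z ord0 i)) * jac z)).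
  move=> z hz; apply: differentiableZ.
  by apply: (holomorphicM _ _ hz); exact/holomorphic_frechet.
apply: eq_frechet_on ((holomorphic_frechet _).1 h3) => z hz.
by rewrite (GammaE _ hz) (product_mapE hz).
Qed.

Let p (c : index -> C) N : Vd -> C := \sum_(alpha <- box d N) c alpha *: Em alpha.

Let Gamma_sum c N : G (p c N) = \sum_(alpha <- box d N) c alpha *: G (Em alpha).
Proof.
rewrite /p; elim: (box d N) => [|alpha s IH].
  rewrite !big_nil; have := Gamma_lin (-1) 0 0.
  by rewrite !scaleN1r !addNr.
by rewrite !big_cons Gamma_lin IH.
Qed.

Let Gamma_p_A2 c N : A2 (G (p c N)).
Proof. by rewrite Gamma_sum; apply: (ph_sum ph) => alpha; apply: (phZ ph); exact: Gamma_monomial_A2. Qed.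

Let sq_Gamma_p c N : sq (G (p c N)) = \sum_(alpha <- box d N) nrm (c alpha) ^+ 2 * w alpha.
Proof.
have GZ alpha (a : C) : A2 (a *: G (Em alpha)) by apply: (phZ ph); exact: Gamma_monomial_A2.
suff : ofR (sq (G (p c N))) = ofR (\sum_(alpha <- box d N) nrm (c alpha) ^+ 2 * w alpha) by case.
rewrite -(ip_self ph (Gamma_p_A2 c N)) Gamma_sum.
have AS : A2 (\sum_(alpha <- box d N) c alpha *: G (Em alpha)) by rewrite -Gamma_sum.
rewrite (ip_suml ph _ (fun alpha => GZ alpha (c alpha)) AS) ofR_sum.
rewrite big_seq [RHS]big_seq; apply: eq_bigr => alpha as_.
rewrite (ip_sumr ph _ (fun beta => GZ beta (c beta)) (GZ alpha (c alpha))).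
have E beta : ip (c alpha *: G (Em alpha)) (c beta *: G (Em beta)) =
    c alpha * cconj (c beta) * (ofR (w alpha) * (alpha == beta)%:R).
  rewrite (ipZl ph (c alpha) (Gamma_monomial_A2 alpha) (GZ beta (c beta))).
  by rewrite (ipZr ph (c beta) (Gamma_monomial_A2 beta) (Gamma_monomial_A2 alpha)) Gamma_gram mulrA.
rewrite (eq_bigr _ (fun beta _ => E beta)) (bigD1_seq alpha) ?box_uniq//= big1 => [|beta /negbTE ba].
  by rewrite eqxx mulr1 addr0 mul_conj ofRM.
by rewrite eq_sym ba !mulr0.
Qed.

(** By Fatou's lemma, since [Gamma] is isometric on polynomials and preserves
    pointwise convergence. *)
Lemma Gamma_bound psi : A2 psi -> A2 (G psi) /\ sq (G psi) <= sq psi.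
Proof.
move=> Ap; have hs := bergman_series Ap.
apply: (@A2_limit R d (G psi) (fun N => G (p (fc ip Em psi) N)) (sq psi)).
- exact: GammaF.
- by case/bergmanP: Ap => _ h _; exact: Gamma_frechet.
- by move=> N; exact: Gamma_p_A2.
- by move=> N; rewrite sq_Gamma_p; apply: (bessel ph EA EO) => //; exact: box_uniq.
move=> z hz e e0; have hz' := product_map_polydisc hz.
pose K := nrm (kap * jac z) + 1; have K0 : 0 < K by rewrite /K; have := nrm_ge0 (kap * jac z); lra.
have e1 : 0 < e / K by rewrite divr_gt0.
have [N0 hN] := unif_series_cvg hs hz' e1; exists N0 => N NN.
set q := p _ N.
have -> : G q z - G psi z = (q (product_map B z) - psi (product_map B z)) * (kap * jac z).
  by rewrite !(GammaE _ hz); ring.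
rewrite nrmM.
have -> : e = e / K * K by rewrite divfK// gt_eqF.
apply: ler_pM; rewrite ?nrm_ge0//; last by rewrite /K; lra.
rewrite -nrmN opprB; apply: le_trans (hN N NN).
rewrite le_eqVlt; apply/orP; left; apply/eqP; congr (nrm (_ - _)).
rewrite /q /p (monomial_sumE _ _ hz'); apply: eq_bigr => alpha _.
by rewrite (fc_series _ Ap hs).
Qed.

Lemma Gamma_contraction : linear_contraction A2 ip G.
Proof.
split=> [f /Gamma_bound[]//|a f g _ _|f /Gamma_bound[]//]; exact: Gamma_lin.
Qed.

Lemma Gamma_iso f g : A2 f -> A2 g -> ip (G f) (G g) = ip f g.
Proof.
move=> Af Ag; have GC := Gamma_contraction.
have step psi beta : A2 psi -> ip (G psi) (G (Em beta)) = ip psi (Em beta).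
  move=> Ap; refine (contr_adj_eq ph EA ED GC (Gamma_monomial_A2 beta) (EA beta) _ Ap) => alpha.
  by rewrite Gamma_gram EO.
refine (contr_adj_eq ph EA ED GC (contr_H GC Ag) Ag _ Af) => alpha.
rewrite (ph_conj ph (contr_H GC Ag) (Gamma_monomial_A2 alpha)) (step _ _ Ag).
by rewrite -(ph_conj ph Ag (EA alpha)).
Qed.

Lemma T_Gamma_commute i f : A2 f -> T i (G f) = G (bergman_multishift i f).
Proof.
move=> Af; apply/funext => z; rewrite /multiplication_tuple /bergman_multishift /multiplication.
have [hz|hz] := pselect (polydisc z); last by rewrite !(GammaF _ hz) mulr0.
by rewrite !(GammaE _ hz) mxE; ring.
Qed.

End gamma.

(** * Blaschke products of order one and of higher order *)

Section order.
Variable R : realType.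
Local Notation C := (Cplx R).

(** The two obstructions to the surjectivity of [Gamma] that a Blaschke
    product of order at least two presents. *)
Definition degenerate (c : C -> C) := (exists2 p, nrm p < 1 & derive1 c p = 0) \/
  (exists p q, [/\ nrm p < 1, nrm q < 1, p != q & c p = c q]).

Definition disc_inverse (c g : C -> C) := [/\ upoly 1 g,
  forall z, nrm z < 1 -> nrm (g z) < 1, forall z, nrm z < 1 -> g (c z) = z &
  forall z, nrm z < 1 -> c (g z) = z].

Lemma inner_blaschke (theta : R) n (a : 'I_n -> C) (k : 'I_n -> nat) :
  (forall j, nrm (a j) < 1) -> (0 < \sum_j k j)%N -> inner (blaschke theta a k) (\sum_j k j).
Proof.
move=> a1 k0; split.
- exact: blaschke_holo.
- by move=> z; exact: blaschke_circle.
- by move=> z; exact: blaschke_disc.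
- exact: blaschke_winding.
Qed.

Lemma blaschke_zero (theta : R) n (a : 'I_n -> C) (k : 'I_n -> nat) j :
  (0 < k j)%N -> blaschke theta a k (a j) = 0.
Proof.
move=> kj; rewrite /blaschke (bigD1 j)//= /bl subrr mul0r expr0n -(negbK (k j == 0)%N).
by rewrite -lt0n kj /= mul0r mulr0.
Qed.

Lemma blaschke_double_zero (theta : R) n (a : 'I_n -> C) (k : 'I_n -> nat) j :
  (forall i, nrm (a i) < 1) -> (1 < k j)%N -> derive1 (blaschke theta a k) (a j) = 0.
Proof.
move=> a1 kj; have [r1 r11 h1] := bl_holo (a1 j).
have [k' k'E] : exists k', k j = k'.+2 by exists (k j).-2; rewrite -subn2; lia.
have den : 1 - cconj (a j) * a j != 0 by apply: bl_den1 => //; exact: ltW.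
have D1 := cdiffX k'.+1 (bl_cdiff den).
have b0 : bl (a j) (a j) = 0 by rewrite /bl subrr mul0r.
rewrite b0 expr0n /= mulr0 mul0r in D1.
have [r2 r21 h2] : exists2 rho : R, 1 < rho & holo_on rho (fun z => \prod_(i < n | i != j) bl (a i) z ^+ k i).
  have [rho rho1 h] := blaschke_holo theta (fun i => if i == j then 0%N else k i) a1.
  exists rho => //.
  have := holoM (@holo_cst R rho (expi theta)^-1) h.
  congr holo_on; apply/funext => z; rewrite /blaschke mulrA mulVf ?mul1r; last first.
    by rewrite -nrm_gt0 nrm_expi.
  rewrite [RHS]big_mkcond; apply: eq_bigr => i _; case: eqP => //= _.
have zr : nrm (a j) < r2 by exact: lt_trans (a1 j) r21.
have [l hl] := h2 _ zr; apply: cdiff_derive1.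
apply: eq_cdiff (cdiffZ (expi theta) (cdiffM D1 hl)).
  by apply/funext => z; rewrite /blaschke [in RHS](bigD1 j)//= k'E.
by rewrite b0 expr0n /=; ring.
Qed.

(** Either some zero is multiple, or there are two distinct zeros. *)
Lemma blaschke_degenerate (theta : R) n (a : 'I_n -> C) (k : 'I_n -> nat) :
  injective a -> (forall i, nrm (a i) < 1) -> (forall i, 0 < k i)%N -> (1 < \sum_i k i)%N ->
  degenerate (blaschke theta a k).
Proof.
move=> inja a1 k0 k1.
have [/existsP[j kj]|/existsPn h] := boolP [exists j, (1 < k j)%N].
  by left; exists (a j); [exact: a1|exact: blaschke_double_zero].
have kE i : k i = 1%N by have := h i; have := k0 i; lia.
have n1 : (1 < n)%N.
  by move: k1; rewrite (eq_bigr (fun=> 1%N)) ?sum1_card ?card_ord// => i _; rewrite kE.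
right; exists (a (Ordinal (ltnW n1))), (a (Ordinal n1)); split => //.
  by rewrite (inj_eq inja).
by rewrite !blaschke_zero.
Qed.

(** The inverse of [u * bl p] with [|u| = 1] is [u^-1 * bl (- u * p)]. *)
Lemma blaschke_invertible (theta : R) n (a : 'I_n -> C) (k : 'I_n -> nat) :
  (forall i, nrm (a i) < 1) -> (forall i, 0 < k i)%N -> (\sum_i k i = 1)%N ->
  exists g : C -> C, disc_inverse (blaschke theta a k) g.
Proof.
case: n a k => [|[|n]] a k a1 k0 k1.
- by rewrite big_ord0 in k1.
- pose p := a ord0; pose u : C := expi theta.
  have p1 : nrm p < 1 by exact: a1.
  have kE : k ord0 = 1%N by rewrite big_ord1 in k1.
  have u1 : nrm u = 1 by exact: nrm_expi.
  have u0 : u != 0 := circle_neq0 u1.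
  have uV : cconj u = u^-1 by rewrite circle_inv.
  have up1 : nrm (- (u * p)) < 1 by rewrite nrmN nrmM u1 mul1r.
  have BE z : blaschke theta a k z = u * ((z - p) / (1 - cconj p * z)).
    by rewrite /blaschke big_ord1 kE expr1.
  have gE z : bl (- (u * p)) z = (z + u * p) / (1 + u^-1 * cconj p * z).
    by rewrite /bl cconjN cconjM uV mulNr !opprK.
  have pp : 1 - p * cconj p != 0 by rewrite mulrC; apply: bl_den1 => //; exact: ltW.
  exists (fun z => u^-1 * bl (- (u * p)) z); split.
  + have [rho r1 h] := bl_holo up1; apply: upolyM; [exact: ler01|exact: upoly_cst|].
    by apply: holo_upoly h _; rewrite ler01.
  + by move=> z z1; rewrite nrmM nrmV u1 invr1 mul1r; exact: bl_disc.
  + move=> z z1; rewrite BE gE.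
    have den : 1 - cconj p * z != 0 by apply: bl_den1 => //; exact: ltW.
    have E : 1 + u^-1 * cconj p * (u * ((z - p) / (1 - cconj p * z))) = (1 - p * cconj p) / (1 - cconj p * z).
      by field; rewrite u0 den.
    by rewrite E; field; rewrite u0 den pp.
  + move=> z z1; rewrite BE gE.
    have den : 1 + u^-1 * cconj p * z != 0.
      have := bl_den1 up1 (ltW z1).
      by rewrite cconjN cconjM uV mulNr opprK.
    have den2 : u + cconj p * z != 0.
      have -> : u + cconj p * z = u * (1 + u^-1 * cconj p * z) by field.
      by rewrite mulf_neq0.
    have E : 1 - cconj p * (u^-1 * ((z + u * p) / (1 + u^-1 * cconj p * z))) = (1 - p * cconj p) / (1 + u^-1 * cconj p * z).
      by field; rewrite u0 den2.
    by rewrite E; field; rewrite u0 den2 pp.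
- exfalso; have := k0 ord0; have := k0 (lift ord0 ord0); move: k1.
  by rewrite !big_ord_recl; lia.
Qed.

Lemma finite_blaschke_inner (B : C -> C) m : (0 < m)%N -> is_finite_blaschke B m ->
  exists b : C -> C, [/\ inner b m, forall z, nrm z < 1 -> B z = b z,
    (1 < m)%N -> degenerate b & m = 1%N -> exists g, disc_inverse b g].
Proof.
move=> m0 [theta [n [a [k [inja a1 k1 mE BE]]]]].
have {}a1 j : nrm (a j) < 1 by rewrite -nrm_lt1.
exists (blaschke theta a k); rewrite mE in m0 *; split.
- exact: inner_blaschke.
- by move=> z z1; rewrite BE// nrm_lt1.
- exact: blaschke_degenerate.
- exact: blaschke_invertible.
Qed.

End order.

Section biholomorphic.
Variables (R : realType) (d : nat).
Local Notation C := (Cplx R).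
Local Notation Vd := 'rV[C]_d.

Lemma coord_frechet (phi f : C -> C) (i : 'I_d) : upoly 1 phi ->
  (forall z, nrm z < 1 -> f z = phi z) -> frechet_on_polydisc (fun z : Vd => f (z ord0 i)).
Proof.
move=> up fE; apply: eq_frechet_on (tensor_frechet (phi := fun j => if j == i then phi else fun=> 1) _) => [z hz|j].
  rewrite /tensor (bigD1 i)//= eqxx big1 ?mulr1 => [|j /negbTE ->//].
  by rewrite fE//; move/polydiscP: hz.
by case: eqP => [_|_] //; exact: upoly_cst.
Qed.

Lemma row_holomorphic (f phi : 'I_d -> C -> C) : (forall i, upoly 1 (phi i)) ->
  (forall i z, nrm z < 1 -> f i z = phi i z) ->
  holomorphic_on (@polydisc R d) (fun z : Vd => \row_i f i (z ord0 i) : Vd).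
Proof.
move=> up fE z hz.
have -> : (fun z : Vd => \row_i f i (z ord0 i) : Vd) =
    \sum_(i < d) (fun z : Vd => f i (z ord0 i) *: delta_mx ord0 i : Vd).
  by apply/funext => x; rewrite fct_sumE [LHS]row_sum_delta; apply: eq_bigr => i _; rewrite mxE.
apply: differentiable_sum => i; apply: differentiableZl.
exact: (holomorphic_frechet _).2 (coord_frechet i (up i) (fE i)) z hz.
Qed.

Lemma automorphism_product (B : 'I_d -> C -> C) (b g : 'I_d -> C -> C) :
  (forall i, upoly 1 (b i)) -> (forall i, upoly 1 (g i)) ->
  (forall i z, nrm z < 1 -> B i z = b i z) ->
  (forall i z, nrm z < 1 -> nrm (b i z) < 1) -> (forall i z, nrm z < 1 -> nrm (g i z) < 1) ->
  (forall i z, nrm z < 1 -> g i (b i z) = z) -> (forall i z, nrm z < 1 -> b i (g i z) = z) ->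
  biholomorphic_self_map (product_map B).
Proof.
move=> ub ug Bb b1 g1 gb bg; split.
- exact: row_holomorphic ub Bb.
- by move=> z /polydiscP hz; apply/polydiscP => i; rewrite mxE Bb// b1.
- exists (product_map g); split.
  + exact: row_holomorphic ug (fun _ _ _ => erefl).
  + by move=> z /polydiscP hz; apply/polydiscP => i; rewrite mxE g1.
  + by move=> z /polydiscP hz; apply/rowP => i; rewrite !mxE Bb// gb.
  + by move=> z /polydiscP hz; apply/rowP => i; rewrite !mxE Bb ?g1// bg.
Qed.

End biholomorphic.

(** * The theorem *)

Section theorem.
Variables (R : realType) (d : nat).
Local Notation C := (Cplx R).
Local Notation Vd := 'rV[C]_d.
Local Notation index := {ffun 'I_d -> nat}.
Local Notation A2 := (@bergman R d).
Local Notation ip := (@bergman_ip R d).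
Local Notation Em := (@bmonomial R d).
Local Notation w := (@wt R d).
Variables (m : 'I_d -> nat) (B b : 'I_d -> C -> C).
Hypothesis m0 : forall i, (0 < m i)%N.
Hypothesis hb : forall i, inner (b i) (m i).
Hypothesis Bb : forall i z, nrm z < 1 -> B i z = b i z.
Local Notation mm := (\prod_i m i)%N.
Local Notation G := (Gamma B mm).
Implicit Types (alpha beta : index).

Lemma Gamma_nonzero : G @` A2 <> [set 0].
Proof.
move=> h; pose i0 : index := [ffun=> 0%N].
have Ae := monomial_A2 R i0.
have : (G @` A2) (G (Em i0)) by exists (Em i0).
rewrite h /= => E0; have := Gamma_gram m0 hb Bb i0 i0.
rewrite E0 (ip0l (A2_prehilbert R d) (ph_0 (A2_prehilbert R d))) eqxx mulr1 => /esym/eqP.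
by rewrite ofR_eq0 gt_eqF// wt_gt0.
Qed.

(** At a critical point the whole range of [Gamma] vanishes. At two points with
    the same image, the values of every element of the range are in the ratio of
    the values of the Jacobian, which cannot hold for both the constant [1] and a
    coordinate function. *)
Lemma Gamma_proper i : degenerate (b i) -> G @` A2 <> A2.
Proof.
move=> deg h; pose i0 : index := [ffun=> 0%N].
pose pnt (p : C) : Vd := setc 0 i p.
have pp p : nrm p < 1 -> polydisc (pnt p).
  move=> p1; apply/polydiscP => j; rewrite mxE; case: eqP => // _.
  by rewrite mxE nrm0.
have GA f z : A2 f -> polydisc z -> exists c, f z = c * jac b z.
  rewrite -h => -[psi Apsi <-] hz; rewrite (GammaE hb Bb psi hz) mulrA.
  by eexists.
have one z : polydisc z -> Em i0 z = 1.
  move=> hz; rewrite /bmonomial (extend0E _ hz) /mono big1// => j _; by rewrite ffunE.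
have jne z : polydisc z -> jac b z != 0.
  move=> hz; have [c] := GA _ _ (monomial_A2 R i0) hz; rewrite one// => /eqP; apply: contraTneq => ->.
  by rewrite mulr0 oner_eq0.
case: deg => [[p p1 dp]|[p [q [p1 q1 pq bpq]]]].
  have := jne _ (pp p p1); rewrite /jac /tensor (bigD1 i)//= setc_same dp mul0r eqxx//.
have bpnt : product_map B (pnt p) = product_map B (pnt q).
  apply/rowP => j; rewrite !mxE; case: (j =P i) => [->|//].
  by rewrite !Bb.
have prop f : A2 f -> f (pnt p) * jac b (pnt q) = f (pnt q) * jac b (pnt p).
  rewrite -h => -[psi _ <-]; rewrite (GammaE hb Bb psi (pp p p1)) (GammaE hb Bb psi (pp q q1)).
  have swap (v x y u : C) : v * (x * y) * u = v * (x * u) * y by ring.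
  by rewrite bpnt; exact: swap.
pose i1 : index := inc i i0.
have coord x : nrm x < 1 -> Em i1 (pnt x) = x.
  move=> x1; rewrite /bmonomial (extend0E _ (pp x x1)).
  rewrite /mono (bigD1 i)//= !ffunE eqxx expr1 setc_same big1 ?mulr1// => j /negbTE ji.
  by rewrite !ffunE ji.
have prop' f x y : A2 f -> f (pnt p) = x -> f (pnt q) = y -> x * jac b (pnt q) = y * jac b (pnt p).
  by move=> Af <- <-; exact: prop.
have J := prop' _ 1 1 (monomial_A2 R i0) (one _ (pp p p1)) (one _ (pp q q1)).
have K := prop' _ p q (monomial_A2 R i1) (coord p p1) (coord q q1).
have jp := jne _ (pp p p1); move: J K jp; move: (jac b (pnt p)) (jac b (pnt q)) => x y.
rewrite !mul1r => -> /eqP; rewrite -subr_eq0 -mulrBl mulf_eq0 subr_eq0 (negbTE pq) /=.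
by move=> ->.
Qed.

Lemma jacobian_powE alpha : jacobian_pow B alpha = ofR (Num.sqrt mm%:R) *: G (Em alpha).
Proof.
have s0 : Num.sqrt mm%:R != 0 :> R by rewrite gt_eqF// sqrtr_gt0 mm_gt0.
apply/funext => z; have -> : (ofR (Num.sqrt mm%:R) *: G (Em alpha)) z = ofR (Num.sqrt mm%:R) * G (Em alpha) z by [].
have [hz|hz] := pselect (polydisc z); last by rewrite /jacobian_pow (extend0F _ hz) (GammaF _ _ _ hz) mulr0.
rewrite (GammaE hb Bb _ hz) mulrA -ofRM divff// ofR1 mul1r /jacobian_pow (extend0E _ hz).
rewrite (jacobianE hb Bb hz) mulrC; congr (_ * _).
rewrite /bmonomial extend0E; last exact: (product_map_polydisc hb Bb).
by rewrite /mono /product_map_pow; apply: eq_bigr => i _; rewrite mxE.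
Qed.

Let ph := A2_prehilbert R d.
Let EA := @monomial_A2 R d.
Let EO := @monomial_orth R d.
Let ED := @A2_dense R d.
Let ER := @A2_riesz_fischer R d.
Let GC := Gamma_contraction m0 hb Bb.
Let GI := Gamma_iso m0 hb Bb.
Let ZC := @shift_contraction R d.
Let TA i f (Af : A2 f) := contr_H (T_contraction hb Bb i) Af.
Let TG := T_Gamma_commute hb Bb.
Let ZE := @shift_monomial R d.
Let TE := T_Gamma hb Bb.

Lemma Gamma_minimal : minimal_joint_reducing A2 ip (multiplication_tuple B) (G @` A2).
Proof. exact: (minimal_reducing ph EA EO ED ER GC GI ZC TA TG ZE TE). Qed.

Lemma Gamma_equivalent : unitarily_equivalent (G @` A2) ip A2 ip
  (multiplication_tuple B) (@bergman_multishift R d).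
Proof. exact: (restriction_equivalent ph EA EO ED GC GI ZC TG). Qed.

Lemma Gamma_span (gam : index -> Vd -> C) (k : index -> C) : (forall alpha, k alpha != 0) ->
  (forall alpha, gam alpha = k alpha *: G (Em alpha)) -> closed_span A2 ip gam = G @` A2.
Proof. exact: (span_M ph EA EO ED ER GC GI). Qed.

Definition onb alpha : Vd -> C :=
  ofR (Num.sqrt (\prod_j ((alpha j).+1%:R / (m j)%:R))) *: jacobian_pow B alpha.

(** The factors [m j] of the normalisation cancel against the one in [Gamma]. *)
Lemma onbE alpha : onb alpha = ofR (Num.sqrt (w alpha)^-1) *: G (Em alpha).
Proof.
have M0 : 0 <= (mm%:R : R) by [].
rewrite /onb jacobian_powE scalerA -ofRM; congr (ofR _ *: _).
rewrite big_split /= sqrtrM; last by apply: prodr_ge0.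
rewrite -mulrA -sqrtrM; last by apply: prodr_ge0 => j _; rewrite invr_ge0.
rewrite natr_prod prodfV mulVf ?sqrtr1 ?mulr1; last by rewrite -natr_prod gt_eqF// mm_gt0.
by rewrite /wt prodfV invrK.
Qed.

Lemma onb_orthonormal : orthonormal_basis A2 ip (G @` A2) onb.
Proof.
have w0 := wt_gt0 R.
have k0 alpha : ofR (Num.sqrt (w alpha)^-1) != 0 :> C.
  by rewrite ofR_eq0 gt_eqF// sqrtr_gt0 invr_gt0.
split.
- move=> alpha; rewrite onbE; exists (ofR (Num.sqrt (w alpha)^-1) *: Em alpha).
    exact: (phZ ph).
  by rewrite (contrZ ph GC _ (EA alpha)).
- move=> alpha beta; have GA gam := contr_H GC (EA gam).
  rewrite !onbE (ipZl ph _ (GA alpha) (phZ ph _ (GA beta))) (ipZr ph _ (GA beta) (GA alpha)).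
  rewrite (Gamma_gram m0 hb Bb) cconj_ofR; case: eqVneq => [->|_]; last by rewrite !mulr0.
  rewrite !mulr1 -!ofRM mulrA -expr2 sqr_sqrtr ?mulVf ?ofR1//; first by rewrite gt_eqF.
  by rewrite invr_ge0 ltW.
- exact: (Gamma_span k0 onbE).
Qed.

End theorem.

Theorem theorem3p7 (R : realType) (d : nat) (m : 'I_d -> nat)
    (B : 'I_d -> Cplx R -> Cplx R)
    (m_ge1 : forall i, (1 <= m i)%N)
    (B_blaschke : forall i, is_finite_blaschke (B i) (m i))
    (B_not_biholo : ~ biholomorphic_self_map (product_map B)) :
  let A2 := @bergman R d in
  let ip := @bergman_ip R d in
  let GammaA2 := Gamma B (\prod_i m i)%N @` A2 in
  [/\ nontrivial_subspace A2 GammaA2,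
      minimal_joint_reducing A2 ip (multiplication_tuple B) GammaA2,
      unitarily_equivalent GammaA2 ip A2 ip
        (multiplication_tuple B) (@bergman_multishift R d),
      GammaA2 = closed_span A2 ip (jacobian_pow B) &
      orthonormal_basis A2 ip GammaA2
        (fun alpha : {ffun 'I_d -> nat} =>
           ofR (Num.sqrt (\prod_j ((alpha j).+1%:R / (m j)%:R))) *:
           jacobian_pow B alpha)].
Proof.
move=> A2 ip GammaA2.
have [b hb] := choice (fun i => finite_blaschke_inner (m_ge1 i) (B_blaschke i)).
have hin i : inner (b i) (m i) by case: (hb i).
have hB i z : nrm z < 1 -> B i z = b i z by case: (hb i) => _ + _ _; exact.
split.
- split; first exact: Gamma_nonzero m_ge1 hin hB.
  have [i mi] : exists i, (1 < m i)%N.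
    apply: contrapT => h; apply: B_not_biholo.
    have hg i : exists g, disc_inverse (b i) g.
      case: (hb i) => _ _ _; apply.
      by apply/eqP; rewrite eqn_leq m_ge1 andbT leqNgt; apply/negP => mi; apply: h; exists i.
    have {hg}[g hg] := choice hg.
    apply: (@automorphism_product _ _ B b g) => //.
    + by move=> i; exact: inner_upoly (hin i).
    + by move=> i; case: (hg i).
    + by move=> i; exact: inner_disc (hin i).
    + by move=> i; case: (hg i).
    + by move=> i; case: (hg i).
    + by move=> i; case: (hg i).
  by apply: (Gamma_proper hin hB (i := i)); case: (hb i) => _ _ + _; apply.
- exact: Gamma_minimal m_ge1 hin hB.
- exact: Gamma_equivalent m_ge1 hin hB.
- apply/esym; apply: (Gamma_span m_ge1 hin hB (k := fun=> ofR (Num.sqrt (\prod_i m i)%:R))).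
    by move=> _; rewrite ofR_eq0 gt_eqF// sqrtr_gt0 mm_gt0.
  by move=> alpha; rewrite (jacobian_powE m_ge1 hin hB).
- exact: onb_orthonormal m_ge1 hin hB.
Qed.
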